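(* Let $n\ge 3$, $k\in\{1,\dots,n\}$ and $d\ge1$ be integers. The composition $$\rho\circ f_d\circ p_k\colon PB_n\to GL(n-1,\mathbb{Z}[t,t^{-1},s,s^{-1}])$$ is a representation of the pure braid group $PB_n$, i.e. a well-defined group homomorphism.
   Context: Conventions: products of braids are concatenations, the first factor coming first in time, and words in generators are read from left to right in time. Put $S^1=\{z\in\mathbb{C}:|z|=1\}$ and $m=n-1$. Pure braids. $\beta\in PB_n$ is represented by strands $\beta_1,\dots,\beta_n\colon[0,1]\to\mathbb{C}$, pairwise distinct at each time, with $\beta_i(0)=\beta_i(1)$ equal to fixed base points, up to isotopy. The map $p_k$. $p_k(\beta)$ is the pure braid in the cylinder on $m$ strands given by the diagram in $S^1\times[0,1]$ with strands $p_k(\beta)_l(t)=\frac{\beta_l(t)-\beta_k(t)}{|\beta_l(t)-\beta_k(t)|}$, $l\ne k$, with over/under information at each crossing determined by comparing the distances $|\beta_l(t)-\beta_k(t)|$ of the two strands involved (one of the two conventions, farther strand over or nearer strand over, is fixed). Braids in the cylinder are such diagrams modulo isotopy and classical Reidemeister moves. The base points are assumed to be in general position: the ratios $p_k(\beta)_l(0)/p_k(\beta)_j(0)$, $l\neq j$, are transcendental numbers. The group $VCB_m$. Virtual braids in the cylinder on $m$ strands are braid diagrams in $S^1\times[0,1]$ (strands monotone in the interval direction, fixed endpoint set of $m$ points) whose crossings are classical (with over/under information) or virtual, modulo isotopy and the classical and virtual Reidemeister moves (second and third classical moves, second and third virtual moves, and the mixed third move in which a strand with two virtual crossings passes through a classical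 crossing). The map $f_d$. For a generic braid diagram $\beta'$ in the cylinder, $f_d(\beta')$ is the virtual braid diagram in the cylinder with strands $t\mapsto\beta'_i(t)^d$; a crossing of the image is classical if it is the image of a crossing of $\beta'$ (with the same sign as that crossing), and virtual otherwise. Generators of $VCB_m$. Number the endpoints $1,\dots,m$ counterclockwise on $S^1$ starting from a chosen cut point. $VCB_m$ is generated by $\sigma_i$ (the classical crossing, of one fixed type, interchanging the cyclically adjacent positions $i,i+1$), $\tau_i$ (the virtual crossing interchanging positions $i,i+1$), $i\in\mathbb{Z}/m$, and the crossingless rotation $\zeta$ in which each strand moves counterclockwise from position $i$ to position $i+1$ (and from $m$ to $1$); one has $\zeta\sigma_i\zeta^{-1}=\sigma_{i-1}$, $\zeta\tau_i\zeta^{-1}=\tau_{i-1}$. The map $\rho\colon VCB_m\to GL(m,\mathbb{Z}[t,t^{-1},s,s^{-1}])$ is the homomorphism given on generators as follows. $\rho(\sigma_i)$ and $\rho(\tau_i)$ coincide with the identity matrix outside the rows and columns $i,i+1$ (modulo $m$), and in those rows and columns (in this order) they equal respectively $\begin{pmatrix}1-t&t\\ 1&0\end{pmatrix}$ and $\begin{pmatrix}0&s\\ s^{-1}&0\end{pmatrix}$. $\rho(\zeta)$ is the permutation matrix with $\rho(\zeta)_{i,i+1}=1$ for $1\le i\le m-1$, $\rho(\zeta)_{m,1}=1$, and other entries $0$. *)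

(* Defs.v *)
From HB Require Import structures.
From Stdlib Require Import Relations.Relation_Operators.
From mathcomp Require Import all_boot all_order all_fingroup all_algebra.
From mathcomp Require Import complex ring.
From mathcomp Require Import all_classical all_reals all_analysis.

Set Implicit Arguments.
Unset Strict Implicit.
Unset Printing Implicit Defensive.

Import Order.TTheory GRing.Theory Num.Theory.
Import numFieldNormedType.Exports.

Local Open Scope classical_set_scope.
Local Open Scope ring_scope.

(* The ring Z[t,t^-1,s,s^-1], realized as the subring of the fraction field   *)
(* of Z[t][s] whose elements are the p / (t^a s^b) with p in Z[t][s].         *)

Definition fracts : fieldType := {fraction {poly {poly int}}}.
Definition fract_t : fracts := tofrac ('X%:P).
Definition fract_s : fracts := tofrac 'X.

Definition laurent_pred : {pred fracts} := fun x =>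
  `[< exists a b (p : {poly {poly int}}),
        x * (fract_t ^+ a * fract_s ^+ b) = tofrac p >].

Lemma laurent_subring : subring_closed laurent_pred.
Proof.
split => [|x y /asboolP[a [b [p hx]]] /asboolP[a' [b' [q hy]]]|
           x y /asboolP[a [b [p hx]]] /asboolP[a' [b' [q hy]]]]; apply/asboolP.
- by exists 0%N, 0%N, 1; rewrite !expr0 !mulr1 tofrac1.
- exists (a + a')%N, (b + b')%N,
    (p * ('X%:P ^+ a' * 'X ^+ b') - q * ('X%:P ^+ a * 'X ^+ b)).
  rewrite tofracB !tofracM !tofracXn -hx -hy -/fract_t -/fract_s !exprD; ring.
- exists (a + a')%N, (b + b')%N, (p * q).
  rewrite tofracM -hx -hy !exprD; ring.
Qed.

HB.instance Definition _ :=
  GRing.isSubringClosed.Build fracts laurent_pred laurent_subring.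

Record laurent :=
  Laurent { laurent_val :> fracts; laurentP : laurent_val \in laurent_pred }.

HB.instance Definition _ := [isSub for laurent_val].
HB.instance Definition _ := [Choice of laurent by <:].
HB.instance Definition _ := [SubChoice_isSubComNzRing of laurent by <:].

Definition laurent_unit : {pred laurent} :=
  fun x => (val x != 0) && ((val x)^-1 \in laurent_pred).
Definition laurent_inv (x : laurent) : laurent := insubd x (val x)^-1.

Lemma laurent_mulVx : {in laurent_unit, left_inverse 1 laurent_inv *%R}.
Proof.
move=> x /andP[x0 xV]; apply: val_inj.
by rewrite rmorphM /= val_insubd xV mulVf.
Qed.

Lemma laurent_unitPl (x y : laurent) : y * x = 1 -> laurent_unit x.
Proof.
move=> yx; have yx1 : val y * val x = 1 by rewrite -rmorphM yx rmorph1.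
have x0 : val x != 0.
  apply: contra_eq_neq yx1 => x0.
  by rewrite (_ : val x = 0) // mulr0 eq_sym oner_eq0.
apply/andP; split=> //.
by rewrite -[_^-1]mul1r -yx1 mulfK //; apply: laurentP.
Qed.

Lemma laurent_inv_out : {in [predC laurent_unit], laurent_inv =1 id}.
Proof.
move=> x; rewrite inE /= /laurent_unit -topredE /= negb_and negbK.
case/orP => [/eqP x0|xV]; apply: val_inj; rewrite val_insubd.
  by have -> : x = 0; [exact: val_inj | rewrite rmorph0 invr0; case: ifP].
by rewrite (negbTE xV).
Qed.

HB.instance Definition _ := GRing.ComNzRing_hasMulInverse.Build laurent
  laurent_mulVx laurent_unitPl laurent_inv_out.

Lemma fract_t_laurent : fract_t \in laurent_pred.
Proof. by apply/asboolP; exists 0%N, 0%N, 'X%:P; rewrite !expr0 !mulr1. Qed.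
Lemma fract_s_laurent : fract_s \in laurent_pred.
Proof. by apply/asboolP; exists 0%N, 0%N, 'X; rewrite !expr0 !mulr1. Qed.

Definition laurent_t : laurent := Laurent fract_t_laurent.
Definition laurent_s : laurent := Laurent fract_s_laurent.

Lemma laurent_t_unit : laurent_t \is a GRing.unit.
Proof.
have t0 : fract_t != 0 by rewrite tofrac_eq0 polyC_eq0 polyX_eq0.
apply/andP; split=> //; apply/asboolP; exists 1%N, 0%N, 1.
by rewrite expr1 expr0 mulr1 mulVf // tofrac1.
Qed.
Lemma laurent_s_unit : laurent_s \is a GRing.unit.
Proof.
have s0 : fract_s != 0 by rewrite tofrac_eq0 polyX_eq0.
apply/andP; split=> //; apply/asboolP; exists 0%N, 1%N, 1.
by rewrite expr1 expr0 mul1r mulVf // tofrac1.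
Qed.

(* Paths and families in the plane; only parameters in [0, 1] matter, the     *)
(* values of a strand outside [0, 1] being irrelevant. Continuity refers to   *)
(* the topology of the plane C = R^2.                                         *)

Section Plane.
Variable R : realType.

Definition cpath (f : R -> R[i]) :=
  {within `[0, 1], continuous (fun t => complex.Re (f t))} /\
  {within `[0, 1], continuous (fun t => complex.Im (f t))}.

Definition cfamily (f : R * R -> R[i]) :=
  {within (`[0, 1] `*` `[0, 1]), continuous (fun x => complex.Re (f x))} /\
  {within (`[0, 1] `*` `[0, 1]), continuous (fun x => complex.Im (f x))}.

Definition cis (a : R) : R[i] := (cos a +i* sin a)%C.

Definition transcendental (x : R[i]) := ~ algebraicOver (ratr : rat -> R[i]) x.

End Plane.

(* Geometric pure braids with base points z, and their isotopies.             *)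

Section PureBraids.
Variables (R : realType) (n : nat).

Definition braid := 'I_n -> R -> R[i].

Definition pure_braid (z : 'I_n -> R[i]) (b : braid) :=
  [/\ forall i, cpath (b i),
      forall t, 0 <= t <= 1 -> injective (b^~ t),
      forall i, b i 0 = z i
    & forall i, b i 1 = z i].

Definition braid_isotopic (z : 'I_n -> R[i]) (b b' : braid) :=
  exists h : R -> braid,
  [/\ forall i, cfamily (fun x => h x.1 i x.2),
      forall u, 0 <= u <= 1 -> pure_braid z (h u),
      forall i t, 0 <= t <= 1 -> h 0 i t = b i t
    & forall i t, 0 <= t <= 1 -> h 1 i t = b' i t].

Definition braid_mul (b b' : braid) : braid :=
  fun i t => if t <= 2^-1 then b i (2 * t) else b' i (2 * t - 1).

End PureBraids.

(* Braid diagrams in the cylinder.                                            *)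

Section Diagrams.
Variables (R : realType) (m : nat).

(* The indices in 'I_m are mere names of the m strands. A crossing is a pair  *)
(* of strands and a time at which they meet: over i j t means that at time t  *)
(* the strands i and j have a classical crossing with i above j; a meeting    *)
(* with neither over i j t nor over j i t is a virtual crossing.              *)
Record diagram := Diagram {
  strand : 'I_m -> R -> R[i];
  over : 'I_m -> 'I_m -> R -> Prop }.

Implicit Types (D : diagram) (E : set R[i]) (G : R -> diagram).

Definition meet D (i j : 'I_m) t :=
  [/\ 0 <= t <= 1, i != j & strand D i t = strand D j t].

Definition classical_at D i j t := over D i j t \/ over D j i t.

Definition all_classical D := forall i j t, meet D i j t -> classical_at D i j t.

(* All the conditions on a diagram with endpoint set E, except general        *)
(* position. *)
Definition prediagram E D :=
  [/\ forall i, cpath (strand D i),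
      forall i t, 0 <= t <= 1 -> `|strand D i t| = 1,
      forall i, E (strand D i 0) /\ E (strand D i 1),
      injective ((strand D)^~ 0) /\ injective ((strand D)^~ 1)
    & forall i j t, 0 <= t <= 1 ->
        over D i j t -> meet D i j t /\ ~ over D j i t].

(* The sine of the angle from strand i to strand j. *)
Definition turn D i j t : R := complex.Im (strand D j t / strand D i t).

Definition crosses D i j t := exists2 e : R, 0 < e &
  (forall r, 0 < `|r| < e -> 0 < r * turn D i j (t + r)) \/
  (forall r, 0 < `|r| < e -> r * turn D i j (t + r) < 0).

Definition touches D i j t := exists2 e : R, 0 < e &
  (forall r, 0 < `|r| < e -> 0 < turn D i j (t + r)) \/
  (forall r, 0 < `|r| < e -> turn D i j (t + r) < 0).

(* S is the set of all strands passing through some point at time t. *)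
Definition node D t (S : {set 'I_m}) := forall i j, i \in S ->
  (j \in S <-> strand D i t = strand D j t).

Definition regular_crossing D i j t := node D t [set i; j] /\ crosses D i j t.

(* Finiteness of the set of crossings follows from this by compactness. *)
Definition generic D := forall i j t, meet D i j t -> regular_crossing D i j t.

(* The singular point of a second or third move. Since in a family of         *)
(* diagrams the crossing data vary continuously, a tangency point covers both *)
(* second moves: the two crossings next to it are both virtual, or are both   *)
(* classical with the same strand on top.                                     *)
Definition tangency_point D t (S : {set 'I_m}) :=
  #|S| = 2%N /\ forall i j, i \in S -> j \in S -> i != j -> touches D i j t.

Definition classical_triple D t (S : {set 'I_m}) :=
  (forall i j, i \in S -> j \in S -> i != j -> classical_at D i j t) /\
  (forall i j l, i \in S -> j \in S -> l \in S ->
     over D i j t -> over D j l t -> over D i l t).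

Definition virtual_triple D t (S : {set 'I_m}) :=
  forall i j, i \in S -> j \in S -> ~ over D i j t.

Definition mixed_triple D t (S : {set 'I_m}) := exists2 i, i \in S &
  (forall j, j \in S -> ~ classical_at D i j t) /\
  (forall j l, j \in S :\ i -> l \in S :\ i -> j != l -> classical_at D j l t).

Definition triple_point D t (S : {set 'I_m}) :=
  [/\ #|S| = 3%N,
      forall i j, i \in S -> j \in S -> i != j -> crosses D i j t
    & [\/ classical_triple D t S, virtual_triple D t S | mixed_triple D t S]].

(* Exactly one singular point, otherwise generic. *)
Definition singular D := exists t S,
  [/\ 0 <= t <= 1, node D t S,
      tangency_point D t S \/ triple_point D t S
    & forall i j r, meet D i j r -> ~ (r = t /\ i \in S) ->
        regular_crossing D i j r].

(* virt tells whether virtual crossings are allowed. *)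
Definition cyl_diagram (virt : bool) E D :=
  [/\ prediagram E D, generic D & virt \/ all_classical D].

Definition diagram_family (virt : bool) E G :=
  [/\ forall i, cfamily (fun x => strand (G x.1) i x.2),
      forall u, 0 <= u <= 1 -> prediagram E (G u) /\ (virt \/ all_classical (G u)),
      forall u i, 0 <= u <= 1 ->
        strand (G u) i 0 = strand (G 0) i 0 /\ strand (G u) i 1 = strand (G 0) i 1
    & forall u t i j, 0 <= u <= 1 -> meet (G u) i j t ->
        exists2 e : R, 0 < e & forall u' t', 0 <= u' <= 1 ->
          `|u' - u| < e -> `|t' - t| < e -> meet (G u') i j t' ->
          (over (G u') i j t' <-> over (G u) i j t)].

Definition same_diagram D D' := forall t, 0 <= t <= 1 ->
  (forall i, strand D i t = strand D' i t) /\
  (forall i j, over D i j t <-> over D' i j t).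

Definition cyl_isotopic virt E D D' := exists G,
  [/\ diagram_family virt E G, forall u, 0 <= u <= 1 -> generic (G u),
      same_diagram (G 0) D & same_diagram (G 1) D'].

Definition reidemeister_move virt E D D' := exists G,
  [/\ diagram_family virt E G,
      exists2 u0, 0 < u0 < 1 & singular (G u0) /\
        forall u, 0 <= u <= 1 -> u != u0 -> generic (G u),
      same_diagram (G 0) D & same_diagram (G 1) D'].

Definition rename (s : 'S_m) D :=
  Diagram (fun i => strand D (s i)) (fun i j => over D (s i) (s j)).

Variant cyl_step virt E D D' : Prop :=
  | Isotopy of cyl_isotopic virt E D D'
  | Reidemeister of reidemeister_move virt E D D'
  | Rename (s : 'S_m) of cyl_diagram virt E D & D' = rename s D.

(* Braids in the cylinder are the classes of cyl_diagram false E under        *)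
(* cyl_equiv false E, virtual braids in the cylinder (the group VCB_m) those  *)
(* of cyl_diagram true E under cyl_equiv true E.                              *)
Definition cyl_equiv virt E := clos_refl_sym_trans diagram (cyl_step virt E).

(* The strand of D' starting where strand i of D ends. *)
Definition continuation D D' (i : 'I_m) : 'I_m :=
  odflt i [pick j | strand D' j 0 == strand D i 1].

Definition diagram_mul D D' := Diagram
  (fun i t => if t <= 2^-1 then strand D i (2 * t)
              else strand D' (continuation D D' i) (2 * t - 1))
  (fun i j t => if t <= 2^-1 then over D i j (2 * t)
                else over D' (continuation D D' i) (continuation D D' j) (2 * t - 1)).

Definition power_map (d : nat) D :=
  Diagram (fun i t => strand D i t ^+ d) (over D).

(* The elements of E numbered counterclockwise from the cut point c. *)
Definition ccw_numbering (c : R[i]) (th : 'I_m -> R) E :=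
  [/\ `|c| = 1, forall i, 0 < th i < 2 * pi,
      forall i j : 'I_m, (i < j)%N -> th i < th j
    & E = [set c * cis (th i) | i in [set: 'I_m]]].

(* Counterclockwise angle from position i to the cyclically next position. *)
Definition gap (th : 'I_m -> R) (i : 'I_m) : R :=
  th (ordS i) + (if (i.+1 == m)%N then 2 * pi else 0) - th i.

Definition swap_strand (c : R[i]) (th : 'I_m -> R) (i j : 'I_m) (t : R) : R[i] :=
  if j == i then c * cis (th j + t * gap th i)
  else if j == ordS i then c * cis (th j - t * gap th i)
  else c * cis (th j).

(* The boolean up selects which of the two classical crossings is sigma_i:    *)
(* the strand moving from position i to i + 1 is above iff up is true.        *)
Definition sigma_diagram (up : bool) c th (i : 'I_m) := Diagram
  (swap_strand c th i)
  (fun a b t => t = 2^-1 /\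
     (if up then a = i /\ b = ordS i else a = ordS i /\ b = i)).

Definition tau_diagram c th (i : 'I_m) :=
  Diagram (swap_strand c th i) (fun _ _ _ => False).

Definition zeta_diagram c th :=
  Diagram (fun j t => c * cis (th j + t * gap th j)) (fun _ _ _ => False).

Definition block2 (i : 'I_m) (a b c d : laurent) : 'M[laurent]_m :=
  \matrix_(p, q)
    if p == i then if q == i then a else if q == ordS i then b else 0
    else if p == ordS i then if q == i then c else if q == ordS i then d else 0
    else (p == q)%:R.

Definition sigma_mx (i : 'I_m) : 'M[laurent]_m :=
  block2 i (1 - laurent_t) laurent_t 1 0.
Definition tau_mx (i : 'I_m) : 'M[laurent]_m :=
  block2 i 0 laurent_s laurent_s^-1 0.
Definition zeta_mx : 'M[laurent]_m := \matrix_(p, q) (q == ordS p)%:R.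

(* rho, given on representatives, is a homomorphism from the group of virtual *)
(* braids in the cylinder to GL(m, Z[t,t^-1,s,s^-1]) with the prescribed      *)
(* values on the generators.                                                  *)
Definition is_rho (up : bool) c th E (rho : diagram -> 'M[laurent]_m) :=
  [/\ forall D, cyl_diagram true E D -> rho D \in unitmx,
      forall D D', cyl_diagram true E D -> cyl_diagram true E D' ->
        cyl_equiv true E D D' -> rho D = rho D',
      forall D D', cyl_diagram true E D -> cyl_diagram true E D' ->
        rho (diagram_mul D D') = rho D *m rho D'
    & [/\ forall i, rho (sigma_diagram up c th i) = sigma_mx i,
          forall i, rho (tau_diagram c th i) = tau_mx i
        & rho (zeta_diagram c th) = zeta_mx]].

End Diagrams.

(* The diagram p_k(b). If far is true the strand farther from strand k is     *)
(* above, otherwise the nearer one is.                                        *)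

Section Projection.
Variables (R : realType) (n : nat).

Definition p_diagram (far : bool) (k : 'I_n) (b : braid R n) : diagram R n.-1 :=
  let v (l : 'I_n.-1) t := b (lift k l) t - b k t in
  Diagram (fun l t => v l t / `|v l t|)
    (fun l j t => v l t / `|v l t| = v j t / `|v j t| /\
       (if far then `|v j t| < `|v l t| else `|v l t| < `|v j t|)).

Definition direction (k : 'I_n) (z : 'I_n -> R[i]) (l : 'I_n.-1) : R[i] :=
  (z (lift k l) - z k) / `|z (lift k l) - z k|.

Definition general_position (k : 'I_n) (z : 'I_n -> R[i]) :=
  injective z /\ forall l j, l != j ->
    transcendental (direction k z l / direction k z j).

Definition endpoints (d : nat) (k : 'I_n) (z : 'I_n -> R[i]) : set R[i] :=
  [set direction k z l ^+ d | l in [set: 'I_n.-1]].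

(* M is a value at the class of b of the composition of p_k, f_d and rho: b   *)
(* is isotopic to some b' projecting to a diagram p_k(b'), which as a braid   *)
(* in the cylinder is represented by some D that is generic enough for        *)
(* f_d(D) to be a virtual diagram, and M = rho (f_d D).                       *)
Definition composition_value (far : bool) (k : 'I_n) (d : nat)
    (rho : diagram R n.-1 -> 'M[laurent]_n.-1)
    (z : 'I_n -> R[i]) (b : braid R n) (M : 'M[laurent]_n.-1) :=
  exists b' D,
  [/\ braid_isotopic z b b',
      cyl_diagram false (endpoints 1 k z) (p_diagram far k b'),
      cyl_equiv false (endpoints 1 k z) (p_diagram far k b') D,
      cyl_diagram true (endpoints d k z) (power_map d D)
    & M = rho (power_map d D)].

End Projection.

(* Main.v *)
Require Import Defs.
From Stdlib Require Import Relations.Relation_Operators.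
From mathcomp Require Import all_boot all_order all_fingroup all_algebra.
From mathcomp Require Import complex ring lra zify.
From mathcomp Require Import all_classical all_reals all_analysis.

Set Implicit Arguments.
Unset Strict Implicit.
Unset Printing Implicit Defensive.

Import Order.TTheory GRing.Theory Num.Theory.
Import numFieldNormedType.Exports.

Local Open Scope ring_scope.

(** At a time x of a diagram the strands split into clusters, the groups of strands standing at
    the same point of the circle, and in each cluster the over relation orders the strands
    meeting classically. Resolving the clusters by the positions of the strands at a nearby time
    y gives a matrix A_x(y), in closed form a Burau matrix with entries in t and s, and
    A_x(y') = A_y(y') A_x(y) for y, y' near x. The A_x are thus a flat connection, on
    every family of diagrams depending continuously on a parameter, in which the meetings may be
    as degenerate as one likes: multiple points, infinitely many meetings, tangencies. Its
    parallel transport from time 0 to time 1, read in the numbering of the endpoints, is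
    multiplicative, has the prescribed values on sigma_i, tau_i and zeta, and does not change
    along families with fixed ends. Isotopies and Reidemeister moves of diagrams, their images
    under f_d, and the images under p_k of isotopies of braids all are such families; in the last
    case p_k need not be generic at any time, so no codimension one analysis is needed.

    The homomorphism rho is unique because the generators generate VCB_m: cut a diagram
    into windows, each containing one time at which strands meet. The number
    sum_b floor((theta_a - theta_b) / 2 pi) says at which endpoint strand a should stand
    between the windows; in a window it changes only for the strands which cross, and these
    swap neighbouring positions in pairs.

    Every braid is isotopic to one whose diagrams under p_k and f_d o p_k are generic: turn the
    strands about strand k by small angles so that the angles become piecewise linear, with
    nodes avoiding the countably many values which create triple points or touching strands.
    The transcendence of the ratios of the base points ensures that distinct points keep distinct
    d-th powers. *)

(** * The Burau matrix of a cluster *)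

(** The closed form of A_x(y) can be read as a random walk: a strand going under another one keeps
    its own track with weight q and jumps to the upper track with weight 1 - q. The cocycle identity
    says that the walk may pause at an intermediate position; early and late ways of reaching a
    strand add up by a telescoping geometric sum. The obstacle is that meetings seen from strand k,
    or created by f_d, may accumulate, so that a product over crossings makes no sense. A horizontal
    section replaces it: a function N with N(y) = A_x(y) N(x) near every x, the radius depending on
    x. N(1) composes from right to left, so the transport is its inverse; hence the walk has the
    parameters t^-1 and s^-1. For uniqueness the strands are lifted to angles in R. Given the
    crossing data, only the order of the lifts and their translates by 2 pi matters up to isotopy.
    Convex combinations keep such orders, so straight-line interpolation supplies most isotopies; a
    second Reidemeister move serves only to reach the inverses of the sigma_i. *)

Section Potential.
Variables (K : comUnitRingType) (q s : K) (m : nat).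
Implicit Types (cl ov lf : rel 'I_m) (a b c o : 'I_m).

(* [cl], [ov] and [lf] say that two strands stand at the same point, that the first passes over
   the second, and that the first comes before the second in the resolution. Strand [a] picks up
   a factor [s] for every strand before it which it meets virtually and a factor [q] for every
   strand over it and before it; from one of the latter, [c], it can jump to [c], with weight
   [1 - q] and only those factors [q] that come from strands over [c]. *)
Definition vcount cl ov lf a :=
  #|[pred b | [&& cl a b, ~~ ov a b, ~~ ov b a & lf b a]]|.

Definition pot cl ov lf : 'M[K]_m := \matrix_(a, c)
  (s ^+ vcount cl ov lf a *
   (if c == a then q ^+ #|[pred o | ov o a && lf o a]|
    else if ov c a && lf c a then (1 - q) * q ^+ #|[pred o | ov o c && lf o a]|
    else 0)).

(** A cluster falls into layers, each totally ordered by [ov]; strands of different layers meet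
    virtually. This structure covers mixed triple points and the clusters created by f_d, where
    classical and virtual meetings share a point. *)
Definition layered cl ov :=
  [/\ irreflexive ov, transitive ov, subrel ov cl, equivalence_rel cl &
      forall a b c, ov a b || ov b a -> ov b c || ov c b ->
        [|| a == c, ov a c | ov c a]].

Lemma pot1 cl ov lf : (forall a b, cl a b -> ~~ lf a b) ->
  symmetric cl -> subrel ov cl -> pot cl ov lf = 1%:M.
Proof.
move=> nlf scl sub; apply/matrixP => a c; rewrite !mxE.
have -> : vcount cl ov lf a = 0%N.
  apply: eq_card0 => b; rewrite !inE; apply/negP => /and4P[cab _ _].
  by apply/negP/nlf; rewrite scl.
rewrite expr0 mul1r eq_sym; case: eqP => [_|_].
  rewrite eq_card0 ?expr0 // => b; rewrite !inE; apply/negP => /andP[/sub /nlf].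
  by move/negP.
by case: ifP => // /andP[/sub /nlf /negP].
Qed.

Hypothesis qu : q \is a GRing.unit.
Hypothesis su : s \is a GRing.unit.

(** Triangularity: row [a] has an invertible diagonal entry and otherwise only entries at strands
    over [a], so the unit row vectors are recovered by induction on the number of strands over
    [a]. *)
Lemma pot_unitmx cl ov lf : layered cl ov -> pot cl ov lf \in unitmx.
Proof.
case=> irr tr _ _ _; set A := pot cl ov lf.
suff H k a : (#|[pred o | ov o a]| < k)%N ->
    exists r : 'rV[K]_m, r *m A = delta_mx 0 a.
  have /fin_all_exists [r hr] : forall a, exists r : 'rV[K]_m, r *m A = delta_mx 0 a.
    by move=> a; apply: (H _.+1).
  have E : (\matrix_i r i) *m A = 1%:M.
    apply/row_matrixP => i; rewrite row_mul rowK hr.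
    by rewrite rowE mulmx1.
  by case/mulmx1_unit: E.
elim: k a => // k IH a; rewrite ltnS => ka.
have /fin_all_exists [r hr] : forall o, exists r : 'rV[K]_m, ov o a -> r *m A = delta_mx 0 o.
  move=> o; case oa: (ov o a); last by exists 0.
  have [|r hr] := IH o; last by exists r.
  apply: leq_trans ka; apply: proper_card; apply/properP; split.
    by apply/fintype.subsetP => b; rewrite !inE => /tr; apply.
  by exists o; rewrite !inE ?oa ?irr.
set x := s ^+ vcount cl ov lf a * q ^+ #|[pred o | ov o a && lf o a]|.
have xu : x \is a GRing.unit by rewrite unitrM !unitrX.
exists (x^-1 *: (delta_mx 0 a - \sum_(o | ov o a) A a o *: r o)).
rewrite -scalemxAl mulmxBl mulmx_suml.
under eq_bigr do rewrite -scalemxAl.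
rewrite (eq_bigr (fun o => A a o *: delta_mx 0 o)); last by move=> o oa; rewrite hr.
rewrite -rowE; apply/rowP => c; rewrite !mxE eqxx /= !summxE.
under eq_bigr do rewrite !mxE eqxx /=.
rewrite -/A; have [->|ca] := eqVneq c a.
  rewrite big1 ?subr0; last first.
    move=> o oa; case: (a =P o) => [E|_]; last by rewrite mulr0.
    by move: oa; rewrite -E irr.
  by rewrite mulVr.
case: (boolP (ov c a && lf c a)) => [/andP[oca lca]|nca].
  rewrite (bigD1 c) //= eqxx mulr1 big1 ?addr0; last first.
    by move=> o /andP[_]; rewrite eq_sym => /negPf ->; rewrite mulr0.
  by rewrite (negPf ca) oca lca subrr mulr0.
rewrite big1 ?subr0 ?mulr0 //= => o oa.
case: (c =P o) => [<-|_]; last by rewrite mulr0.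
by rewrite (negPf ca) (negPf nca) !mulr0 mul0r.
Qed.

(** In a chain the numbers of strands above are 0, 1, ..., #|S| - 1, so the sum telescopes. The
    induction removes the lowest strand, found as the one with most strands over it, because it
    counts for none of the others. *)
Lemma sum_geometric ov (S : {set 'I_m}) : irreflexive ov -> transitive ov ->
  {in S &, forall a b, [|| a == b, ov a b | ov b a]} ->
  \sum_(b in S) (1 - q) * q ^+ #|[pred o in S | ov o b]| = 1 - q ^+ #|S|.
Proof.
move=> irr tr; move En: #|S| => n; elim: n S En => [|n IH] S.
  by move/eqP; rewrite cards_eq0 => /eqP -> _; rewrite big_set0 expr0 subrr.
move=> cS tot.
have [b0 bS] : exists b, b \in S by apply/card_gt0P; rewrite cS.
case: (@arg_maxnP _ b0 (mem S) (fun b => #|[pred o in S | ov o b]|) bS) => b bS' bmax {b0 bS}.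
have lowest o : o \in S -> o != b -> ov o b.
  move=> oS ob; have := tot o b oS bS'; rewrite (negPf ob) /= => /orP[//|bo].
  have := bmax o oS; rewrite /= leqNgt => /negP; case.
  apply: proper_card; apply/properP; split.
    by apply/fintype.subsetP => x; rewrite !inE => /andP[-> /tr ->].
  by exists b; rewrite !inE (bS' : b \in S) ?bo ?irr.
have {}bS' : b \in S by [].
have cSb : #|S :\ b| = n by have := cardsD1 b S; rewrite bS' cS => -[].
have totb : {in S :\ b &, forall a c, [|| a == c, ov a c | ov c a]}.
  by move=> x y /setD1P[_ xS] /setD1P[_ yS]; apply: tot.
rewrite (big_setD1 b) //= (eq_bigr (fun i => (1 - q) * q ^+ #|[pred o in S :\ b | ov o i]|)).
  rewrite IH // (_ : #|_| = n) ?exprS; first by ring.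
  rewrite -cSb; apply: eq_card => o; rewrite !inE.
  case: eqVneq => [->|ob]; first by rewrite irr andbF.
  by case oS: (o \in S) => //=; rewrite lowest.
move=> i /setD1P[ib iS]; congr (_ * _ ^+ _); apply: eq_card => o; rewrite !inE.
case: eqVneq => [->|//]; rewrite bS' /=; apply/negP => bi.
by have := tr _ _ _ bi (lowest _ iS ib); rewrite irr.
Qed.

(** The cocycle identity behind flatness: the primed data are the finer clusters left at an
    intermediate position [lf0], and [lf] is a position near it. The product describes two-step
    walks, which jump inside the finer cluster and then at the coarse level. *)
Lemma pot_refine cl ov lf0 cl' ov' lf :
    layered cl ov -> equivalence_rel cl' -> subrel cl' cl ->
    (forall a b, ov' a b = cl' a b && ov a b) ->
    (forall a b, cl a b -> ~~ cl' a b -> lf a b = lf0 a b) ->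
    (forall a b, cl' a b -> ~~ lf0 a b) ->
    (forall a b c, cl' a b -> lf0 c a = lf0 c b) ->
  pot cl ov lf = pot cl' ov' lf *m pot cl ov lf0.
Proof.
case=> irr tr sub /equivalence_relP[clr clt] cmp /equivalence_relP[cr ct] subcl eov elf nlf0 elf0.
have csym : symmetric cl.
  by move=> x y; apply/idP/idP => h; rewrite -(clt _ _ h) clr.
have csym' : symmetric cl'.
  by move=> x y; apply/idP/idP => h; rewrite -(ct _ _ h) cr.
apply/matrixP => a c; rewrite !mxE.
(* The strands over and before [a] are split into those still together with [a] at the intermediate
   position ([S']) and those already separated from it there ([S0]). *)
pose S' := [set o | ov' o a && lf o a].
pose S0 := [set o | ov o a && lf0 o a].
have S'0 o : o \in S' -> o \in S0 = false.
  rewrite !inE eov => /andP[/andP[coa _] _]; apply/negP => /andP[_]; apply/negP/nlf0.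
  exact: coa.
have SE o : ov o a && lf o a = (o \in S') || (o \in S0).
  rewrite !inE eov; case ova: (ov o a); rewrite ?andbF //= andbT.
  case coa: (cl' o a) => /=; first by rewrite (negPf (nlf0 _ _ coa)) orbF.
  by rewrite elf ?coa // sub.
have cardU (P : pred 'I_m) :
    #|[pred o | P o && (ov o a && lf o a)]| =
    (#|[pred o in S' | P o]| + #|[pred o in S0 | P o]|)%N.
  rewrite -cardUI [X in (_ + X)%N]eq_card0 ?addn0.
    apply: eq_card => o; move: (SE o); rewrite !inE => ->.
    by case: (P o); rewrite ?andbT ?andbF ?orbF.
  move=> o; rewrite !inE; apply/negP => /andP[/andP[h1 _] /andP[h2 _]].
  by have := S'0 o; rewrite !inE h1 h2 => /(_ isT).
have cardO b : ov b a || (b == a) ->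
    #|[pred o | ov o b && lf o a]| = (#|[pred o in S' | ov o b]| + #|[pred o in S0 | ov o b]|)%N.
  move=> h; rewrite -cardU; apply: eq_card => o; rewrite !inE.
  case: (boolP (ov o b)) => //= ob.
  case/orP: h => [/(tr _ _ _ ob) -> //|/eqP ba]; by rewrite -ba ob.
(* Strands of one layer and one fine cluster have the same virtual meetings and the same place under
   [lf0], so the coarse count may be taken at [b] instead of [a]: a jump does not change the power
   of [s]. *)
have vE b : cl' a b -> (ov b a || (b == a)) ->
    vcount cl ov lf a = (vcount cl' ov' lf a + vcount cl ov lf0 b)%N.
  move=> cab ob.
  rewrite /vcount -cardUI [X in (_ + X)%N]eq_card0 ?addn0; last first.
    move=> o; rewrite !inE; apply/negP => /andP[/and4P[h1 h2 h3 h4] /and4P[h5 h6 h7 h8]].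
    move: h8; apply/negP/nlf0; rewrite csym' -(ct _ _ cab) //.
  apply: eq_card => o; rewrite !inE !eov -(elf0 _ _ o cab).
  rewrite -(clt _ _ (subcl _ _ cab) o) (csym' o a).
  case cao: (cl a o) => /=; last first.
    rewrite orbF; apply/esym/negP => /andP[cao' _].
    by have := subcl _ _ cao'; rewrite cao.
  have E : ov a o || ov o a = ov b o || ov o b \/ o = b \/ o = a.
    have [->|na] := eqVneq b a; first by left.
    have [->|nao] := eqVneq o a; first by right; right.
    have [->|nbo] := eqVneq o b; first by right; left.
    have oba : ov b a by move: ob; rewrite (negPf na) orbF.
    left; apply/idP/idP => h.
      by have := cmp b a o _ h; rewrite oba eq_sym (negPf nbo); apply.
    by have := cmp a b o _ h; rewrite oba orbT eq_sym (negPf nao); apply.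
  case cao': (cl' a o) => /=; last first.
    rewrite -elf ?(csym o) ?(csym' o) ?cao' //.
    case: E => [E|[E|E]].
    - by rewrite !andbA -!negb_or E.
    - by move: cao'; rewrite E cab.
    - by move: cao'; rewrite E cr.
  rewrite (negPf (nlf0 _ _ _)) ?andbF ?orbF // csym' //.
rewrite (bigD1 a) //= !mxE eqxx.
rewrite (eq_bigr (fun b => if b \in S' then s ^+ vcount cl ov lf a * ((1 - q) * q ^+ #|[pred o in S' | ov o b]| *
   (if c == b then q ^+ #|[pred o in S0 | ov o b]|
    else if (c \in S0) && ov c b then (1 - q) * q ^+ #|[pred o in S0 | ov o c]|
    else 0)) else 0)); last first.
  move=> b ba; rewrite !mxE (negPf ba) !inE; case: ifP => [/andP[oba lba]|_]; last by rewrite mulr0 mul0r.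
  have := oba; rewrite eov => /andP[cba oba'].
  have cab : cl' a b by rewrite csym'.
  rewrite (vE b cab) ?oba' // exprD.
  have -> : #|[pred o | ov' o b && lf o a]| = #|[pred o in S' | ov o b]|.
    apply: eq_card => o; rewrite !inE !eov -(csym' b o) -(csym' a o) -(ct _ _ cab).
    case: (cl' a o); rewrite ?andbF //=.
    by case ob: (ov o b); rewrite ?andbF ?andbT //= (tr _ _ _ ob).
  have h0 o : ov o b && lf0 o b = (o \in S0) && ov o b.
    rewrite !inE -(elf0 _ _ o cab).
    by case ob: (ov o b); rewrite ?andbF //= (tr _ _ _ ob) // andbT.
  have -> : #|[pred o | ov o b && lf0 o b]| = #|[pred o in S0 | ov o b]|.
    by apply: eq_card => o; rewrite !inE h0 !inE.
  have -> : (ov c b && lf0 c b) = (c \in S0) && ov c b by rewrite h0.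
  rewrite !inE.
  case: (c =P b) => _; first by ring.
  case: ifP => [/andP[/andP[oca lca] ocb]|_]; last by rewrite !mulr0.
  have -> : #|[pred o | ov o c && lf0 o b]| = #|[pred o in S0 | ov o c]|.
    apply: eq_card => o; rewrite !inE -(elf0 _ _ o cab).
    by case oc: (ov o c); rewrite ?andbF //= (tr _ _ _ oc) // andbT.
  by ring.
rewrite -big_mkcondr /=.
have -> : s ^+ vcount cl ov lf a = s ^+ vcount cl' ov' lf a * s ^+ vcount cl ov lf0 a.
  by rewrite (vE a) ?cr ?eqxx ?orbT // exprD.
have cardS' : #|[pred o | ov' o a && lf o a]| = #|S'|.
  by apply: eq_card => o; rewrite !inE.
have aS' : a \notin S' by rewrite !inE eov irr andbF.
rewrite (eq_bigl (mem S')); last first.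
  by move=> b; rewrite andbC /= andb_idr // => bS'; apply: contraNneq aS' => <-.
rewrite -mulr_sumr cardS'.
set X := s ^+ _; set Y := s ^+ _; set T := \sum_(_ in _) _.
have D (Z : K) : X * q ^+ #|S'| * (Y * Z) + X * Y * T = X * Y * (q ^+ #|S'| * Z + T) by ring.
rewrite D {D}; congr (_ * _); rewrite /T {T X Y}.
have cO0 b : ov b a || (b == a) -> #|[pred o | ov o b && lf0 o a]| = #|[pred o in S0 | ov o b]|.
  move=> h; apply: eq_card => o; rewrite !inE; case ob: (ov o b); rewrite ?andbF //= andbT.
  by case/orP: h => [/(tr _ _ _ ob) -> //|/eqP ba]; rewrite -ba ob.
have [->|ca] := eqVneq c a.
  rewrite cardO ?eqxx ?orbT // cO0 ?eqxx ?orbT // big1 ?addr0; last first.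
    move=> b bS'; case: eqP => [E|_]; first by move: aS'; rewrite E bS'.
    case: ifP => [/andP[]|_]; last by rewrite mulr0.
    by rewrite !inE irr.
  rewrite exprD; congr (q ^+ _ * _); apply: eq_card => o; rewrite !inE eov.
  by case: (ov o a); rewrite ?andbF ?andbT.
rewrite SE (_ : ov c a && lf0 c a = (c \in S0)); last by rewrite inE.
have [cS'|ncS'] := boolP (c \in S').
  rewrite S'0 //= mulr0 add0r (bigD1 c) //= eqxx big1 ?addr0; last first.
    by move=> b /andP[_]; rewrite eq_sym => /negPf ->; rewrite mulr0.
  rewrite cardO ?exprD ?mulrA //.
  by move: cS'; rewrite inE eov => /andP[/andP[_ ->]].
rewrite /=; have [cS0|ncS0] := boolP (c \in S0); last first.
  rewrite mulr0 add0r big1 // => b bS'; case: eqP => [E|_]; last by rewrite mulr0.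
  by move: ncS'; rewrite E bS'.
have oca : ov c a by move: cS0; rewrite inE => /andP[].
rewrite cardO ?oca // cO0 ?oca //.
have tot : {in S' &, forall x y, [|| x == y, ov x y | ov y x]}.
  move=> x y; rewrite !inE !eov => /andP[/andP[_ xa] _] /andP[/andP[_ ya] _].
  by apply: (cmp x a y); rewrite ?xa ?ya ?orbT.
(* A walk reaches [c] after passing all of [S'], or by way of a strand of [S'] below [c]. The jumps
   to such strands have total weight q^#|U| - q^#|S'|, a difference of two geometric sums. *)
pose U := [set b in S' | ov b c].
have totU : {in U &, forall x y, [|| x == y, ov x y | ov y x]}.
  by move=> x y; rewrite !(inE, in_setI) => /andP[xS _] /andP[yS _]; apply: tot; rewrite !inE.
have gS := sum_geometric irr tr tot; have gU := sum_geometric irr tr totU.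
rewrite (eq_bigr (fun b => if ov c b then (1 - q) * q ^+ #|[pred o in S' | ov o b]| *
    ((1 - q) * q ^+ #|[pred o in S0 | ov o c]|) else 0)); last first.
  move=> b bS'; case: eqP => [E|_]; first by move: ncS'; rewrite E bS'.
  by rewrite /=; case: (ov c b); rewrite ?mulr0.
rewrite -big_mkcondr /= -mulr_suml.
have : \sum_(b in S') (1 - q) * q ^+ #|[pred o in S' | ov o b]| =
   \sum_(b in S' | ov c b) (1 - q) * q ^+ #|[pred o in S' | ov o b]| + (1 - q ^+ #|U|).
  rewrite -gU (bigID (fun b => ov c b)) /=; congr (_ + _).
  apply: eq_big => [b|b /andP[bS' ncb]].
    rewrite !inE; case bS': (ov' b a && lf b a) => //=.
    have := cmp b a c; rewrite oca orbT; move: (bS'); rewrite eov => /andP[/andP[_ ->] _].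
    move=> /(_ isT isT) /or3P[/eqP E|obc|ocb].
    - by move: ncS'; rewrite -E inE bS'.
    - by rewrite obc; apply/negP => /(tr _ _ _ obc); rewrite irr.
    - by rewrite ocb; apply/esym/negP => /(tr _ _ _ ocb); rewrite irr.
  congr (_ * _ ^+ _); apply: eq_card => o; rewrite !inE.
  case ob: (ov o b); rewrite ?andbF //= !andbT.
  have obc : ov b c.
    have := cmp b a c; rewrite oca orbT; move: (bS'); rewrite inE eov => /andP[/andP[_ ->] _].
    move=> /(_ isT isT) /or3P[/eqP E|//|ocb]; last by rewrite ocb in ncb.
    by move: ncS'; rewrite -E bS'.
  by rewrite (tr _ _ _ ob obc) andbT.
rewrite gS; set W := \sum_(b in S' | ov c b) _ => gE.
have -> : W = q ^+ #|U| - q ^+ #|S'|.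
  have -> : W = (W + (1 - q ^+ #|U|)) - (1 - q ^+ #|U|) by ring.
  by rewrite -gE; ring.
rewrite exprD; have -> : #|[pred o in S' | ov o c]| = #|U|.
  by apply: eq_card => o; rewrite !inE.
by ring.
Qed.

End Potential.

(** * Continuous induction and compactness on [0, 1] *)

Section UnitInterval.
Variable R : realType.

(** Connectedness of [0, 1]: the supremum of the t such that [P] holds on [0, t] is 1. The local
    hypothesis carries [P] from any point near t to any other one, to the left or to the right. *)
Lemma unit_interval_ind (P : R -> Prop) :
    (forall t, 0 <= t <= 1 -> exists2 e : R, 0 < e &
       forall s s', 0 <= s <= 1 -> 0 <= s' <= 1 -> `|s - t| < e -> `|s' - t| < e ->
         P s -> P s') ->
  P 0 -> forall t, 0 <= t <= 1 -> P t.
Proof.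
move=> loc P0; pose S := [set t : R | 0 <= t <= 1 /\ forall s, 0 <= s <= t -> P s]%classic.
have S0 : S 0.
  split; first by rewrite lexx ler01.
  by move=> s /andP[s0 s0']; have -> : s = 0 by apply/eqP; rewrite eq_le s0' s0.
have hS : has_sup S by split; [exists 0 | exists 1 => x [/andP[]]].
set c := sup S.
have c0 : 0 <= c by apply: ub_le_sup => //; case: hS.
have c1 : c <= 1 by apply: ge_sup; [exists 0 | move=> x [/andP[]]].
have cI : 0 <= c <= 1 by rewrite c0 c1.
have [e e0 He] := loc c cI.
have [s Ss cs] := sup_adherent e0 hS.
have sc : s <= c by apply: ub_le_sup => //; case: hS.
have [/andP[s0 s1] sP] := Ss.
have Ps : P s by apply: sP; rewrite s0 lexx.
have near s' : 0 <= s' <= 1 -> c - e < s' < c + e -> P s'.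
  move=> s'I /andP[h1 h2]; apply: (He s) => //; first by rewrite s0 s1.
    by rewrite ltr_norml; apply/andP; split; move: cs; rewrite -/c; lra.
  by rewrite ltr_norml; apply/andP; split; lra.
have all t : 0 <= t <= 1 -> t < c + e -> P t.
  move=> /andP[t0 t1] tc; have [ts|st] := leP t s; first by apply: sP; rewrite t0.
  by apply: near; [rewrite t0 t1 | rewrite tc andbT (lt_trans _ st)].
suff c_eq1 : c = 1 by move=> t tI; apply: all => //; rewrite c_eq1; lra.
apply/eqP; rewrite eq_le c1 leNgt; apply/negP => c_lt1.
have : S (Num.min 1 (c + e / 2)).
  split=> [|t /andP[t0]]; first by rewrite le_min ge_min lexx ler01 /=; lra.
  rewrite le_min => /andP[t1 tc]; apply: all; first by rewrite t0 t1.
  by lra.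
move=> /(ub_le_sup (proj2 hS)); rewrite -/c ge_min; lra.
Qed.

Lemma close_pair (t e s s' x y : R) : `|s - t| < e / 2 -> `|s' - t| < e / 2 -> `|x - y| < e / 2 ->
  x <= s' -> y <= s' -> ~~ ((x <= s) && (y <= s)) -> `|x - t| < e /\ `|y - t| < e.
Proof.
rewrite !ltr_norml negb_and -!ltNge => /andP[h1 h2] /andP[h3 h4] /andP[h5 h6] xs ys.
by case/orP=> h; split; apply/andP; split; lra.
Qed.

Lemma unit_interval_lebesgue (Q : R -> R -> Prop) :
    (forall t, 0 <= t <= 1 -> exists2 e : R, 0 < e &
       forall s s', 0 <= s <= 1 -> 0 <= s' <= 1 -> `|s - t| < e -> `|s' - t| < e -> Q s s') ->
  exists2 e : R, 0 < e & forall s s', 0 <= s <= 1 -> 0 <= s' <= 1 -> `|s - s'| < e -> Q s s'.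
Proof.
move=> loc; pose P (t : R) := exists2 e : R, 0 < e &
  forall s s', 0 <= s <= t -> 0 <= s' <= t -> `|s - s'| < e -> Q s s'.
suff [e e0 he] : P 1 by exists e.
apply: unit_interval_ind; last by rewrite ler01 lexx.
  move=> t tI; have [e e0 He] := loc t tI; exists (e / 2); first by lra.
  move=> s s' /andP[s0 s1] /andP[s'0 s'1] st s't [d d0 Hd].
  exists (Num.min d (e / 2)); first by rewrite lt_min d0 /=; lra.
  move=> x y /andP[x0 xs] /andP[y0 ys]; rewrite lt_min => /andP[xyd xye].
  have [/andP[xs1 ys1]|xys] := boolP ((x <= s) && (y <= s)).
    by apply: Hd; rewrite ?x0 ?y0.
  have [hx hy] := close_pair st s't xye xs ys xys.
  by apply: He => //; apply/andP; split=> //; [exact: le_trans xs s'1|exact: le_trans ys s'1].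
have I0 : 0 <= (0 : R) <= 1 by rewrite lexx ler01.
have [e e0 He] := loc 0 I0; exists 1 => // s s' /andP[h1 h2] /andP[h3 h4] _.
have -> : s = 0 by apply/eqP; rewrite eq_le h1 h2.
have -> : s' = 0 by apply/eqP; rewrite eq_le h3 h4.
by apply: He; rewrite ?subrr ?normr0 ?lexx ?ler01.
Qed.

End UnitInterval.

(** * Horizontal sections of a locally flat connection *)

Section Horizontal.
Variables (R : realType) (T : Type) (A : R -> R -> T -> T).

(** The radius [e] serves all x' near x, while [e'] depends on x': meetings may accumulate at x. *)
Definition locally_flat := forall x, 0 <= x <= 1 -> exists2 e : R, 0 < e &
  forall x', 0 <= x' <= 1 -> `|x' - x| < e -> exists2 e' : R, 0 < e' &
    forall y, 0 <= y <= 1 -> `|y - x'| < e' -> forall v, A x y v = A x' y (A x x' v).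

(** Parallel sections of a connection which is known only through its transports from x to nearby
    points; no derivative is involved. *)
Definition horizontal (b : R) (N : R -> T) := forall x, 0 <= x <= b ->
  exists2 e : R, 0 < e & forall y, 0 <= y <= b -> `|y - x| < e -> N y = A x y (N x).

Hypothesis flat : locally_flat.
Hypothesis bijA : forall x y, 0 <= x <= 1 -> bijective (A x y).
Hypothesis idA : forall x v, 0 <= x <= 1 -> A x x v = v.

Lemma horizontal_exists v : exists2 N, N 0 = v & horizontal 1 N.
Proof.
suff : forall b, 0 <= b <= 1 -> exists2 N, N 0 = v & horizontal b N.
  by apply; rewrite ler01 lexx.
apply: unit_interval_ind => [t tI|]; last first.
  exists (fun=> v) => // x /andP[x0 x0'].
  have -> : x = 0 by apply/eqP; rewrite eq_le x0' x0.
  exists 1 => // y /andP[y0 y0'] _.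
  have -> : y = 0 by apply/eqP; rewrite eq_le y0' y0.
  by rewrite idA // lexx ler01.
have [e e0 He] := flat tI; exists e => // s s' /andP[s0 s1] /andP[s'0 s'1] st s't [N N0 hN].
have [s's|ss'] := leP s' s.
  exists N => // x /andP[x0 xs']; have [|d d0 hd] := hN x; first by rewrite x0 (le_trans xs').
  by exists d => // y /andP[y0 ys'] yx; apply: hd => //; rewrite y0 (le_trans ys').
have [g gK Kg] := bijA s tI.
(* Beyond s the section is continued by transporting from t the value [w] that matches [N] at s. *)
pose w := g (N s).
exists (fun y => if y <= s then N y else A t y w); first by rewrite s0.
have near y : s <= y <= s' -> 0 <= y <= 1 /\ `|y - t| < e.
  move=> /andP[sy ys']; split; first by apply/andP; split; lra.
  by move: st s't; rewrite !ltr_norml => /andP[? ?] /andP[? ?]; apply/andP; split; lra.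
have Ns : N s = A t s w by rewrite /w Kg.
move=> x /andP[x0 xs'].
have [xs|sx|xs] := ltgtP x s.
- have [|d d0 hd] := hN x; first by rewrite x0 ltW.
  exists (Num.min d (s - x)); first by rewrite lt_min d0 /= subr_gt0.
  move=> y /andP[y0 ys']; rewrite lt_min => /andP[yd ysx].
  have ys : y <= s by move: ysx; rewrite ltr_norml => /andP[_]; lra.
  by rewrite ys; apply: hd => //; rewrite y0.
- have [|xI xt] := near x; first by rewrite ltW.
  have [d d0 hd] := He x xI xt.
  exists (Num.min d (x - s)); first by rewrite lt_min d0 /= subr_gt0.
  move=> y /andP[y0 ys']; rewrite lt_min => /andP[yd ysx].
  have sy : s < y by move: ysx; rewrite ltr_norml => /andP[? _]; lra.
  by rewrite leNgt sy /= hd // y0 /=; lra.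
- rewrite {}xs; have [|sI _] := near s; first by rewrite lexx ltW.
  have [d d0 hd] := He s sI st; have [|d' d'0 hd'] := hN s; first by rewrite s0 lexx.
  exists (Num.min d d'); first by rewrite lt_min d0.
  move=> y /andP[y0 ys']; rewrite lt_min => /andP[yd yd'].
  have [ys|sy] := leP y s; first by apply: hd' => //; rewrite y0.
  by rewrite Ns hd // y0 /=; lra.
Qed.

(** Near a point of the segment both functions are images of their values at this point under one
    bijection, so equality spreads. The ends may come in either order and horizontality is asked
    only along the segment, which suits the deformation argument. *)
Lemma horizontal_unique_on N N' (s s' : R) : 0 <= s <= 1 -> 0 <= s' <= 1 ->
  (forall r : R, 0 <= r <= 1 -> exists2 e : R, 0 < e & forall y, 0 <= y <= 1 ->
     `|y - (s + r * (s' - s))| < e ->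
     N y = A (s + r * (s' - s)) y (N (s + r * (s' - s))) /\
     N' y = A (s + r * (s' - s)) y (N' (s + r * (s' - s)))) ->
  N s = N' s -> N s' = N' s'.
Proof.
move=> /andP[s0 s1] /andP[s'0 s'1] h Ns; pose p (r : R) := s + r * (s' - s).
have pI r : 0 <= r <= 1 -> 0 <= p r <= 1.
  by rewrite /p => /andP[r0 r1]; apply/andP; split; nra.
suff H : forall r, 0 <= r <= 1 -> N (p r) = N' (p r).
  by have := H 1; rewrite /p mul1r addrC subrK; apply; rewrite ler01 lexx.
apply: unit_interval_ind; last by rewrite /p mul0r addr0.
move=> r rI; have [e e0 He] := h r rI; exists e => // r1 r2 r1I r2I hr1 hr2.
have close r' : `|r' - r| < e -> `|p r' - p r| < e.
  apply: le_lt_trans; have -> : p r' - p r = (r' - r) * (s' - s) by rewrite /p; ring.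
  by rewrite normrM ler_piMr // ler_norml; apply/andP; split; lra.
have [-> ->] := He _ (pI _ r1I) (close _ hr1).
move=> /(bij_inj (bijA _ (pI _ rI))) E.
by have [-> ->] := He _ (pI _ r2I) (close _ hr2); rewrite E.
Qed.

Lemma horizontal_unique N N' : horizontal 1 N -> horizontal 1 N' -> N 0 = N' 0 ->
  forall t, 0 <= t <= 1 -> N t = N' t.
Proof.
move=> hN hN' NN'0 t /andP[t0 t1]; apply: (@horizontal_unique_on _ _ 0 t); rewrite ?lexx ?ler01 ?t0 //.
move=> r /andP[r0 r1]; have xI : 0 <= 0 + r * (t - 0) <= 1 by apply/andP; split; nra.
have [e e0 He] := hN _ xI; have [e' e'0 He'] := hN' _ xI.
exists (Num.min e e'); first by rewrite lt_min e0.
by move=> y yI; rewrite lt_min => /andP[h1 h2]; split; [exact: He|exact: He'].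
Qed.

End Horizontal.

(** * Continuity in epsilon-delta form; points of the unit circle *)

Section Circle.
Local Open Scope classical_set_scope.
Local Open Scope ring_scope.
Variable R : realType.
Implicit Types (z w : R[i]).
Local Notation Re := (@complex.Re R).
Local Notation Im := (@complex.Im R).

Definition square : set (R * R) := (`[0, 1] `*` `[0, 1])%classic.

Lemma squareP (u t : R) : square (u, t) <-> 0 <= u <= 1 /\ 0 <= t <= 1.
Proof. by rewrite /square /=; split=> -[]; rewrite !in_itv. Qed.

Lemma within_squareP (f : R * R -> R) : {within square, continuous f} <->
  forall (u t : R), 0 <= u <= 1 -> 0 <= t <= 1 -> forall e : R, 0 < e -> exists2 d : R, 0 < d &
    forall (u' t' : R), 0 <= u' <= 1 -> 0 <= t' <= 1 -> `|u' - u| < d -> `|t' - t| < d ->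
      `|f (u', t') - f (u, t)| < e.
Proof.
rewrite subspace_continuousP; split=> [h u t uI tI e e0|h [u t] /squareP[uI tI]].
  have /h : square (u, t) by apply/squareP.
  move=> /cvgrPdist_lt /(_ e e0); rewrite near_withinE => /nbhs_ballP[d /= d0 hd].
  exists d => // u' t' u'I t'I ud td; rewrite distrC; apply: hd; last by apply/squareP.
  by split; rewrite /ball /= distrC.
apply/cvgrPdist_lt => e e0; rewrite near_withinE; apply/nbhs_ballP.
have [d d0 hd] := h u t uI tI e e0; exists d => //= -[u' t'] [/= bu bt] /squareP[u'I t'I].
by rewrite distrC; apply: hd => //; [move: bu | move: bt]; rewrite /ball /= distrC.
Qed.

Lemma within_itvP (f : R -> R) : {within `[0, 1], continuous f} <->
  forall t : R, 0 <= t <= 1 -> forall e : R, 0 < e -> exists2 d : R, 0 < d &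
    forall t' : R, 0 <= t' <= 1 -> `|t' - t| < d -> `|f t' - f t| < e.
Proof.
rewrite subspace_continuousP; split=> [h t tI e e0|h t].
  have /h : `[0, 1]%classic t by rewrite /= in_itv.
  move=> /cvgrPdist_lt /(_ e e0); rewrite near_withinE => /nbhs_ballP[d /= d0 hd].
  exists d => // t' t'I td; rewrite distrC; apply: hd; last by rewrite /= in_itv.
  by rewrite /ball /= distrC.
rewrite /= in_itv /= => tI.
apply/cvgrPdist_lt => e e0; rewrite near_withinE; apply/nbhs_ballP.
have [d d0 hd] := h t tI e e0; exists d => //= t' bt; rewrite in_itv /= => t'I.
by rewrite distrC; apply: hd => //; move: bt; rewrite /ball /= distrC.
Qed.

Lemma cfamily_const (f : R -> R[i]) : cpath f -> cfamily (fun x => f x.2).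
Proof.
move=> [h1 h2]; split; apply/within_squareP => u t uI tI e e0.
  have [d d0 hd] := (within_itvP _).1 h1 t tI e e0.
  by exists d => // u' t' u'I t'I _; apply: hd.
have [d d0 hd] := (within_itvP _).1 h2 t tI e e0.
by exists d => // u' t' u'I t'I _; apply: hd.
Qed.

Lemma cfamily_slice (f : R * R -> R[i]) u : 0 <= u <= 1 -> cfamily f -> cpath (fun t => f (u, t)).
Proof.
move=> uI [h1 h2]; split; apply/within_itvP => t tI e e0.
  have [d d0 hd] := (within_squareP _).1 h1 u t uI tI e e0.
  by exists d => // t' t'I h; apply: hd; rewrite ?subrr ?normr0.
have [d d0 hd] := (within_squareP _).1 h2 u t uI tI e e0.
by exists d => // t' t'I h; apply: hd; rewrite ?subrr ?normr0.
Qed.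

Lemma complex_eqP z w : z = w <-> Re z = Re w /\ Im z = Im w.
Proof. by case: z w => [a b] [c d] /=; split=> [[-> ->] | [-> ->]]. Qed.

Lemma norm1E z : (`|z| == 1) = (Re z ^+ 2 + Im z ^+ 2 == 1).
Proof.
rewrite normc_def; apply/eqP/eqP => [|->]; last by rewrite sqrtr1.
move=> /(congr1 Re) /= h.
have : (Num.sqrt (Re z ^+ 2 + Im z ^+ 2)) ^+ 2 = 1 by rewrite h expr1n.
by rewrite sqr_sqrtr // addr_ge0 ?sqr_ge0.
Qed.

Lemma norm1_inv z : `|z| = 1 -> z^-1 = (z^*)%C.
Proof.
move=> /eqP; rewrite norm1E; case: z => a b /= /eqP h; apply/complex_eqP => /=.
by rewrite /GRing.inv /= h !divr1 ?mulr1.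
Qed.

Lemma Im_quotient z w : `|w| = 1 -> Im (z / w) = Im z * Re w - Re z * Im w.
Proof. by move=> /norm1_inv ->; case: z w => [a b] [c d] /=; ring. Qed.

Lemma Re_quotient z w : `|w| = 1 -> Re (z / w) = Re z * Re w + Im z * Im w.
Proof. by move=> /norm1_inv ->; case: z w => [a b] [c d] /=; ring. Qed.

Lemma norm1_neq0 z : `|z| = 1 -> z != 0.
Proof. by move=> h; rewrite -normr_eq0 h oner_neq0. Qed.

Lemma norm1_eq1 z : `|z| = 1 -> 0 < Re z -> Im z = 0 -> z = 1.
Proof.
move=> /eqP; rewrite norm1E; case: z => a b /= /eqP h a0 b0; apply/complex_eqP => /=.
by split => //; move: h; rewrite b0 expr0n addr0 => /eqP; rewrite sqrf_eq1 => /orP[/eqP //|/eqP]; lra.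
Qed.

(** The condition on the real part excludes opposite points, whose angle has sine 0 too. *)
Lemma norm1_eq z w : `|z| = 1 -> `|w| = 1 -> 0 < Re (z / w) -> Im (z / w) = 0 -> z = w.
Proof.
move=> z1 w1 h1 h2; have /(congr1 (fun x => x * w)) : z / w = 1.
  by apply: norm1_eq1 => //; rewrite normrM normfV z1 w1 invr1 mulr1.
by rewrite divfK ?mul1r // norm1_neq0.
Qed.

End Circle.

(** * Coherent families of diagrams and the flatness of their connection *)

Section Coherent.
Local Open Scope classical_set_scope.
Local Open Scope ring_scope.
Variables (R : realType) (m : nat) (up : bool).
Implicit Types (D : diagram R m) (G : R -> diagram R m).

Definition cl D t : rel 'I_m := fun i j => strand D i t == strand D j t.
(** [up] reverses the order, so that in sigma_i the strand starting at position i + 1 is always the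
    upper one for [ov], and one matrix serves both conventions. *)
Definition ov D t : rel 'I_m :=
  fun o a => if up then `[< Defs.over D a o t >] else `[< Defs.over D o a t >].
Definition lf D t : rel 'I_m := fun i j => 0 < turn D i j t.

Definition coherent G :=
  [/\ forall i, cfamily (fun x => strand (G x.1) i x.2),
      forall (u : R) i (t : R), 0 <= u <= 1 -> 0 <= t <= 1 -> `|strand (G u) i t| = 1,
      forall (u t : R), 0 <= u <= 1 -> 0 <= t <= 1 -> layered (cl (G u) t) (ov (G u) t)
    & forall (u t : R), 0 <= u <= 1 -> 0 <= t <= 1 -> exists2 e : R, 0 < e &
        forall (u' t' : R), 0 <= u' <= 1 -> 0 <= t' <= 1 -> `|u' - u| < e -> `|t' - t| < e ->
        forall i j, cl (G u') t' i j -> (Defs.over (G u') i j t' <-> Defs.over (G u) i j t)].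

(** Clusters are read at ([D], [t]), positions at ([D'], [t']): in a family both the time and the
    parameter move. *)
Definition dpot D t D' t' := pot (laurent_t^-1) (laurent_s^-1) (cl D t) (ov D t) (lf D' t').

Lemma cl_equiv D t : equivalence_rel (cl D t).
Proof. by move=> i j k; rewrite /cl; split=> // /eqP ->. Qed.

Lemma turn_nn D i j t : `|strand D i t| = 1 -> cl D t i j -> turn D i j t = 0.
Proof. by move=> h /eqP E; rewrite /turn -E divff // norm1_neq0. Qed.

Lemma turn_continuous G i j : (forall i, cfamily (fun x => strand (G x.1) i x.2)) ->
  (forall (u : R) i (t : R), 0 <= u <= 1 -> 0 <= t <= 1 -> `|strand (G u) i t| = 1) ->
  {within @square R, continuous (fun x => turn (G x.1) i j x.2)} /\
  {within @square R, continuous (fun x => complex.Re (strand (G x.1) j x.2 / strand (G x.1) i x.2))}.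
Proof.
move=> hc h1; have [hRi hIi] := hc i; have [hRj hIj] := hc j; split.
- apply: (@subspace_eq_continuous _ _ _ (fun x => complex.Im (strand (G x.1) j x.2) * complex.Re (strand (G x.1) i x.2) -
    complex.Re (strand (G x.1) j x.2) * complex.Im (strand (G x.1) i x.2))).
    by move=> [u t] /set_mem/squareP[uI tI]; rewrite /from_subspace /turn Im_quotient // h1.
  by move=> x; apply: cvgB; apply: cvgM; [exact: hIj|exact: hRi|exact: hRj|exact: hIi].
- apply: (@subspace_eq_continuous _ _ _ (fun x => complex.Re (strand (G x.1) j x.2) * complex.Re (strand (G x.1) i x.2) +
    complex.Im (strand (G x.1) j x.2) * complex.Im (strand (G x.1) i x.2))).
    by move=> [u t] /set_mem/squareP[uI tI]; rewrite /from_subspace Re_quotient // h1.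
  by move=> x; apply: cvgD; apply: cvgM; [exact: hRj|exact: hRi|exact: hIj|exact: hIi].
Qed.

Lemma fin_exists_pos (I : finType) (P : I -> R -> Prop) :
  (forall i e e', 0 < e' <= e -> P i e -> P i e') ->
  (forall i, exists2 e : R, 0 < e & P i e) -> exists2 e : R, 0 < e & forall i, P i e.
Proof.
move=> mono /fin_all_exists2[f f0 fP].
exists (\big[Num.min/1]_i f i).
  by apply: (big_ind (fun x => 0 < x)) => // x y x0 y0; rewrite lt_min x0.
move=> i; apply: mono (fP i); apply/andP; split; last exact: bigmin_le_cond.
by apply: (big_ind (fun x => 0 < x)) => // x y x0 y0; rewrite lt_min x0.
Qed.

(** Near (u, t) separated strands stay separated, and the strands of a cluster stay within a half
    circle of each other, where the sign of [turn] can change only at a meeting. So the clusters at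
    (u', t') are finer, and [pot_refine] applies. *)
Lemma coherent_flat G : coherent G -> forall (u t : R), 0 <= u <= 1 -> 0 <= t <= 1 ->
  exists2 e : R, 0 < e &
    forall (u' t' : R), 0 <= u' <= 1 -> 0 <= t' <= 1 -> `|u' - u| < e -> `|t' - t| < e ->
  exists2 e' : R, 0 < e' &
    forall (v r : R), 0 <= v <= 1 -> 0 <= r <= 1 -> `|v - u'| < e' -> `|r - t'| < e' ->
  dpot (G u) t (G v) r = dpot (G u') t' (G v) r *m dpot (G u) t (G u') t'.
Proof.
case=> hc h1 hl ho u t uI tI; have [e0 e00 he0] := ho u t uI tI.
pose P (x : 'I_m * 'I_m) (e : R) := forall (u' t' : R), 0 <= u' <= 1 -> 0 <= t' <= 1 ->
  `|u' - u| < e -> `|t' - t| < e ->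
  (cl (G u') t' x.1 x.2 -> cl (G u) t x.1 x.2) /\
  (cl (G u) t x.1 x.2 -> 0 < complex.Re (strand (G u') x.2 t' / strand (G u') x.1 t')).
have [|[i j]|e1 e10 he1] := @fin_exists_pos _ P.
- move=> x e e' /andP[e'0 ee'] he u' t' u'I t'I h h'.
  by apply: he => //; apply: lt_le_trans ee'.
- have [/within_squareP cI /within_squareP cR] := turn_continuous i j hc h1.
  case: (boolP (cl (G u) t i j)) => cij.
    have [d d0 hd] := cR u t uI tI 1 ltr01; exists d => // u' t' u'I t'I hu ht; split=> // _ /=.
    have := hd u' t' u'I t'I hu ht; rewrite /= -(eqP cij) divff ?norm1_neq0 ?h1 //= ltr_norml.
    by move=> /andP[? _]; lra.
  suff [d d0 hd] : exists2 d : R, 0 < d & forall (u' t' : R), 0 <= u' <= 1 -> 0 <= t' <= 1 ->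
      `|u' - u| < d -> `|t' - t| < d -> ~~ cl (G u') t' i j.
    exists d => // u' t' u'I t'I hu ht; split=> /=; last by rewrite (negPf cij).
    by have := hd u' t' u'I t'I hu ht => /negPf ->.
  set z := strand (G u) j t / strand (G u) i t.
  have nc u' t' : 0 <= u' <= 1 -> 0 <= t' <= 1 -> cl (G u') t' i j ->
      strand (G u') j t' / strand (G u') i t' = 1.
    by move=> u'I t'I /eqP <-; rewrite divff // norm1_neq0 // h1.
  have [Re1|Re1] := eqVneq (complex.Re z) 1; last first.
    have [|d d0 hd] := cR u t uI tI `|complex.Re z - 1|; first by rewrite normr_gt0 subr_eq0.
    exists d => // u' t' u'I t'I hu ht; apply/negP => /nc - /(_ u'I t'I) E.
    by have := hd u' t' u'I t'I hu ht; rewrite /= E /= distrC ltxx.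
  have Im0 : complex.Im z = 0.
    apply/eqP; move: (h1 u j t uI tI) (h1 u i t uI tI) => hj hi.
    have : `|z| == 1 by rewrite normrM normfV hi hj divr1.
    by rewrite norm1E Re1 expr1n -subr_eq0 addrAC subrr add0r sqrf_eq0.
  case/negP: cij; apply/eqP/esym; apply: norm1_eq; rewrite ?h1 //.
  by rewrite -/z Re1.
exists (Num.min e0 e1); first by rewrite lt_min e00.
move=> u' t' u'I t'I; rewrite !lt_min => /andP[hu0 hu1] /andP[ht0 ht1].
pose P' (x : 'I_m * 'I_m) (e : R) := forall (v r : R), 0 <= v <= 1 -> 0 <= r <= 1 ->
  `|v - u'| < e -> `|r - t'| < e ->
  cl (G u) t x.1 x.2 -> ~~ cl (G u') t' x.1 x.2 -> lf (G v) r x.1 x.2 = lf (G u') t' x.1 x.2.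
have [|[i j]|e' e'0 he'] := @fin_exists_pos _ P'.
- move=> x e e' /andP[e'0 ee'] he v r vI rI h h'.
  by apply: he => //; apply: lt_le_trans ee'.
- case: (boolP (cl (G u) t i j && ~~ cl (G u') t' i j)) => [/andP[cij ncij]|nc]; last first.
    by exists 1 => // v r _ _ _ _ h1' h2'; move: nc; rewrite h1' h2'.
  have [/within_squareP cI _] := turn_continuous i j hc h1.
  have [_ /(_ cij) rpos] := he1 (i, j) u' t' u'I t'I hu1 ht1.
  have tn0 : turn (G u') i j t' != 0.
    apply: contra ncij => /eqP t0; apply/eqP/esym; apply: norm1_eq; rewrite ?h1 //.
  have [|d d0 hd] := cI u' t' u'I t'I `|turn (G u') i j t'|; first by rewrite normr_gt0.
  exists d => // v r vI rI hv hr _ _ /=; have := hd v r vI rI hv hr; rewrite /= /lf.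
  case: (ltgtP 0 (turn (G u') i j t')) => [gt0|lt0|E]; last by rewrite -E eqxx in tn0.
    by rewrite (gtr0_norm gt0) ltr_norml => /andP[? _]; lra.
  by rewrite (ltr0_norm lt0) ltr_norml => /andP[_ ?]; apply/negbTE; rewrite -leNgt; lra.
exists e' => // v r vI rI hv hr; apply: pot_refine => //.
- exact: hl.
- exact: cl_equiv.
- by move=> i j; have [] := he1 (i, j) u' t' u'I t'I hu1 ht1.
- move=> i j; case: (boolP (cl (G u') t' i j)) => cij /=.
    rewrite /ov; case: up; apply: asbool_equiv_eq; apply: he0 => //.
    by rewrite /cl eq_sym.
  by apply/negP => oij; have [_ _ /(_ i j oij) h _ _] := hl u' t' u'I t'I; rewrite h in cij.
- by move=> i j; apply: (he' (i, j)).
- by move=> i j cij; rewrite /lf turn_nn ?ltxx ?h1.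
- by move=> i j k /eqP E; rewrite /lf /turn E.
Qed.

End Coherent.

(** * Parallel transport *)

Section Transport.
Local Open Scope classical_set_scope.
Local Open Scope ring_scope.
Variables (R : realType) (m : nat) (up : bool).
Implicit Types (D : diagram R m) (G : R -> diagram R m).

Lemma unit0 : 0 <= (0 : R) <= 1. Proof. by rewrite lexx ler01. Qed.
Lemma unit1 : 0 <= (1 : R) <= 1. Proof. by rewrite lexx ler01. Qed.
Hint Resolve unit0 unit1 : core.

Lemma segment_between (s s' r : R) : 0 <= r -> r <= 1 ->
  s <= s + r * (s' - s) <= s' \/ s' <= s + r * (s' - s) <= s.
Proof.
move=> r0 r1; have [ss'|/ltW ss'] := leP s s'; [left|right]; apply/andP; split; nra.
Qed.

Lemma segment_le (a b s s' r : R) : 0 <= r -> r <= 1 -> a <= s <= b -> a <= s' <= b ->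
  a <= s + r * (s' - s) <= b.
Proof.
move=> r0 r1 /andP[h1 h2] /andP[h3 h4].
by case: (segment_between s s' r0 r1) => /andP[h5 h6]; apply/andP; split;
  [exact: le_trans h5|exact: le_trans h4|exact: le_trans h5|exact: le_trans h2].
Qed.

Lemma segment_lt (a b s s' r : R) : 0 <= r -> r <= 1 -> a < s < b -> a < s' < b ->
  a < s + r * (s' - s) < b.
Proof.
move=> r0 r1 /andP[h1 h2] /andP[h3 h4].
by case: (segment_between s s' r0 r1) => /andP[h5 h6]; apply/andP; split;
  [exact: lt_le_trans h5|exact: le_lt_trans h4|exact: lt_le_trans h5|exact: le_lt_trans h2].
Qed.

Definition good D := [/\ coherent up (fun=> D), injective ((strand D)^~ 0) &
  injective ((strand D)^~ 1)].

Lemma coherent_slice G u : 0 <= u <= 1 -> coherent up G -> coherent up (fun=> G u).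
Proof.
move=> uI [hc h1 hl ho]; split.
- by move=> i; have := cfamily_const (cfamily_slice uI (hc i)).
- by move=> _ i t _ tI; apply: h1.
- by move=> _ t _ tI; apply: hl.
- move=> u0 t u0I tI; have [e e0 he] := ho u t uI tI; exists e => // u' t' u'I t'I _.
  by apply: he; rewrite ?subrr ?normr0.
Qed.

Lemma dpot_unitmx D t D' t' : layered (cl D t) (ov up D t) -> dpot up D t D' t' \in unitmx.
Proof.
move=> h; apply: pot_unitmx => //; rewrite unitrV; [exact: laurent_t_unit|exact: laurent_s_unit].
Qed.

Lemma dpot_trivial D t D' t' : (forall i, `|strand D' i t'| = 1) ->
  layered (cl D t) (ov up D t) ->
  (forall i j, cl D t i j -> strand D' i t' = strand D' j t') -> dpot up D t D' t' = 1%:M.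
Proof.
move=> h1 [_ _ sub _ _] he; apply: pot1 => //.
- by move=> i j /he E; rewrite /lf turn_nn ?ltxx // /cl E.
- by move=> i j; rewrite /cl eq_sym.
Qed.

Lemma dpot_injective D t D' t' : (forall i, `|strand D' i t'| = 1) ->
  layered (cl D t) (ov up D t) -> injective ((strand D)^~ t) -> dpot up D t D' t' = 1%:M.
Proof. by move=> h1 hl inj; apply: dpot_trivial => // i j /eqP/inj ->. Qed.

Definition flow D (x y : R) (M : 'M[laurent]_m) := dpot up D x D y *m M.

Definition section D N := horizontal (flow D) 1 N.

(* Junk value: the identity when [D] has no horizontal section. *)
Definition transport D : 'M[laurent]_m :=
  xget 1%:M [set M | exists N, [/\ N 0 = 1%:M, section D N & M = invmx (N 1)]].

Section Single.
Variable D : diagram R m.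
Hypothesis cD : coherent up (fun=> D).

Lemma flow_flat : locally_flat (flow D).
Proof.
move=> x xI; have [e e0 he] := coherent_flat cD unit0 xI; exists e => // x' x'I hx.
have [|e' e'0 he'] := he 0 x' unit0 x'I _ hx; first by rewrite subrr normr0.
exists e' => // y yI hy v; rewrite /flow mulmxA; congr (_ *m _).
by apply: (he' 0) => //; rewrite subrr normr0.
Qed.

Lemma flow_bij x y : 0 <= x <= 1 -> bijective (flow D x y).
Proof.
move=> xI; have [_ _ hl _] := cD; have h := dpot_unitmx D y (hl 0 x unit0 xI).
by exists (mulmx (invmx (dpot up D x D y))) => M; rewrite /flow ?mulKmx ?mulKVmx.
Qed.

Lemma flow_id x M : 0 <= x <= 1 -> flow D x x M = M.
Proof.
move=> xI; have [_ h1 hl _] := cD.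
rewrite /flow dpot_trivial ?mul1mx //; first by move=> i; apply: (h1 0).
  exact: (hl 0).
by move=> i j /eqP.
Qed.

Lemma section_unit N : N 0 = 1%:M -> section D N -> forall t, 0 <= t <= 1 -> N t \in unitmx.
Proof.
move=> N0 hN; apply: unit_interval_ind; last by rewrite N0 unitmx1.
move=> t tI; have [e e0 he] := hN t tI; exists e => // s s' sI s'I hs hs'.
have [_ _ hl _] := cD; have h y := dpot_unitmx D y (hl 0 t unit0 tI).
by rewrite (he s sI hs) (he s' s'I hs') /flow !unitmx_mul (h s) (h s').
Qed.

Lemma section_exists : exists2 N, N 0 = 1%:M & section D N.
Proof. exact: (horizontal_exists flow_flat flow_bij flow_id). Qed.

Lemma transportE N : N 0 = 1%:M -> section D N -> transport D = invmx (N 1).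
Proof.
move=> N0 hN; rewrite /transport; case: xgetP => [M _ [N' [N'0 hN' ->]]|/(_ (invmx (N 1)))].
  by rewrite (horizontal_unique flow_bij hN' hN) ?N'0.
by case; exists N.
Qed.

Lemma transport_unit : transport D \in unitmx.
Proof.
have [N N0 hN] := section_exists.
by rewrite (transportE N0 hN) unitmx_inv (section_unit N0 hN).
Qed.

End Single.

(** The sections of neighbouring diagrams are compared at equal times: they differ by the matrix
    which changes the parameter from u0 to u. It is the identity at times 0 and 1, where no two
    strands meet. *)
Lemma transport_family G : coherent up G -> (forall u, 0 <= u <= 1 -> good (G u)) ->
  transport (G 0) = transport (G 1).
Proof.
move=> cG gG; have cs u : 0 <= u <= 1 -> coherent up (fun=> G u) by move=> /gG[].
have [hc h1 hl ho] := cG.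
have /choice[N hN] : forall u, exists N, 0 <= u <= 1 -> N 0 = 1%:M /\ section (G u) N.
  move=> u; case: (boolP (0 <= u <= 1)) => [/cs/section_exists[N N0 hN]|_]; last by exists (fun=> 0).
  by exists N.
suff const u0 : 0 <= u0 <= 1 -> exists2 e : R, 0 < e & forall u, 0 <= u <= 1 ->
    `|u - u0| < e -> transport (G u) = transport (G u0).
  have : forall u, 0 <= u <= 1 -> transport (G 0) = transport (G u).
    apply: unit_interval_ind => // u0 u0I; have [e e0 he] := const u0 u0I.
    by exists e => [//|u u' uI u'I hu hu' ->]; rewrite (he u uI hu) (he u' u'I hu').
  by move/(_ 1); apply.
move=> u0I; pose Q (t : R) := exists2 e : R, 0 < e & forall u, 0 <= u <= 1 -> `|u - u0| < e ->
  N u t = dpot up (G u0) t (G u) t *m N u0 t.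
suff [e e0 he] : Q 1.
  exists e => [//|u uI hu]; have [Nu0 hNu] := hN u uI; have [Nu00 hNu0] := hN u0 u0I.
  rewrite (transportE (cs _ uI) Nu0 hNu) (transportE (cs _ u0I) Nu00 hNu0) (he u uI hu).
  rewrite dpot_injective ?mul1mx //; [by move=> i; apply: h1|exact: hl|].
  by case: (gG u0 u0I).
apply: unit_interval_ind => //; last first.
  exists 1 => // u uI _; have [-> _] := hN u uI; have [-> _] := hN u0 u0I.
  rewrite dpot_injective ?mul1mx //; [by move=> i; apply: h1|exact: hl|].
  by case: (gG u0 u0I).
move=> t tI; have [e1 e10 he1] := coherent_flat cG u0I tI.
have [Nu00 hNu0] := hN u0 u0I; have [e2 e20 he2] := hNu0 t tI.
exists (Num.min e1 e2); first by rewrite lt_min e10.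
move=> s s' sI s'I; rewrite !lt_min => /andP[hs1 hs2] /andP[hs'1 hs'2] [es es0 hes].
have u00 : `|u0 - u0| < e1 by rewrite subrr normr0.
have [d d0 hd] := he1 u0 s u0I sI u00 hs1.
have [d' d'0 hd'] := he1 u0 s' u0I s'I u00 hs'1.
exists (Num.min (Num.min es e1) (Num.min d d')); first by rewrite !lt_min es0 e10 d0.
move=> u uI; rewrite !lt_min => /andP[/andP[hu1 hu2] /andP[hu3 hu4]].
have [Nu0 hNu] := hN u uI.
(* The section of [G u0] at t, carried over to [G u]. By flatness in two variables it is horizontal
   for [G u] between s and s', so it agrees with [N u] there. *)
pose K y := dpot up (G u0) t (G u) y *m N u0 t.
suff : N u s' = K s'.
  rewrite /K => ->; rewrite (he2 s' s'I hs'2) /flow mulmxA; congr (_ *m _).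
  by apply: hd' => //; rewrite subrr normr0.
apply: (horizontal_unique_on (flow_bij (cs u uI)) sI s'I); last first.
  rewrite hes // (he2 s sI hs2) /flow mulmxA /K; congr (_ *m _).
  by apply/esym; apply: hd => //; rewrite subrr normr0.
move=> r /andP[r0 r1]; set x := s + r * (s' - s).
have [xI hx] : 0 <= x <= 1 /\ `|x - t| < e1.
  by split; [exact: segment_le|move: hs1 hs'1; rewrite !ltr_distl => h2 h3; exact: segment_lt].
have [e e0 he] := hNu x xI; have [e' e'0 he'] := he1 u x uI xI hu2 hx.
exists (Num.min e e'); first by rewrite lt_min e0.
move=> y yI; rewrite lt_min => /andP[hy hy']; split; first exact: he.
rewrite /K /flow mulmxA; congr (_ *m _); apply: he' => //.
by rewrite subrr normr0.
Qed.

Lemma same_diagram_coherent D D' : same_diagram D D' -> coherent up (fun=> D) ->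
  coherent up (fun=> D').
Proof.
move=> sD [hc h1 hl ho]; split.
- move=> i; have [/within_squareP hr /within_squareP hi] := hc i.
  split; apply/within_squareP => u t uI tI e e0.
    have [d d0 hd] := hr u t uI tI e e0; exists d => // u' t' u'I t'I hu ht.
    by have := hd u' t' u'I t'I hu ht; rewrite /= !(proj1 (sD _ _)).
  have [d d0 hd] := hi u t uI tI e e0; exists d => // u' t' u'I t'I hu ht.
  by have := hd u' t' u'I t'I hu ht; rewrite /= !(proj1 (sD _ _)).
- by move=> u i t uI tI; rewrite -(proj1 (sD t tI)); apply: (h1 0).
- move=> u t uI tI; have := hl u t uI tI.
  congr layered; apply/funext => i; apply/funext => j.
    by rewrite /cl !(proj1 (sD t tI)).
  by rewrite /ov; case: up; apply: asbool_equiv_eq; apply: (proj2 (sD t tI)).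
- move=> u t uI tI; have [e e0 he] := ho u t uI tI; exists e => // u' t' u'I t'I hu ht i j.
  rewrite /cl -!(proj1 (sD t' t'I)) => /(he _ _ _) h.
  have [_ oE'] := sD t' t'I; have [_ oE] := sD t tI.
  by have [h1' h2'] := h u' u'I t'I hu ht; split=> [/oE' /h1' /oE|/oE /h2' /oE'].
Qed.

Lemma same_diagram_good D D' : same_diagram D D' -> good D -> good D'.
Proof.
move=> sD [h1 h2 h3]; split; first exact: same_diagram_coherent h1.
  by move=> i j; rewrite /= -!(proj1 (sD 0 _)) //; apply: h2.
by move=> i j; rewrite /= -!(proj1 (sD 1 _)) //; apply: h3.
Qed.

Lemma same_diagram_transport D D' : same_diagram D D' -> good D -> transport D = transport D'.
Proof.
move=> sD gD; have gD' := same_diagram_good sD gD.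
have [cD _ _] := gD; have [cD' _ _] := gD'.
have [N N0 hN] := section_exists cD.
rewrite (transportE cD N0 hN); apply/esym/transportE => // x xI.
have [e e0 he] := hN x xI; exists e => // y yI hy; rewrite he // /flow; congr (_ *m _).
have clE t : 0 <= t <= 1 -> cl D t = cl D' t.
  by move=> tI; apply/funext => i; apply/funext => j; rewrite /cl !(proj1 (sD t tI)).
rewrite /dpot clE //; congr pot; apply/funext => i; apply/funext => j.
  by rewrite /ov; case: up; apply: asbool_equiv_eq; apply: (proj2 (sD x xI)).
by rewrite /lf /turn !(proj1 (sD y yI)).
Qed.

End Transport.

(** * Coherence of generic and singular diagrams and of d-th powers *)

Section CoherentFamilies.
Local Open Scope classical_set_scope.
Local Open Scope ring_scope.
Variables (R : realType) (m : nat) (up : bool).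
Implicit Types (D : diagram R m) (G : R -> diagram R m).

(** Since [classical_at] is symmetric, a chain of two classical meetings may return to its start;
    this is the alternative i = l. *)
Definition tame D t :=
  [/\ forall i, ~ Defs.over D i i t,
      forall i j, Defs.over D i j t -> strand D i t = strand D j t &
      forall i j l, classical_at D i j t -> classical_at D j l t ->
        i = l \/ classical_at D i l t /\ (Defs.over D i j t -> Defs.over D j l t -> Defs.over D i l t)].

Lemma tame_layered D t : (forall i j, Defs.over D i j t -> ~ Defs.over D j i t) ->
  tame D t -> layered (cl D t) (ov up D t).
Proof.
move=> asym [irr sub chain]; split.
- by move=> i; rewrite /ov if_same; apply/asboolP.
- move=> j i l; rewrite /ov; case: up => /asboolP h1 /asboolP h2; apply/asboolP.
    have [E|[_]] := chain l j i (or_introl h2) (or_introl h1); last by apply.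
    by have := asym _ _ h1; rewrite -E.
  have [E|[_]] := chain i j l (or_introl h1) (or_introl h2); last by apply.
  by have := asym _ _ h1; rewrite E.
- by move=> i j; rewrite /ov /cl; case: up => /asboolP/sub ->.
- exact: cl_equiv.
- have ovE i j : ov up D t i j || ov up D t j i <-> classical_at D i j t.
    rewrite /ov /classical_at; case: up; split.
    + by move=> /orP[/asboolP|/asboolP]; tauto.
    + by move=> [h|h]; apply/orP; [right|left]; apply/asboolP.
    + by move=> /orP[/asboolP|/asboolP]; tauto.
    + by move=> [h|h]; apply/orP; [left|right]; apply/asboolP.
  move=> i j l /ovE h1 /ovE h2; have [->|[h _]] := chain i j l h1 h2; first by rewrite eqxx.
  by move/ovE: h => ->; rewrite orbT.
Qed.

Lemma near_not_cl G i j (u t : R) : (forall i, cfamily (fun x => strand (G x.1) i x.2)) ->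
  (forall (u : R) i (t : R), 0 <= u <= 1 -> 0 <= t <= 1 -> `|strand (G u) i t| = 1) ->
  0 <= u <= 1 -> 0 <= t <= 1 -> ~~ cl (G u) t i j ->
  exists2 d : R, 0 < d & forall u' t' : R, 0 <= u' <= 1 -> 0 <= t' <= 1 ->
    `|u' - u| < d -> `|t' - t| < d -> ~~ cl (G u') t' i j.
Proof.
move=> hc h1 uI tI ncij.
have [/within_squareP cI /within_squareP cR] := turn_continuous i j hc h1.
set z := strand (G u) j t / strand (G u) i t.
have nc (u' t' : R) : 0 <= u' <= 1 -> 0 <= t' <= 1 -> cl (G u') t' i j ->
    strand (G u') j t' / strand (G u') i t' = 1.
  by move=> u'I t'I /eqP <-; rewrite divff // norm1_neq0 // h1.
have [Re1|Re1] := eqVneq (complex.Re z) 1; last first.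
  have [|d d0 hd] := cR u t uI tI `|complex.Re z - 1|; first by rewrite normr_gt0 subr_eq0.
  exists d => // u' t' u'I t'I hu ht; apply/negP => /nc - /(_ u'I t'I) E.
  by have := hd u' t' u'I t'I hu ht; rewrite /= E /= distrC ltxx.
have Im0 : complex.Im z = 0.
  apply/eqP; move: (h1 u j t uI tI) (h1 u i t uI tI) => hj hi.
  have : `|z| == 1 by rewrite normrM normfV hi hj divr1.
  by rewrite norm1E Re1 expr1n -subr_eq0 addrAC subrr add0r sqrf_eq0.
case/negP: ncij; apply/eqP/esym; apply: norm1_eq; rewrite ?h1 //.
by rewrite -/z Re1.
Qed.

Lemma coherent_intro G :
  (forall i, cfamily (fun x => strand (G x.1) i x.2)) ->
  (forall (u : R) i (t : R), 0 <= u <= 1 -> 0 <= t <= 1 -> `|strand (G u) i t| = 1) ->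
  (forall u t i j, 0 <= u <= 1 -> 0 <= t <= 1 -> Defs.over (G u) i j t -> ~ Defs.over (G u) j i t) ->
  (forall u t, 0 <= u <= 1 -> 0 <= t <= 1 -> tame (G u) t) ->
  (forall (u t : R) i j, 0 <= u <= 1 -> 0 <= t <= 1 -> i != j -> cl (G u) t i j ->
    exists2 e : R, 0 < e & forall u' t' : R, 0 <= u' <= 1 -> 0 <= t' <= 1 ->
      `|u' - u| < e -> `|t' - t| < e -> cl (G u') t' i j ->
      (Defs.over (G u') i j t' <-> Defs.over (G u) i j t)) ->
  coherent up G.
Proof.
move=> hc h1 asym ht ho; split=> //.
  by move=> u t uI tI; apply: tame_layered; [move=> i j; apply: asym|apply: ht].
move=> u t uI tI.
pose P (x : 'I_m * 'I_m) (e : R) := forall u' t' : R, 0 <= u' <= 1 -> 0 <= t' <= 1 ->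
  `|u' - u| < e -> `|t' - t| < e -> cl (G u') t' x.1 x.2 ->
   (Defs.over (G u') x.1 x.2 t' <-> Defs.over (G u) x.1 x.2 t).
have [|[i j]|e e0 he] := @fin_exists_pos _ _ P; last first.
- by exists e => // u' t' u'I t'I hu ht' i j; apply: (he (i, j)).
- have [cij|ncij] := boolP (cl (G u) t i j); last first.
    have [e e0 he] := near_not_cl hc h1 uI tI ncij.
    by exists e => // u' t' u'I t'I hu ht'; rewrite (negPf (he _ _ _ _ _ _)).
  have [->|ij] := eqVneq i j; last exact: ho.
  exists 1 => // u' t' u'I t'I _ _ _ /=.
  by split=> h; [have [/(_ j)] := ht u' t' u'I t'I | have [/(_ j)] := ht u t uI tI].
- move=> x e e' /andP[e'0 ee'] he u' t' u'I t'I h h'.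
  by apply: he => //; apply: lt_le_trans ee'.
Qed.

Lemma cfamilyM (f g : R * R -> R[i]) : cfamily f -> cfamily g -> cfamily (fun x => f x * g x).
Proof.
move=> [fr fi] [gr gi]; split.
  rewrite (_ : (fun x => _) = (fun x => complex.Re (f x) * complex.Re (g x) -
     complex.Im (f x) * complex.Im (g x))).
    by move=> x; apply: cvgB; apply: cvgM; [exact: fr|exact: gr|exact: fi|exact: gi].
  by apply/funext => x; case: (f x) (g x) => [a b] [c d].
rewrite (_ : (fun x => _) = (fun x => complex.Re (f x) * complex.Im (g x) +
   complex.Im (f x) * complex.Re (g x))).
  by move=> x; apply: cvgD; apply: cvgM; [exact: fr|exact: gi|exact: fi|exact: gr].
by apply/funext => x; case: (f x) (g x) => [a b] [c d].
Qed.

Lemma cfamily_cst (z : R[i]) : cfamily (fun=> z).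
Proof. by split; apply/within_squareP => u t _ _ e e0; exists 1 => // *; rewrite subrr normr0. Qed.

Lemma cfamilyX (f : R * R -> R[i]) d : cfamily f -> cfamily (fun x => f x ^+ d).
Proof.
move=> cf; elim: d => [|d IH]; first exact: cfamily_cst.
rewrite (_ : (fun x => _) = fun x => f x * f x ^+ d); first exact: cfamilyM.
by apply/funext => x; rewrite exprS.
Qed.

Lemma norm_subX1 (z : R[i]) k : `|z| = 1 -> `|z ^+ k - 1| <= k%:R * `|z - 1|.
Proof.
move=> z1; elim: k => [|k IH]; first by rewrite expr0 subrr normr0 mul0r.
have -> : z ^+ k.+1 - 1 = z ^+ k * (z - 1) + (z ^+ k - 1) by rewrite exprSr; ring.
rewrite (le_trans (ler_normD _ _)) // normrM normrX z1 expr1n mul1r.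
by rewrite -natr1 mulrDl mul1r addrC lerD2r.
Qed.

(** If z were not 1, its powers z^0, ..., z^d would have sum 0, although each is within (d + 1) |z -
    1| < 1 of 1. The bound on the real part is this inequality, because |z - 1|^2 = 2 - 2 Re z. *)
Lemma root_unity_isolated (z : R[i]) d : `|z| = 1 -> z ^+ d.+1 = 1 ->
  1 - (2 * d.+1%:R ^+ 2)^-1 < complex.Re z -> z = 1.
Proof.
move=> z1 zd hz; apply/eqP; rewrite -subr_eq0; apply/negPn/negP => zn1.
have sm : d.+1%:R * `|z - 1| < 1.
  have d0 : (0 : R[i]) < d.+1%:R by rewrite ltr0n.
  rewrite -(@ltr_pXn2r _ 2) ?nnegrE ?mulr_ge0 ?ler01 ?ler0n //.
  rewrite expr1n exprMn -add_Re2_Im2.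
  have -> : (d.+1%:R : R[i]) = (d.+1%:R : R)%:C%C by rewrite rmorph_nat.
  rewrite -rmorphXn -rmorphM -(rmorph1 (@real_complex_def R (Phant R))) ltcR.
  move/eqP: z1; rewrite norm1E => /eqP; case: (z) hz => a b /= hz ab1.
  have -> : (a - 1) ^+ 2 + (b - 0) ^+ 2 = 2 - 2 * a by move: ab1; rewrite !expr2; lra.
  have p0 : (0 : R) < d.+1%:R ^+ 2 by rewrite exprn_gt0 // ltr0n.
  have : (1 - a) * (2 * d.+1%:R ^+ 2) < 1.
    by rewrite -ltr_pdivlMr ?mulr_gt0 // div1r; move: hz; set e := _^-1 => hz; lra.
  lra.
have s0 : \sum_(k < d.+1) z ^+ k = 0.
  by apply: (mulfI zn1); rewrite mulr0 -subrX1 zd subrr.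
have : `|\sum_(k < d.+1) (z ^+ k - 1)| <= \sum_(k < d.+1) d.+1%:R * `|z - 1|.
  apply: (le_trans (ler_norm_sum _ _ _)); apply: ler_sum => k _.
  by apply: (le_trans (norm_subX1 _ z1)); rewrite ler_wpM2r // ler_nat ltnW.
rewrite sumrB s0 sumr_const cardT size_enum_ord sub0r normrN normr_nat sumr_const cardT size_enum_ord.
rewrite -[X in _ <= X]mulr_natl -[X in X <= _]mulr1 ler_pM2l ?ltr0n //.
by move=> h; have := lt_le_trans sm h; rewrite ltxx.
Qed.

(** f_d creates only virtual meetings. Roots of unity being isolated, near a meeting of two strands
    their powers meet only where the strands do, so the crossing data stay locally constant. *)
Lemma coherent_power G d : (0 < d)%N -> coherent up G -> coherent up (fun u => power_map d (G u)).
Proof.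
case: d => // d _ [hc h1 hl ho]; have norm1X : forall (u : R) i (t : R), 0 <= u <= 1 -> 0 <= t <= 1 ->
    `|strand (power_map d.+1 (G u)) i t| = 1.
  by move=> u i t uI tI; rewrite normrX h1 // expr1n.
split=> //.
- by move=> i; apply: cfamilyX.
- move=> u t uI tI; have [irr tr sub _ cmp] := hl u t uI tI; split=> //; last exact: cl_equiv.
  by move=> i j /sub /eqP; rewrite /cl /= => ->.
move=> u t uI tI; have [e0 e00 he0] := ho u t uI tI.
pose P (x : 'I_m * 'I_m) (e : R) := forall u' t' : R, 0 <= u' <= 1 -> 0 <= t' <= 1 ->
  `|u' - u| < e -> `|t' - t| < e -> cl (power_map d.+1 (G u')) t' x.1 x.2 ->
  cl (G u) t x.1 x.2 -> cl (G u') t' x.1 x.2.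
have [|[i j]|e e'0 he] := @fin_exists_pos _ _ P; last first.
- pose Q (x : 'I_m * 'I_m) (e : R) := forall u' t' : R, 0 <= u' <= 1 -> 0 <= t' <= 1 ->
    `|u' - u| < e -> `|t' - t| < e -> cl (G u') t' x.1 x.2 -> cl (G u) t x.1 x.2.
  have [|[i j]|e1 e10 he1] := @fin_exists_pos _ _ Q; last first.
  + have hsub (v r : R) i j : 0 <= v <= 1 -> 0 <= r <= 1 -> Defs.over (G v) i j r -> cl (G v) r i j.
      move=> vI rI h; have [_ _ sub _ _] := hl v r vI rI.
      have : ov up (G v) r i j || ov up (G v) r j i.
        by rewrite /ov; case: up; apply/orP; [right|left]; apply/asboolP.
      by move=> /orP[/sub //|/sub]; rewrite /cl eq_sym.
    exists (Num.min e0 (Num.min e e1)); first by rewrite !lt_min e00 e'0.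
    move=> u' t' u'I t'I; rewrite !lt_min => /and3P[hu1 hu2 hu3] /and3P[ht1 ht2 ht3] i j hcl.
    split=> h.
      by apply/(he0 u' t' u'I t'I hu1 ht1 i j _) => //; apply: hsub h.
    have cij : cl (G u') t' i j by apply: (he (i, j)) => //; apply: hsub h.
    by apply/(he0 u' t' u'I t'I hu1 ht1 i j _).
  + have [cij|ncij] := boolP (cl (G u) t i j); first by exists 1.
    have [d' d'0 hd'] := near_not_cl hc h1 uI tI ncij.
    by exists d' => // u' t' u'I t'I hu ht; rewrite (negPf (hd' _ _ _ _ _ _)).
  + move=> x e1 e2 /andP[e'0' ee'] he' u' t' u'I t'I h h'.
    by apply: he' => //; apply: lt_le_trans ee'.
- have [cij|ncij] := boolP (cl (G u) t i j); last first.
    by exists 1 => // u' t' _ _ _ _ _ /= h; case/negP: ncij.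
  have [_ /within_squareP cR] := turn_continuous i j hc h1.
  have p0 : 0 < (2 * d.+1%:R ^+ 2)^-1 :> R by rewrite invr_gt0 mulr_gt0 // exprn_gt0 // ltr0n.
  have [d' d'0 hd'] := cR u t uI tI _ p0; exists d' => // u' t' u'I t'I hu ht /= hp _.
  have := hd' u' t' u'I t'I hu ht; rewrite /= -(eqP cij) divff ?norm1_neq0 ?h1 //= ltr_norml => /andP[hr _].
  have hi := h1 u' i t' u'I t'I; have hj := h1 u' j t' u'I t'I.
  have : strand (G u') j t' / strand (G u') i t' = 1.
    apply: (@root_unity_isolated _ d); last by move: hr; set e := (2 * _)^-1 => hr; lra.
      by rewrite normrM normfV hi hj divr1.
    have hp' : strand (G u') i t' ^+ d.+1 = strand (G u') j t' ^+ d.+1 by apply/eqP.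
    by rewrite expr_div_n -hp' divff // expf_neq0 // norm1_neq0.
  move=> /(congr1 (fun x => x * strand (G u') i t')); rewrite divfK ?norm1_neq0 // mul1r => E.
  by rewrite /cl E.
- move=> x e1 e2 /andP[e'0' ee'] he' u' t' u'I t'I h h'.
  by apply: he' => //; apply: lt_le_trans ee'.
Qed.

(** A generic node has only two strands, so every chain returns to its start. *)
Lemma generic_tame E D t : prediagram E D -> generic D -> 0 <= t <= 1 -> tame D t.
Proof.
move=> [_ _ _ _ ho] gD tI.
have cm i j : classical_at D i j t -> meet D i j t.
  move=> [/(ho _ _ _ tI)[] //|/(ho _ _ _ tI)[[h1 h2 h3] _]].
  by split=> //; rewrite eq_sym.
split.
- by move=> i /(ho _ _ _ tI)[[_]]; rewrite eqxx.
- by move=> i j /(ho _ _ _ tI)[[]].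
- move=> i j l /cm/gD[nd _] /cm[_ jl jlE]; left.
  have [|_ h] := nd j l; first by rewrite !inE eqxx orbT.
  have := h jlE; rewrite !inE => /orP[/eqP //|/eqP lj].
  by rewrite lj eqxx in jl.
Qed.

(** A chain of three distinct strands occurs only at a classical triple point: a tangency has two
    strands, a virtual triple point has no classical pair, and at a mixed one the strand with
    virtual crossings would be a fourth element of the node. *)
Lemma singular_tame E D t : prediagram E D -> singular D -> 0 <= t <= 1 -> tame D t.
Proof.
move=> [_ _ _ _ ho] [t0 [S [t0I nd sing reg]]] tI.
have cm i j : classical_at D i j t -> meet D i j t.
  move=> [/(ho _ _ _ tI)[] //|/(ho _ _ _ tI)[[h1 h2 h3] _]].
  by split=> //; rewrite eq_sym.
split.
- by move=> i /(ho _ _ _ tI)[[_]]; rewrite eqxx.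
- by move=> i j /(ho _ _ _ tI)[[]].
- move=> i j l cij cjl; have [_ ij ijE] := cm _ _ cij; have [_ jl jlE] := cm _ _ cjl.
  case: (pselect (t = t0 /\ i \in S)) => [[E0 iS]|ns]; last first.
    have [nd' _] := reg _ _ _ (cm _ _ cij) ns; left.
    have [|_ h] := nd' j l; first by rewrite !inE eqxx orbT.
    have := h jlE; rewrite !inE => /orP[/eqP //|/eqP lj].
    by rewrite lj eqxx in jl.
  have jS : j \in S by apply/(nd i j iS); rewrite -E0.
  have lS : l \in S by apply/(nd j l jS); rewrite -E0.
  have [->|il] := eqVneq i l; [by left|right].
  have c3 : (2 < #|S|)%N.
    have : [set i; j; l]%SET \subset S.
      by apply/fintype.subsetP => x; rewrite !inE => /orP[/orP[]|] /eqP ->.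
    move=> /subset_leq_card; apply: leq_trans.
    by rewrite -finset.setUA cardsU1 !inE negb_or ij il /= cards2 jl.
  case: sing => [[c2 _]|[c3' _ []]]; first by rewrite c2 in c3.
  + by rewrite -E0 => -[h1 h2]; split; [exact: h1|exact: h2].
  + by rewrite -E0 => h; case: cij => o; [case: (h i j iS)|case: (h j i jS)].
  + rewrite -E0 => -[i0 i0S [h1 h2]].
    have csym a b : classical_at D a b t -> classical_at D b a t by case; [right|left].
    have ni0 a b : classical_at D a b t -> b \in S -> a != i0.
      by move=> cab bS; apply/eqP => aE; apply: (h1 b bS); rewrite -aE.
    have hi := ni0 _ _ cij jS; have hj := ni0 _ _ cjl lS; have hl := ni0 _ _ (csym _ _ cjl) jS.
    have : [set i0; i; j; l]%SET \subset S.
      by apply/fintype.subsetP => x; rewrite !inE => /orP[/orP[/orP[]|]|] /eqP ->.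
    move=> /subset_leq_card; rewrite c3' -!finset.setUA cardsU1 !inE !negb_or ![i0 == _]eq_sym hi hj hl /=.
    by rewrite cardsU1 !inE negb_or ij il /= cards2 jl.
Qed.

End CoherentFamilies.

(** * Renaming and concatenation of diagrams *)

Lemma half_le_in (R : realType) (t : R) : 0 <= t -> t <= 2^-1 -> 0 <= 2 * t <= 1.
Proof. by move=> h1 h2; apply/andP; split; lra. Qed.

Lemma half_gt_in (R : realType) (t : R) : t <= 1 -> 2^-1 < t -> 0 <= 2 * t - 1 <= 1.
Proof. by move=> h1 h2; apply/andP; split; lra. Qed.

Lemma half_dist (R : realType) (x y d : R) : `|y - x| < d / 2 -> `|2 * y - 2 * x| < d.
Proof. by rewrite !ltr_norml => /andP[h1 h2]; apply/andP; split; lra. Qed.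

Lemma half_dist1 (R : realType) (x y d : R) : `|y - x| < d / 2 -> `|2 * y - 1 - (2 * x - 1)| < d.
Proof. by rewrite !ltr_norml => /andP[h1 h2]; apply/andP; split; lra. Qed.

Lemma half_distl (R : realType) (y d : R) : `|y - 2^-1| < d / 2 -> `|2 * y - 1| < d.
Proof. by rewrite !ltr_norml => /andP[h1 h2]; apply/andP; split; lra. Qed.

Lemma half_distr (R : realType) (y d : R) : `|y - 2^-1| < d / 2 -> `|2 * y - 1 - 0| < d.
Proof. by rewrite !ltr_norml => /andP[h1 h2]; apply/andP; split; lra. Qed.

Lemma dist_lt_half (R : realType) (x y : R) : `|y - x| < 2^-1 - x -> y < 2^-1.
Proof. by rewrite !ltr_norml => /andP[h1 h2]; lra. Qed.

Lemma dist_gt_half (R : realType) (x y : R) : `|y - x| < x - 2^-1 -> 2^-1 < y.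
Proof. by rewrite !ltr_norml => /andP[h1 h2]; lra. Qed.

Lemma two_half (R : realType) : 2 * 2^-1 = 1 :> R. Proof. by rewrite divff. Qed.

Lemma two_sub1 (R : realType) : 2 * 1 - 1 = 1 :> R. Proof. by rewrite mulr1 addrK. Qed.

Lemma half_ge0 (R : realType) : 0 <= 2^-1 :> R. Proof. by rewrite invr_ge0. Qed.

Lemma half_in (R : realType) : (0 : R) <= (2^-1 : R) <= 1.
Proof. by apply/andP; split; lra. Qed.

Lemma half_lt1 (R : realType) : (1 <= 2^-1 :> R) = false.
Proof. by apply/negbTE; rewrite -ltNge invf_lt1 // ltr1n. Qed.

Section Operations.
Local Open Scope classical_set_scope.
Local Open Scope ring_scope.
Variables (R : realType) (m : nat) (up : bool).
Implicit Types (D : diagram R m) (G : R -> diagram R m).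

Lemma family_coherent virt E G : diagram_family virt E G ->
  (forall u, 0 <= u <= 1 -> generic (G u) \/ singular (G u)) -> coherent up G.
Proof.
move=> [hc hp hend ho] hgs; apply: coherent_intro => //.
- by move=> u i t uI tI; have [[_ h _ _ _] _] := hp u uI; apply: h.
- by move=> u t i j uI tI; have [[_ _ _ _ h] _] := hp u uI; move=> /(h _ _ _ tI)[].
- move=> u t uI tI; have [hpu _] := hp u uI.
  by case: (hgs u uI) => h; [apply: generic_tame hpu h tI|apply: singular_tame hpu h tI].
- move=> u t i j uI tI ij /eqP cij; have [|e e0 he] := ho u t i j uI; first by split.
  exists e => // u' t' u'I t'I hu ht /eqP c'; apply: he => //; by split.
Qed.

Lemma over_injective D t i j : layered (cl D t) (ov up D t) -> injective ((strand D)^~ t) ->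
  ~ Defs.over D i j t.
Proof.
move=> [irr _ sub _ _] inj o.
have oo : ov up D t i j || ov up D t j i.
  by rewrite /ov; case: up; apply/orP; [right|left]; apply/asboolP.
have E : i = j by case/orP: oo => /sub/eqP h; [exact: inj|exact/esym/inj].
by move: oo; rewrite E !irr.
Qed.

(** Here the crossing data are locally constant because a meeting of two strands is isolated among
    the meetings of the same strands. *)
Lemma cyl_diagram_good virt E D : cyl_diagram virt E D -> good up D.
Proof.
move=> [pD gD _]; have [hc h1 _ [i0 i1] ho] := pD; split=> //.
apply: coherent_intro => //.
- by move=> i; apply: cfamily_const.
- by move=> _ i t _; apply: h1.
- by move=> _ t i j _ tI /(ho _ _ _ tI)[].
- by move=> _ t _ tI; apply: generic_tame pD gD tI.
- move=> u t i j uI tI ij /eqP cij.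
  have [_ [e e0 he]] : regular_crossing D i j t by apply: gD.
  exists e => // u' t' u'I t'I _ ht /eqP c'.
  have [->//|tt'] := eqVneq t' t; exfalso.
  have r0 : 0 < `|t' - t| < e by rewrite normr_gt0 subr_eq0 tt' ht.
  have tn0 : turn D i j t' = 0 by apply: turn_nn; [exact: h1|apply/eqP].
  by case: he => /(_ _ r0); rewrite addrCA subrr addr0 tn0 mulr0 ltxx.
Qed.

Lemma pot_perm (K : comUnitRingType) (q s : K) (p : 'S_m) (c o l : rel 'I_m) :
  pot q s (fun i j => c (p i) (p j)) (fun i j => o (p i) (p j)) (fun i j => l (p i) (p j)) =
  perm_mx p *m pot q s c o l *m perm_mx p^-1.
Proof.
have cardp (P : pred 'I_m) : #|[pred b | P (p b)]| = #|P|.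
  by rewrite -!sum1_card [RHS](reindex_inj (@perm_inj _ p)).
rewrite -row_permE -col_permE; apply/matrixP => a b; rewrite !mxE.
congr (_ ^+ _ * _).
  exact: (cardp [pred b | [&& c (p a) b, ~~ o (p a) b, ~~ o b (p a) & l b (p a)]]).
rewrite (inj_eq (@perm_inj _ p)); case: ifP => _.
  by congr (_ ^+ _); exact: (cardp [pred x | o x (p a) && l x (p a)]).
case: ifP => // _; congr (_ * _ ^+ _).
exact: (cardp [pred x | o x (p b) && l x (p a)]).
Qed.

Lemma perm_mxKV (K : comUnitRingType) (p : 'S_m) : perm_mx p^-1 *m perm_mx p = 1%:M :> 'M[K]_m.
Proof. by rewrite -perm_mxM mulVg perm_mx1. Qed.

Lemma perm_mxVK (K : comUnitRingType) (p : 'S_m) : perm_mx p *m perm_mx p^-1 = 1%:M :> 'M[K]_m.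
Proof. by rewrite -perm_mxM mulgV perm_mx1. Qed.

Lemma rename_good p D : good up D -> good up (rename p D).
Proof.
move=> [[hc h1 hl ho] h0 h1']; split; last 2 first.
- by move=> i j /h0 /perm_inj.
- by move=> i j /h1' /perm_inj.
split.
- by move=> i; apply: hc.
- by move=> u i; apply: h1.
- move=> u t uI tI; have [irr tr sub _ cmp] := hl u t uI tI; split.
  + by move=> i; apply: irr.
  + by move=> j i l; apply: tr.
  + by move=> i j; apply: sub.
  + exact: cl_equiv.
  + move=> i j l h h'; rewrite -(inj_eq (@perm_inj _ p)); exact: cmp h h'.
- move=> u t uI tI; have [e e0 he] := ho u t uI tI; exists e => // u' t' u'I t'I hu ht i j.
  exact: (he u' t' u'I t'I hu ht (p i) (p j)).
Qed.

Lemma rename_transport p D : good up D ->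
  transport up (rename p D) = perm_mx p *m transport up D *m perm_mx p^-1.
Proof.
move=> gD; have [cD _ _] := gD; have [cD' _ _] := rename_good p gD.
have [N N0 hN] := section_exists cD.
have E : invmx (perm_mx p *m N 1 *m perm_mx p^-1) = perm_mx p *m invmx (N 1) *m perm_mx p^-1.
  have uN : N 1 \in unitmx by apply: (section_unit cD N0 hN); rewrite ler01 lexx.
  set A := _ *m _ *m _; set B := RHS; have AB : A *m B = 1%:M.
    rewrite /A /B !mulmxA -[_ *m _ *m _ *m perm_mx p]mulmxA perm_mxKV mulmx1.
    by rewrite -[_ *m _ *m invmx _]mulmxA mulmxV // mulmx1 perm_mxVK.
  have uA : A \in unitmx by case/mulmx1_unit: AB.
  by rewrite -[RHS]mul1mx -(mulVmx uA) -mulmxA AB mulmx1.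
rewrite (transportE cD N0 hN) -E.
apply: (transportE cD' (N := fun t => perm_mx p *m N t *m perm_mx p^-1)).
  by rewrite N0 mulmx1 perm_mxVK.
move=> x xI; have [e e0 he] := hN x xI; exists e => // y yI hy.
have -> : flow up (rename p D) x y (perm_mx p *m N x *m perm_mx p^-1) =
   (perm_mx p *m dpot up D x D y *m perm_mx p^-1) *m (perm_mx p *m N x *m perm_mx p^-1).
  rewrite /flow; congr (_ *m _); rewrite /dpot -pot_perm; congr pot.
rewrite !mulmxA -[_ *m _ *m _ *m perm_mx p]mulmxA perm_mxKV mulmx1.
by rewrite (he y yI hy) /flow !mulmxA.
Qed.

(** The product of diagrams whose strand names already match; [mul_cat] reduces [diagram_mul] to it
    by a renaming. *)
Definition cat_diagram D D' := Diagram
  (fun i t => if t <= 2^-1 then strand D i (2 * t) else strand D' i (2 * t - 1))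
  (fun i j t => if t <= 2^-1 then Defs.over D i j (2 * t) else Defs.over D' i j (2 * t - 1)).

Lemma paste_continuous (f g : R -> R) : f 1 = g 0 ->
  {within `[0, 1], continuous f} -> {within `[0, 1], continuous g} ->
  {within `[0, 1], continuous (fun t => if t <= 2^-1 then f (2 * t) else g (2 * t - 1))}.
Proof.
move=> fg /within_itvP cf /within_itvP cg; apply/within_itvP => t /andP[t0 t1] e e0.
have [tlt|tgt|->] := ltgtP t 2^-1.
- have [d d0 hd] := cf (2 * t) (half_le_in t0 (ltW tlt)) e e0.
  exists (Num.min (d / 2) (2^-1 - t)); first by rewrite lt_min divr_gt0 // subr_gt0.
  move=> t' /andP[t'0 t'1]; rewrite lt_min => /andP[h1 /dist_lt_half/ltW h2].
  by rewrite h2; apply: hd; [exact: half_le_in|exact: half_dist].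
- have [d d0 hd] := cg (2 * t - 1) (half_gt_in t1 tgt) e e0.
  exists (Num.min (d / 2) (t - 2^-1)); first by rewrite lt_min divr_gt0 // subr_gt0.
  move=> t' /andP[t'0 t'1]; rewrite lt_min => /andP[h1 /dist_gt_half h2].
  by rewrite leNgt h2 /=; apply: hd; [exact: half_gt_in|exact: half_dist1].
- have [d d0 hd] := cf 1 (unit1 R) e e0; have [d' d'0 hd'] := cg 0 (unit0 R) e e0.
  exists (Num.min (d / 2) (d' / 2)); first by rewrite lt_min !divr_gt0.
  rewrite two_half => t' /andP[t'0 t'1]; rewrite lt_min => /andP[h1 h2].
  case: (leP t' 2^-1) => ht'; first by apply: hd; [exact: half_le_in|exact: half_distl].
  by rewrite fg; apply: hd'; [exact: half_gt_in|exact: half_distr].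
Qed.

Lemma paste_cpath (f g : R -> R[i]) : f 1 = g 0 -> cpath f -> cpath g ->
  cpath (fun t => if t <= 2^-1 then f (2 * t) else g (2 * t - 1)).
Proof.
move=> fg [f1 f2] [g1 g2]; split.
  rewrite (_ : (fun t => _) = (fun t : R => if t <= 2^-1 then complex.Re (f (2 * t)) else complex.Re (g (2 * t - 1)))).
    by apply: (@paste_continuous (fun t => complex.Re (f t)) (fun t => complex.Re (g t))); rewrite ?fg.
  by apply/funext => t; case: ifP.
rewrite (_ : (fun t => _) = (fun t : R => if t <= 2^-1 then complex.Im (f (2 * t)) else complex.Im (g (2 * t - 1)))).
  by apply: (@paste_continuous (fun t => complex.Im (f t)) (fun t => complex.Im (g t))); rewrite ?fg.
by apply/funext => t; case: ifP.
Qed.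

Section Cat.
Variables D D' : diagram R m.
Hypotheses (gD : good up D) (gD' : good up D').
Hypothesis aligned : forall i, strand D i 1 = strand D' i 0.

Lemma cat_good : good up (cat_diagram D D').
Proof.
have [[hc h1 hl ho] i0 i1] := gD; have [[hc' h1' hl' ho'] i0' i1'] := gD'.
split; last 2 first.
- by move=> i j; rewrite /= half_ge0 mulr0; apply: i0.
- by move=> i j; rewrite /= half_lt1 two_sub1; apply: i1'.
split.
- move=> i; apply: cfamily_const; apply: (paste_cpath (aligned i)).
    exact: (cfamily_slice (unit0 R) (hc i)).
  exact: (cfamily_slice (unit0 R) (hc' i)).
- move=> u i t uI /andP[t0 t1] /=; case: (leP t 2^-1) => ht.
    exact: (h1 0 _ _ (unit0 R) (half_le_in t0 ht)).
  exact: (h1' 0 _ _ (unit0 R) (half_gt_in t1 ht)).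
- move=> u t uI /andP[t0 t1]; rewrite /cl /ov /=; case: (leP t 2^-1) => ht.
    exact: (hl 0 (2 * t) (unit0 R) (half_le_in t0 ht)).
  exact: (hl' 0 (2 * t - 1) (unit0 R) (half_gt_in t1 ht)).
have z0 d : 0 < d -> `|0 - 0 : R| < d by rewrite subrr normr0.
move=> u t uI /andP[t0 t1]; rewrite /cl /=; have [tlt|tgt|->] := ltgtP t 2^-1.
- have [d d0 hd] := ho 0 (2 * t) (unit0 R) (half_le_in t0 (ltW tlt)).
  exists (Num.min (d / 2) (2^-1 - t)); first by rewrite lt_min divr_gt0 // subr_gt0.
  move=> u' t' u'I /andP[t'0 t'1] _; rewrite lt_min => /andP[h3 /dist_lt_half/ltW h2].
  rewrite h2 => i j; exact: (hd 0 _ (unit0 R) (half_le_in t'0 h2) (z0 _ d0) (half_dist h3)).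
- have [d d0 hd] := ho' 0 (2 * t - 1) (unit0 R) (half_gt_in t1 tgt).
  exists (Num.min (d / 2) (t - 2^-1)); first by rewrite lt_min divr_gt0 // subr_gt0.
  move=> u' t' u'I /andP[t'0 t'1] _; rewrite lt_min => /andP[h3 /dist_gt_half h2].
  rewrite leNgt h2 /= => i j.
  exact: (hd 0 _ (unit0 R) (half_gt_in t'1 h2) (z0 _ d0) (half_dist1 h3)).
- have [d d0 hd] := ho 0 1 (unit0 R) (unit1 R); have [d' d'0 hd'] := ho' 0 0 (unit0 R) (unit0 R).
  have no i j := over_injective (i := i) (j := j) (hl 0 1 (unit0 R) (unit1 R)) i1.
  have no' i j := over_injective (i := i) (j := j) (hl' 0 0 (unit0 R) (unit0 R)) i0'.
  exists (Num.min (d / 2) (d' / 2)); first by rewrite lt_min !divr_gt0.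
  rewrite two_half => u' t' u'I /andP[t'0 t'1] _; rewrite lt_min => /andP[h3 h2] i j.
  case: (leP t' 2^-1) => ht'.
    exact: (hd 0 _ (unit0 R) (half_le_in t'0 ht') (z0 _ d0) (half_distl h3)).
  move=> c'; split; [move=> o|by move/no].
  by have /(no' i j) := (hd' 0 _ (unit0 R) (half_gt_in t'1 ht') (z0 _ d'0) (half_distr h2) i j c').1 o.
Qed.

(** At the seam the strands are at distinct points, so [flow] is the identity there and the second
    section continues the first, multiplied on the left. Inversion restores the order of the
    factors. *)
Lemma cat_transport : transport up (cat_diagram D D') = transport up D *m transport up D'.
Proof.
have [cD i0 i1] := gD; have [cD' i0' i1'] := gD'; have [cC _ _] := cat_good.
have [N N0 hN] := section_exists cD; have [N' N'0 hN'] := section_exists cD'.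
have uN := section_unit cD N0 hN (unit1 R); have uN' := section_unit cD' N'0 hN' (unit1 R).
rewrite (transportE cD N0 hN) (transportE cD' N'0 hN').
have -> : invmx (N 1) *m invmx (N' 1) = invmx (N' 1 *m N 1).
  have uNN : N' 1 *m N 1 \in unitmx by rewrite unitmx_mul uN uN'.
  have L : N' 1 *m N 1 *m (invmx (N 1) *m invmx (N' 1)) = 1%:M.
    by rewrite !mulmxA mulmxK // mulmxV.
  by rewrite -[LHS]mul1mx -(mulVmx uNN) -mulmxA L mulmx1.
pose M t := if t <= 2^-1 then N (2 * t) else N' (2 * t - 1) *m N 1.
have M1 : M 1 = N' 1 *m N 1 by rewrite /M half_lt1 two_sub1.
have M0 : M 0 = 1%:M by rewrite /M half_ge0 mulr0.
rewrite -M1; apply: (transportE cC M0) => x /andP[x0 x1].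
have [_ h1 hl _] := cD; have [_ h1' hl' _] := cD'; have [_ h1C hlC _] := cC.
have [xlt|xgt|xeq] := ltgtP x 2^-1.
- have [d d0 hd] := hN (2 * x) (half_le_in x0 (ltW xlt)).
  exists (Num.min (d / 2) (2^-1 - x)); first by rewrite lt_min divr_gt0 // subr_gt0.
  move=> y /andP[y0 y1]; rewrite lt_min => /andP[h3 /dist_lt_half/ltW hy].
  rewrite /M hy (ltW xlt) (hd _ (half_le_in y0 hy) (half_dist h3)).
  by rewrite /flow /dpot /cl /ov /lf /turn /= hy (ltW xlt).
- have [d d0 hd] := hN' (2 * x - 1) (half_gt_in x1 xgt).
  exists (Num.min (d / 2) (x - 2^-1)); first by rewrite lt_min divr_gt0 // subr_gt0.
  move=> y /andP[y0 y1]; rewrite lt_min => /andP[h3 /dist_gt_half hy].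
  have hy' : (y <= 2^-1) = false by rewrite leNgt hy.
  have hx' : (x <= 2^-1) = false by rewrite leNgt xgt.
  rewrite /M hy' hx' (hd _ (half_gt_in y1 hy) (half_dist1 h3)).
  by rewrite /flow mulmxA /dpot /cl /ov /lf /turn /= hy' hx'.
- have [d d0 hd] := hN 1 (unit1 R); have [d' d'0 hd'] := hN' 0 (unit0 R).
  exists (Num.min (d / 2) (d' / 2)); first by rewrite lt_min !divr_gt0.
  rewrite xeq => y /andP[y0 y1]; rewrite lt_min => /andP[h3 h2].
  have yI : 0 <= y <= 1 by rewrite y0 y1.
  have xI := half_in R.
  have -> : flow up (cat_diagram D D') 2^-1 y (M 2^-1) = N 1.
    rewrite /flow (_ : dpot _ _ _ _ _ = 1%:M) ?mul1mx ?/M ?lexx ?two_half //.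
    apply: dpot_injective.
    + by move=> i; exact: (h1C 0 i y (unit0 R) yI).
    + exact: (hlC 0 2^-1 (unit0 R) xI).
    + by move=> i j; rewrite /= lexx two_half; apply: i1.
  rewrite /M; case: (leP y 2^-1) => hy.
    rewrite (hd _ (half_le_in y0 hy) (half_distl h3)).
    rewrite /flow (_ : dpot _ _ _ _ _ = 1%:M) ?mul1mx //.
    apply: dpot_injective; [|exact: (hl 0 1 (unit0 R) (unit1 R))|exact: i1].
    by move=> i; exact: (h1 0 i _ (unit0 R) (half_le_in y0 hy)).
  rewrite (hd' _ (half_gt_in y1 hy) (half_distr h2)).
  rewrite /flow (_ : dpot _ _ _ _ _ = 1%:M) ?N'0 ?mul1mx //.
  apply: dpot_injective; [|exact: (hl' 0 0 (unit0 R) (unit0 R))|exact: i0'].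
  by move=> i; exact: (h1' 0 i _ (unit0 R) (half_gt_in y1 hy)).
Qed.

End Cat.

End Operations.

(** * Angles and their continuous lifts along paths *)

Section Angles.
Local Open Scope classical_set_scope.
Local Open Scope ring_scope.
Variable R : realType.
Implicit Types (x y a b : R).

Lemma cisD a b : cis (a + b) = cis a * cis b.
Proof.
apply/complex_eqP; rewrite /cis /= cosD sinD; split=> //.
by rewrite addrC [cos a * _]mulrC [sin a * _]mulrC; ring.
Qed.

Lemma cis0 : cis 0 = 1 :> R[i].
Proof. by apply/complex_eqP; rewrite /cis /= cos0 sin0. Qed.

Lemma norm_cis a : `|cis a| = 1.
Proof. by apply/eqP; rewrite norm1E /= cos2Dsin2. Qed.

Lemma cis_neq0 a : cis a != 0.
Proof. exact/norm1_neq0/norm_cis. Qed.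

Lemma cisN a : cis (- a) = (cis a)^-1.
Proof. by apply: (mulfI (cis_neq0 a)); rewrite -cisD subrr cis0 divff ?cis_neq0. Qed.

Lemma cisB a b : cis (a - b) = cis a / cis b.
Proof. by rewrite cisD cisN. Qed.

Lemma cisX a n : cis a ^+ n = cis (n%:R * a).
Proof.
elim: n => [|n IH]; first by rewrite mul0r cis0.
by rewrite exprS IH -cisD -natr1 mulrDl mul1r addrC.
Qed.

Lemma cis_2pi : cis (2 * pi) = 1 :> R[i].
Proof. by apply/complex_eqP; rewrite /cis /= mulr_natl cos2pi sin2pi. Qed.

Lemma cis_period a (k : int) : cis (a + k%:~R * (2 * pi)) = cis a.
Proof.
have nat_case (n : nat) : cis (n%:R * (2 * pi)) = 1 :> R[i].
  by rewrite -cisX cis_2pi expr1n.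
rewrite cisD; case: k => n; first by rewrite nat_case mulr1.
by rewrite NegzE mulrNz mulNr cisN nat_case invr1 mulr1.
Qed.

Lemma sin_sgP x : `|x| < pi -> (0 < sin x) = (0 < x) /\ (sin x < 0) = (x < 0).
Proof.
rewrite ltr_norml => /andP[h1 h2]; have [x0|x0|<-] := ltgtP 0 x.
- have s0 : 0 < sin x by rewrite sin_gt0_pi // x0.
  by rewrite s0; split=> //; apply/negbTE; rewrite -leNgt ltW.
- have s0 : sin x < 0 by rewrite -oppr_gt0 -sinN sin_gt0_pi //; apply/andP; split; lra.
  by rewrite s0; split=> //; apply/negbTE; rewrite -leNgt ltW.
- by rewrite sin0 ltxx.
Qed.

Lemma cis_eq1_small x : `|x| < 2 * pi -> cis x = 1 -> x = 0.
Proof.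
wlog x0 : x / 0 <= x => [H|].
  have [/H //|x0 h c1] := leP 0 x; apply/eqP; rewrite -oppr_eq0; apply/eqP.
  by apply: H; rewrite ?normrN ?cisN ?c1 ?invr1 // oppr_ge0 ltW.
rewrite ger0_norm // => x2 /complex_eqP[]; rewrite /cis /= => c1 s0.
apply/eqP; rewrite eq_le x0 andbT leNgt; apply/negP => xgt.
have [xpi|xpi|xpi] := ltgtP x pi.
- by have := sin_gt0_pi (x := x); rewrite xgt xpi s0 ltxx => /(_ isT).
- have : 0 < sin (x - pi) by apply: sin_gt0_pi; apply/andP; split; lra.
  by have := sinDpi (x - pi); rewrite subrK s0 => /eqP; rewrite eq_sym oppr_eq0 => /eqP ->; rewrite ltxx.
- by move: c1; rewrite xpi cospi; lra.
Qed.

Lemma twopi_gt0 : 0 < 2 * pi :> R. Proof. by rewrite mulr_gt0 ?pi_gt0. Qed.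

Lemma cis_eqP a b : cis a = cis b -> exists k : int, a = b + k%:~R * (2 * pi).
Proof.
have := twopi_gt0; set P : R := 2 * pi => P0 E; set k := Num.floor ((a - b) / P); exists k.
have /andP[h1 h2] := floor_itv ((a - b) / P).
move: h1 h2; rewrite -/k ler_pdivlMr // ltr_pdivrMr // intrD mulrDl mul1r => h1 h2.
suff : a - b - k%:~R * P = 0 by move: h1 h2; set u := k%:~R * _; lra.
apply: cis_eq1_small; last by rewrite -mulNr -mulrNz cis_period cisB E divff ?cis_neq0.
by rewrite ltr_norml -/P; apply/andP; split; move: h1 h2; set u := k%:~R * _; lra.
Qed.

Lemma norm1_asin (z : R[i]) : `|z| = 1 -> 0 < complex.Re z ->
  z = cis (asin (complex.Im z)) /\ - (pi / 2) < asin (complex.Im z) < pi / 2.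
Proof.
move=> /eqP; rewrite norm1E; case: z => a b /= /eqP ab a0.
have b2 : b ^+ 2 < 1 by rewrite -ab ltrDr exprn_gt0.
have /andP[b1 b3] : -1 < b < 1.
  rewrite -ltr_norml -(@ltr_pXn2r _ 2) ?nnegrE ?normr_ge0 ?ler01 //.
  by rewrite expr1n real_normK ?num_real.
have bI : -1 <= b <= 1 by rewrite !ltW.
split; last by rewrite asin_gtNpi2 ?asin_ltpi2 ?b1 ?b3 ?ltW.
apply/complex_eqP; rewrite /cis /= asinK ?in_itv //= cos_asin // -ab addrK.
by rewrite sqrtr_sqr gtr0_norm.
Qed.

Lemma unit_coordinates (a b : R) : a ^+ 2 + b ^+ 2 = 1 -> `|a| <= 1 /\ `|b| <= 1.
Proof. by move=> h; split; rewrite ler_norml; apply/andP; split; nra. Qed.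

Lemma norm_mul_le (x y e : R) : `|x| < e -> `|y| <= 1 -> `|x * y| <= e.
Proof. by move=> xe y1; rewrite normrM -[e]mulr1 ler_pM // ltW. Qed.

Lemma sum_bounds (e1 e p q r s : R) : 0 < e1 -> e1 <= 1 / 4 -> 4 * e1 <= e ->
  `|p| <= e1 -> `|q| <= e1 -> `|r| <= e1 -> `|s| <= e1 -> 0 < 1 + p + q /\ `|r - s| < e.
Proof.
rewrite !ler_norml => e0 e14 ee /andP[p1 p2] /andP[q1 q2] /andP[r1 r2] /andP[s1 s2].
by split; [|rewrite ltr_norml; apply/andP; split]; lra.
Qed.

Lemma cpath_div (f : R -> R[i]) : cpath f -> (forall t, 0 <= t <= 1 -> `|f t| = 1) ->
  forall x, 0 <= x <= 1 -> forall e, 0 < e -> exists2 d : R, 0 < d & forall y, 0 <= y <= 1 ->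
    `|y - x| < d -> 0 < complex.Re (f y / f x) /\ `|complex.Im (f y / f x)| < e.
Proof.
move=> [/within_itvP fr /within_itvP fi] f1 x xI e e0.
pose e1 := Num.min e 1 / 4; have e10 : 0 < e1 by rewrite divr_gt0 // lt_min e0 ltr01.
have [d d0 hd] := fr x xI _ e10; have [d' d'0 hd'] := fi x xI _ e10.
exists (Num.min d d'); first by rewrite lt_min d0.
move=> y yI; rewrite lt_min => /andP[h1 h2].
have := hd y yI h1; have := hd' y yI h2.
rewrite Re_quotient ?Im_quotient ?f1 //.
have /eqP := f1 x xI; rewrite norm1E => /eqP.
case: (f x) (f y) => [a b] [a' b'] /= h4 hb ha.
have e14 : e1 <= 1 / 4 by rewrite /e1 ler_pM2r ?invr_gt0 // ge_min lexx orbT.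
have ee1 : 4 * e1 <= e by rewrite /e1 mulrCA divff ?mulr1 // ge_min lexx.
have [a1 b1] := unit_coordinates h4.
have -> : a' * a + b' * b = 1 + (a' - a) * a + (b' - b) * b by rewrite -h4; ring.
have -> : b' * a - a' * b = (b' - b) * a - (a' - a) * b by ring.
exact: (sum_bounds e10 e14 ee1 (norm_mul_le ha a1) (norm_mul_le hb b1) (norm_mul_le hb a1) (norm_mul_le ha b1)).
Qed.

(** A lift is a horizontal section for another flat connection, which adds to an angle at x the
    arcsine of the imaginary part of f y / f x. *)
Lemma lift_exists (f : R -> R[i]) th0 : cpath f -> (forall t, 0 <= t <= 1 -> `|f t| = 1) ->
  f 0 = cis th0 -> exists th : R -> R, [/\ {within `[0, 1], continuous th}, th 0 = th0 &
    forall t, 0 <= t <= 1 -> f t = cis (th t)].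
Proof.
move=> cf f1 f0; pose A (x y r : R) := r + asin (complex.Im (f y / f x)).
have n1 x y : 0 <= x <= 1 -> 0 <= y <= 1 -> `|f y / f x| = 1.
  by move=> xI yI; rewrite normrM normfV !f1 // divr1.
have Axx x v : 0 <= x <= 1 -> A x x v = v.
  by move=> xI; rewrite /A divff ?norm1_neq0 ?f1 //= -sin0 sinK ?addr0 // in_itv /=; have := pi_gt0 R; lra.
have flatA : locally_flat A.
  move=> x xI; have [d d0 hd] := cpath_div cf f1 xI ltr01; exists d => // x' x'I hx'.
  have [d' d'0 hd'] := cpath_div cf f1 x'I ltr01.
  exists (Num.min d' (d - `|x' - x|)); first by rewrite lt_min d'0 subr_gt0.
  move=> y yI; rewrite lt_min => /andP[hy hyx] v; rewrite /A -addrA; congr (_ + _).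
  have yx : `|y - x| < d.
    by rewrite (_ : y - x = (y - x') + (x' - x)) ?(le_lt_trans (ler_normD _ _)) // -?ltrBrDr //; ring.
  have [r1 _] := hd _ x'I hx'; have [r2 _] := hd' _ yI hy; have [r3 _] := hd _ yI yx.
  have [E1 /andP[b1 b1']] := norm1_asin (n1 _ _ xI x'I) r1.
  have [E2 /andP[b2 b2']] := norm1_asin (n1 _ _ x'I yI) r2.
  have [E3 /andP[b3 b3']] := norm1_asin (n1 _ _ xI yI) r3.
  move: E1 E2 E3 b1 b1' b2 b2' b3 b3'.
  set u := asin _; set w := asin _; set v' := asin _ => E1 E2 E3 b1 b1' b2 b2' b3 b3'.
  (* The three angles lie between - pi / 2 and pi / 2, so this combination is smaller than 2 pi in
     absolute value; it vanishes because its [cis] is 1. *)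
  suff : v' - (u + w) = 0 by lra.
  apply: cis_eq1_small; first by rewrite ltr_norml; have := pi_gt0 R; move=> pi0; apply/andP; split; lra.
  rewrite cisB cisD -E1 -E2 -E3.
  have nx := norm1_neq0 (f1 x xI); have nx' := norm1_neq0 (f1 x' x'I); have ny := norm1_neq0 (f1 y yI).
  have -> : f x' / f x * (f y / f x') = f y / f x.
    by rewrite mulrACA [f x' * _]mulrC -mulrACA divff // mulr1.
  by rewrite divff // mulf_neq0 // invr_neq0.
have bijA x y : 0 <= x <= 1 -> bijective (A x y).
  by move=> _; exists (fun r => r - asin (complex.Im (f y / f x))) => r; rewrite /A ?addrK ?subrK.
have [th th00 hth] := horizontal_exists flatA bijA Axx th0.
have near x : 0 <= x <= 1 -> forall e, 0 < e -> exists2 d : R, 0 < d & forall y, 0 <= y <= 1 ->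
    `|y - x| < d -> [/\ `|th y - th x| < e & f y / f x = cis (th y - th x)].
  move=> xI e e0; have [d d0 hd] := hth x xI.
  have ca : {for (0 : R), continuous (@asin R)} by apply: continuous_asin; lra.
  have asin0 : asin (0 : R) = 0.
    by rewrite -[in LHS]sin0 sinK // in_itv /=; have := pi_gt0 R; lra.
  have [d1 d10 hd1] : exists2 d1 : R, 0 < d1 & forall z, `|z| < d1 -> `|asin z| < e.
    move/cvgrPdist_lt: ca => /(_ e e0) /nbhs_ballP[d1 /= d10 h]; exists d1 => // z hz.
    have := h z; rewrite asin0 sub0r normrN; apply.
    by rewrite /ball /= sub0r normrN.
  have [d2 d20 hd2] := cpath_div cf f1 xI d10.
  exists (Num.min d d2); first by rewrite lt_min d0.
  move=> y yI; rewrite lt_min => /andP[h1 h2]; have [r0 i0] := hd2 y yI h2.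
  rewrite (hd y yI h1) /A addrC addKr; split; first exact: hd1.
  by have [] := norm1_asin (n1 _ _ xI yI) r0.
exists th; split=> //.
  apply/within_itvP => t tI e e0; have [d d0 hd] := near t tI e e0.
  by exists d => // y yI hy; have [] := hd y yI hy.
apply: unit_interval_ind; last by rewrite th00.
move=> t tI; have [d d0 hd] := near t tI 1 ltr01; exists d => // s s' sI s'I hs hs' E.
have nt := norm1_neq0 (f1 t tI).
have [_ /(congr1 (fun z => z * f t))] := hd s sI hs; rewrite divfK // => E1.
have [_ /(congr1 (fun z => z * f t))] := hd s' s'I hs'; rewrite divfK // => E2.
have Et : f t = cis (th t).
  apply: (mulfI (cis_neq0 (th s - th t))); rewrite -E1 E -cisD subrK //.
by rewrite E2 Et -cisD subrK.
Qed.

End Angles.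

(** * The homomorphism rho defined by parallel transport *)

Section Rho.
Local Open Scope classical_set_scope.
Local Open Scope ring_scope.
Variables (R : realType) (m : nat) (up : bool) (c : R[i]) (th : 'I_m -> R) (E : set R[i]).
Hypothesis numE : ccw_numbering c th E.
Implicit Types (D : diagram R m) (G : R -> diagram R m).

Definition pos (p : 'I_m) : R[i] := c * cis (th p).

Lemma pos_inj : injective pos.
Proof.
have [c1 th2 thm _] := numE; move=> p q /(mulfI (norm1_neq0 c1)) /cis_eqP[k E'].
have [hp hq] := (th2 p, th2 q).
have k0 : k = 0.
  have P0 := twopi_gt0 R; apply/eqP; rewrite eq_le; apply/andP; split; rewrite leNgt; apply/negP => hk.
    have : (1 : R) <= k%:~R by rewrite -[1]/(1%:~R) ler_int -gtz0_ge1.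
    by move: hp hq E' P0; set P := 2 * pi; nra.
  have : (k%:~R : R) <= -1 by rewrite -[-1]/((-1)%:~R) ler_int; lia.
  by move: hp hq E' P0; set P := 2 * pi; nra.
move: E'; rewrite k0 mul0r addr0 => E'.
have [pq|qp|/val_inj //] := ltngtP p q; first by have := thm _ _ pq; rewrite E' ltxx.
by have := thm _ _ qp; rewrite E' ltxx.
Qed.

Lemma pos_in p : E (pos p).
Proof. by have [_ _ _ ->] := numE; exists p. Qed.

Lemma pos_onto z : E z -> exists p, z = pos p.
Proof. by have [_ _ _ ->] := numE => -[p _ <-]; exists p. Qed.

Lemma pos_perm (f : 'I_m -> R[i]) : injective f -> (forall i, E (f i)) ->
  exists s : 'S_m, forall p, f (s p) = pos p.
Proof.
move=> inj fE; have /fin_all_exists[g hg] : forall i, exists p, f i = pos p.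
  by move=> i; apply: pos_onto.
have ginj : injective g by move=> i j E'; apply: inj; rewrite !hg E'.
by exists (perm ginj)^-1%g => p; rewrite hg -[g _](permE ginj) permKV.
Qed.

(** Rows are endpoints and columns are strands: this matrix translates names of strands into the
    numbering of [E]. *)
Definition place_mx (f : 'I_m -> R[i]) : 'M[laurent]_m := \matrix_(p, a) (f a == pos p)%:R.

Lemma place_mxE f (s : 'S_m) : injective f -> (forall p, f (s p) = pos p) -> place_mx f = perm_mx s.
Proof.
move=> inj hs; apply/matrixP => p a; rewrite !mxE -hs (inj_eq inj) eq_sym.
by rewrite eq_sym.
Qed.

Definition rho0 D : 'M[laurent]_m :=
  place_mx ((strand D)^~ 0) *m transport up D *m (place_mx ((strand D)^~ 1))^T.

Definition fits D := good up D /\ forall i, E (strand D i 0) /\ E (strand D i 1).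

Lemma tr_place_mxE f (s : 'S_m) : injective f -> (forall p, f (s p) = pos p) ->
  (place_mx f)^T = perm_mx s^-1.
Proof. by move=> inj hs; rewrite (place_mxE inj hs) tr_perm_mx. Qed.

Lemma fits_perms D : fits D -> exists s s' : 'S_m, [/\ forall p, strand D (s p) 0 = pos p,
  forall p, strand D (s' p) 1 = pos p & rho0 D = perm_mx s *m transport up D *m perm_mx s'^-1].
Proof.
move=> [[_ i0 i1] hE].
have [|s hs] := pos_perm i0; first by move=> i; have [] := hE i.
have [|s' hs'] := pos_perm i1; first by move=> i; have [] := hE i.
by exists s, s'; split=> //; rewrite /rho0 (place_mxE i0 hs) (tr_place_mxE i1 hs').
Qed.

Lemma rho0_unit D : fits D -> rho0 D \in unitmx.
Proof.
move=> fD; have [s [s' [_ _ ->]]] := fits_perms fD; have [[cD _ _] _] := fD.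
by rewrite !unitmx_mul !unitmx_perm (transport_unit cD).
Qed.

Lemma rho0_family G : coherent up G -> (forall u, 0 <= u <= 1 -> good up (G u)) ->
  (forall i, strand (G 1) i 0 = strand (G 0) i 0) ->
  (forall i, strand (G 1) i 1 = strand (G 0) i 1) -> rho0 (G 0) = rho0 (G 1).
Proof.
move=> cG gG h0 h1; rewrite /rho0 (transport_family cG gG).
by congr (place_mx _ *m _ *m (place_mx _)^T); apply/funext => i.
Qed.

Lemma rho0_same D D' : same_diagram D D' -> good up D -> rho0 D = rho0 D'.
Proof.
move=> sD gD; rewrite /rho0 (same_diagram_transport sD gD).
congr (place_mx _ *m _ *m (place_mx _)^T); apply/funext => i.
  by have [-> ] := sD 0 (unit0 R).
by have [-> ] := sD 1 (unit1 R).
Qed.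

Lemma rho0_rename (s : 'S_m) D : good up D -> rho0 (rename s D) = rho0 D.
Proof.
move=> gD; rewrite /rho0 (rename_transport s gD).
have hp f : place_mx (fun i => f (s i)) = place_mx f *m perm_mx s^-1.
  by rewrite -col_permE; apply/matrixP => p a; rewrite !mxE.
have e0 : place_mx ((strand (rename s D))^~ 0) = _ := hp ((strand D)^~ 0).
have e1 : place_mx ((strand (rename s D))^~ 1) = _ := hp ((strand D)^~ 1).
rewrite e0 e1 trmx_mul tr_perm_mx invgK !mulmxA.
rewrite -[_ *m _ *m perm_mx s *m transport _ _]mulmxA -[_ *m _ *m (perm_mx s *m _)]mulmxA.
rewrite [perm_mx s^-1 *m _]mulmxA perm_mxKV mul1mx -!mulmxA [perm_mx s^-1 *m _]mulmxA perm_mxKV.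
by rewrite mul1mx.
Qed.

Lemma mul_cat D D' : fits D -> fits D' -> exists2 s : 'S_m,
  forall i, strand D' (s i) 0 = strand D i 1 & diagram_mul D D' = cat_diagram D (rename s D').
Proof.
move=> fD fD'; have [s [s' [_ hs _]]] := fits_perms fD; have [r [r' [hr _ _]]] := fits_perms fD'.
have [[_ _ i1] _] := fD; have [[_ i0' _] _] := fD'.
have h i : strand D' ((s'^-1 * r)%g i) 0 = strand D i 1.
  by rewrite permM hr -hs permKV.
exists (s'^-1 * r)%g => //; rewrite /diagram_mul /cat_diagram.
have cE i : continuation D D' i = (s'^-1 * r)%g i.
  rewrite /continuation; case: pickP => [j /eqP E'|/(_ ((s'^-1 * r)%g i))]; last by rewrite h eqxx.
  by apply: i0'; rewrite /= E' h.
by congr Diagram; apply/funext => i; apply/funext => j; rewrite ?cE //; apply/funext => t; rewrite !cE.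
Qed.

(** The two placement matrices at the seam multiply to the renaming which aligns D' with D. *)
Lemma rho0_mul D D' : fits D -> fits D' -> rho0 (diagram_mul D D') = rho0 D *m rho0 D'.
Proof.
move=> fD fD'; have [s hs ->] := mul_cat fD fD'; have [gD hE] := fD; have [gD' hE'] := fD'.
rewrite {1}/rho0 (cat_transport gD (rename_good s gD') (fun i => esym (hs i))).
rewrite (rename_transport s gD').
rewrite (_ : (fun i => strand (cat_diagram D (rename s D')) i 0) = (strand D)^~ 0); last first.
  by apply/funext => i; rewrite /= half_ge0 mulr0.
rewrite (_ : (fun i => strand (cat_diagram D (rename s D')) i 1) = (fun i => strand D' (s i) 1)); last first.
  by apply/funext => i; rewrite /= half_lt1 two_sub1.
have hp f : place_mx (fun i => f (s i)) = place_mx f *m perm_mx s^-1.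
  by rewrite -col_permE; apply/matrixP => p a; rewrite !mxE.
rewrite (hp ((strand D')^~ 1)) trmx_mul tr_perm_mx invgK.
have sE : perm_mx s = (place_mx ((strand D)^~ 1))^T *m place_mx ((strand D')^~ 0).
  rewrite (_ : (strand D)^~ 1 = (fun i => strand D' (s i) 0)); last by apply/funext => i; rewrite hs.
  rewrite (hp ((strand D')^~ 0)) trmx_mul tr_perm_mx invgK.
  have [r [r' [hr _ _]]] := fits_perms fD'; have [_ i0' _] := gD'.
  by rewrite (tr_place_mxE i0' hr) (place_mxE i0' hr) -mulmxA perm_mxKV mulmx1.
have sV : perm_mx s^-1 *m perm_mx s = 1%:M :> 'M[laurent]_m by rewrite -perm_mxM mulVg perm_mx1.
rewrite /rho0; move: sE sV; set P := perm_mx s; set Q := perm_mx s^-1.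
move: (place_mx ((strand D)^~ 0)) (transport up D) (place_mx ((strand D)^~ 1))^T => X T Y.
move: (place_mx ((strand D')^~ 0)) (transport up D') (place_mx ((strand D')^~ 1))^T => X' T' Y' sE sV.
have -> : X *m T *m Y *m (X' *m T' *m Y') = X *m T *m (Y *m X') *m T' *m Y' by rewrite !mulmxA.
rewrite -sE.
have -> : X *m (T *m (P *m T' *m Q)) *m (P *m Y') = X *m T *m P *m T' *m (Q *m P) *m Y' by rewrite !mulmxA.
by rewrite sV mulmx1.
Qed.

Lemma cyl_fits virt D : cyl_diagram virt E D -> fits D.
Proof. by move=> cD; split; [exact: cyl_diagram_good cD|case: cD => -[]]. Qed.

End Rho.

(** * Invariance under isotopies and Reidemeister moves *)

Section Equivalence.
Local Open Scope classical_set_scope.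
Local Open Scope ring_scope.
Variables (R : realType) (m : nat) (up : bool) (c : R[i]) (th : 'I_m -> R) (E E' : set R[i]) (d : nat).
Hypothesis numE : ccw_numbering c th E'.
Hypothesis d0 : (0 < d)%N.
Hypothesis dE : forall x y, E x -> E y -> x ^+ d = y ^+ d -> x = y.
Local Notation rho0 := (rho0 up c th).

Lemma power_good (D : diagram R m) : coherent up (fun=> D) ->
  injective ((strand D)^~ 0) -> injective ((strand D)^~ 1) ->
  (forall i, E (strand D i 0) /\ E (strand D i 1)) -> good up (power_map d D).
Proof.
move=> cD i0 i1 hE; split.
- exact: (coherent_power d0 cD).
- by move=> i j /= h; apply: i0; apply: dE h; have [] := hE i; have [] := hE j.
- by move=> i j /= h; apply: i1; apply: dE h; have [] := hE i; have [] := hE j.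
Qed.

Lemma rho0_power_family virt G : diagram_family virt E G ->
  (forall u, 0 <= u <= 1 -> generic (G u) \/ singular (G u)) ->
  rho0 (power_map d (G 0)) = rho0 (power_map d (G 1)).
Proof.
move=> fG hG; have cG := family_coherent up fG hG; have [_ hp hend _] := fG.
apply: (@rho0_family _ _ _ _ _ (fun u => power_map d (G u))).
- exact: coherent_power.
- move=> u uI; have [[_ _ hE [i0 i1] _] _] := hp u uI.
  by apply: power_good => //; apply: coherent_slice uI cG.
- by move=> i /=; have [-> _] := hend 1 i (unit1 R).
- by move=> i /=; have [_ ->] := hend 1 i (unit1 R).
Qed.

Lemma same_diagram_power (D D' : diagram R m) : same_diagram D D' ->
  same_diagram (power_map d D) (power_map d D').
Proof. by move=> sD t tI; have [h1 h2] := sD t tI; split=> //= i; rewrite h1. Qed.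

Lemma rho0_power_ends virt G (D D' : diagram R m) : diagram_family virt E G ->
  (forall u, 0 <= u <= 1 -> generic (G u) \/ singular (G u)) ->
  same_diagram (G 0) D -> same_diagram (G 1) D' ->
  rho0 (power_map d D) = rho0 (power_map d D').
Proof.
move=> fG hG s0 s1; have cG := family_coherent up fG hG; have [_ hp _ _] := fG.
have gG u : 0 <= u <= 1 -> good up (power_map d (G u)).
  move=> uI; have [[_ _ hE [i0 i1] _] _] := hp u uI.
  by apply: power_good => //; apply: coherent_slice uI cG.
rewrite -(rho0_same _ _ (same_diagram_power s0) (gG 0 (unit0 R))).
rewrite -(rho0_same _ _ (same_diagram_power s1) (gG 1 (unit1 R))).
exact: rho0_power_family fG hG.
Qed.

(** For d = 1 this makes [rho0] a function on VCB_m. For general d it makes rho o f_d a function on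
    braids in the cylinder directly, without following the images of the moves under f_d through
    virtual moves. *)
Lemma rho0_step virt (D D' : diagram R m) : cyl_step virt E D D' ->
  rho0 (power_map d D) = rho0 (power_map d D').
Proof.
case=> [[G [fG gG s0 s1]]|[G [fG [u0 u01 [sG gG]] s0 s1]]|s cD ->].
- by apply: rho0_power_ends fG _ s0 s1 => u uI; left; apply: gG.
- apply: rho0_power_ends fG _ s0 s1 => u uI.
  by have [->|uu0] := eqVneq u u0; [right|left; apply: gG].
- have [cD' i0 i1] := cyl_diagram_good up cD; have [[_ _ hE _ _] _ _] := cD.
  by rewrite -[RHS]/(rho0 (rename s (power_map d D))) rho0_rename //; apply: power_good.
Qed.

Lemma rho0_equiv virt (D D' : diagram R m) : cyl_equiv virt E D D' ->
  rho0 (power_map d D) = rho0 (power_map d D').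
Proof.
elim=> [x y|x|x y _ E1|x y z _ E1 _ E2]; [exact: rho0_step|by []|by rewrite E1|by rewrite E1].
Qed.

End Equivalence.

(** * Uniqueness of rho *)

Section LiftDiagrams.
Local Open Scope classical_set_scope.
Local Open Scope ring_scope.
Variable R : realType.

Lemma cis_cpath (f : R -> R) : {within `[0, 1], continuous f} -> cpath (fun t => cis (f t)).
Proof.
move=> cf; split=> x.
  by apply: (cvg_comp _ _ (cf x)); exact: continuous_cos.
by apply: (cvg_comp _ _ (cf x)); exact: continuous_sin.
Qed.

Lemma cis_cfamily (f : R * R -> R) : {within @square R, continuous f} -> cfamily (fun x => cis (f x)).
Proof.
move=> cf; split=> x.
  by apply: (cvg_comp _ _ (cf x)); exact: continuous_cos.
by apply: (cvg_comp _ _ (cf x)); exact: continuous_sin.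
Qed.

Lemma norm1_cis (z : R[i]) : `|z| = 1 -> exists a, z = cis a.
Proof.
move=> /eqP; rewrite norm1E; case: z => a b /= /eqP ab.
have aI : -1 <= a <= 1 by apply/andP; split; nra.
have sE : Num.sqrt (1 - a ^+ 2) = `|b| by rewrite -ab addrAC subrr add0r sqrtr_sqr.
have [b0|b0] := leP 0 b.
  exists (acos a); apply/complex_eqP; rewrite /cis /= acosK ?in_itv //= sin_acos // sE.
  by rewrite ger0_norm.
exists (- acos a); apply/complex_eqP; rewrite /cis /= cosN sinN acosK ?in_itv //= sin_acos // sE.
by rewrite ltr0_norm // opprK.
Qed.

Lemma sin_period (x : R) (k : int) : sin (x + k%:~R * (2 * pi)) = sin x.
Proof. by have /complex_eqP[_] := cis_period x k. Qed.

Definition xing (f : R -> R) (t : R) := exists2 e : R, 0 < e &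
  (forall r, 0 < `|r| < e -> 0 < r * f (t + r)) \/ (forall r, 0 < `|r| < e -> r * f (t + r) < 0).

Lemma interior_near (t : R) : 0 < t < 1 -> exists2 e : R, 0 < e & forall r, `|r| < e -> 0 <= t + r <= 1.
Proof.
move=> /andP[t0 t1]; exists (Num.min t (1 - t)); first by rewrite lt_min t0 subr_gt0.
by move=> r; rewrite lt_min !ltr_norml => /andP[/andP[h1 h2] /andP[h3 h4]]; apply/andP; split; lra.
Qed.

Variable m : nat.
Implicit Types (th : 'I_m -> R -> R) (ov : 'I_m -> 'I_m -> R -> Prop).

Definition angle_diagram th ov : diagram R m := Diagram (fun i t => cis (th i t)) ov.

Lemma lift_turn th ov i j t : turn (angle_diagram th ov) i j t = sin (th j t - th i t).
Proof. by rewrite /turn -[strand _ j t / _]/(cis (th j t) / cis (th i t)) -cisB. Qed.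

Lemma turn_near th i j (k : int) t :
  {within `[0, 1], continuous (th i)} -> {within `[0, 1], continuous (th j)} -> 0 < t < 1 ->
  th j t - th i t = k%:~R * (2 * pi) -> exists2 e : R, 0 < e & forall r, `|r| < e ->
    0 <= t + r <= 1 /\ `|th j (t + r) - th i (t + r) - k%:~R * (2 * pi)| < pi.
Proof.
move=> /within_itvP ci /within_itvP cj tI Ek; have [e e0 he] := interior_near tI.
have tI' : 0 <= t <= 1 by case/andP: tI => *; rewrite !ltW.
have p0 : 0 < pi / 2 :> R by rewrite divr_gt0 // pi_gt0.
have [d d0 hd] := ci t tI' _ p0; have [d' d'0 hd'] := cj t tI' _ p0.
exists (Num.min e (Num.min d d')); first by rewrite !lt_min e0 d0.
move=> r; rewrite !lt_min => /and3P[h1 h2 h3]; have trI := he r h1; split=> //.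
have tr : t + r - t = r by rewrite addrAC subrr add0r.
have := hd (t + r) trI; have := hd' (t + r) trI; rewrite tr => /(_ h3) g1 /(_ h2) g2.
rewrite -Ek; move: g1 g2; rewrite !ltr_norml => /andP[? ?] /andP[? ?]; apply/andP; split; lra.
Qed.

Lemma pmul_sgP (r x y : R) : (0 < x) = (0 < y) -> (x < 0) = (y < 0) ->
  (0 < r * x) = (0 < r * y) /\ (r * x < 0) = (r * y < 0).
Proof.
move=> h1 h2; have [r0|r0|<-] := ltgtP 0 r; last by rewrite !mul0r.
  by rewrite !pmulr_rgt0 // !pmulr_rlt0.
by rewrite !nmulr_rgt0 // !nmulr_rlt0.
Qed.

(** Near the meeting the difference of the angles is within pi of k turns, where the sine has the
    sign of the deviation. *)
Lemma lift_crosses th ov i j (k : int) t :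
  {within `[0, 1], continuous (th i)} -> {within `[0, 1], continuous (th j)} -> 0 < t < 1 ->
  th j t - th i t = k%:~R * (2 * pi) ->
  crosses (angle_diagram th ov) i j t <-> xing (fun t => th j t - th i t - k%:~R * (2 * pi)) t.
Proof.
move=> ci cj tI Ek; have [e e0 he] := turn_near ci cj tI Ek.
have key r : `|r| < e ->
   (0 < r * turn (angle_diagram th ov) i j (t + r)) =
     (0 < r * (th j (t + r) - th i (t + r) - k%:~R * (2 * pi))) /\
   (r * turn (angle_diagram th ov) i j (t + r) < 0) =
     (r * (th j (t + r) - th i (t + r) - k%:~R * (2 * pi)) < 0).
  move=> /he[_ h]; have [h1 h2] := sin_sgP h; rewrite lift_turn.
  by apply: pmul_sgP; rewrite -?h1 -?h2 -(sin_period (_ - _ - _) k) subrK.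
split=> -[e' e'0 h]; exists (Num.min e e'); rewrite ?lt_min ?e0 //.
  by case: h => h; [left|right] => r /andP[r0]; rewrite lt_min => /andP[/key[h1 h2] h3];
    [rewrite -h1|rewrite -h2]; apply: h; rewrite r0.
by case: h => h; [left|right] => r /andP[r0]; rewrite lt_min => /andP[/key[h1 h2] h3];
    [rewrite h1|rewrite h2]; apply: h; rewrite r0.
Qed.

Lemma lift_prediagram (E : set R[i]) th ov :
  (forall i, {within `[0, 1], continuous (th i)}) ->
  (forall i, E (cis (th i 0)) /\ E (cis (th i 1))) ->
  (forall i j, i != j -> cis (th i 0) <> cis (th j 0) /\ cis (th i 1) <> cis (th j 1)) ->
  (forall i j t, 0 <= t <= 1 -> ov i j t -> [/\ i != j, cis (th i t) = cis (th j t) & ~ ov j i t]) ->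
  prediagram E (angle_diagram th ov).
Proof.
move=> hc hE hinj ho; split=> //.
- by move=> i; apply: cis_cpath.
- by move=> i t _; apply: norm_cis.
- by split=> i j /= h; apply/eqP/negPn/negP => /hinj[].
- by move=> i j t tI o; have [h1 h2 h3] := ho i j t tI o.
Qed.

Lemma meet_interior (E : set R[i]) (D : diagram R m) i j t : prediagram E D -> meet D i j t -> 0 < t < 1.
Proof.
move=> [_ _ _ [i0 i1] _] [/andP[t0 t1] ij mE]; rewrite !lt_neqAle t0 t1 !andbT; apply/andP; split.
  by apply: contra_neq ij => tE; apply: i0; rewrite /= tE mE.
by apply: contra_neq ij => tE; apply: i1; rewrite /= -tE mE.
Qed.

Lemma lift_generic (E : set R[i]) th ov : prediagram E (angle_diagram th ov) ->
  (forall i, {within `[0, 1], continuous (th i)}) ->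
  (forall i j t (k : int), 0 < t < 1 -> i != j -> th j t - th i t = k%:~R * (2 * pi) ->
     (forall l, cis (th l t) = cis (th i t) -> l = i \/ l = j) /\
     xing (fun t => th j t - th i t - k%:~R * (2 * pi)) t) ->
  generic (angle_diagram th ov).
Proof.
move=> pD hc h i j t me; have tI := meet_interior pD me; have [_ ij /= mE] := me.
have [k /eqP] := cis_eqP (esym mE); rewrite addrC -subr_eq => /eqP Ek.
have [nd xi] := h i j t k tI ij Ek; split; last exact/(lift_crosses _ (hc i) (hc j) tI Ek).
have nd' l : (l == i) || (l == j) <-> cis (th i t) = cis (th l t).
  split=> [/orP[] /eqP ->|/esym/nd[] ->]; by rewrite ?eqxx ?orbT.
by move=> a b; rewrite !inE => /orP[] /eqP -> /=; rewrite nd' -?mE.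
Qed.

End LiftDiagrams.

(** * Lifted endpoints and diagrams in which neighbours exchange places *)

Section Positions.
Local Open Scope classical_set_scope.
Local Open Scope ring_scope.
Variables (R : realType) (m' : nat) (gamma : R) (th : 'I_m'.+2 -> R) (E : set R[i]).
Local Notation m := m'.+2.
Hypothesis numE : ccw_numbering (cis gamma) th E.

Definition res (j : int) : 'I_m := inord `|(j %% m)%Z|%N.

(* The lifts to R of the points of E, numbered increasingly. *)
Definition vt (j : int) : R := gamma + th (res j) + (j %/ m)%Z%:~R * (2 * pi).

Lemma res_val j : (res j : nat) = `|(j %% m)%Z|%N.
Proof.
rewrite /res inordK //; have := ltz_pmod j (isT : 0 < Posz m); have := modz_ge0 j (isT : Posz m != 0).
by lia.
Qed.

Lemma vt_period (j k : int) : vt (j + k * m) = vt j + k%:~R * (2 * pi).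
Proof.
have m0 : (m : int) != 0 by [].
rewrite /vt; have -> : res (j + k * m) = res j by rewrite /res addrC modzMDl.
by rewrite addrC [j + _]addrC divzMDl // intrD mulrDl; ring.
Qed.

Lemma ltr_vt : {mono vt : j j' / (j < j')%R}.
Proof.
suff mono (j j' : int) : j < j' -> vt j < vt j'.
  move=> j j'; have [/mono -> //|h|->] := ltgtP j j'; last by rewrite ltxx.
  by apply/negbTE; rewrite -leNgt ltW // mono.
move=> jj'; have [_ th2 thm _] := numE; have m0 : (m : int) != 0 by [].
have E1 := divz_eq j m; have E2 := divz_eq j' m.
have h1 := modz_ge0 j m0; have h2 := ltz_pmod j (isT : (0 : int) < m).
have h3 := modz_ge0 j' m0; have h4 := ltz_pmod j' (isT : (0 : int) < m).
have [le|gt] := lerP (j' %/ m)%Z (j %/ m)%Z; last first.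
  have : ((j %/ m)%Z%:~R + 1 : R) <= (j' %/ m)%Z%:~R by rewrite -[1]/(1%:~R) -intrD ler_int; lia.
  have := th2 (res j); have := th2 (res j'); have := twopi_gt0 R.
  by rewrite /vt; set P := 2 * pi => ? ? ? ?; nra.
have Ed : (j' %/ m)%Z = (j %/ m)%Z.
  apply/eqP; rewrite eq_le le /=; rewrite leNgt; apply/negP => h; move: jj'; rewrite E1 E2; nia.
have : (j %% m)%Z < (j' %% m)%Z.
  by move: E1 E2; rewrite Ed; set q := (_ %/ _)%Z * _ => E1 E2; lia.
by rewrite /vt Ed ltrD2r ltrD2l => hlt; apply: thm; rewrite !res_val; lia.
Qed.

Lemma ler_vt : {mono vt : j j' / (j <= j')%R}.
Proof. by move=> j j'; rewrite !leNgt ltr_vt. Qed.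

Lemma cis_vt j : cis (vt j) = pos (cis gamma) th (res j).
Proof. by rewrite /vt cis_period cisD. Qed.

Lemma cis_vt_in j : E (cis (vt j)).
Proof. by rewrite cis_vt; apply: pos_in numE _. Qed.

(* Strands a and pi a exchange their positions J a and J a + kappa a (up to m). *)
Definition swap_data (J kappa : 'I_m -> int) (pr : 'I_m -> 'I_m) :=
  [/\ forall a b (k : int), J a = J b + k * m -> a = b,
      forall a, kappa (pr a) = - kappa a,
      forall a, `|kappa a| <= 1 &
      forall a, exists k : int, J (pr a) = J a + kappa a + k * m].

Definition ang (J kappa : 'I_m -> int) (a : 'I_m) (s : R) :=
  vt (J a) + (vt (J a + kappa a) - vt (J a)) * s.

Section SwapDiagrams.
Variables (J kappa : 'I_m -> int) (pr : 'I_m -> 'I_m).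
Hypothesis sw : swap_data J kappa pr.

(** The paths join equal or neighbouring lifted endpoints, so two of them can meet only if they
    share an end. As [J] is injective modulo m, they are then the paths of an exchanging pair,
    traversed in opposite directions. *)
Lemma ang_meet a b (s s' : R) : 0 <= s <= 1 -> 0 <= s' <= 1 -> a != b ->
  cis (ang J kappa a s) = cis (ang J kappa b s') -> [/\ b = pr a, kappa a != 0 & s + s' = 1].
Proof.
move=> /andP[s0 s1] /andP[s'0 s'1] ab /cis_eqP[k]; have [Jinj kpr k1 Jpr] := sw.
(* The k turns are absorbed into [B], which leaves an equation between real numbers. *)
pose A := J a; pose A' := J a + kappa a; pose B := J b + k * m; pose B' := B + kappa b.
have E1 : ang J kappa b s' + k%:~R * (2 * pi) = vt B + (vt B' - vt B) * s'.
  have -> : B' = J b + kappa b + k * m by rewrite /B' /B; ring.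
  by rewrite /B !vt_period /ang; ring.
rewrite {}E1 -/(ang _ _ _ _) /ang -/A -/A' => E1.
have [ka kb] := (k1 a, k1 b).
have AB : A != B by apply/eqP => /(Jinj a b k) E2; rewrite E2 eqxx in ab.
have AB' : A = B' -> b = pr a.
  move=> h; have [k' hk] := Jpr b; have [k'' hk'] := Jpr a.
  have pb : pr b = a by apply: (Jinj _ _ (k' - k)); rewrite hk -/A h /B' /B; ring.
  have ka' : kappa a = - kappa b by rewrite -pb kpr.
  apply/esym/(Jinj _ _ (k'' + k)); rewrite hk' -/A h /B' /B ka'; ring.
have A'B : A' = B -> b = pr a.
  move=> h; have [k'' hk'] := Jpr a.
  by apply/esym/(Jinj _ _ (k'' + k)); rewrite hk' -/A' h /B; ring.
have A'B' : A' != B'.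
  apply/eqP => h; have [k' hk] := Jpr b; have [k'' hk'] := Jpr a.
  have E2 : pr a = pr b.
    by apply: (Jinj _ _ (k'' - k' + k)); rewrite hk' hk -/A' h /B' /B; ring.
  have E3 : kappa a = kappa b by apply: oppr_inj; rewrite -!kpr E2.
  by case/eqP: AB; apply: (addIr (kappa a)); rewrite -/A' h E3.
have crossing : b = pr a -> A' = B -> A = B' -> [/\ b = pr a, kappa a != 0 & s + s' = 1].
  move=> bE h1 h2; have k0 : kappa a != 0.
    by apply: contra AB => /eqP h; rewrite -h1 /A' h addr0.
  split=> //; move: E1; rewrite -h2 -h1 => E1.
  have vn : vt A' - vt A != 0.
    rewrite subr_eq0; apply: contra k0 => /eqP h.
    have : A' = A by apply/eqP; rewrite eq_le -!ler_vt h lexx.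
    by rewrite /A' /A => /eqP; rewrite -subr_eq0 addrAC subrr add0r.
  apply/eqP; rewrite -subr_eq0 -(mulrI_eq0 _ (mulfI vn)); apply/eqP; lra.
have kbE : b = pr a -> kappa b = - kappa a by move=> ->.
have [h|h] := eqVneq A B'.
  have bE := AB' h; apply: crossing => //.
  by rewrite /A' -/A h /B' (kbE bE) addrNK.
have [h'|h'] := eqVneq A' B.
  have bE := A'B h'; case/eqP: h; rewrite /B' -h' (kbE bE) /A'; ring.
exfalso; move: ka kb; rewrite !ler_norml => /andP[ka1 ka2] /andP[kb1 kb2].
have lo x y z w : x < z -> x < w -> y < z -> y < w ->
    vt x + (vt y - vt x) * s < vt z + (vt w - vt z) * s'.
  rewrite -!(ltr_vt) => h1 h2 h3 h4.
  have [xy|xy] := lerP (vt x) (vt y); have [zw|zw] := lerP (vt z) (vt w); nra.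
have lo' x y z w : x < z -> x < w -> y < z -> y < w ->
    vt x + (vt y - vt x) * s' < vt z + (vt w - vt z) * s.
  rewrite -!(ltr_vt) => h1 h2 h3 h4.
  have [xy|xy] := lerP (vt x) (vt y); have [zw|zw] := lerP (vt z) (vt w); nra.
have A'1 : A' <= A + 1 by rewrite /A' lerD2l.
have A'2 : A <= A' + 1 by rewrite /A' /A; lia.
have B'1 : B' <= B + 1 by rewrite /B' lerD2l.
have B'2 : B <= B' + 1 by rewrite /B'; lia.
move: (lo A A' B B') (lo' B B' A A'); rewrite E1 ltxx.
move: A A' B B' AB h h' A'B' A'1 A'2 B'1 B'2 {E1 lo lo' AB' A'B crossing} => A A' B B' *.
have [|] : (A < B) && (A' < B) && (A < B') && (A' < B') \/ (B < A) && (B' < A) && (B < A') && (B' < A') by lia.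
  by lia.
by lia.
Qed.

Lemma ang_pr a : exists k : int, forall s, ang J kappa (pr a) s =
  vt (J a + kappa a) + (vt (J a) - vt (J a + kappa a)) * s + k%:~R * (2 * pi).
Proof.
have [_ kpr _ Jpr] := sw; have [k hk] := Jpr a; exists k => s.
rewrite /ang hk kpr (_ : J a + kappa a + k * m - kappa a = J a + k * m); last by ring.
by rewrite !vt_period; ring.
Qed.

Lemma vt_step a : kappa a != 0 -> vt (J a + kappa a) - vt (J a) != 0.
Proof.
move=> k0; rewrite subr_eq0; apply: contra k0 => /eqP h.
have /eqP : J a + kappa a = J a by apply/eqP; rewrite eq_le -!ler_vt h lexx.
by rewrite -subr_eq0 addrAC subrr add0r.
Qed.

Lemma pr_neq a : kappa a != 0 -> pr a != a.
Proof.
have [_ kpr _ _] := sw; apply: contra => /eqP h; have := kpr a; rewrite h => /eqP.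
by rewrite -addr_eq0 -mulr2n mulrn_eq0.
Qed.

Variable typ : 'I_m -> 'I_m -> Prop.
Hypothesis typ_asym : forall a b, typ a b -> ~ typ b a.

(** Time enters only through [phi], which may pause, run backwards and differ from pair to pair; the
    moving partners meet exactly when it is 1/2. *)
Definition swap_diagram (phi : 'I_m -> R -> R) : diagram R m :=
  angle_diagram (fun a t => ang J kappa a (phi a t))
    (fun a b t => [/\ b = pr a, kappa a != 0, phi a t = 2^-1 & typ a b]).

Definition warp (phi : 'I_m -> R -> R) :=
  [/\ forall a t, 0 <= t <= 1 -> 0 <= phi a t <= 1,
      forall a, phi (pr a) = phi a,
      forall a, phi a 0 = 0 \/ phi a 0 = 1 &
      forall a, phi a 1 = 0 \/ phi a 1 = 1].

Lemma swap_meet phi i j t : warp phi -> 0 <= t <= 1 -> i != j ->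
  cis (ang J kappa i (phi i t)) = cis (ang J kappa j (phi j t)) ->
  [/\ j = pr i, kappa i != 0 & phi i t = 2^-1].
Proof.
move=> [h1 h2 _ _] tI ij /(ang_meet (h1 i t tI) (h1 j t tI) ij)[jE k0 E1].
split=> //; move: E1; rewrite jE h2; lra.
Qed.

Lemma ang_pr_half a : cis (ang J kappa a 2^-1) = cis (ang J kappa (pr a) 2^-1).
Proof.
have [k ->] := ang_pr a; rewrite cis_period /ang; congr cis; lra.
Qed.

Lemma swap_prediagram (phi : 'I_m -> R -> R) : (forall a, {within `[0, 1], continuous (phi a)}) -> warp phi ->
  prediagram E (swap_diagram phi).
Proof.
move=> hc hw; have [h1 h2 h3 h4] := hw.
have half a : (phi a 0 = 2^-1 -> False) /\ (phi a 1 = 2^-1 -> False).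
  by split; [case: (h3 a)|case: (h4 a)] => ->; lra.
apply: lift_prediagram.
- move=> i x; apply: cvgD; first exact: cvg_cst.
  by apply: cvgM; [exact: cvg_cst|exact: hc].
- by move=> i; split; [case: (h3 i)|case: (h4 i)] => ->; rewrite /ang ?mulr0 ?mulr1 ?addr0 ?[vt _ + (_ - _)]addrC ?subrK; apply: cis_vt_in.
- by move=> i j ij; split=> /(swap_meet hw _ ij); [case=> [|_ _ /(proj1 (half i))]|case=> [|_ _ /(proj2 (half i))]]; rewrite ?lexx ?ler01.
- move=> i j t tI [-> k0 ph ty]; split.
  + by rewrite eq_sym pr_neq.
  + by rewrite h2 ph; apply: ang_pr_half.
  + by case=> _ _ _; apply: typ_asym.
Qed.

Lemma xing_scale (f : R -> R) (g : R) t : g != 0 -> xing f t -> xing (fun t => g * f t) t.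
Proof.
move=> g0 [e e0 he]; exists e => //.
have E1 r : r * (g * f (t + r)) = g * (r * f (t + r)) by ring.
have [gp|gn|gz] := ltgtP 0 g; last by rewrite -gz eqxx in g0.
  case: he => h; [left|right] => r /h; rewrite E1; first by rewrite (pmulr_rgt0 _ gp).
  by rewrite (pmulr_rlt0 _ gp).
case: he => h; [right|left] => r /h; rewrite E1; first by rewrite (nmulr_rlt0 _ gn).
by rewrite (nmulr_rgt0 _ gn).
Qed.

Lemma eq_xing (f f' : R -> R) t : f =1 f' -> xing f t -> xing f' t.
Proof. by move=> ff' [e e0 he]; exists e => //; case: he => h; [left|right] => r /h; rewrite ff'. Qed.

Lemma swap_regular (phi : 'I_m -> R -> R) i j (t : R) : (forall a, {within `[0, 1], continuous (phi a)}) -> warp phi ->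
  meet (swap_diagram phi) i j t -> (kappa i != 0 -> phi i t = 2^-1 -> xing (fun t => phi i t - 2^-1) t) ->
  regular_crossing (swap_diagram phi) i j t.
Proof.
move=> hc hw me hx; have pD := swap_prediagram hc hw; have tI := meet_interior pD me.
have [tI' ij /= mE] := me; have [jE k0 ph] := swap_meet hw tI' ij mE; have [h1 h2 h3 h4] := hw.
split.
  have nd l : (l == i) || (l == j) <-> cis (ang J kappa i (phi i t)) = cis (ang J kappa l (phi l t)).
    split=> [/orP[] /eqP ->//|h]; have [//|il] := eqVneq l i.
    have il' : i != l by rewrite eq_sym.
    by have [-> _ _] := swap_meet hw tI' il' h; rewrite jE eqxx orbT.
  by move=> a b; rewrite !inE => /orP[] /eqP -> /=; rewrite nd -?mE.
have [k hk] := ang_pr i.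
have cang a : {within `[0, 1], continuous (fun t => ang J kappa a (phi a t))}.
  move=> x; apply: cvgD; first exact: cvg_cst.
  by apply: cvgM; [exact: cvg_cst|exact: hc].
have fE r : ang J kappa j (phi j r) - ang J kappa i (phi i r) - k%:~R * (2 * pi) =
    (- 2 * (vt (J i + kappa i) - vt (J i))) * (phi i r - 2^-1).
  by rewrite jE hk h2 /ang; lra.
have E1 : ang J kappa j (phi j t) - ang J kappa i (phi i t) = k%:~R * (2 * pi).
  by apply/eqP; rewrite -subr_eq0 fE ph subrr mulr0.
apply/(lift_crosses _ (cang i) (cang j) tI E1).
apply: (eq_xing (fun r => esym (fE r))); apply: xing_scale; last exact: hx.
by rewrite mulf_neq0 ?oppr_eq0 ?vt_step.
Qed.

Lemma swap_cyl (phi : 'I_m -> R -> R) : (forall a, {within `[0, 1], continuous (phi a)}) -> warp phi ->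
  (forall a t, 0 <= t <= 1 -> kappa a != 0 -> phi a t = 2^-1 -> xing (fun t => phi a t - 2^-1) t) ->
  cyl_diagram true E (swap_diagram phi).
Proof.
move=> hc hw hx; split=> //; [exact: swap_prediagram|move=> i j t me|by left].
by apply: swap_regular => //; have [tI _ _] := me; apply: hx.
Qed.

Lemma square_slice (f : R * R -> R) (u : R) : 0 <= u <= 1 -> {within @square R, continuous f} ->
  {within `[0, 1], continuous (fun t => f (u, t))}.
Proof.
move=> uI /within_squareP h; apply/within_itvP => t tI e e0.
by have [d d0 hd] := h u t uI tI e e0; exists d => // t' t'I ht; apply: hd => //; rewrite subrr normr0.
Qed.

Lemma swap_family (phi : R -> 'I_m -> R -> R) :
  (forall a, {within @square R, continuous (fun x => phi x.1 a x.2)}) ->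
  (forall u, 0 <= u <= 1 -> warp (phi u)) ->
  (forall u a, 0 <= u <= 1 -> phi u a 0 = phi 0 a 0 /\ phi u a 1 = phi 0 a 1) ->
  diagram_family true E (fun u => swap_diagram (phi u)).
Proof.
move=> hc hw he; split.
- move=> a; apply: cis_cfamily => x; apply: cvgD; first exact: cvg_cst.
  by apply: cvgM; [exact: cvg_cst|exact: hc].
- move=> u uI; split; last by left.
  by apply: swap_prediagram (hw u uI) => a; exact: (square_slice uI (hc a)).
- by move=> u i uI /=; have [-> ->] := he u i uI.
(* Any radius works: at a meeting, whenever it takes place, the crossing is described by [typ]
   alone. *)
- move=> u t i j uI [tI ij /= mE]; exists 1 => // u' t' u'I _ _ [t'I _ /= mE'].
  have [h1 h2 h3] := swap_meet (hw u uI) tI ij mE.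
  by have [h1' h2' h3'] := swap_meet (hw u' u'I) t'I ij mE'; split=> -[? ? ? ?].
Qed.

End SwapDiagrams.

End Positions.

(** * Elementary isotopies and isolated meetings *)

Section Isotopies.
Local Open Scope classical_set_scope.
Local Open Scope ring_scope.
Variables (R : realType) (m : nat) (E : set R[i]).
Implicit Types (D : diagram R m) (G : R -> diagram R m).

Lemma same_diagram_sym D D' : same_diagram D D' -> same_diagram D' D.
Proof.
move=> h t tI; have [h1 h2] := h t tI; split=> [i|i j]; first by rewrite h1.
by split=> /h2.
Qed.

Lemma same_cyl virt D D' : same_diagram D D' -> cyl_diagram virt E D -> cyl_diagram virt E D'.
Proof.
move=> sD [pD gD vD]; have [hc h1 hE [i0 i1] ho] := pD.
have sE i t : 0 <= t <= 1 -> strand D i t = strand D' i t by move=> /sD[].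
have oE i j t : 0 <= t <= 1 -> Defs.over D i j t <-> Defs.over D' i j t by move=> /sD[].
have mE i j t : meet D i j t <-> meet D' i j t.
  by split=> -[tI ij E1]; split=> //; [rewrite -!sE|rewrite !sE].
split; last first.
- case: vD => [v|v]; [by left|right] => i j t me; have [tI _ _] := me.
  by have := v i j t ((mE i j t).2 me); rewrite /classical_at !oE.
- move=> i j t /mE me; have [nd [e e0 he]] := gD i j t me; have tI := meet_interior pD me.
  have [tI' _ _] := me; split.
    by move=> a b aS; have := nd a b aS; rewrite !sE.
  have [d d0 hd] := interior_near tI; exists (Num.min e d); first by rewrite lt_min e0.
  have tE r : `|r| < d -> turn D' i j (t + r) = turn D i j (t + r).
    by move=> /hd h; rewrite /turn !sE.
  by case: he => h; [left|right] => r /andP[r0]; rewrite lt_min => /andP[re rd]; rewrite tE //;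
    apply: h; rewrite r0.
split.
- move=> i; have [/within_itvP hr /within_itvP hi] := hc i; split; apply/within_itvP => t tI e e0.
    by have [d d0 hd] := hr t tI e e0; exists d => // t' t'I ht; rewrite -!sE //; apply: hd.
  by have [d d0 hd] := hi t tI e e0; exists d => // t' t'I ht; rewrite -!sE //; apply: hd.
- by move=> i t tI; rewrite -sE //; apply: h1.
- by move=> i; rewrite -!sE ?unit0 ?unit1 //; apply: hE.
- by split=> i j /=; rewrite -!sE ?unit0 ?unit1 //; [apply: i0|apply: i1].
- move=> i j t tI /(oE _ _ _ tI)/(ho _ _ _ tI)[me no]; split; first exact/mE.
  by move/(oE _ _ _ tI).
Qed.

Lemma const_family (virt : bool) D : prediagram E D -> virt \/ all_classical D ->
  (forall i j t, meet D i j t -> exists2 e : R, 0 < e & forall t', 0 <= t' <= 1 -> `|t' - t| < e ->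
      meet D i j t' -> (Defs.over D i j t' <-> Defs.over D i j t)) ->
  diagram_family virt E (fun=> D).
Proof.
move=> pD vD ho; have [hc _ _ _ _] := pD; split=> //.
- by move=> i; apply: cfamily_const.
- move=> u t i j uI me; have [e e0 he] := ho i j t me; exists e => // u' t' u'I hu ht me'.
  by have [t'I _ _] := me'; apply: he.
Qed.

Lemma generic_isolated D i j t : prediagram E D -> generic D -> meet D i j t ->
  exists2 e : R, 0 < e & forall t', 0 <= t' <= 1 -> `|t' - t| < e -> meet D i j t' -> t' = t.
Proof.
move=> [_ h1 _ _ _] gD /gD[_ [e e0 he]]; exists e => // t' t'I ht [_ _ mE'].
apply/eqP/negPn/negP => tt'; have r0 : 0 < `|t' - t| < e by rewrite normr_gt0 subr_eq0 tt' ht.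
have tn0 : turn D i j t' = 0 by apply: turn_nn; [exact: h1|apply/eqP].
by case: he => /(_ _ r0); rewrite addrCA subrr addr0 tn0 mulr0 ltxx.
Qed.

Lemma same_isotopic virt D D' : cyl_diagram virt E D -> same_diagram D D' -> cyl_isotopic virt E D D'.
Proof.
move=> [pD gD vD] sD; exists (fun=> D); split=> //.
apply: const_family => // i j t me; have [e e0 he] := generic_isolated pD gD me.
by exists e => // t' t'I ht /(he _ t'I ht) ->.
Qed.

Lemma isotopic_cyl virt D D' : cyl_isotopic virt E D D' -> cyl_diagram virt E D'.
Proof.
move=> [G [[_ hp _ _] gG _ s1]]; apply: same_cyl s1 _.
by have [pG vG] := hp 1 (unit1 R); split=> //; apply: gG; rewrite unit1.
Qed.

Lemma isotopic_equiv virt D D' : cyl_isotopic virt E D D' -> cyl_equiv virt E D D'.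
Proof. by move=> h; apply: rst_step; apply: Isotopy. Qed.

End Isotopies.

(** * Agreement of two candidates for rho; splitting simultaneous swaps *)

Section Swaps.
Local Open Scope classical_set_scope.
Local Open Scope ring_scope.
Variables (R : realType) (m' : nat) (gamma : R) (th : 'I_m'.+2 -> R) (E : set R[i]) (up : bool).
Local Notation m := m'.+2.
Hypothesis numE : ccw_numbering (cis gamma) th E.
Variables rho rho' : diagram R m -> 'M[laurent]_m.
Hypotheses (hrho : is_rho up (cis gamma) th E rho) (hrho' : is_rho up (cis gamma) th E rho').
Implicit Types (D : diagram R m).

(** [rho] and [rho'] are known only through [is_rho], so the set of agreement can be enlarged only
    by equivalences, products and cancellation, starting from the generators. *)
Definition agree D := cyl_diagram true E D /\ rho D = rho' D.

Lemma agree_isotopic D D' : agree D -> cyl_isotopic true E D D' -> agree D'.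
Proof.
move=> [cD rE] iD; have cD' := isotopic_cyl iD; split=> //.
have [_ h _ _] := hrho; have [_ h' _ _] := hrho'; have eD := isotopic_equiv iD.
by rewrite -(h _ _ cD cD' eD) -(h' _ _ cD cD' eD).
Qed.

Lemma agree_same D D' : agree D -> same_diagram D D' -> agree D'.
Proof. by move=> aD sD; apply: agree_isotopic (aD) (same_isotopic (proj1 aD) sD). Qed.

Lemma agree_mul D D' X : agree D -> agree D' -> cyl_diagram true E X ->
  cyl_equiv true E X (diagram_mul D D') -> cyl_diagram true E (diagram_mul D D') -> agree X.
Proof.
move=> [cD rE] [cD' rE'] cX eX cM; split=> //.
have [_ h hm _] := hrho; have [_ h' hm' _] := hrho'.
by rewrite (h _ _ cX cM eX) (h' _ _ cX cM eX) hm // hm' // rE rE'.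
Qed.

Lemma mul_aligned D D' : cyl_diagram true E D -> cyl_diagram true E D' ->
  (forall i, strand D' i 0 = strand D i 1) -> diagram_mul D D' = cat_diagram D D'.
Proof.
move=> cD cD' al; have fD := cyl_fits up cD; have fD' := cyl_fits up cD'.
have [s hs ->] := mul_cat numE fD fD'; have [[_ i0 _] _] := fD'.
have s1 i : s i = i by apply: i0; rewrite /= hs al.
by rewrite /cat_diagram; congr Diagram; apply/funext => i; apply/funext => j;
  rewrite /= ?s1 //; apply/funext => t; rewrite !s1.
Qed.

Lemma agree_cat D D' X : agree D -> agree D' -> (forall i, strand D' i 0 = strand D i 1) ->
  cyl_diagram true E X -> cyl_isotopic true E X (cat_diagram D D') -> agree X.
Proof.
move=> aD aD' al cX iX; have := mul_aligned (proj1 aD) (proj1 aD') al => E1.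
apply: (agree_mul aD aD' cX); rewrite E1; last exact: isotopic_cyl iX.
exact: isotopic_equiv.
Qed.

(** This reaches inverses: the values are invertible matrices, so agreement on a product and on its
    first factor gives agreement on the second. *)
Lemma agree_cancel D D' I : agree D -> cyl_diagram true E D' -> (forall i, strand D' i 0 = strand D i 1) ->
  agree I -> cyl_diagram true E (cat_diagram D D') -> cyl_equiv true E (cat_diagram D D') I -> agree D'.
Proof.
move=> [cD rE] cD' al [cI rI] cM eM; split=> //.
have [hu h hm _] := hrho; have [hu' h' hm' _] := hrho'.
have E1 := mul_aligned cD cD' al.
have := hm _ _ cD cD'; have := hm' _ _ cD cD'; rewrite E1 (h _ _ cM cI eM) (h' _ _ cM cI eM) -rI rE.
by move=> -> /(congr1 (mulmx (invmx (rho' D)))); rewrite !mulKmx ?hu'.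
Qed.

(** The identity is the only invertible idempotent matrix; this yields the common value on
    motionless diagrams. *)
Lemma agree_idem D : cyl_diagram true E D -> (forall i, strand D i 0 = strand D i 1) ->
  same_diagram D (cat_diagram D D) -> agree D.
Proof.
move=> cD al sD; have iD := same_isotopic cD sD; have cM := isotopic_cyl iD.
have E1 := mul_aligned cD cD al; have eD := isotopic_equiv iD.
have idem r : is_rho up (cis gamma) th E r -> r D = 1%:M.
  move=> [hu h hm _]; have := hm _ _ cD cD; rewrite E1 -(h _ _ cD cM eD).
  move=> /(congr1 (mulmx (invmx (r D)))); rewrite mulKmx ?hu // mulVmx ?hu //.
by split=> //; rewrite !idem.
Qed.

Section Elementary.
Variables (J kappa : 'I_m -> int) (pr : 'I_m -> 'I_m) (typ : 'I_m -> 'I_m -> Prop).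
Hypothesis sw : swap_data J kappa pr.
Hypothesis typ_asym : forall a b, typ a b -> ~ typ b a.

Lemma cst_continuous (x : R) : {within `[0, 1], continuous ((fun=> x) : R -> R)}.
Proof. by apply: continuous_subspaceT => t; exact: cvg_cst. Qed.

Lemma id_continuous : {within `[0, 1], continuous ((fun t => t) : R -> R)}.
Proof. by apply: continuous_subspaceT => t; exact: cvg_id. Qed.

Definition still := swap_diagram gamma th J kappa pr typ (fun _ _ => 0).
Definition swapping := swap_diagram gamma th J kappa pr typ (fun _ t => t).

Lemma agree_still : agree still.
Proof.
have cS : cyl_diagram true E still.
  apply: (swap_cyl numE sw typ_asym).
  - by move=> a; apply: cst_continuous.
  - split=> // *; [by rewrite lexx ler01|by left|by left].
  - by move=> a t _ _; lra.
apply: agree_idem => // t tI; split=> [i|i j] /=; first by rewrite if_same.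
by rewrite if_same; split=> -[_ _]; lra.
Qed.

Lemma xing_affine (f : R -> R) (s e t : R) : s != 0 -> 0 < e ->
  (forall r, `|r| < e -> f (t + r) = s * r) -> xing f t.
Proof.
move=> s0 e0 hf; exists e => //; have r2 (r : R) : 0 < `|r| -> 0 < r * r
  by rewrite normr_gt0 => r0; rewrite -[r * r]expr2 lt_neqAle eq_sym sqrf_eq0 r0 sqr_ge0.
have [sp|sn|sz] := ltgtP 0 s; last by rewrite -sz eqxx in s0.
  by left=> r /andP[/r2 rr /hf ->]; rewrite mulrCA pmulr_rgt0.
by right=> r /andP[/r2 rr /hf ->]; rewrite mulrCA pmulr_llt0.
Qed.

Lemma swapping_cyl : cyl_diagram true E swapping.
Proof.
apply: (swap_cyl numE sw typ_asym).
- by move=> a; apply: id_continuous.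
- by split=> //= a; [left|right].
- move=> a t _ _ tE; apply: (@xing_affine (fun t => t - 2^-1) 1 1 t); [exact: oner_neq0|exact: ltr01|].
  by move=> r _; rewrite tE mul1r addrAC subrr add0r.
Qed.

Lemma pr_inv a : pr (pr a) = a.
Proof.
have [Jinj kpr _ Jpr] := sw; have [k hk] := Jpr a; have [k' hk'] := Jpr (pr a).
by apply: (Jinj _ _ (k + k')); rewrite hk' hk kpr; ring.
Qed.

Lemma shift_inj a b (k : int) : J a + kappa a = J b + kappa b + k * m -> a = b.
Proof.
have [Jinj _ _ Jpr] := sw; have [x hx] := Jpr a; have [y hy] := Jpr b => h.
rewrite -(pr_inv a) -(pr_inv b); congr pr; apply: (Jinj _ _ (k + x - y)).
by rewrite hx hy h; ring.
Qed.

Lemma reverse_data : swap_data (fun a => J a + kappa a) (fun a => - kappa a) pr.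
Proof.
have [Jinj kpr k1 Jpr] := sw; split; [exact: shift_inj|by move=> a; rewrite kpr|by move=> a; rewrite normrN|].
by move=> a; have [k hk] := Jpr a; exists k; rewrite hk kpr; ring.
Qed.

(* The two halves of the time interval, [min (2 t) 1] and [max (2 t - 1) 0] for [t] in [0, 1]. *)
Definition lo (t : R) := (2 * t + 1 - `|2 * t - 1|) / 2.
Definition hi (t : R) := (2 * t - 1 + `|2 * t - 1|) / 2.

Lemma loE (t : R) : lo t = if t <= 2^-1 then 2 * t else 1.
Proof.
rewrite /lo; have [h|h] := leP t 2^-1; [rewrite ler0_norm|rewrite gtr0_norm]; lra.
Qed.

Lemma hiE (t : R) : hi t = if t <= 2^-1 then 0 else 2 * t - 1.
Proof.
rewrite /hi; have [h|h] := leP t 2^-1; [rewrite ler0_norm|rewrite gtr0_norm]; lra.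
Qed.

Definition tent (t : R) := 1 - `|2 * t - 1|.

Lemma tentE (t : R) : tent t = if t <= 2^-1 then 2 * t else 2 - 2 * t.
Proof.
rewrite /tent; have [h|h] := leP t 2^-1; [rewrite ler0_norm|rewrite gtr0_norm]; lra.
Qed.

Lemma norm2_continuous : continuous (fun x : R * R => `|2 * x.2 - 1| : R).
Proof.
move=> x; apply: cvg_norm; apply: cvgB; last exact: cvg_cst.
by apply: cvgM; [exact: cvg_cst|exact: cvg_snd].
Qed.

Lemma mix_continuous (f : R -> R) : continuous (fun x : R * R => f x.2) ->
  {within @square R, continuous ((fun x => (1 - x.1) * x.2 + x.1 * f x.2) : R * R -> R)}.
Proof.
move=> cf; apply: continuous_subspaceT => x; apply: cvgD; apply: cvgM.
- by apply: cvgB; [exact: cvg_cst|exact: cvg_fst].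
- exact: cvg_snd.
- exact: cvg_fst.
- exact: cf.
Qed.

Lemma lo_continuous : continuous (fun x : R * R => lo x.2).
Proof.
move=> x; apply: cvgM; last exact: cvg_cst.
apply: cvgB; last exact: norm2_continuous.
by apply: cvgD; [apply: cvgM; [exact: cvg_cst|exact: cvg_snd]|exact: cvg_cst].
Qed.

Lemma hi_continuous : continuous (fun x : R * R => hi x.2).
Proof.
move=> x; apply: cvgM; last exact: cvg_cst.
apply: cvgD; last exact: norm2_continuous.
by apply: cvgB; [apply: cvgM; [exact: cvg_cst|exact: cvg_snd]|exact: cvg_cst].
Qed.

Section Split.
Variable P : pred 'I_m.
Hypothesis prP : forall a, P (pr a) = P a.

Definition kappa1 a := if P a then kappa a else 0.
Definition pr1 a := if P a then pr a else a.
Definition kappa2 a := if P a then 0 else kappa a.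
Definition pr2 a := if P a then a else pr a.

Lemma split_data1 : swap_data J kappa1 pr1.
Proof.
have [Jinj kpr k1 Jpr] := sw; rewrite /kappa1 /pr1; split=> // a.
- by case Pa: (P a); rewrite ?prP ?Pa ?oppr0.
- by case: ifP; rewrite ?normr0.
- by case: ifP => _; [exact: Jpr|exists 0; rewrite mul0r !addr0].
Qed.

Lemma split_data2 : swap_data (fun a => J a + kappa1 a) kappa2 pr2.
Proof.
have [Jinj kpr k1 Jpr] := sw; have [J1 k1pr k11 Jpr1] := split_data1.
split.
- move=> a b k h; have [x hx] := Jpr1 a; have [y hy] := Jpr1 b.
  have E1 : pr1 a = pr1 b by apply: (Jinj _ _ (k + x - y)); rewrite hx hy h; ring.
  have pp c : pr1 (pr1 c) = c by rewrite /pr1; case Pc: (P c); rewrite ?prP ?Pc ?pr_inv.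
  by rewrite -(pp a) E1 pp.
- by move=> a; rewrite /kappa2 /pr2; case Pa: (P a); rewrite ?prP ?Pa ?oppr0.
- by move=> a; rewrite /kappa2; case: ifP; rewrite ?normr0.
- move=> a; rewrite /kappa2 /kappa1 /pr2; case Pa: (P a); rewrite ?prP ?Pa.
    by exists 0; rewrite mul0r !addr0.
  by have [k hk] := Jpr a; exists k; rewrite hk; ring.
Qed.

Definition split_phi (u : R) (a : 'I_m) (t : R) : R :=
  (1 - u) * t + u * (if P a then lo t else hi t).

Lemma split_warp u : 0 <= u <= 1 -> warp pr (split_phi u).
Proof.
move=> /andP[u0 u1]; rewrite /split_phi; split.
- move=> a t /andP[t0 t1]; rewrite loE hiE.
  by case: (P a); have [h|h] := leP t 2^-1; apply/andP; split; nra.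
- by move=> a; apply/funext => t; rewrite prP.
- by move=> a; left; rewrite loE hiE half_ge0; case: (P a); ring.
- by move=> a; right; rewrite loE hiE half_lt1; case: (P a); ring.
Qed.

Lemma split_xing u a t : 0 <= u <= 1 -> 0 <= t <= 1 -> split_phi u a t = 2^-1 ->
  xing (fun t => split_phi u a t - 2^-1) t.
Proof.
move=> /andP[u0 u1] /andP[t0 t1]; have [->|un0] := eqVneq u 0.
  rewrite /split_phi => E1; apply: (@xing_affine _ 1 1 t); [exact: oner_neq0|exact: ltr01|].
  by move=> r _; move: E1; lra.
have up0 : 0 < u by rewrite lt_neqAle eq_sym un0.
rewrite /split_phi loE hiE; case: (P a) => E1.
  have tlt : t < 2^-1 by rewrite ltNge; apply/negP => h; move: E1; case: leP => h'; nra.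
  apply: (@xing_affine _ (1 + u) (2^-1 - t) t); [lra|lra|] => r; rewrite ltr_norml => /andP[h1 h2].
  move: E1; rewrite (ltW tlt) loE; have -> : t + r <= 2^-1 by lra.
  by lra.
have tgt : 2^-1 < t by rewrite ltNge; apply/negP => h; move: E1; rewrite h; nra.
apply: (@xing_affine _ (1 + u) (t - 2^-1) t); [lra|lra|] => r; rewrite ltr_norml => /andP[h1 h2].
move: E1; rewrite leNgt tgt /= hiE; have -> : (t + r <= 2^-1) = false by apply/negbTE; rewrite -ltNge; lra.
by lra.
Qed.

End Split.

End Elementary.

(** Different pairs cross at different points of the circle, so delaying some of them is an isotopy.
    Each pair has its own law of time, deformed from t to [lo t] if it lies in [P] and to [hi t]
    otherwise. *)
Lemma swapping_split J kappa pr typ (P : pred 'I_m) : swap_data J kappa pr ->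
  (forall a b, typ a b -> ~ typ b a) -> (forall a, P (pr a) = P a) ->
  cyl_isotopic true E (swapping J kappa pr typ)
    (cat_diagram (swapping J (kappa1 kappa P) (pr1 pr P) typ)
       (swapping (fun a => J a + kappa1 kappa P a) (kappa2 kappa P) (pr2 pr P) typ)).
Proof.
move=> sw ty prP; exists (fun u => swap_diagram gamma th J kappa pr typ (split_phi P u)).
have ends u a : split_phi P u a 0 = 0 /\ split_phi P u a 1 = 1.
  by rewrite /split_phi !loE !hiE half_ge0 half_lt1; case: (P a); split; ring.
have cphi a : {within @square R, continuous ((fun x => split_phi P x.1 a x.2) : R * R -> R)}.
  rewrite /split_phi; case: (P a); apply: mix_continuous; [exact: lo_continuous|exact: hi_continuous].
split.
- apply: (swap_family numE sw ty cphi).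
    by move=> u uI; exact: (split_warp prP uI).
  by move=> u a _; rewrite !(proj1 (ends _ a)) !(proj2 (ends _ a)).
- move=> u uI; have [] := swap_cyl numE sw ty (phi := split_phi P u) _ _ _ => //.
  + by move=> a; exact: (square_slice uI (cphi a)).
  + exact: (split_warp prP uI).
  + by move=> a t tI _; apply: split_xing.
- move=> t tI; have E0 a : split_phi P 0 a t = t by rewrite /split_phi; ring.
  by split=> [i|i j] /=; rewrite E0.
- move=> t tI; have E1 a : split_phi P 1 a t = if P a then lo t else hi t by rewrite /split_phi; ring.
  split=> [i|i j] /=; rewrite E1 loE hiE /ang /kappa1 /kappa2 /pr1 /pr2.
    by case: (P i); case: (leP t 2^-1) => ht; congr cis; rewrite ?addr0; ring.
  case: (P i); case: (leP t 2^-1) => ht; rewrite ?addr0.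
  + by [].
  + by split=> -[h1 h2 h3 h4]; [lra|rewrite eqxx in h2].
  + by split=> -[h1 h2 h3 h4]; [lra|rewrite eqxx in h2].
  + by [].
Qed.

End Swaps.

(** * Swap diagrams as products of generators *)

Section Uniqueness.
Local Open Scope classical_set_scope.
Local Open Scope ring_scope.
Variables (R : realType) (m' : nat) (gamma : R) (th : 'I_m'.+2 -> R) (E : set R[i]) (up : bool).
Local Notation m := m'.+2.
Hypothesis numE : ccw_numbering (cis gamma) th E.
Variables rho rho' : diagram R m -> 'M[laurent]_m.
Hypotheses (hrho : is_rho up (cis gamma) th E rho) (hrho' : is_rho up (cis gamma) th E rho').
Implicit Types (D : diagram R m).
Local Notation agree := (agree E rho rho').
Local Notation swapping := (swapping gamma th).
Local Notation still := (still gamma th).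
Local Notation vtt := (vt gamma th).

Section Cancel.
Variables (J kappa : 'I_m -> int) (pr : 'I_m -> 'I_m) (typ : 'I_m -> 'I_m -> Prop) (a0 : 'I_m).
Hypothesis sw : swap_data J kappa pr.
Hypothesis typ_asym : forall a b, typ a b -> ~ typ b a.
Hypothesis single : forall a, kappa a != 0 -> a = a0 \/ a = pr a0.
Hypothesis k0 : kappa a0 != 0.

(** The tent has height 1 - u and the partners meet at height 1/2: they cross twice for u < 1/2,
    touch for u = 1/2 and do not meet for u > 1/2. *)
Let phi (u : R) (a : 'I_m) (t : R) : R := (1 - u) * tent t.

Lemma cancel_warp u : 0 <= u <= 1 -> warp pr (phi u).
Proof.
move=> /andP[u0 u1]; rewrite /phi; split=> [a t /andP[t0 t1]|a|a|a].
- by rewrite tentE; have [h|h] := leP t 2^-1; apply/andP; split; nra.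
- by [].
- by left; rewrite tentE half_ge0; ring.
- by left; rewrite tentE half_lt1; ring.
Qed.

Lemma cancel_continuous a : {within @square R, continuous ((fun x => phi x.1 a x.2) : R * R -> R)}.
Proof.
apply: continuous_subspaceT => x; apply: cvgM.
  by apply: cvgB; [exact: cvg_cst|exact: cvg_fst].
by apply: cvgB; [exact: cvg_cst|exact: norm2_continuous].
Qed.

Lemma cancel_xing u a t : 0 <= u <= 1 -> u != 2^-1 -> 0 <= t <= 1 -> phi u a t = 2^-1 ->
  xing (fun t => phi u a t - 2^-1) t.
Proof.
move=> /andP[u0 u1] un /andP[t0 t1]; rewrite /phi => E1.
have u1' : 0 < 1 - u by rewrite lt_neqAle subr_ge0 u1 andbT; apply/eqP => h; move: E1; rewrite -h mul0r; lra.
have [tlt|tgt|tE] := ltgtP t 2^-1.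
- apply: (@xing_affine _ _ (2 * (1 - u)) (2^-1 - t) t); [by rewrite mulf_neq0 // gt_eqF|lra|].
  move=> r; rewrite ltr_norml => /andP[h1 h2].
  move: E1; rewrite !tentE (ltW tlt); have -> : t + r <= 2^-1 by lra.
  by lra.
- apply: (@xing_affine _ _ (- (2 * (1 - u))) (t - 2^-1) t); [by rewrite oppr_eq0 mulf_neq0 // gt_eqF|lra|].
  move=> r; rewrite ltr_norml => /andP[h1 h2].
  move: E1; rewrite !tentE leNgt tgt /=; have -> : (t + r <= 2^-1) = false by apply/negbTE; rewrite -ltNge; lra.
  by lra.
- case/eqP: un; move: E1; rewrite tentE tE lexx; lra.
Qed.

Lemma phi_half (a : 'I_m) (t : R) : phi 2^-1 a t = 2^-1 -> t = 2^-1.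
Proof. by rewrite /phi tentE; case: leP => h; lra. Qed.

(** Up to full turns, the angle between the partners is a nonzero constant times |2 t - 1|, which
    gives a tangency at t = 1/2. There is no other singular point since a single pair moves. *)
Lemma cancel_singular : singular (swap_diagram gamma th J kappa pr typ (phi 2^-1)).
Proof.
have hI : (0 : R) <= (2^-1 : R) <= 1 := half_in R.
have hw := cancel_warp hI.
have cphi a : {within `[0, 1], continuous (phi 2^-1 a)} := square_slice hI (@cancel_continuous a).
have p1 a : phi 2^-1 a 2^-1 = 2^-1 by rewrite /phi tentE lexx; lra.
have ka a : a \in [set a0; pr a0]%SET -> kappa a != 0.
  by have [_ kpr _ _] := sw; rewrite !inE => /orP[] /eqP ->; rewrite ?kpr ?oppr_eq0.
have prS a : a \in [set a0; pr a0]%SET -> pr a \in [set a0; pr a0]%SET.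
  by rewrite !inE => /orP[] /eqP ->; rewrite ?(pr_inv sw) eqxx ?orbT.
exists 2^-1, [set a0; pr a0]%SET; split=> //.
- move=> i j iS /=; rewrite !p1; split=> [jS|h].
    have [->//|ij] := eqVneq i j.
    have -> : j = pr i.
      move: iS jS ij; rewrite !inE => /orP[] /eqP -> /orP[] /eqP ->; rewrite ?eqxx ?(pr_inv sw) //.
    exact: (ang_pr_half gamma th sw).
  have [<-//|ij] := eqVneq i j.
  have := swap_meet numE sw hw hI ij; rewrite !p1 => /(_ h)[-> _ _]; exact: prS.
- left; split; first by rewrite cards2 eq_sym (pr_neq sw).
  move=> i j iS jS ij.
  have jE : j = pr i.
    move: iS jS ij; rewrite !inE => /orP[] /eqP -> /orP[] /eqP ->; rewrite ?eqxx ?(pr_inv sw) //.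
  have [k hk] := ang_pr gamma th sw i; have g0 := vt_step numE J (ka i iS).
  have cang a : {within `[0, 1], continuous ((fun t => ang gamma th J kappa a (phi 2^-1 a t)) : R -> R)}.
    move=> x; apply: cvgD; first exact: cvg_cst.
    by apply: cvgM; [exact: cvg_cst|exact: cphi].
  pose f t := ang gamma th J kappa j (phi 2^-1 j t) - ang gamma th J kappa i (phi 2^-1 i t) - k%:~R * (2 * pi).
  have fE r : f r = (vtt (J i + kappa i) - vtt (J i)) * `|2 * r - 1|.
    by rewrite /f jE hk /ang /phi /tent; lra.
  have E1 : ang gamma th J kappa j (phi 2^-1 j 2^-1) - ang gamma th J kappa i (phi 2^-1 i 2^-1) = k%:~R * (2 * pi).
    by apply/eqP; rewrite -subr_eq0 -/(f 2^-1) fE divff // subrr normr0 mulr0.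
  have t01 : 0 < (2^-1 : R) < 1 by apply/andP; split; lra.
  have [e e0 he] := turn_near (th := fun a t => ang gamma th J kappa a (phi 2^-1 a t)) (cang i) (cang j) t01 E1.
  exists e => //.
  have key r : 0 < `|r| < e -> (0 < turn (swap_diagram gamma th J kappa pr typ (phi 2^-1)) i j (2^-1 + r)) =
       (0 < vtt (J i + kappa i) - vtt (J i)) /\
     (turn (swap_diagram gamma th J kappa pr typ (phi 2^-1)) i j (2^-1 + r) < 0) =
       (vtt (J i + kappa i) - vtt (J i) < 0).
    move=> /andP[r0 /he[_ h]]; have [h1 h2] := sin_sgP h.
    rewrite lift_turn -(sin_period (_ - _) (- k)) mulrNz mulNr h1 h2 -/(f _) fE.
    have n0 : 0 < `|2 * (2^-1 + r) - 1|.
      rewrite normr_gt0 mulrDr divff // addrAC subrr add0r mulf_neq0 //.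
      by rewrite -normr_gt0.
    by rewrite pmulr_lgt0 // pmulr_llt0.
  have [gp|gn|/eqP] := ltgtP 0 (vtt (J i + kappa i) - vtt (J i)); last by rewrite eq_sym (negPf g0).
    by left=> r /key[-> _].
  by right=> r /key[_ ->].
- move=> i j r me ns; exfalso; have [rI ij /= h] := me; apply: ns.
  have [_ k1 /phi_half ->] := swap_meet numE sw hw rI ij h; split=> //.
  by rewrite !inE; case: (single k1) => ->; rewrite eqxx ?orbT.
Qed.

(** [typ] is the same on the way there and back, so an upper strand stays the upper one and the
    deformation is a second Reidemeister move. *)
Lemma swapping_cancel :
  let D := cat_diagram (swapping J kappa pr typ)
             (swapping (fun a => J a + kappa a) (fun a => - kappa a) pr typ) in
  cyl_diagram true E D /\ cyl_equiv true E D (still J kappa pr typ).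
Proof.
move=> D; pose G u := swap_diagram gamma th J kappa pr typ (phi u).
have sD : same_diagram (G 0) D.
  move=> t tI; have p0 a : phi 0 a t = tent t by rewrite /phi; ring.
  split=> [i|i j] /=; rewrite p0 tentE /ang.
    by case: (leP t 2^-1) => ht //; congr cis; rewrite addrK; ring.
  case: (leP t 2^-1) => ht; first by [].
  by rewrite oppr_eq0; split=> -[h1 h2 h3 h4]; split=> //; move: h3; lra.
have gG u : 0 <= u <= 1 -> u != 2^-1 -> cyl_diagram true E (G u).
  move=> uI un; apply: (swap_cyl numE sw typ_asym).
  - by move=> a; exact: (square_slice uI (@cancel_continuous a)).
  - exact: cancel_warp.
  - by move=> a t tI _; apply: cancel_xing.
have n0 : (0 : R) != 2^-1 by rewrite eq_sym invr_eq0.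
have cD : cyl_diagram true E D by apply: same_cyl sD (gG 0 (unit0 R) n0).
split=> //; apply: rst_step; apply: Reidemeister; exists G; split=> //.
- apply: (swap_family numE sw typ_asym (@cancel_continuous)); first exact: cancel_warp.
  by move=> u a uI; rewrite /phi !tentE half_ge0 half_lt1; split; ring.
- exists 2^-1; first by apply/andP; split; lra.
  by split; [exact: cancel_singular|move=> u uI /(gG u uI)[]].
- move=> t tI; have p1 a : phi 1 a t = 0 by rewrite /phi; ring.
  by split=> [i|i j] /=; rewrite p1.
Qed.

End Cancel.

Lemma div_res (j : int) : j = (j %/ m)%Z * m + (res m' j : nat).
Proof.
rewrite {1}(divz_eq j m) res_val gez0_abs // modz_ge0 //.
Qed.

Lemma div_res_uniq (q : int) (r : nat) : (r < m)%N ->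
  ((q * m + r) %/ m)%Z = q /\ (res m' (q * m + r) : nat) = r.
Proof.
move=> rm; have m0 : (m : int) != 0 by [].
have rI : 0 <= (r : int) < `|m|%N by rewrite absz_nat ltz_nat.
rewrite divzMDl // divz_small // addr0; split=> //.
by rewrite res_val modzMDl modz_small // ltz_nat.
Qed.

Lemma res_eq (j j' : int) : res m' j = res m' j' -> exists k : int, j = j' + k * m.
Proof.
move=> h; exists ((j %/ m)%Z - (j' %/ m)%Z); rewrite mulrBl.
have := div_res j; have := div_res j'; rewrite h.
by set a := (j %/ m)%Z * _; set b := (j' %/ m)%Z * _; lia.
Qed.

Lemma res_period (j k : int) : res m' (j + k * m) = res m' j.
Proof. by rewrite /res addrC modzMDl. Qed.

Lemma res_ord (i : 'I_m) : res m' (i : nat) = i.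
Proof. by apply: val_inj => /=; have [_] := div_res_uniq 0 (ltn_ord i); rewrite mul0r add0r. Qed.

Lemma res_succ (j : int) : res m' (j + 1) = ordS (res m' j).
Proof.
apply: val_inj => /=; rewrite {1}(div_res j) -addrA; set r := res m' j.
have [rm|] := ltnP r.+1 m.
  have [_] := div_res_uniq (j %/ m)%Z rm; rewrite modn_small // => <-.
  by have -> : (r.+1 : int) = (r : nat)%:Z + 1 by rewrite intS addrC.
rewrite leq_eqVlt ltnNge ltn_ord orbF => /eqP rm.
have -> : (j %/ m)%Z * m + ((r : nat)%:Z + 1) = ((j %/ m)%Z + 1) * m + 0%N.
  by rewrite mulrDl mul1r addr0; congr (_ + _); lia.
by have [_ ->] := div_res_uniq ((j %/ m)%Z + 1) (isT : (0 < m)%N); rewrite [X in (X %% _)%N](esym rm) modnn.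
Qed.

Lemma vt_gap (j : int) : vtt (j + 1) - vtt j = gap th (res m' j).
Proof.
have E1 := div_res j; have E2 := div_res (j + 1).
rewrite /vt /gap -res_succ; case: eqP => rm.
  have E3 : (res m' (j + 1) : nat) = 0%N by rewrite res_succ /= rm modnn.
  have -> : ((j + 1) %/ m)%Z = (j %/ m)%Z + 1.
    apply: (@mulIf _ (m : int)) => //; move: E2; rewrite E3 addr0 => <-.
    by rewrite {1}E1 mulrDl mul1r -addrA; congr (_ + _); lia.
  by rewrite intrD; ring.
have rm' : ((res m' j).+1 < m)%N by rewrite ltn_neqAle ltn_ord andbT; apply/eqP.
have E3 : (res m' (j + 1) : nat) = (res m' j).+1 by rewrite res_succ /= modn_small.
have -> : ((j + 1) %/ m)%Z = (j %/ m)%Z.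
  apply: (@mulIf _ (m : int)) => //; apply: (addIr ((res m' j).+1 : int)).
  by rewrite -{1}E3 -E2 {1}E1 -addrA; congr (_ + _); lia.
by ring.
Qed.

Lemma cyl_rename (s : 'S_m) D : cyl_diagram true E D -> cyl_diagram true E (rename s D).
Proof.
move=> [pD gD _]; have [hc h1 hE [i0 i1] ho] := pD.
have mE i j t : meet (rename s D) i j t -> meet D (s i) (s j) t.
  by move=> [tI ij E1]; split=> //; rewrite (inj_eq perm_inj).
split; [split|idtac|by left].
- by move=> i; apply: hc.
- by move=> i; apply: h1.
- by move=> i; apply: hE.
- by split=> i j /= h; apply: (@perm_inj _ s); [apply: i0|apply: i1].
- move=> i j t tI /(ho _ _ _ tI)[[tI' ij E1] no]; split=> //; split=> //.
  by rewrite (inj_eq perm_inj) in ij.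
- move=> i j t /mE/gD[nd cr]; split=> // a b; rewrite !inE => aS.
  have := nd (s a) (s b); rewrite !inE !(inj_eq perm_inj); exact.
Qed.

Lemma agree_rename' (s : 'S_m) D : agree D -> agree (rename s D).
Proof.
move=> [cD rE]; have cR := cyl_rename s cD; split=> //.
have [_ h _ _] := hrho; have [_ h' _ _] := hrho'.
have eD : cyl_equiv true E D (rename s D) by apply: rst_step; apply: Rename cD _.
by rewrite -(h _ _ cD cR eD) -(h' _ _ cD cR eD).
Qed.

Section Single.
Variables (J kappa : 'I_m -> int) (pr : 'I_m -> 'I_m) (typ : 'I_m -> 'I_m -> Prop) (a0 : 'I_m).
Hypothesis sw : swap_data J kappa pr.
Hypothesis typ_asym : forall a b, typ a b -> ~ typ b a.
Hypothesis single : forall a, kappa a != 0 -> a = a0 \/ a = pr a0.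
Hypothesis k0 : kappa a0 = 1.

Lemma res_inj : injective (fun a => res m' (J a)).
Proof. by have [Jinj _ _ _] := sw; move=> a b /res_eq[k] /Jinj. Qed.

Lemma res_pr : res m' (J (pr a0)) = ordS (res m' (J a0)).
Proof. by have [_ _ _ Jpr] := sw; have [k ->] := Jpr a0; rewrite k0 res_period res_succ. Qed.

Lemma single_strand e t : swap_strand (cis gamma) th (res m' (J a0)) (res m' (J e)) t =
  cis (ang gamma th J kappa e t).
Proof.
have per (j : int) (x : R) : cis gamma * cis (th (res m' j) + x) = cis (vtt j + x).
  by rewrite -cisD -(cis_period _ (j %/ m)%Z); congr cis; rewrite /vt; ring.
have pa : pr a0 != a0 by apply: (pr_neq sw); rewrite k0 oner_neq0.
rewrite /swap_strand (inj_eq res_inj) -res_pr (inj_eq res_inj) /ang.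
have [->|ea] := eqVneq e a0; first by rewrite per k0 vt_gap mulrC.
have [->|eb] := eqVneq e (pr a0).
  rewrite -mulNr per; congr cis; congr (_ + _); have [_ kpr _ Jpr] := sw; have [k hk] := Jpr a0.
  rewrite kpr hk k0 (_ : J a0 + 1 + k * m - 1 = J a0 + k * m); last by ring.
  by rewrite !vt_period -vt_gap; ring.
have ke : kappa e = 0.
  by apply/eqP/negPn/negP => /single[] h; [rewrite h eqxx in ea|rewrite h eqxx in eb].
by rewrite ke addr0 subrr mul0r -[th _]addr0 per.
Qed.

Lemma single_over (i j : 'I_m) (t : R) :
  [/\ j = pr i, kappa i != 0, t = 2^-1 & typ i j] <->
  t = 2^-1 /\ ((i = a0 /\ j = pr a0 /\ typ a0 (pr a0)) \/ (i = pr a0 /\ j = a0 /\ typ (pr a0) a0)).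
Proof.
have [_ kpr _ _] := sw; split=> [[-> /single[] -> -> ty]|[-> [[-> [-> ty]]|[-> [-> ty]]]]].
- by split=> //; left.
- by move: ty; rewrite (pr_inv sw) => ty; split=> //; right.
- by rewrite k0 oner_neq0.
- by rewrite kpr k0 (pr_inv sw) oppr_eq0 oner_neq0.
Qed.

(** Naming each strand by the endpoint where it starts turns the exchange of one pair into the
    standard diagram of sigma_i. *)
Lemma single_sigma : (if up then typ a0 (pr a0) else typ (pr a0) a0) ->
  same_diagram (swapping J kappa pr typ)
    (rename (perm res_inj) (sigma_diagram up (cis gamma) th (res m' (J a0)))).
Proof.
move=> ty t tI; split=> [i|i j] /=; first by rewrite permE single_strand.
rewrite !permE -res_pr single_over.
have inj a b : res m' (J a) = res m' (J b) <-> a = b by split=> [/res_inj|->].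
case: up ty => ty; split=> -[-> h]; split=> //.
- by case: h => [[-> [-> _]]//|[-> [-> /typ_asym]]].
- by case: h => /inj -> /inj ->; left.
- by case: h => [[-> [-> /typ_asym]]|[-> [-> _]]].
- by case: h => /inj -> /inj ->; right.
Qed.

Lemma single_tau : ~ typ a0 (pr a0) -> ~ typ (pr a0) a0 ->
  same_diagram (swapping J kappa pr typ)
    (rename (perm res_inj) (tau_diagram (cis gamma) th (res m' (J a0)))).
Proof.
move=> ty1 ty2 t tI; split=> [i|i j] /=; first by rewrite permE single_strand.
by rewrite single_over; split=> // -[_ [[_ [_]]|[_ [_]]]].
Qed.

End Single.

Section Standard.
Variable i : 'I_m.

Definition std_J (a : 'I_m) : int := (a : nat).
Definition std_kappa (a : 'I_m) : int := if a == i then 1 else if a == ordS i then -1 else 0.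
Definition std_pr (a : 'I_m) := if a == i then ordS i else if a == ordS i then i else a.

Lemma ordS_neq : ordS i != i.
Proof.
apply/eqP => /(congr1 val) /=; have im := ltn_ord i.
have [h|] := ltnP i.+1 m; first by rewrite modn_small //; lia.
rewrite leq_eqVlt ltnNge im orbF => /eqP h; by rewrite -{1}h modnn => h'; move: h; rewrite -h'.
Qed.

Lemma std_data : swap_data std_J std_kappa std_pr.
Proof.
have n0 := negPf ordS_neq; rewrite /std_J /std_kappa /std_pr; split.
- by move=> a b k h; rewrite -[a]res_ord h res_period res_ord.
- move=> a; have [_|ai] := eqVneq a i; first by rewrite n0 eqxx.
  by have [_|aS] := eqVneq a (ordS i); rewrite ?eqxx ?opprK // (negPf ai) (negPf aS) oppr0.
- by move=> a; case: ifP => _; [|case: ifP].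
have SE : exists k : int, Posz (ordS i) = Posz i + 1 + k * Posz m.
  by apply: res_eq; rewrite res_ord res_succ res_ord.
move=> a; have [->|ai] := eqVneq a i; first exact: SE.
have [->|aS] := eqVneq a (ordS i); last by exists 0; rewrite mul0r !addr0.
by have [k ->] := SE; exists (- k); ring.
Qed.

Lemma std_single a : std_kappa a != 0 -> a = i \/ a = std_pr i.
Proof.
rewrite /std_kappa /std_pr eqxx; have [->|_] := eqVneq a i; first by left.
by have [->|_] := eqVneq a (ordS i); [right|rewrite eqxx].
Qed.

Lemma std_k0 : std_kappa i = 1. Proof. by rewrite /std_kappa eqxx. Qed.

Lemma std_perm : perm (res_inj std_data) = 1%g.
Proof. by apply/permP => a; rewrite permE perm1 res_ord. Qed.

Lemma rename1 (D : diagram R m) : rename 1%g D = D.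
Proof.
case: D => f o; rewrite /rename; congr Diagram; apply/funext => a /=; first by rewrite perm1.
by apply/funext => b; rewrite !perm1.
Qed.

Lemma agree_sigma : agree (sigma_diagram up (cis gamma) th i).
Proof.
pose typ (a b : 'I_m) := if up then a = i /\ b = ordS i else a = ordS i /\ b = i.
have ty a b : typ a b -> ~ typ b a.
  by rewrite /typ; case: up => -[-> ->] [h _]; have := ordS_neq; [rewrite h|rewrite -h]; rewrite eqxx.
have pE : std_pr i = ordS i by rewrite /std_pr eqxx.
have sD : same_diagram (swapping std_J std_kappa std_pr typ) (sigma_diagram up (cis gamma) th i).
  have := @single_sigma std_J std_kappa std_pr typ i std_data ty std_single std_k0.
  rewrite std_perm rename1 pE /std_J res_ord; apply.
  by rewrite /typ; case: up.
split; first by apply: same_cyl sD (swapping_cyl numE std_data ty).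
by have [_ _ _ [-> _ _]] := hrho; have [_ _ _ [-> _ _]] := hrho'.
Qed.

Lemma agree_tau : agree (tau_diagram (cis gamma) th i).
Proof.
pose typ (a b : 'I_m) := False.
have ty a b : typ a b -> ~ typ b a by [].
have pE : std_pr i = ordS i by rewrite /std_pr eqxx.
have sD : same_diagram (swapping std_J std_kappa std_pr typ) (tau_diagram (cis gamma) th i).
  have := @single_tau std_J std_kappa std_pr typ i std_data std_single std_k0.
  by rewrite std_perm rename1 /std_J res_ord; apply.
split; first by apply: same_cyl sD (swapping_cyl numE std_data ty).
by have [_ _ _ [_ -> _]] := hrho; have [_ _ _ [_ -> _]] := hrho'.
Qed.

End Standard.

(** Besides sigma_i and tau_i there is the classical crossing of the opposite type. In its reversal
    the partners exchange their directions but keep their heights, which gives a renamed sigma_i;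
    the product of the two cancels. *)
Lemma agree_single J kappa pr typ a0 : swap_data J kappa pr ->
  (forall a b, typ a b -> ~ typ b a) -> (forall a, kappa a != 0 -> a = a0 \/ a = pr a0) ->
  kappa a0 = 1 -> agree (swapping J kappa pr typ).
Proof.
move=> sw ty sg k0.
have positive J' kappa' pr' a : swap_data J' kappa' pr' ->
    (forall b, kappa' b != 0 -> b = a \/ b = pr' a) -> kappa' a = 1 ->
    (if up then typ a (pr' a) else typ (pr' a) a) -> agree (swapping J' kappa' pr' typ).
  move=> sw' sg' k0' h; have sD := single_sigma sw' ty sg' k0' h.
  by apply: (agree_same hrho hrho' _ (same_diagram_sym sD)); apply/agree_rename'/agree_sigma.
case: (pselect (if up then typ a0 (pr a0) else typ (pr a0) a0)) => h; first exact: positive sw sg k0 h.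
case: (pselect (if up then typ (pr a0) a0 else typ a0 (pr a0))) => h'; last first.
  have sD : same_diagram (swapping J kappa pr typ)
      (rename (perm (res_inj sw)) (tau_diagram (cis gamma) th (res m' (J a0)))).
    by apply: single_tau => //; case: up h h'.
  by apply: (agree_same hrho hrho' _ (same_diagram_sym sD)); apply/agree_rename'/agree_tau.
have swr := reverse_data sw.
have aR : agree (swapping (fun a => J a + kappa a) (fun a => - kappa a) pr typ).
  apply: (positive _ _ _ (pr a0) swr).
  - by move=> b; rewrite oppr_eq0 (pr_inv sw) => /sg[]; [right|left].
  - by have [_ -> _ _] := sw; rewrite opprK.
  - by rewrite (pr_inv sw).
have sgr a : - kappa a != 0 -> a = a0 \/ a = pr a0 by rewrite oppr_eq0; apply: sg.
have k0r : - kappa a0 != 0 by rewrite oppr_eq0 k0 oner_neq0.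
have [cM eM] := swapping_cancel swr ty sgr k0r.
have e1 : (fun a => J a + kappa a + - kappa a) = J by apply/funext => a; rewrite addrK.
have e2 : (fun a => - - kappa a) = kappa by apply/funext => a; rewrite opprK.
rewrite e1 e2 in cM eM.
apply: (agree_cancel numE hrho hrho' aR _ _ (agree_still numE hrho hrho' swr ty) cM eM).
  exact: swapping_cyl.
by move=> i /=; rewrite /ang !mulr0 !mulr1 addr0 addrC subrK addrK.
Qed.

Lemma agree_swapping J kappa pr typ : swap_data J kappa pr ->
  (forall a b, typ a b -> ~ typ b a) -> agree (swapping J kappa pr typ).
Proof.
move En : #|[pred a | kappa a != 0]| => n; move: J kappa pr En.
elim/ltn_ind: n => n IH J kappa pr En sw ty.
(* If no strand moves up then none moves down, since partners have opposite displacements. *)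
have [a0 k0|all0] := pickP [pred a | kappa a == 1]; last first.
  have kz a : kappa a = 0.
    have [_ kpr k1 _] := sw; have := all0 a; have := all0 (pr a); rewrite /= kpr.
    have := k1 a; rewrite ler_norml => /andP[h1 h2] /eqP h3 /eqP h4; lia.
  apply: (agree_same hrho hrho' (agree_still numE hrho hrho' sw ty)) => t tI.
  by split=> [i|i j] /=; rewrite /ang kz ?addr0 ?subrr ?mul0r //; split=> -[] //; rewrite eqxx.
move/eqP: k0 => k0; pose P := [pred a | (a == a0) || (a == pr a0)].
have prP a : P (pr a) = P a.
  rewrite /P /= -{1}(pr_inv sw a0) orbC; congr (_ || _); apply: inj_eq;
    exact: (can_inj (pr_inv sw)).
have sw1 := split_data1 sw prP; have sw2 := split_data2 sw prP.
have iso := swapping_split numE sw ty prP.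
apply: (agree_cat numE hrho hrho' _ _ _ (swapping_cyl numE sw ty) iso).
- apply: (@agree_single _ _ _ _ a0 sw1 ty).
    move=> a; rewrite /kappa1 /pr1 /P /= eqxx /=; case: ifP => [/orP[] /eqP -> _|_]; by [left|right|rewrite eqxx].
  by rewrite /kappa1 /P /= eqxx k0.
- apply: (IH _ _ _ _ _ erefl sw2 ty); rewrite -En; apply: proper_card; apply/properP; split.
    by apply/fintype.subsetP => a; rewrite !inE /kappa2; case: ifP => //; rewrite eqxx.
  by exists a0; rewrite !inE ?k0 /kappa2 /P /= ?eqxx.
- by move=> i /=; rewrite /ang mulr0 mulr1 addr0; congr cis; ring.
Qed.

End Uniqueness.

(** * Isotopies between diagrams with the same order of lifts *)

Section SameOrder.
Local Open Scope classical_set_scope.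
Local Open Scope ring_scope.
Variables (R : realType) (m : nat).
Implicit Types (x y : 'I_m -> R) (th : 'I_m -> R -> R) (ov : 'I_m -> 'I_m -> R -> Prop).

(** The order of all translates of the strands in the universal cover. It determines in particular
    which strands stand at the same point of the circle. *)
Definition same_order x y := forall i j (k : int),
  (x i < x j + k%:~R * (2 * pi)) = (y i < y j + k%:~R * (2 * pi)).

Lemma same_order_sym x y : same_order x y -> same_order y x.
Proof. by move=> h i j k; rewrite h. Qed.

Lemma same_order_trans y x z : same_order x y -> same_order y z -> same_order x z.
Proof. by move=> h h' i j k; rewrite h h'. Qed.

Lemma same_order_eq x y i j (k : int) : same_order x y ->
  x i = x j + k%:~R * (2 * pi) -> y i = y j + k%:~R * (2 * pi).
Proof.
move=> h E1; have := h i j k; have := h j i (- k); rewrite E1 mulrNz mulNr addrK !ltxx => h1 h2.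
by apply/eqP; rewrite eq_le !leNgt -h2 andbT ltrBrDr in h1 *; rewrite -h1.
Qed.

Lemma same_order_cis x y i j : same_order x y -> cis (x i) = cis (x j) -> cis (y i) = cis (y j).
Proof. by move=> h /cis_eqP[k] /(same_order_eq h) ->; rewrite cis_period. Qed.

Lemma mix_gt0 (r a b : R) : 0 <= r <= 1 -> 0 < a -> 0 < b -> 0 < (1 - r) * a + r * b.
Proof.
move=> /andP[r0 r1] a0 b0; have [->|r0'] := eqVneq r 0; first by rewrite mul0r addr0 subr0 mul1r.
by apply: ltr_wpDl; [rewrite mulr_ge0 ?subr_ge0 // ltW|rewrite mulr_gt0 // lt_neqAle eq_sym r0'].
Qed.

(** Each comparison is a linear inequality, so the configurations with a given order form a convex
    set. *)
Lemma mix_order x y (r : R) : 0 <= r <= 1 -> same_order x y -> same_order x (fun i => x i + r * (y i - x i)).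
Proof.
move=> rI h i j k; have := h i j k; set P := _ * (2 * pi).
have [h1 /esym h2|h1 /esym/negbT] := ltP (x i) (x j + P).
  apply/esym; have := mix_gt0 rI (_ : 0 < x j + P - x i) (_ : 0 < y j + P - y i).
  by rewrite !subr_gt0 => /(_ h1 h2); lra.
rewrite -leNgt => h2; apply/esym/negbTE; rewrite -leNgt; case/andP: rI => r0 r1.
have : 0 <= (1 - r) * (x i - (x j + P)) by rewrite mulr_ge0 // subr_ge0.
have : 0 <= r * (y i - (y j + P)) by rewrite mulr_ge0 // subr_ge0.
lra.
Qed.

Lemma xing_sign (f f' : R -> R) t : 0 < t < 1 -> (forall s, 0 <= s <= 1 ->
    (0 < f s) = (0 < f' s) /\ (f s < 0) = (f' s < 0)) -> xing f t -> xing f' t.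
Proof.
move=> tI h [e e0 he]; have [d d0 hd] := interior_near tI.
exists (Num.min e d); first by rewrite lt_min e0.
by case: he => he; [left|right] => r /andP[r0]; rewrite lt_min => /andP[re rd];
  have [h1 h2] := h _ (hd r rd); have [e1 e2] := pmul_sgP r h1 h2; rewrite -?e1 -?e2; apply: he; rewrite r0.
Qed.

Lemma lift_ov E th ov : prediagram E (angle_diagram th ov) -> forall i j t, 0 <= t <= 1 -> ov i j t ->
  [/\ i != j, cis (th i t) = cis (th j t) & ~ ov j i t].
Proof. by move=> [_ _ _ _ ho] i j t tI /(ho _ _ _ tI)[[]]. Qed.

Lemma lift_nd E th ov i j t : generic (angle_diagram th ov) -> prediagram E (angle_diagram th ov) ->
  0 <= t <= 1 -> i != j -> cis (th i t) = cis (th j t) ->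
  forall l, cis (th l t) = cis (th i t) -> l = i \/ l = j.
Proof.
move=> gD pD tI ij mE l lE; have [nd _] : regular_crossing (angle_diagram th ov) i j t by apply: gD.
have := (nd i l); rewrite !inE eqxx => /(_ isT)[_ /(_ (esym lE))] /orP[] /eqP; by [left|right].
Qed.

(** In the straight-line homotopy every diagram has the same meetings at the same times, and the
    signs which decide transversality are the same too. *)
Lemma order_isotopic E th th' ov :
  (forall i, {within `[0, 1], continuous (th i)}) -> (forall i, {within `[0, 1], continuous (th' i)}) ->
  cyl_diagram true E (angle_diagram th ov) -> (forall i, th' i 0 = th i 0) -> (forall i, th' i 1 = th i 1) ->
  (forall t, 0 <= t <= 1 -> same_order (th^~ t) (th'^~ t)) ->
  cyl_isotopic true E (angle_diagram th ov) (angle_diagram th' ov).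
Proof.
move=> hc hc' cD e0 e1 so; have [pD gD _] := cD; have [_ _ hE [i0 i1] _] := pD.
pose thu u i t := th i t + u * (th' i t - th i t).
have sou u t : 0 <= u <= 1 -> 0 <= t <= 1 -> same_order (th^~ t) (fun i => thu u i t).
  by move=> uI tI; apply: mix_order (uI) (so t tI).
have thu0 u i : thu u i 0 = th i 0 by rewrite /thu e0 subrr mulr0 addr0.
have thu1 u i : thu u i 1 = th i 1 by rewrite /thu e1 subrr mulr0 addr0.
have mE u i j t : 0 <= u <= 1 -> meet (angle_diagram (thu u) ov) i j t -> meet (angle_diagram th ov) i j t.
  move=> uI [tI ij /= h]; split=> //=.
  exact: (same_order_cis (same_order_sym (sou u t uI tI)) h).
have cu u i : {within `[0, 1], continuous (thu u i)}.
  move=> t; apply: cvgD; first exact: hc.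
  by apply: cvgM; [exact: cvg_cst|apply: cvgB; [exact: hc'|exact: hc]].
have pu u : 0 <= u <= 1 -> prediagram E (angle_diagram (thu u) ov).
  move=> uI; apply: lift_prediagram => //.
  - by move=> i; rewrite thu0 thu1; exact: hE.
  - by move=> i j ij; rewrite !thu0 !thu1; split=> h; case/eqP: ij; [exact: i0|exact: i1].
  - move=> i j t tI /(lift_ov pD tI)[ij h no]; split=> //.
    exact: (same_order_cis (sou u t uI tI) h).
have gu u : 0 <= u <= 1 -> generic (angle_diagram (thu u) ov).
  move=> uI; apply: lift_generic (pu u uI) (cu u) _ => i j t k tI ij Ek.
  have tI' : 0 <= t <= 1 by case/andP: tI => *; rewrite !ltW.
  have so' := same_order_sym (sou u t uI tI').
  have Ek' : th j t - th i t = k%:~R * (2 * pi).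
    by apply/eqP; rewrite subr_eq addrC; apply/eqP/(same_order_eq so'); rewrite -Ek /= addrC subrK.
  have mE' : cis (th i t) = cis (th j t).
    by move/eqP: Ek'; rewrite subr_eq => /eqP ->; rewrite addrC cis_period.
  split=> [l lE|].
    by apply: (lift_nd gD pD tI' ij mE'); apply: same_order_cis so' lE.
  have [_ /(lift_crosses _ (hc i) (hc j) tI Ek')] : regular_crossing (angle_diagram th ov) i j t by exact: gD.
  apply: xing_sign => // s sI; have := sou u s uI sI i j (- k); have := sou u s uI sI j i k.
  rewrite mulrNz mulNr !subr_gt0 !subr_lt0 !ltrBrDr !ltrBlDr.
  by rewrite ![_ + th _ _]addrC ![_ + thu _ _ _]addrC => <- <-.
exists (fun u => angle_diagram (thu u) ov); split=> //.
- split.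
  + move=> i; apply: cis_cfamily; apply/within_squareP => u t uI tI e e0'.
    have /within_itvP c1 := hc i; have /within_itvP c2 := hc' i.
    have c3 : {within `[0, 1], continuous (fun t => th' i t - th i t)}.
      by move=> x; apply: cvgB; [exact: hc'|exact: hc].
    suff : {within @square R, continuous (fun x : R * R => th i x.2 + x.1 * (th' i x.2 - th i x.2))}.
      by move/within_squareP; apply.
    have c4 (f : R -> R) : {within `[0, 1], continuous f} -> {within @square R, continuous (fun x : R * R => f x.2)}.
      move=> /within_itvP cf; apply/within_squareP => u' t' u'I t'I e' e'0.
      by have [d d0 hd] := cf t' t'I e' e'0; exists d => // u2 t2 *; apply: hd.
    move=> x; apply: cvgD; first exact: (c4 _ (hc i)).
    apply: cvgM; last exact: (c4 _ c3).
    by apply: continuous_subspaceT => z; exact: cvg_fst.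
  + by move=> u uI; split; [exact: pu|left].
  + by move=> u i uI /=; rewrite !thu0 !thu1.
  + move=> u t i j uI /(mE u i j t uI) me; have [e e0' he] := generic_isolated pD gD me.
    exists e => // u' t' u'I _ ht /(mE u' _ _ _ u'I) me'; have [t'I _ _] := me'.
    by rewrite (he t' t'I ht me').
- by move=> t tI; split=> [i|i j] //=; rewrite /thu mul0r addr0.
- by move=> t tI; split=> [i|i j] //=; rewrite /thu mul1r addrC subrK.
Qed.

Lemma xing_comp (f phi : R -> R) t : {within `[0, 1], continuous phi} -> 0 < t < 1 ->
  (exists2 e : R, 0 < e & forall r, 0 < `|r| < e -> 0 < r * (phi (t + r) - phi t)) ->
  xing f (phi t) -> xing (fun t => f (phi t)) t.
Proof.
move=> /within_itvP cphi tI [e e0 he] [e' e'0 hf]; have [d d0 hd] := interior_near tI.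
have tI' : 0 <= t <= 1 by case/andP: tI => *; rewrite !ltW.
have [d' d'0 hd'] := cphi t tI' e' e'0.
exists (Num.min e (Num.min d d')); first by rewrite !lt_min e0 d0.
have key r : 0 < `|r| < Num.min e (Num.min d d') -> exists2 q, 0 < r * q &
    0 < `|q| < e' /\ phi (t + r) = phi t + q.
  rewrite !lt_min => /andP[r0 /and3P[r1 r2 r3]]; exists (phi (t + r) - phi t).
    by apply: he; rewrite r0.
  split; last by rewrite [RHS]addrC subrK.
  have tE : t + r - t = r by rewrite addrAC subrr add0r.
  rewrite (hd' _ (hd r r2)) ?tE // andbT normr_gt0; apply/eqP => h.
  by have := he r; rewrite h mulr0 ltxx r0 r1 => /(_ isT).
have sg (r q y : R) : 0 < r * q -> (0 < q * y -> 0 < r * y) /\ (q * y < 0 -> r * y < 0).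
  move=> rq; have q0 : q != 0 by apply: contraTneq rq => ->; rewrite mulr0 ltxx.
  have qq : 0 < q * q by rewrite -expr2 lt_neqAle eq_sym sqrf_eq0 q0 sqr_ge0.
  split=> h.
    have : 0 < (r * q) * (q * y) by exact: mulr_gt0.
    by rewrite mulrACA [r * q]mulrC -mulrACA pmulr_rgt0.
  have : (r * q) * (q * y) < 0 by rewrite pmulr_rlt0.
  by rewrite mulrACA [r * q]mulrC -mulrACA pmulr_rlt0.
by case: hf => hf; [left|right] => r /key[q rq [qe ->]]; have [h1 h2] := sg r q (f (phi t + q)) rq;
  [apply: h1|apply: h2]; apply: hf.
Qed.

(** [phi] may pause, but not at a meeting, which would then last for a while; hence strict increase
    at the times sent to meetings. For u < 1 the mixture with the identity increases strictly by
    itself. *)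
Lemma reparam_isotopic E th ov (phi : R -> R) :
  (forall i, {within `[0, 1], continuous (th i)}) -> cyl_diagram true E (angle_diagram th ov) ->
  {within `[0, 1], continuous phi} -> phi 0 = 0 -> phi 1 = 1 ->
  (forall s t, 0 <= s -> s <= t -> t <= 1 -> phi s <= phi t) ->
  (forall i j t, 0 < t < 1 -> meet (angle_diagram th ov) i j (phi t) ->
     exists2 e : R, 0 < e & forall r, 0 < `|r| < e -> 0 < r * (phi (t + r) - phi t)) ->
  cyl_isotopic true E (angle_diagram th ov) (angle_diagram (fun i t => th i (phi t)) (fun i j t => ov i j (phi t))).
Proof.
move=> hc cD cphi p0 p1 pm px; have [pD gD _] := cD; have [_ _ hE [i0 i1] _] := pD.
pose ph u t := t + u * (phi t - t).
have ph0 u : ph u 0 = 0 by rewrite /ph p0 subrr mulr0 addr0.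
have ph1 u : ph u 1 = 1 by rewrite /ph p1 subrr mulr0 addr0.
have phI u t : 0 <= u <= 1 -> 0 <= t <= 1 -> 0 <= ph u t <= 1.
  move=> /andP[u0 u1] /andP[t0 t1]; have := pm 0 t (lexx _) t0 t1; have := pm t 1 t0 t1 (lexx _).
  by rewrite p0 p1 /ph => h1 h2; apply/andP; split; nra.
have cph : {within @square R, continuous (fun x : R * R => ph x.1 x.2)}.
  move=> x; apply: cvgD; first by apply: continuous_subspaceT => z; exact: cvg_snd.
  apply: cvgM; first by apply: continuous_subspaceT => z; exact: cvg_fst.
  apply: cvgB; last by apply: continuous_subspaceT => z; exact: cvg_snd.
  move: x; apply/within_squareP => u' t' u'I t'I e' e'0; move/within_itvP: cphi => cphi.
  by have [d d0 hd] := cphi t' t'I e' e'0; exists d => // u2 t2 *; apply: hd.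
have cphu u : 0 <= u <= 1 -> {within `[0, 1], continuous (ph u)}.
  by move=> uI; exact: (square_slice uI cph).
have cth i : {within @square R, continuous (fun x : R * R => th i (ph x.1 x.2))}.
  apply/within_squareP => u t uI tI e e0; have /within_itvP ci := hc i.
  have [d d0 hd] := ci _ (phI u t uI tI) e e0; move/within_squareP: cph => cph.
  have [d' d'0 hd'] := cph u t uI tI d d0; exists d' => // u' t' u'I t'I hu ht.
  by apply: hd; [exact: phI|exact: hd'].
pose G u := angle_diagram (fun i t => th i (ph u t)) (fun i j t => ov i j (ph u t)).
have mE u i j t : 0 <= u <= 1 -> meet (G u) i j t -> meet (angle_diagram th ov) i j (ph u t).
  by move=> uI [tI ij /= h]; split=> //; exact: phI.
have pu u : 0 <= u <= 1 -> prediagram E (G u).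
  move=> uI; apply: lift_prediagram => //.
  - by move=> i; exact: (square_slice uI (cth i)).
  - by move=> i; rewrite ph0 ph1; exact: hE.
  - by move=> i j ij; rewrite !ph0 !ph1; split=> h; case/eqP: ij; [exact: i0|exact: i1].
  - by move=> i j t tI /(lift_ov pD (phI u t uI tI)).
have gu u : 0 <= u <= 1 -> generic (G u).
  move=> uI; apply: lift_generic (pu u uI) (fun i => square_slice uI (cth i)) _ => i j t k tI ij Ek.
  have tI' : 0 <= t <= 1 by case/andP: tI => *; rewrite !ltW.
  have mE' : cis (th i (ph u t)) = cis (th j (ph u t)).
    by move/eqP: Ek; rewrite subr_eq => /eqP ->; rewrite addrC cis_period.
  have phI' := phI u t uI tI'.
  have me : meet (angle_diagram th ov) i j (ph u t) by split.
  split=> [l lE|]; first exact: (lift_nd gD pD phI' ij mE').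
  have [_ /(lift_crosses _ (hc i) (hc j) (meet_interior pD me) Ek) xi] := gD _ _ _ me.
  apply: (@xing_comp (fun t => th j t - th i t - k%:~R * (2 * pi)) (ph u) t (cphu u uI) tI) => //.
  have [u1|un1] := eqVneq u 1.
    have phE : ph u = phi by apply/funext => s; rewrite u1 /ph mul1r addrC subrK.
    by move: me; rewrite phE => /(px _ _ _ tI).
  have ult : u < 1 by case/andP: uI => _; rewrite lt_neqAle un1.
  have [d d0 hd] := interior_near tI; exists d => // r /andP[r0 rd].
  have rr : 0 < r * r.
    by rewrite -expr2 lt_neqAle eq_sym sqrf_eq0 -normr_gt0 r0 sqr_ge0.
  have /andP[a0 a1] := hd r rd; have /andP[b0 b1] := tI'; have /andP[u0 _] := uI.
  have mono : 0 <= r * (phi (t + r) - phi t).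
    have [h|h] := leP 0 r.
      by have := pm t (t + r) b0 _ a1; rewrite lerDl => /(_ h) ?; rewrite mulr_ge0 // subr_ge0.
    have := pm (t + r) t a0 _ b1; rewrite gerDl (ltW h) => /(_ isT) ?.
    by rewrite mulr_le0 ?subr_le0 // ltW.
  have -> : r * (ph u (t + r) - ph u t) = (1 - u) * (r * r) + u * (r * (phi (t + r) - phi t)).
    by rewrite /ph; ring.
  by apply: ltr_wpDr; [exact: mulr_ge0|rewrite mulr_gt0 ?subr_gt0].
exists G; split=> //.
- split.
  + by move=> i; exact: cis_cfamily (cth i).
  + by move=> u uI; split; [exact: pu|left].
  + by move=> u i uI /=; rewrite !ph0 !ph1.
  + move=> u t i j uI me0; have [tI _ _] := me0; have me := mE u i j t uI me0.
    have [e e0 he] := generic_isolated pD gD me; move/within_squareP: cph => cph.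
    have [d d0 hd] := cph u t uI tI e e0; exists d => // u' t' u'I hu ht me0'; have [t'I _ _] := me0'.
    by rewrite /= (he _ (phI u' t' u'I t'I) (hd _ _ u'I t'I hu ht) (mE _ _ _ _ u'I me0')).
- by move=> t tI; split=> [i|i j] //=; rewrite /ph mul0r addr0.
- by move=> t tI; split=> [i|i j] //=; rewrite /ph mul1r addrC subrK.
Qed.

Lemma order_equiv E th ov th' ov' (phi : R -> R) :
  (forall i, {within `[0, 1], continuous (th i)}) -> cyl_diagram true E (angle_diagram th ov) ->
  {within `[0, 1], continuous phi} -> phi 0 = 0 -> phi 1 = 1 ->
  (forall s t, 0 <= s -> s <= t -> t <= 1 -> phi s <= phi t) ->
  (forall i j t, 0 < t < 1 -> meet (angle_diagram th ov) i j (phi t) ->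
     exists2 e : R, 0 < e & forall r, 0 < `|r| < e -> 0 < r * (phi (t + r) - phi t)) ->
  (forall i, {within `[0, 1], continuous (th' i)}) ->
  (forall i, th' i 0 = th i 0) -> (forall i, th' i 1 = th i 1) ->
  (forall t, 0 <= t <= 1 -> same_order (th^~ (phi t)) (th'^~ t)) ->
  (forall i j t, 0 <= t <= 1 -> ov' i j t <-> ov i j (phi t)) ->
  cyl_diagram true E (angle_diagram th' ov') /\ cyl_equiv true E (angle_diagram th ov) (angle_diagram th' ov').
Proof.
move=> hc cD cphi p0 p1 pm px hc' e0 e1 so ho.
have i1 := reparam_isotopic hc cD cphi p0 p1 pm px; have c1 := isotopic_cyl i1.
have i2 : cyl_isotopic true E (angle_diagram (fun i t => th i (phi t)) (fun i j t => ov i j (phi t)))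
    (angle_diagram th' (fun i j t => ov i j (phi t))).
  apply: order_isotopic => //.
  - move=> i; apply/within_itvP => t tI e e00; have /within_itvP ci := hc i.
    move/within_itvP: cphi => cphi.
    have phI s : 0 <= s <= 1 -> 0 <= phi s <= 1.
      move=> /andP[t0 t1]; rewrite -{1}p0 -p1; apply/andP; split; apply: pm => //.
    have [d d0 hd] := ci _ (phI t tI) e e00; have [d' d'0 hd'] := cphi t tI d d0.
    by exists d' => // t' t'I ht; apply: hd; [exact: phI|exact: hd'].
  - by move=> i; rewrite p0.
  - by move=> i; rewrite p1.
have c2 := isotopic_cyl i2.
have sd : same_diagram (angle_diagram th' (fun i j t => ov i j (phi t))) (angle_diagram th' ov').
  by move=> t tI; split=> [i|i j] //=; rewrite ho.
have i3 := same_isotopic c2 sd; split; first exact: isotopic_cyl i3.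
by apply: rst_trans (isotopic_equiv i1) _; apply: rst_trans (isotopic_equiv i2) (isotopic_equiv i3).
Qed.

End SameOrder.

(** * Winding numbers and the index of a strand *)

Section Index.
Local Open Scope classical_set_scope.
Local Open Scope ring_scope.
Variables (R : realType).

Definition winding (x : R) : int := Num.floor (x / (2 * pi)).

Lemma winding_lt (x : R) (k : int) : (winding x < k) = (x < k%:~R * (2 * pi)).
Proof. by rewrite /winding -ltr_pdivrMr ?twopi_gt0 // ltNge [RHS]ltNge floor_ge_int. Qed.

Lemma winding_uniq (x : R) (k : int) : x < (k + 1)%:~R * (2 * pi) -> k%:~R * (2 * pi) <= x -> winding x = k.
Proof.
rewrite -winding_lt leNgt -winding_lt; lia.
Qed.

Lemma windingD (x : R) (k : int) : winding (x + k%:~R * (2 * pi)) = winding x + k.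
Proof.
have := winding_lt x (winding x + 1); have := winding_lt x (winding x).
rewrite ltxx ltzD1 lexx => /esym/negbT; rewrite -leNgt => h1 /esym h2.
apply: winding_uniq; last by rewrite intrD mulrDl lerD2r.
by rewrite addrAC [(_ + k)%:~R]intrD [X in _ < X]mulrDl ltrD2r.
Qed.

Lemma winding0 : winding 0 = 0.
Proof. by apply: winding_uniq; rewrite ?mul0r // add0r mul1r twopi_gt0. Qed.

Lemma winding_small (x : R) : `|x| < 2 * pi -> x != 0 -> winding x = if x < 0 then -1 else 0.
Proof.
rewrite ltr_norml => /andP[h1 h2]; have [x0|x0|->] := ltgtP x 0; last by [].
  by move=> _; apply: winding_uniq; rewrite ?mul0r // mulN1r ltW.
by move=> _; apply: winding_uniq; rewrite ?mul0r ?mul1r // ltW.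
Qed.

Lemma shift_gt0 (w : R) (q : int) : `|w| < 2 * pi -> (0 < w + q%:~R * (2 * pi)) = (0 < q) || (q == 0) && (0 < w).
Proof.
rewrite ltr_norml => /andP[h1 h2]; have p0 := twopi_gt0 R; have [q0|q0|<-] := ltgtP 0 q.
- have : (1 : R) <= q%:~R by rewrite -[1]/(1%:~R) ler_int -gtz0_ge1.
  rewrite -subr_ge0 => q1 /=; have := mulr_ge0 q1 (ltW p0); lra.
- have : (q%:~R : R) <= -1 by rewrite -[-1]/((-1)%:~R) ler_int; lia.
  rewrite -subr_ge0 => q1 /=; apply/negbTE; rewrite -leNgt.
  have := mulr_ge0 q1 (ltW p0); lra.
- by rewrite mul0r addr0.
Qed.

Variable m : nat.
Implicit Types (x y : 'I_m -> R).

Definition apart x := forall i j, i != j -> cis (x i) <> cis (x j).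

Lemma same_order_apart x y : same_order x y -> apart x -> apart y.
Proof. by move=> h ax i j /ax nx /(same_order_cis (same_order_sym h)). Qed.

(* The lifts [x a + 2 pi k] of the strands to R stand in the order of the integers
   [winding_index x a + k m], so strand [a] can be slid to the endpoint with this number. *)
Definition winding_index x (a : 'I_m) : int := \sum_b winding (x a - x b).

(** Termwise comparison: rounding down is monotone and turns k full rotations into k in each of the
    m terms; the term of [b] is the strict one. *)
Lemma index_lt x a b (k : int) : x a < x b + k%:~R * (2 * pi) -> winding_index x a < winding_index x b + k * m.
Proof.
move=> h; have -> : k * m = \sum_(e < m) k by rewrite sumr_const card_ord -mulr_natr natz.
rewrite /winding_index -big_split /= (bigD1 b) //= [ltRHS](bigD1 b) //=; apply: ltr_leD.
  by rewrite subrr winding0 add0r winding_lt ltrBlDl.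
apply: ler_sum => e _; rewrite -windingD.
have h1 : x a - x e <= x b - x e + k%:~R * (2 * pi) by lra.
by rewrite -ltzD1 winding_lt; apply: le_lt_trans h1 _; rewrite -winding_lt ltzD1.
Qed.

Lemma index_inj x a b (k : int) : apart x -> winding_index x a = winding_index x b + k * m -> a = b.
Proof.
move=> ax h; apply/eqP/negPn/negP => /ax ab; have [h1|h1|h1] := ltgtP (x a) (x b + k%:~R * (2 * pi)).
- by have := index_lt h1; rewrite h ltxx.
- have /index_lt : x b < x a + (- k)%:~R * (2 * pi) by rewrite mulrNz mulNr ltrBrDr.
  by rewrite h mulNr addrK ltxx.
- by apply: ab; rewrite h1 cis_period.
Qed.

End Index.

(** * Orders realized by endpoints, and rotations *)

Section Generation.
Local Open Scope classical_set_scope.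
Local Open Scope ring_scope.
Variables (R : realType) (m' : nat) (gamma : R) (th : 'I_m'.+2 -> R) (E : set R[i]) (up : bool).
Local Notation m := m'.+2.
Local Notation vtt := (vt gamma th).
Hypothesis numE : ccw_numbering (cis gamma) th E.
Variables rho rho' : diagram R m -> 'M[laurent]_m.
Hypotheses (hrho : is_rho up (cis gamma) th E rho) (hrho' : is_rho up (cis gamma) th E rho').
Implicit Types (D : diagram R m) (x y : 'I_m -> R) (K : 'I_m -> int).
Implicit Types (w : 'I_m -> R -> R) (ov : 'I_m -> 'I_m -> R -> Prop).
Local Notation agree := (agree E rho rho').

Lemma vt_shift_lt (j j' k : int) : (vtt j < vtt j' + k%:~R * (2 * pi)) = (j < j' + k * m).
Proof. by rewrite -vt_period (ltr_vt numE). Qed.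

Lemma index_order x : apart x -> same_order x (fun a => vtt (winding_index x a)).
Proof.
move=> ax i j k; rewrite vt_shift_lt; have [h|h|h] := ltgtP (x i) (x j + k%:~R * (2 * pi)).
- by rewrite index_lt.
- have /index_lt : x j < x i + (- k)%:~R * (2 * pi) by rewrite mulrNz mulNr ltrBrDr.
  by rewrite mulNr ltrBrDr; case: ltgtP.
- have ij : i = j by apply/eqP/negPn/negP => /ax; rewrite h cis_period.
  move/eqP: h; rewrite ij eq_sym -subr_eq0 addrAC subrr add0r mulf_eq0 (negPf (lt0r_neq0 (twopi_gt0 R))) orbF.
  by rewrite intr_eq0 => /eqP ->; rewrite mul0r addr0 ltxx.
Qed.

Lemma vt_winding (j i : int) : winding (vtt j - vtt i) = ((j - i) %/ m)%Z.
Proof.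
have E1 := divz_eq (j - i) m; have h1 := modz_ge0 (j - i) (isT : (m : int) != 0).
have h2 := ltz_pmod (j - i) (isT : (0 : int) < m).
apply: winding_uniq; first by rewrite ltrBlDl vt_shift_lt mulrDl mul1r; lia.
rewrite lerBrDl -vt_period (ler_vt numE); lia.
Qed.

Definition spread K := forall a b (k : int), K a = K b + k * m -> a = b.

(** Divide K a - K b by m with remainder and sum over b: all residues occur once, so m times the
    index is m K a minus a constant. The index thus recovers the number of an endpoint only up to a
    common shift, for which rotations will compensate. *)
Lemma index_vt K : spread K -> exists sh : int, forall a, winding_index (fun a => vtt (K a)) a = K a + sh.
Proof.
move=> Kinj; pose S := \sum_b K b + \sum_(p < m) (p : int).
have key a : winding_index (fun a => vtt (K a)) a * m = K a * m - S.
  have inj : injective (fun b => res m' (K a - K b)).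
    by move=> b b' /res_eq[k hk]; apply: (Kinj b b' (- k)); rewrite mulNr; move: hk; set X := k * _; lia.
  rewrite /winding_index big_distrl /= /S (reindex_inj inj (P := predT) (F := fun p : 'I_m => (p : int))) /=.
  rewrite opprD -sumrN -sumrN.
  have -> : K a * m = \sum_(b < m) K a by rewrite sumr_const card_ord -mulr_natr natz.
  rewrite addrA -!big_split /=; apply: eq_bigr => b _; rewrite vt_winding.
  by have := div_res m' (K a - K b); set X := _ * _; lia.
exists (winding_index (fun a => vtt (K a)) ord0 - K ord0) => a; apply: (@mulIf _ (m : int)) => //.
by have := key a; have := key ord0; rewrite !mulrDl mulNr; lia.
Qed.

Lemma spread_apart K : spread K -> apart (fun a => vtt (K a)).
Proof.
move=> Kinj i j ij /cis_eqP[k]; rewrite -(vt_period gamma th) => h; case/eqP: ij; apply: (Kinj i j k).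
by apply/eqP; rewrite eq_le -!(ler_vt numE) h lexx.
Qed.

Lemma index_spread x : apart x -> spread (winding_index x).
Proof. by move=> ax a b k; apply: index_inj. Qed.

Lemma lift_cat w ov w' ov' : cat_diagram (angle_diagram w ov) (angle_diagram w' ov') =
  angle_diagram (fun i t => if t <= 2^-1 then w i (2 * t) else w' i (2 * t - 1))
    (fun i j t => if t <= 2^-1 then ov i j (2 * t) else ov' i j (2 * t - 1)).
Proof.
rewrite /cat_diagram /angle_diagram; congr Diagram.
by apply/funext => i; apply/funext => t /=; case: ifP.
Qed.

(** The tool for cutting diagrams: the two factors only have to reproduce the order of the strands
    of [w], along a change of time [phi], and its crossing data; their positions may differ from
    those of [w] except at the outer ends. *)
Lemma agree_order_cat w ov (phi : R -> R) w1 ov1 w2 ov2 :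
  (forall i, {within `[0, 1], continuous (w i)}) -> cyl_diagram true E (angle_diagram w ov) ->
  {within `[0, 1], continuous phi} -> phi 0 = 0 -> phi 1 = 1 ->
  (forall s t, 0 <= s -> s <= t -> t <= 1 -> phi s <= phi t) ->
  (forall i j t, 0 < t < 1 -> meet (angle_diagram w ov) i j (phi t) ->
     exists2 e : R, 0 < e & forall r, 0 < `|r| < e -> 0 < r * (phi (t + r) - phi t)) ->
  (forall i, {within `[0, 1], continuous (w1 i)}) -> (forall i, {within `[0, 1], continuous (w2 i)}) ->
  (forall i, w1 i 0 = w i 0) -> (forall i, w2 i 1 = w i 1) -> (forall i, w1 i 1 = w2 i 0) ->
  (forall t, 0 <= t <= 2^-1 -> same_order (w^~ (phi t)) (w1^~ (2 * t))) ->
  (forall t, 2^-1 < t <= 1 -> same_order (w^~ (phi t)) (w2^~ (2 * t - 1))) ->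
  (forall i j t, 0 <= t <= 2^-1 -> ov1 i j (2 * t) <-> ov i j (phi t)) ->
  (forall i j t, 2^-1 < t <= 1 -> ov2 i j (2 * t - 1) <-> ov i j (phi t)) ->
  agree (angle_diagram w1 ov1) -> agree (angle_diagram w2 ov2) -> agree (angle_diagram w ov).
Proof.
move=> hc cD cphi p0 p1 pm px c1 c2 e0 e1 e01 so1 so2 o1 o2 a1 a2.
have := @order_equiv _ _ E w ov
  (fun i t => if t <= 2^-1 then w1 i (2 * t) else w2 i (2 * t - 1))
  (fun i j t => if t <= 2^-1 then ov1 i j (2 * t) else ov2 i j (2 * t - 1)) phi hc cD cphi p0 p1 pm px.
have cc i : {within `[0, 1], continuous (fun t => if t <= 2^-1 then w1 i (2 * t) else w2 i (2 * t - 1))}.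
  by apply: paste_continuous.
move/(_ cc); rewrite half_ge0 mulr0 half_lt1 two_sub1 => /(_ e0 e1).
case=> [t /andP[t0 t1]|i j t /andP[t0 t1]|].
- by case: leP => ht; [apply: so1; rewrite t0|apply: so2; rewrite ht].
- by case: leP => ht; [apply: o1; rewrite t0|apply: o2; rewrite ht].
rewrite -lift_cat => cX eX.
have al i : strand (angle_diagram w2 ov2) i 0 = strand (angle_diagram w1 ov1) i 1 by rewrite /= e01.
have M := mul_aligned up numE (proj1 a1) (proj1 a2) al.
by apply: (agree_mul hrho hrho' a1 a2 cD); rewrite M.
Qed.

Lemma agree_order w ov w' : (forall i, {within `[0, 1], continuous (w i)}) ->
  (forall i, {within `[0, 1], continuous (w' i)}) ->
  (forall i, w' i 0 = w i 0) -> (forall i, w' i 1 = w i 1) ->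
  (forall t, 0 <= t <= 1 -> same_order (w^~ t) (w'^~ t)) ->
  agree (angle_diagram w ov) -> agree (angle_diagram w' ov).
Proof.
move=> hc hc' e0 e1 so aD; apply: (agree_isotopic hrho hrho' aD).
by apply: order_isotopic => //; case: aD.
Qed.

(** The power of zeta with exponent [sh], for strands starting at the endpoints numbered by [K]. *)
Definition rot K (sh : int) := angle_diagram (fun a t => vtt (K a) + t * (vtt (K a + sh) - vtt (K a)))
  (fun _ _ _ => False).

Lemma rot_order K sh t : 0 <= t <= 1 -> same_order (fun a => vtt (K a))
  (fun a => vtt (K a) + t * (vtt (K a + sh) - vtt (K a))).
Proof.
move=> tI; apply: (mix_order tI (y := fun a => vtt (K a + sh))) => i j k.
by rewrite !vt_shift_lt addrAC ltrD2r.
Qed.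

Lemma line_continuous (x y : R) : {within `[0, 1], continuous (fun t : R => x + t * y)}.
Proof.
apply: continuous_subspaceT => t; apply: cvgD; first exact: cvg_cst.
by apply: cvgM; [exact: cvg_id|exact: cvg_cst].
Qed.

Lemma rot_cyl K sh : spread K -> cyl_diagram true E (rot K sh).
Proof.
move=> sK; have ap t : 0 <= t <= 1 -> apart (fun a => vtt (K a) + t * (vtt (K a + sh) - vtt (K a))).
  by move=> tI; apply: same_order_apart (rot_order K sh tI) (spread_apart sK).
have pD : prediagram E (rot K sh).
  apply: lift_prediagram => //.
  - by move=> i; apply: line_continuous.
  - by move=> i; rewrite mul0r addr0 mul1r addrC subrK; split; apply: cis_vt_in numE _.
  - by move=> i j ij; split; [apply: ap (unit0 R) i j ij|apply: ap (unit1 R) i j ij].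
split=> //; last by left.
by move=> i j t [tI ij /= h]; case: (ap t tI i j ij h).
Qed.

Lemma rot_cat K s s' : spread K -> agree (rot K s) -> agree (rot (fun a => K a + s) s') ->
  agree (rot K (s + s')).
Proof.
move=> sK; apply: agree_order_cat (rot_cyl _ sK) (id_continuous (R := R)) _ _ _ _ _ _ _ _ _ _ _ _ _ => //.
- by move=> i; apply: line_continuous.
- by move=> i j t tI _; exists 1 => // r /andP[r0 _];
    rewrite addrAC subrr add0r -expr2 lt_neqAle eq_sym sqrf_eq0 -normr_gt0 r0 sqr_ge0.
- by move=> i; apply: line_continuous.
- by move=> i; apply: line_continuous.
- by move=> i; rewrite !mul0r.
- by move=> i; rewrite !mul1r !addrA; ring.
- by move=> i; rewrite mul0r mul1r addr0 addrC subrK.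
- move=> t tI; have t1 : 0 <= t <= 1 by apply/andP; case/andP: tI => *; split; lra.
  apply: (same_order_trans (same_order_sym (rot_order K (s + s') t1))).
  by apply: rot_order; apply: half_le_in; case/andP: tI.
- move=> t tI; have t1 : 0 <= t <= 1 by apply/andP; case/andP: tI => *; split; lra.
  apply: (same_order_trans (same_order_sym (rot_order K (s + s') t1))).
  have tI' : 0 <= 2 * t - 1 <= 1 by apply: half_gt_in; case/andP: tI.
  apply: same_order_trans (rot_order (fun a => K a + s) s' tI') => i j k.
  by rewrite !vt_shift_lt addrAC ltrD2r.
Qed.

Lemma agree_rot0 K : spread K -> agree (rot K 0).
Proof.
move=> sK; apply: (agree_idem numE hrho hrho' (rot_cyl 0 sK)) => [i|t tI].
  by rewrite /= addr0 subrr !mulr0.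
by split=> [i|i j] /=; rewrite ?addr0 ?subrr ?mulr0 if_same.
Qed.

Lemma spread_inj K : spread K -> injective (fun a => res m' (K a)).
Proof. by move=> sK a b /res_eq[k] /sK. Qed.

Lemma rot1 K (sK : spread K) :
  same_diagram (rot K 1) (rename (perm (spread_inj sK)) (zeta_diagram (cis gamma) th)).
Proof.
move=> t tI; split=> [a|a b] //=; rewrite permE vt_gap -cisD -[RHS](cis_period _ (K a %/ m)%Z).
by congr cis; rewrite {1}/vt; ring.
Qed.

Lemma agree_rot1 K : spread K -> agree (rot K 1).
Proof.
move=> sK; pose K0 (a : 'I_m) : int := (a : nat).
have sK0 : spread K0 by move=> a b k h; rewrite -[a]res_ord -/(K0 a) h res_period res_ord.
have az : agree (zeta_diagram (cis gamma) th).
  split; last by have [_ _ _ [_ _ ->]] := hrho; have [_ _ _ [_ _ ->]] := hrho'.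
  apply: same_cyl (rot_cyl 1 sK0); have := rot1 sK0.
  have -> : perm (spread_inj sK0) = 1%g by apply/permP => a; rewrite permE perm1 res_ord.
  by rewrite rename1.
apply: (agree_same hrho hrho' _ (same_diagram_sym (rot1 sK))).
exact: (agree_rename' hrho hrho').
Qed.

Lemma spread_shift K s : spread K -> spread (fun a => K a + s).
Proof. by move=> sK a b k h; apply: (sK a b k); apply: (addIr s); rewrite h addrAC. Qed.

Lemma agree_rot K sh : spread K -> agree (rot K sh).
Proof.
have pos n : forall K, spread K -> agree (rot K (n : nat)).
  elim: n => [|n IH] {}K sK; first exact: agree_rot0.
  rewrite -addn1 PoszD; apply: rot_cat => //; first exact: IH.
  by apply: agree_rot1; apply: spread_shift.
move=> sK; case: sh => n; first exact: pos.
(* A negative rotation is obtained by cancellation: preceded by the opposite rotation it keeps the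
   order constant, as the rotation by 0 does. *)
rewrite NegzE; set s : int := n.+1.
have sK' : spread (fun a => K a - s) by apply: spread_shift.
have a0 := agree_rot0 sK'; have a1 : agree (rot (fun a => K a - s) s) by apply: pos.
have EK : K = (fun a => K a - s + s) by apply/funext => a; rewrite subrK.
have := @order_equiv _ _ E _ _
  (fun a t => if t <= 2^-1 then vtt (K a - s) + 2 * t * (vtt (K a - s + s) - vtt (K a - s)) else
     vtt (K a) + (2 * t - 1) * (vtt (K a - s) - vtt (K a)))
  (fun i j t => if t <= 2^-1 then False else False) id _ (proj1 a0) (id_continuous (R := R)) erefl erefl _ _ _ _ _ _ _.
case.
- by move=> i; apply: line_continuous.
- by [].
- by move=> i j t tI _; exists 1 => // r /andP[r0 _];
    rewrite addrAC subrr add0r -expr2 lt_neqAle eq_sym sqrf_eq0 -normr_gt0 r0 sqr_ge0.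
- move=> i; apply: (@paste_continuous _ (fun t => vtt (K i - s) + t * (vtt (K i - s + s) - vtt (K i - s)))
    (fun t => vtt (K i) + t * (vtt (K i - s) - vtt (K i)))).
  + by rewrite mul0r mul1r addr0 subrK addrC subrK.
  + exact: line_continuous.
  + exact: line_continuous.
- by move=> i; rewrite half_ge0 mulr0 !mul0r.
- by move=> i; rewrite half_lt1 two_sub1 !mul1r addrC subrK addr0 [RHS]addrC subrK.
- move=> t tI; apply: (same_order_trans (same_order_sym (rot_order _ 0 tI))).
  case: leP => ht.
    by apply: (@rot_order (fun a => K a - s) s); apply: half_le_in => //; case/andP: tI.
  have tI' : 0 <= 2 * t - 1 <= 1 by apply: half_gt_in => //; case/andP: tI.
  apply: same_order_trans (rot_order K (- s) tI') => i j k.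
  by rewrite !vt_shift_lt addrAC ltrD2r.
- by move=> i j t tI; case: ifP.
have := lift_cat (fun a t => vtt (K a - s) + t * (vtt (K a - s + s) - vtt (K a - s))) (fun _ _ _ => False)
  (fun a t => vtt (K a) + t * (vtt (K a - s) - vtt (K a))) (fun _ _ _ => False) => /= <- cM eM.
apply: (agree_cancel numE hrho hrho' a1 _ _ a0 cM); first exact: rot_cyl.
  by move=> i /=; rewrite mul0r mul1r addr0 subrK addrC subrK.
exact: rst_sym.
Qed.

End Generation.

(** * Windows around one time of meeting *)

Section Windows.
Local Open Scope classical_set_scope.
Local Open Scope ring_scope.
Variables (R : realType) (m : nat) (E : set R[i]) (w : 'I_m -> R -> R) (ov : 'I_m -> 'I_m -> R -> Prop).
Hypothesis hc : forall i, {within `[0, 1], continuous (w i)}.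
Hypothesis cD : cyl_diagram true E (angle_diagram w ov).

Definition steady (t1 c t2 : R) i j := cis (w i c) <> cis (w j c) /\ forall t, t1 <= t <= t2 ->
  forall k : int, (w i t < w j t + k%:~R * (2 * pi)) = (w i c < w j c + k%:~R * (2 * pi)).

(** [k0] counts the turns between the two lifts at the meeting. After correction by [k0] turns, [s]
    tells whether j is behind i before time c; the crossing reverses this. *)
Definition flips (t1 c t2 : R) i j (k0 : int) (s : bool) := w j c = w i c + k0%:~R * (2 * pi) /\
  forall t, t1 <= t <= t2 -> t != c -> let g := w j t - w i t - k0%:~R * (2 * pi) in
    [/\ `|g| < 2 * pi, g != 0 & (g < 0) = s (+) (c < t)].

Definition window (t1 c t2 : R) := [/\ 0 <= t1, t1 < c < t2, t2 <= 1 & forall i j, i != j ->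
  steady t1 c t2 i j \/ exists k0 s, flips t1 c t2 i j k0 s].

Lemma flips_order t1 c t2 i j k0 s t (k : int) : flips t1 c t2 i j k0 s -> t1 <= t <= t2 -> t != c ->
  (w i t < w j t + k%:~R * (2 * pi)) = (0 < k + k0) || (k + k0 == 0) && ~~ (s (+) (c < t)).
Proof.
move=> [_ h] tI tc; have [g1 g2 g3] := h t tI tc; rewrite -g3 -leNgt le_eqVlt [0 == _]eq_sym (negPf g2) /=.
rewrite -(shift_gt0 _ g1) -[LHS]subr_gt0 intrD; congr (0 < _); ring.
Qed.

Lemma steady_near x i j : 0 <= x <= 1 -> cis (w i x) <> cis (w j x) -> exists2 e : R, 0 < e &
  forall t, 0 <= t <= 1 -> `|t - x| < e -> cis (w i t) <> cis (w j t) /\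
  forall k : int, (w i t < w j t + k%:~R * (2 * pi)) = (w i x < w j x + k%:~R * (2 * pi)).
Proof.
move=> xI ne; pose f t := w i t - w j t; pose q := winding (f x).
have /within_itvP cf : {within `[0, 1], continuous f} by move=> t; apply: cvgB; exact: hc.
have := winding_lt (f x) (q + 1); rewrite ltzD1 lexx => /esym h2.
have h1 : q%:~R * (2 * pi) < f x.
  rewrite lt_neqAle; apply/andP; split; last by rewrite leNgt -winding_lt ltxx.
  apply/eqP => h; apply: ne; rewrite -(cis_period (w j x) q) h; congr cis.
  by rewrite /f addrC subrK.
have [|d d0 hd] := cf x xI (Num.min (f x - q%:~R * (2 * pi)) ((q + 1)%:~R * (2 * pi) - f x)).
  by rewrite lt_min !subr_gt0 h1.
exists d => // t tI /(hd t tI); rewrite lt_min !ltr_norml => /andP[/andP[a1 a2] /andP[a3 a4]].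
have b1 : q%:~R * (2 * pi) < f t by lra.
have E1 : winding (f t) = q by apply: winding_uniq; lra.
split=> [/cis_eqP[k hk]|k].
  have ft : f t = 0 + k%:~R * (2 * pi) by rewrite /f hk addrAC subrr.
  by move: E1 b1; rewrite ft windingD winding0 add0r => ->; rewrite add0r ltxx.
by rewrite -!ltrBlDl -!winding_lt -/(f t) -/(f x) E1.
Qed.

Lemma flips_near x (i j : 'I_m) : 0 <= x <= 1 -> i != j -> cis (w i x) = cis (w j x) ->
  exists2 e : R, 0 < e & exists (k0 : int) (s : bool), w j x = w i x + k0%:~R * (2 * pi) /\
    forall t, 0 <= t <= 1 -> `|t - x| < e ->
    t != x -> let g := w j t - w i t - k0%:~R * (2 * pi) in
      [/\ `|g| < 2 * pi, g != 0 & (g < 0) = s (+) (x < t)].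
Proof.
move=> xI ij mE; have [pD gD _] := cD.
have me : meet (angle_diagram w ov) i j x by split.
have tI := meet_interior pD me; have [k hk] := cis_eqP (esym mE).
have Ek : w j x - w i x = k%:~R * (2 * pi) by rewrite hk addrAC subrr add0r.
have [_ /(lift_crosses _ (@hc i) (@hc j) tI Ek)[d d0 hd]] := gD i j x me.
have [e e0 he] := turn_near (@hc i) (@hc j) tI Ek.
exists (Num.min d e); first by rewrite lt_min d0.
have key t : `|t - x| < Num.min d e -> t != x ->
   [/\ 0 < `|t - x| < d, x + (t - x) = t & `|w j t - w i t - k%:~R * (2 * pi)| < 2 * pi].
  rewrite lt_min => /andP[a1 a2] tx; have E1 : x + (t - x) = t by rewrite addrC subrK.
  split=> //; first by rewrite normr_gt0 subr_eq0 tx.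
  have [_] := he _ a2; rewrite E1 => /lt_trans; apply.
  by rewrite mulr_natl mulr2n ltrDl pi_gt0.
exists k; case: hd => hd; [exists true|exists false]; split=> // t tI' ht tx; have [a1 a2 a3] := key t ht tx;
  have := hd _ a1; rewrite a2; set g := w j t - _ - _ => sg; split=> //;
  try (by apply: contraTneq sg => ->; rewrite mulr0 ltxx).
  have [xt|xt] := ltrP x t; rewrite /=.
    have p : 0 < t - x by rewrite subr_gt0.
    by move: sg; rewrite (pmulr_rgt0 _ p) => g0; apply/negbTE; rewrite -leNgt ltW.
  have p : t - x < 0 by rewrite subr_lt0 lt_neqAle tx.
  by move: sg; rewrite (nmulr_rgt0 _ p).
have [xt|xt] := ltrP x t; rewrite /=.
  have p : 0 < t - x by rewrite subr_gt0.
  by move: sg; rewrite (pmulr_rlt0 _ p).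
have p : t - x < 0 by rewrite subr_lt0 lt_neqAle tx.
by move: sg; rewrite (nmulr_rlt0 _ p) => g0; apply/negbTE; rewrite -leNgt ltW.
Qed.

Lemma local_window x : 0 <= x <= 1 -> exists2 e : R, 0 < e & forall t1 t2, 0 <= t1 -> t2 <= 1 ->
  `|t1 - x| < e -> `|t2 - x| < e -> t1 < t2 -> apart (w^~ t1) -> apart (w^~ t2) ->
  exists c, window t1 c t2.
Proof.
move=> xI.
pose Q i j (e : R) := (forall t, 0 <= t <= 1 -> `|t - x| < e -> cis (w i t) <> cis (w j t) /\
    forall k : int, (w i t < w j t + k%:~R * (2 * pi)) = (w i x < w j x + k%:~R * (2 * pi))) \/
  exists (k0 : int) (s : bool), w j x = w i x + k0%:~R * (2 * pi) /\ forall t, 0 <= t <= 1 -> `|t - x| < e ->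
    t != x -> let g := w j t - w i t - k0%:~R * (2 * pi) in
      [/\ `|g| < 2 * pi, g != 0 & (g < 0) = s (+) (x < t)].
have [|p|e e0 he] := @fin_exists_pos R _ (fun (p : 'I_m * 'I_m) e => p.1 != p.2 -> Q p.1 p.2 e).
- move=> p e e' /andP[e'0 ee'] h /h [h'|[k0 [s [E1 h']]]]; [left|right].
    by move=> t tI ht; apply: h' => //; apply: lt_le_trans ee'.
  by exists k0, s; split=> // t tI ht; apply: h' => //; apply: lt_le_trans ee'.
- have [->|ij] := eqVneq p.1 p.2; first by exists 1.
  have [mE|ne] := pselect (cis (w p.1 x) = cis (w p.2 x)); last first.
    by have [e e0 he] := steady_near xI ne; exists e => // _; left.
  by have [e e0 he] := flips_near xI ij mE; exists e => // _; right.
exists e => // t1 t2 t10 t21 h1 h2 t12 ap1 ap2.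
(* If x is not strictly inside, no strands meet in the window, since they are apart at its ends, and
   any inner point can serve as [c]. *)
pose c := if (t1 < x) && (x < t2) then x else (t1 + t2) / 2.
have cI : t1 < c < t2.
  by rewrite /c; case: ifP => [//|_]; apply/andP; split; lra.
exists c; split=> // i j ij.
have near t : t1 <= t <= t2 -> 0 <= t <= 1 /\ `|t - x| < e.
  move: h1 h2; rewrite !ltr_norml => /andP[? ?] /andP[? ?] /andP[? ?].
  by split; apply/andP; split; lra.
have cI' : t1 <= c <= t2 by case/andP: cI => *; rewrite !ltW.
have [c01 cnear] := near c cI'.
have [h|[k0 [s [E1 h]]]] := he (i, j) ij.
  left; split; first by have [] := h c c01 cnear.
  by move=> t /near[tI ht] k; have [_ ->] := h t tI ht; have [_ ->] := h c c01 cnear.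
have fl : flips t1 x t2 i j k0 s by split=> // t /near[tI ht]; apply: h.
have [cx|nc] := boolP ((t1 < x) && (x < t2)).
  by right; exists k0, s; rewrite /c cx.
have mE : cis (w i x) = cis (w j x) by rewrite E1 cis_period.
have side : x < t1 \/ t2 < x.
  have n1 : x != t1 by apply/eqP => h0; apply: (ap1 _ _ ij); rewrite -h0.
  have n2 : x != t2 by apply/eqP => h0; apply: (ap2 _ _ ij); rewrite -h0.
  move: nc; rewrite negb_and -!leNgt => /orP[h3|h3]; [left|right]; rewrite lt_neqAle ?n1 ?h3 //.
  by rewrite eq_sym n2.
have tx t : t1 <= t <= t2 -> t != x /\ (x < t) = (x < c).
  move=> /andP[a1 a2]; case/andP: cI => a3 a4; case: side => h3.
    have -> : x < c by lra.
    by have h4 : x < t := lt_le_trans h3 a1; rewrite h4 gt_eqF.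
  have -> : (x < c) = false by apply/negbTE; rewrite -leNgt; lra.
  by have h4 : t < x := le_lt_trans a2 h3; rewrite lt_eqF // ltNge ltW.
left; split.
  have [cx _] := tx c cI'; have [g1 g2 _] := h c c01 cnear cx.
  move=> h3; case/eqP: g2; apply: cis_eq1_small g1 _.
  by rewrite -mulNr -mulrNz cis_period cisB h3 divff // cis_neq0.
move=> t tI k; have [n1 n2] := tx t tI; have [n3 _] := tx c cI'.
by rewrite (flips_order _ fl tI n1) (flips_order _ fl cI' n3) n2.
Qed.

Section Window.
Variables t1 c t2 : R.
Hypothesis W : window t1 c t2.
Hypotheses (ap1 : apart (w^~ t1)) (ap2 : apart (w^~ t2)).

Lemma window_in t : t1 <= t <= t2 -> 0 <= t <= 1.
Proof. by case: W => [h1 _ h2 _] /andP[h3 h4]; rewrite (le_trans h1 h3) (le_trans h4 h2). Qed.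

Lemma window_side t t' : t1 <= t <= t2 -> t1 <= t' <= t2 -> t != c -> t' != c -> (c < t) = (c < t') ->
  same_order (w^~ t) (w^~ t').
Proof.
move=> tI t'I tc t'c E1 i j k; have [<-|ij] := eqVneq i j; first by rewrite !ltrDl.
have [_ _ _ /(_ _ _ ij)[[_ h]|[k0 [s fl]]]] := W; first by rewrite (h t) // (h t').
by rewrite (flips_order _ fl tI tc) (flips_order _ fl t'I t'c) E1.
Qed.

Lemma window_before t : t1 <= t -> t < c -> same_order (w^~ t1) (w^~ t).
Proof.
case: W => _ /andP[h1 h2] _ _ h3 h4; have h5 := le_lt_trans h3 h4.
apply: window_side; rewrite ?lexx ?(lt_eqF h5) ?(lt_eqF h4) //.
- by rewrite ltW // (lt_trans h1).
- by rewrite h3 ltW // (lt_trans h4).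
- by rewrite !ltNge !ltW.
Qed.

Lemma window_after t : c < t -> t <= t2 -> same_order (w^~ t2) (w^~ t).
Proof.
case: W => _ /andP[h1 h2] _ _ h3 h4; have h5 := lt_le_trans h3 h4.
apply: window_side; rewrite ?lexx ?(gt_eqF h5) ?(gt_eqF h3) //.
- by rewrite andbT ltW // (lt_trans h1).
- by rewrite h4 andbT ltW // (lt_trans h1).
- by rewrite h5 h3.
Qed.

Lemma c_in : t1 <= c <= t2. Proof. by case: W => _ /andP[h1 h2] _ _; rewrite !ltW. Qed.
Lemma t1_in : t1 <= t1 <= t2. Proof. by have /andP[h1 h2] := c_in; rewrite lexx (le_trans h1). Qed.
Lemma t2_in : t1 <= t2 <= t2. Proof. by have /andP[h1 h2] := c_in; rewrite lexx (le_trans h1). Qed.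
Lemma t1c : t1 != c. Proof. by case: W => _ /andP[h1 h2] _ _; rewrite lt_eqF. Qed.
Lemma t2c : t2 != c. Proof. by case: W => _ /andP[h1 h2] _ _; rewrite gt_eqF. Qed.
Lemma ct1 : (c < t1) = false. Proof. by case: W => _ /andP[h1 h2] _ _; rewrite ltNge ltW. Qed.
Lemma ct2 : c < t2. Proof. by case: W => _ /andP[]. Qed.

(** A strand which meets no other one at time c is its own partner. Genericity makes the choice
    unambiguous. *)
Definition partner (a : 'I_m) : 'I_m := odflt a [pick b | (b != a) && (cis (w b c) == cis (w a c))].

Lemma partner_neq a b : b != a -> b != partner a -> cis (w b c) <> cis (w a c).
Proof.
rewrite /partner; case: pickP => [b' /andP[b'a /eqP h]|h] /= ba bb' h'; last first.
  by have := h b; rewrite ba h' eqxx.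
have [pD gD _] := cD; have b'a' : a != b' by rewrite eq_sym.
have := lift_nd gD pD (window_in c_in) b'a' (esym h) h'.
by case=> h2; [rewrite h2 eqxx in ba|rewrite h2 eqxx in bb'].
Qed.

Lemma partner_cis a : cis (w (partner a) c) = cis (w a c).
Proof. by rewrite /partner; case: pickP => [b' /andP[b'a /eqP h]|h]. Qed.

Lemma partnerK a : partner (partner a) = a.
Proof.
have [h|h] := eqVneq (partner a) a; first by rewrite !h.
apply/eqP/negPn/negP => h'; rewrite eq_sym in h; rewrite eq_sym in h'.
by case: (partner_neq h h'); rewrite partner_cis.
Qed.

Lemma steady_winding i j t : steady t1 c t2 i j -> t1 <= t <= t2 ->
  winding (w i t - w j t) = winding (w i c - w j c).
Proof.
move=> [_ h] tI; apply/eqP; rewrite eq_le -!ltzD1 !winding_lt !ltrBlDl h //= -!ltrBlDl -winding_lt.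
by rewrite ltzD1 lexx /= ltrBlDl -(h t tI) -ltrBlDl -winding_lt ltzD1 lexx.
Qed.

Lemma flips_winding i j k0 s t : flips t1 c t2 i j k0 s -> t1 <= t <= t2 -> t != c ->
  winding (w i t - w j t) = (if s (+) (c < t) then 0 else -1) - k0 /\
  winding (w j t - w i t) = (if s (+) (c < t) then -1 else 0) + k0.
Proof.
move=> [_ h] tI tc; have [g1 g2 <-] := h t tI tc; set g := w j t - _ - _ in g1 g2 *.
have -> : w i t - w j t = - g + (- k0)%:~R * (2 * pi) by rewrite mulrNz /g; ring.
have -> : w j t - w i t = g + k0%:~R * (2 * pi) by rewrite /g; ring.
rewrite !windingD (winding_small g1) // winding_small ?normrN ?oppr_eq0 // oppr_lt0; split=> //.
by congr (_ + _); case: ltgtP g2.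
Qed.

Lemma window_pair i j : i != j -> j != partner i -> steady t1 c t2 i j.
Proof.
move=> ij jp; have [_ _ _ /(_ _ _ ij)[//|[k0 [s [h _]]]]] := W.
rewrite eq_sym in ij; case: (partner_neq ij jp); by rewrite h cis_period.
Qed.

Lemma window_flips i : partner i != i -> exists k0 s, flips t1 c t2 i (partner i) k0 s.
Proof.
rewrite eq_sym => ip; have [_ _ _ /(_ _ _ ip)[[h _]|//]] := W.
by case: h; rewrite partner_cis.
Qed.

Definition jump a := winding_index (w^~ t2) a - winding_index (w^~ t1) a.

(** A pair which does not meet in the window keeps its winding number, so only the term of the
    partner changes. *)
Lemma jumpE a : jump a = winding (w a t2 - w (partner a) t2) - winding (w a t1 - w (partner a) t1).
Proof.
rewrite /jump /winding_index -sumrB (bigD1 (partner a)) //= big1 ?addr0 // => b bp.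
have [->|ab] := eqVneq a b; first by rewrite !subrr ?winding0 ?subrr.
have st := window_pair ab bp.
by rewrite (steady_winding st t1_in) (steady_winding st t2_in) subrr.
Qed.

Lemma jump0 a : partner a = a -> jump a = 0.
Proof. by move=> pa; rewrite jumpE pa !subrr ?winding0 ?subrr. Qed.

Lemma jump_flips a k0 s : flips t1 c t2 a (partner a) k0 s ->
  jump a = (if s then -1 else 1) /\ jump (partner a) = (if s then 1 else -1).
Proof.
move=> fl; have [h1 h2] := flips_winding fl t1_in t1c; have [h3 h4] := flips_winding fl t2_in t2c.
rewrite !jumpE partnerK h1 h2 h3 h4 ct1 ct2; case: s {fl h1 h2 h3 h4} => /=; split; ring.
Qed.

(** Any third strand meets neither of the two, so both winding numbers with it can be read at time
    c, where [a] and its partner differ by exactly [k0] turns. The two remaining terms are those of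
    the pair itself. *)
Lemma index_partner a k0 s : partner a != a -> flips t1 c t2 a (partner a) k0 s ->
  winding_index (w^~ t1) (partner a) = winding_index (w^~ t2) a + k0 * m.
Proof.
move=> pa fl; have [h1 h2] := flips_winding fl t1_in t1c; have [h3 h4] := flips_winding fl t2_in t2c.
apply/eqP; rewrite -subr_eq0 opprD addrA; apply/eqP.
have -> : k0 * m = \sum_(e < m) k0 by rewrite sumr_const card_ord -mulr_natr natz.
rewrite /winding_index -!sumrB (bigD1 a) //= (bigD1 (partner a)) //= big1 => [|e /andP[ea ep]].
  by rewrite h2 h3 ct1 ct2 !subrr winding0; case: s {fl h1 h2 h3 h4} => /=; ring.
rewrite eq_sym in ea; rewrite eq_sym in ep.
have st1 : steady t1 c t2 a e by apply: window_pair => //; rewrite eq_sym.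
have st2 : steady t1 c t2 (partner a) e by apply: window_pair => //; rewrite partnerK eq_sym.
rewrite (steady_winding st1 t2_in) (steady_winding st2 t1_in); have [-> _] := fl.
by rewrite [w a c + _ - _]addrAC windingD; ring.
Qed.

End Window.
End Windows.

(** * The swap diagram of a window *)

Section Generation.
Local Open Scope classical_set_scope.
Local Open Scope ring_scope.
Variables (R : realType) (m' : nat) (gamma : R) (th : 'I_m'.+2 -> R) (E : set R[i]) (up : bool).
Local Notation m := m'.+2.
Local Notation vtt := (vt gamma th).
Hypothesis numE : ccw_numbering (cis gamma) th E.
Variables (w : 'I_m -> R -> R) (ov : 'I_m -> 'I_m -> R -> Prop).
Hypothesis hc : forall i, {within `[0, 1], continuous (w i)}.
Hypothesis cD : cyl_diagram true E (angle_diagram w ov).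

Section Window.
Variables t1 c t2 : R.
Hypothesis W : window w t1 c t2.
Hypotheses (ap1 : apart (w^~ t1)) (ap2 : apart (w^~ t2)).
Local Notation pr := (partner w c).
Local Notation J := (winding_index (w^~ t1)).
Local Notation kap := (jump w t1 t2).

Lemma window_swap : swap_data J kap pr.
Proof.
split.
- by move=> a b k; apply: index_inj.
- move=> a; have [pa|pa] := eqVneq (pr a) a; first by rewrite pa !(jump0 cD W pa) oppr0.
  have [k0 [s fl]] := window_flips W pa; have [-> ->] := jump_flips cD W fl.
  by case: s {fl}; rewrite ?opprK.
- move=> a; have [pa|pa] := eqVneq (pr a) a; first by rewrite (jump0 cD W pa) normr0.
  have [k0 [s fl]] := window_flips W pa; have [-> _] := jump_flips cD W fl.
  by case: s {fl}; rewrite ?normrN normr1.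
- move=> a; have [pa|pa] := eqVneq (pr a) a.
    by exists 0; rewrite pa (jump0 cD W pa) mul0r !addr0.
  have [k0 [s fl]] := window_flips W pa; exists k0.
  by rewrite (index_partner cD W pa fl) /jump [J a + _]addrC subrK.
Qed.

Lemma jumpK a : J a + kap a = winding_index (w^~ t2) a.
Proof. by rewrite /jump addrC subrK. Qed.

(** For strands which do not meet, the order is the same at both ends of the window and convexity
    settles the times between. For partners the difference of the angles is, up to full turns, 1 - 2
    s times a distance of neighbouring endpoints, and changes sign at 1/2 as the lifts of [w] do at
    c. *)
Lemma swap_order s : 0 <= s <= 1 ->
  same_order (w^~ (if s < 2^-1 then t1 else if s == 2^-1 then c else t2)) (fun a => ang gamma th J kap a s).
Proof.
move=> sI i j k; set t := if _ then _ else _; have [<-|ij] := eqVneq i j; first by rewrite !ltrDl.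
have tI : t1 <= t <= t2 by rewrite /t; do 2?case: ifP => _; rewrite ?(t1_in W) ?(c_in W) ?(t2_in W).
have [jp|jp] := eqVneq j (pr i); last first.
  have [_ st] := window_pair cD W ij jp; rewrite st // /ang !jumpK.
  have := index_order numE ap1 i j k; have := index_order numE ap2 i j k; rewrite !st ?(t1_in W) ?(t2_in W) //.
  set P := _ * (2 * pi); set A := vtt (J i); set B := vtt (J j); set A' := vtt (winding_index _ i); set B' := vtt (winding_index _ j).
  case: (w i c < w j c + P) => /esym h1 /esym h2; apply/esym.
    have := mix_gt0 sI (_ : 0 < B + P - A) (_ : 0 < B' + P - A').
    by rewrite !subr_gt0 => /(_ h2 h1); lra.
  move/negbT: h1; move/negbT: h2; rewrite -!leNgt => h2 h1; apply/negbTE; rewrite -leNgt; case/andP: sI => s0 s1.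
  have : 0 <= (1 - s) * (A - (B + P)) by rewrite mulr_ge0 // subr_ge0.
  have : 0 <= s * (A' - (B' + P)) by rewrite mulr_ge0 // subr_ge0.
  lra.
have pi' : pr i != i by rewrite -jp eq_sym.
have [k0 [b fl]] := window_flips W pi'; have [kE kE'] := jump_flips cD W fl.
have iE := index_partner cD W pi' fl; rewrite -jp in fl iE.
set de := vtt (J i + kap i) - vtt (J i).
have -> : (ang gamma th J kap i s < ang gamma th J kap j s + k%:~R * (2 * pi)) =
    (0 < (1 - 2 * s) * de + (k + k0)%:~R * (2 * pi)).
  rewrite -subr_gt0; congr (0 < _); rewrite /ang iE -jumpK jp kE'.
  have -> : J i + kap i + k0 * m + (if b then 1 else -1) = J i + k0 * m.
    by rewrite kE; case: (b); ring.
  by rewrite !vt_period intrD /de; ring.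
have de2 : `|de| < 2 * pi.
  rewrite ltr_norml; have [h1 h2] : J i + kap i < J i + m /\ J i < J i + kap i + m.
    by rewrite kE; case: (b); split; lia.
  have := vt_period gamma th (J i) 1; have := vt_period gamma th (J i + kap i) 1.
  move: h1 h2; rewrite !mul1r -!(ltr_vt numE) /de => h1 h2 e1 e2; rewrite e1 in h2; rewrite e2 in h1.
  by apply/andP; split; lra.
have sde : `|(1 - 2 * s) * de| < 2 * pi.
  rewrite normrM; apply: le_lt_trans de2; rewrite ler_piMl // ler_norml; case/andP: sI => *; apply/andP; split; lra.
rewrite (shift_gt0 _ sde).
have de0 : (0 < de) = ~~ b /\ (de < 0) = b.
  by rewrite /de subr_gt0 subr_lt0 !(ltr_vt numE) ltrDl gtrDl kE; case: (b).
have [tc|tc] := eqVneq t c.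
  have s2 : s = 2^-1.
    move: tc; rewrite /t; case: ifP => _ h; first by have := t1c W; rewrite h eqxx.
    by move: h; case: eqP => // _ h; have := t2c W; rewrite h eqxx.
  rewrite tc s2 mulfV // subrr mul0r ltxx andbF orbF; have [-> _] := fl.
  by rewrite -addrA ltrDl -mulrDl -intrD pmulr_lgt0 ?twopi_gt0 // ltr0z addrC.
rewrite (flips_order _ fl tI tc); congr (_ || (_ && _)).
move: tc; rewrite /t; have [hs|hs|->] := ltgtP s 2^-1; rewrite ?eqxx // => _.
  by rewrite (ct1 W) addbF pmulr_rgt0; [case: de0|lra].
by rewrite (ct2 W) addbT negbK nmulr_rgt0; [case: de0|lra].
Qed.

End Window.
End Generation.

(** * Piecewise linear changes of time *)

Section Ramps.
Local Open Scope classical_set_scope.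
Local Open Scope ring_scope.
Variable R : realType.
Implicit Types t : R.

Lemma lo_cont : continuous (@lo R).
Proof.
move=> x; apply: cvgM; last exact: cvg_cst.
apply: cvgB; first by apply: cvgD; [apply: cvgM; [exact: cvg_cst|exact: cvg_id]|exact: cvg_cst].
apply: cvg_norm; apply: cvgB; last exact: cvg_cst.
by apply: cvgM; [exact: cvg_cst|exact: cvg_id].
Qed.

Lemma hi_cont : continuous (@hi R).
Proof.
move=> x; apply: cvgM; last exact: cvg_cst.
apply: cvgD.
  by apply: cvgB; [apply: cvgM; [exact: cvg_cst|exact: cvg_id]|exact: cvg_cst].
apply: cvg_norm; apply: cvgB; last exact: cvg_cst.
by apply: cvgM; [exact: cvg_cst|exact: cvg_id].
Qed.

Lemma lo0 : lo 0 = 0 :> R. Proof. by rewrite loE half_ge0 mulr0. Qed.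
Lemma hi0 : hi 0 = 0 :> R. Proof. by rewrite hiE half_ge0. Qed.
Lemma lo1 : lo 1 = 1 :> R. Proof. by rewrite loE half_lt1. Qed.
Lemma hi1 : hi 1 = 1 :> R. Proof. by rewrite hiE half_lt1 two_sub1. Qed.

Lemma lo_in t : 0 <= t <= 1 -> 0 <= lo t <= 1.
Proof. by move=> /andP[h1 h2]; rewrite loE; case: (leP t 2^-1) => h; apply/andP; split; lra. Qed.

Lemma hi_in t : 0 <= t <= 1 -> 0 <= hi t <= 1.
Proof. by move=> /andP[h1 h2]; rewrite hiE; case: (leP t 2^-1) => h; apply/andP; split; lra. Qed.

Lemma lo_mono (s t : R) : s <= t -> lo s <= lo t.
Proof. by move=> st; rewrite !loE; case: (leP s) => h; case: (leP t) => h'; lra. Qed.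

Lemma hi_mono (s t : R) : s <= t -> hi s <= hi t.
Proof. by move=> st; rewrite !hiE; case: (leP s) => h; case: (leP t) => h'; lra. Qed.

Lemma lo_ge t : 2^-1 <= t -> lo t = 1.
Proof. by rewrite loE le_eqVlt => /orP[/eqP <-|h]; [rewrite lexx mulfV|rewrite leNgt h]. Qed.

End Ramps.

Section Clock.
Local Open Scope ring_scope.
Variables (R : realType) (t1 c t2 : R).
Hypotheses (t10 : 0 <= t1) (t1c : t1 < c) (ct2 : c < t2).

Let i2 := (2 * t2)^-1.
Let A := t1 * i2.
Let B := (c - t1) * i2.
Let C := 1 - c * i2.

(* Chosen so that [lo (clock t) * t2] runs from 0 to [t1] on [0, 1/4], waits until 1/2, is [c] at
   3/4 and arrives at [t2] before time 1. *)
Definition clock t := A * lo (lo t) + B * lo (hi t) + C * hi (hi t).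

Let t20 : 0 < t2. Proof. exact: le_lt_trans t10 (lt_trans t1c ct2). Qed.

Let i2E : 2 * (i2 * t2) = 1.
Proof. by rewrite mulrCA mulVf // mulf_neq0 // ?pnatr_eq0 // gt_eqF. Qed.

Let i20 : 0 < i2. Proof. by rewrite invr_gt0 mulr_gt0. Qed.

Let AE : 2 * A * t2 = t1.
Proof. by rewrite /A; transitivity (t1 * (2 * (i2 * t2))); [ring|rewrite i2E mulr1]. Qed.

Let BE : 2 * B * t2 = c - t1.
Proof. by rewrite /B; transitivity ((c - t1) * (2 * (i2 * t2))); [ring|rewrite i2E mulr1]. Qed.

Let A0 : 0 <= A. Proof. by rewrite mulr_ge0 // ltW. Qed.

Let B0 : 0 < B. Proof. by rewrite mulr_gt0 // subr_gt0. Qed.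

Let ABC : A + B + C = 1. Proof. by rewrite /A /B /C; ring. Qed.

(** Hence A + B < 1/2: when the time c is reached, [lo] is still running and the truncated diagram
    still follows [w]. *)
Let C2 : 2^-1 < C.
Proof.
have : c * i2 < t2 * i2 by rewrite ltr_pM2r.
by rewrite /C; move: i2E; rewrite [i2 * t2]mulrC; set X := t2 * i2; lra.
Qed.

Let AB2 : A + B < 2^-1. Proof. by move: ABC C2; lra. Qed.

Lemma clock_cont : continuous clock.
Proof.
have cc (f g : R -> R) : continuous f -> continuous g -> continuous (fun t => f (g t)).
  by move=> cf cg x; apply: (@continuous_comp _ _ _ g f); [exact: cg|exact: cf].
move=> x; apply: cvgD; [apply: cvgD|]; apply: cvgM; try exact: cvg_cst.
- exact: (cc _ _ (@lo_cont R) (@lo_cont R)).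
- exact: (cc _ _ (@lo_cont R) (@hi_cont R)).
- exact: (cc _ _ (@hi_cont R) (@hi_cont R)).
Qed.

Lemma clock0 : clock 0 = 0. Proof. by rewrite /clock hi0 !lo0 hi0 !mulr0 !addr0. Qed.

Lemma clock1 : clock 1 = 1. Proof. by rewrite /clock hi1 !lo1 hi1 !mulr1. Qed.

Lemma clock_mono s t : s <= t -> clock s <= clock t.
Proof.
move=> st; apply: lerD; first apply: lerD.
- by rewrite ler_wpM2l // !lo_mono.
- by apply: ler_wpM2l; [exact: ltW|exact/lo_mono/hi_mono].
- by apply: ler_wpM2l; [move: C2; lra|exact/hi_mono/hi_mono].
Qed.

Lemma clock_in t : 0 <= t <= 1 -> 0 <= clock t <= 1.
Proof. by move=> /andP[h1 h2]; rewrite -[X in X <= _]clock0 -clock1 !clock_mono. Qed.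

Let clock_loE t : t <= 2^-1 -> clock t = A * lo (2 * t).
Proof.
move=> ht; have h : lo t = 2 * t by rewrite loE ht.
by rewrite /clock [hi t]hiE ht lo0 hi0 h !mulr0 !addr0.
Qed.

Let clock_hiE t : 2^-1 < t -> clock t = A + B * lo (2 * t - 1) + C * hi (2 * t - 1).
Proof. by move=> ht; rewrite /clock (lo_ge (ltW ht)) [hi t]hiE leNgt ht /= lo1 mulr1. Qed.

Lemma clock_lo t : 0 <= t <= 2^-1 -> lo (clock t) * t2 = lo (2 * t) * t1.
Proof.
move=> /andP[ta tb]; have lI := lo_in (half_le_in ta tb); rewrite clock_loE // [lo (A * _)]loE.
have -> : A * lo (2 * t) <= 2^-1 by case/andP: lI => la lb; move: A0 B0 AB2 la lb; nra.
by rewrite -[in RHS]AE; ring.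
Qed.

Lemma clock_hi t : 2^-1 < t <= 1 -> let s := 2 * t - 1 in
  (s < 2^-1 -> t1 <= lo (clock t) * t2 /\ lo (clock t) * t2 < c) /\
  (s = 2^-1 -> lo (clock t) * t2 = c) /\
  (2^-1 < s -> c < lo (clock t) * t2 /\ lo (clock t) * t2 <= t2).
Proof.
move=> /andP[ta tb] s; rewrite clock_hiE // -/s; split; [|split].
- move=> hs; have s0 : 0 <= s by rewrite /s; move: ta; lra.
  rewrite [lo s]loE [hi s]hiE (ltW hs) mulr0 addr0 [lo _]loE.
  have -> : A + B * (2 * s) <= 2^-1 by move: B0 AB2 s0 hs; nra.
  have -> : 2 * (A + B * (2 * s)) * t2 = 2 * A * t2 + 2 * B * t2 * (2 * s) by ring.
  by rewrite AE BE; move: s0 hs t1c; split; nra.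
- move=> ->; rewrite [lo 2^-1]loE [hi 2^-1]hiE lexx mulr0 addr0 mulfV // mulr1 loE (ltW AB2).
  by rewrite mulrDr mulrDl AE BE; ring.
- move=> hs; rewrite [lo s]loE [hi s]hiE [s <= _]leNgt hs /= mulr1 loE.
  have s1 : s <= 1 by rewrite /s; move: tb; lra.
  case: (leP (A + B + C * (2 * s - 1)) 2^-1) => h3; last by rewrite mul1r.
  split; last by rewrite -[leRHS]mul1r ler_wpM2r ?(ltW t20) //; move: h3; lra.
  have -> : 2 * (A + B + C * (2 * s - 1)) * t2 = 2 * A * t2 + 2 * B * t2 + 2 * (C * (2 * s - 1)) * t2 by ring.
  rewrite AE BE addrCA subrr addr0 ltrDl mulr_gt0 // mulr_gt0 // mulr_gt0 //.
    by move: C2; lra.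
  by move: hs; lra.
Qed.

Let sq (q : R) : 0 < `|q| -> 0 < q * q.
Proof. by move=> q0; rewrite -expr2 lt_neqAle eq_sym sqrf_eq0 -normr_gt0 q0 sqr_ge0. Qed.

Lemma clock_inc_lo t : t1 != 0 -> 2 * t < 2^-1 -> exists2 e : R, 0 < e &
  forall q, 0 < `|q| < e -> 0 < q * (clock (t + q) - clock t).
Proof.
move=> t1n ht.
have A1 : 0 < A by rewrite mulr_gt0 // lt_neqAle eq_sym t1n.
exists (4^-1 - t); first by move: ht; lra.
move=> q /andP[q0]; rewrite ltr_norml => /andP[q1 q2].
rewrite !clock_loE; [|by move: q2; lra|by move: ht; lra].
rewrite !loE (ltW ht) (_ : 2 * (t + q) <= 2^-1); last by move: q2; lra.
by move: (mulr_gt0 (sq q0) A1); lra.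
Qed.

(** 3/4 is the moment at which the window reaches c, the only one in the second half at which
    strands can meet. The slopes on its two sides differ, but both are positive. *)
Lemma clock_inc_hi : exists2 e : R, 0 < e &
  forall q, 0 < `|q| < e -> 0 < q * (clock (3 / 4 + q) - clock (3 / 4)).
Proof.
exists 4^-1; first by lra.
move=> q /andP[q0]; rewrite ltr_norml => /andP[q1 q2].
rewrite !clock_hiE; [|by move: q1; lra|by lra].
rewrite [lo (2 * (3 / 4) - 1)]loE [hi (2 * (3 / 4) - 1)]hiE (_ : 2 * (3 / 4) - 1 <= 2^-1); last by lra.
rewrite loE hiE; case: (leP (2 * (3 / 4 + q) - 1) 2^-1) => h3.
  by move: (mulr_gt0 (sq q0) B0); lra.
have qp : 0 < q by move: h3; lra.
by have := mulr_gt0 qp (lt_trans (_ : 0 < 2^-1) C2); rewrite invr_gt0 ltr0n => /(_ isT); move: (mulr_gt0 qp qp); nra.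
Qed.

End Clock.

(** * Truncated diagrams and induction over the windows *)

Section Truncation.
Local Open Scope classical_set_scope.
Local Open Scope ring_scope.
Variables (R : realType) (m' : nat) (gamma : R) (th : 'I_m'.+2 -> R) (E : set R[i]) (up : bool).
Local Notation m := m'.+2.
Local Notation vtt := (vt gamma th).
Hypothesis numE : ccw_numbering (cis gamma) th E.
Variables rho rho' : diagram R m -> 'M[laurent]_m.
Hypotheses (hrho : is_rho up (cis gamma) th E rho) (hrho' : is_rho up (cis gamma) th E rho').
Local Notation agree := (agree E rho rho').
Variables (w : 'I_m -> R -> R) (ov : 'I_m -> 'I_m -> R -> Prop).
Hypothesis hc : forall i, {within `[0, 1], continuous (w i)}.
Hypothesis cD : cyl_diagram true E (angle_diagram w ov).

(** Cut at time t, the strands do not stand at endpoints. Sliding each of them to the endpoint given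
    by its index keeps their order and completes the piece to a diagram. *)
Definition trunc (t : R) (a : 'I_m) (r : R) : R :=
  w a (lo r * t) + hi r * (vtt (winding_index (w^~ t) a) - w a t).

Definition trunc_diagram (t : R) := angle_diagram (trunc t) (fun i j r => ov i j (lo r * t)).

Lemma lo_scale (t r : R) : 0 <= t <= 1 -> 0 <= r <= 1 -> 0 <= lo r * t <= 1.
Proof.
move=> /andP[t0 t1] /lo_in/andP[h1 h2]; rewrite mulr_ge0 //=.
by rewrite -[leRHS]mulr1 ler_pM.
Qed.

Lemma trunc_order t r : 0 <= r <= 1 -> apart (w^~ t) -> same_order (w^~ (lo r * t)) (fun a => trunc t a r).
Proof.
move=> rI ap; rewrite /trunc loE; have hI := hi_in rI; case: leP => h.
  by move=> i j k; rewrite hiE h !mul0r !addr0.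
rewrite mul1r; exact: (mix_order hI (index_order numE ap)).
Qed.

Lemma trunc_continuous t a : 0 <= t <= 1 -> {within `[0, 1], continuous (trunc t a)}.
Proof.
move=> tI x; apply: cvgD; last first.
  apply: cvgM; last exact: cvg_cst.
  by move: x; apply: continuous_subspaceT; apply: hi_cont.
move: x; apply/within_itvP => r rI e e0; have /within_itvP ca := @hc a.
have cl : {within `[0, 1], continuous (fun r : R => lo r * t)}.
  apply: continuous_subspaceT => x; apply: cvgM; last exact: cvg_cst.
  exact: lo_cont.
move/within_itvP: cl => cl.
have [d d0 hd] := ca _ (lo_scale tI rI) e e0; have [d' d'0 hd'] := cl r rI d d0.
by exists d' => // r' r'I hr; apply: hd; [exact: lo_scale|exact: hd'].
Qed.

Lemma trunc0 t a : trunc t a 0 = w a 0.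
Proof. by rewrite /trunc lo0 hi0 !mul0r addr0. Qed.

Lemma trunc1 t a : trunc t a 1 = vtt (winding_index (w^~ t) a).
Proof. by rewrite /trunc lo1 hi1 !mul1r addrC subrK. Qed.

Lemma trunc_meet t r i j : 0 <= t <= 1 -> apart (w^~ t) -> meet (trunc_diagram t) i j r ->
  meet (angle_diagram w ov) i j (lo r * t) /\ r < 2^-1.
Proof.
move=> tI ap [rI ij /= h]; have h' := same_order_cis (same_order_sym (trunc_order rI ap)) h.
split; first by split=> //; exact: lo_scale.
rewrite ltNge; apply/negP => h2; apply: (ap i j ij); move: h'.
by rewrite lo_ge // mul1r.
Qed.

Lemma trunc_cyl t : 0 <= t <= 1 -> apart (w^~ t) -> cyl_diagram true E (trunc_diagram t).
Proof.
move=> tI ap; have [pD gD _] := cD; have [_ _ hE [i0 i1] _] := pD.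
have ap1 : apart (fun a => trunc t a 1).
  apply: same_order_apart (trunc_order (unit1 R) ap) _; by rewrite lo1 mul1r.
have pT : prediagram E (trunc_diagram t).
  apply: lift_prediagram.
  - by move=> i; apply: trunc_continuous.
  - by move=> i; rewrite trunc0 trunc1; split; [have [] := hE i|apply: cis_vt_in numE _].
  - by move=> i j ij; split; [rewrite !trunc0 => h; case/eqP: ij; exact: i0|exact: ap1].
  - move=> i j r rI /(lift_ov pD (lo_scale tI rI))[ij h no]; split=> //.
    exact: (same_order_cis (trunc_order rI ap) h).
split=> //; last by left.
apply: lift_generic pT (fun i => @trunc_continuous t i tI) _ => i j r k rI ij Ek.
have rI' : 0 <= r <= 1 by case/andP: rI => *; rewrite !ltW.
have mE : cis (trunc t i r) = cis (trunc t j r).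
  by move/eqP: Ek; rewrite subr_eq => /eqP ->; rewrite addrC cis_period.
have [me r2] : meet (angle_diagram w ov) i j (lo r * t) /\ r < 2^-1 by apply: trunc_meet.
have so := same_order_sym (trunc_order rI' ap); have sI := meet_interior pD me.
have sI' := lo_scale tI rI'; have [_ _ /= mE'] := me.
have Ek' : w j (lo r * t) - w i (lo r * t) = k%:~R * (2 * pi).
  by apply/eqP; rewrite subr_eq addrC; apply/eqP/(same_order_eq so); rewrite -Ek /= addrC subrK.
split=> [l lE|].
  by apply: (lift_nd gD pD sI' ij mE'); apply: same_order_cis so lE.
have [_ /(lift_crosses _ (@hc i) (@hc j) sI Ek') xi] := gD _ _ _ me.
have t0 : 0 < t.
  rewrite lt_neqAle; case/andP: tI => -> _; rewrite andbT; apply/eqP => t0.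
  by move: sI; rewrite -t0 mulr0 ltxx.
have := @xing_comp _ (fun s => w j s - w i s - k%:~R * (2 * pi)) (fun r => lo r * t) r _ rI _ xi.
move=> xc; apply: xing_sign (xc _ _) => //.
- move=> s sI2; have so2 := trunc_order sI2 ap; have := so2 i j (- k); have := so2 j i k.
  rewrite mulrNz mulNr !subr_gt0 !subr_lt0 !ltrBrDr !ltrBlDr.
  by rewrite ![_ + w _ _]addrC ![_ + trunc _ _ _]addrC => <- <-.
- apply: continuous_subspaceT => x; apply: cvgM; last exact: cvg_cst.
  exact: lo_cont.
- exists (2^-1 - r); first by rewrite subr_gt0.
  move=> q /andP[q0]; rewrite ltr_norml => /andP[q1 q2].
  rewrite !loE (ltW r2); have -> : r + q <= 2^-1 by lra.
  have qq : 0 < q * q by rewrite -expr2 lt_neqAle eq_sym sqrf_eq0 -normr_gt0 q0 sqr_ge0.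
  have := mulr_gt0 qq t0; nra.
Qed.

Section Step.
Variables t1 c t2 : R.
Hypothesis W : window w t1 c t2.
Hypotheses (ap1 : apart (w^~ t1)) (ap2 : apart (w^~ t2)).
Local Notation pr := (partner w c).
Local Notation J := (winding_index (w^~ t1)).
Local Notation kap := (jump w t1 t2).

Definition typ (i j : 'I_m) := ov i j c.

Lemma typ_asym i j : typ i j -> ~ typ j i.
Proof.
have [pD _ _] := cD; have cI := window_in W (c_in W).
by move=> /(lift_ov pD cI)[].
Qed.

Lemma apart_near t : t1 <= t <= t2 -> t != c -> apart (w^~ t).
Proof.
move=> /andP[h1 h2]; rewrite neq_lt => /orP[h|h].
  exact: same_order_apart (window_before W h1 h) ap1.
exact: same_order_apart (window_after W h h2) ap2.
Qed.

(** The truncation at t2 is equivalent to the truncation at t1 followed by the swap diagram of the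
    window: the intermediate slide to endpoints does not change the order of the strands. *)
Lemma agree_step : agree (trunc_diagram t1) -> agree (trunc_diagram t2).
Proof.
move=> a1; have [t10 /andP[h1 h2] t21 _] := W; have [pD gD _] := cD.
have t20 : 0 < t2 by lra.
have t2I : 0 <= t2 <= 1 by rewrite ltW.
have t1I : 0 <= t1 <= 1 by rewrite t10 /=; lra.
pose phi := clock t1 c t2.
have time_lo := clock_lo t10 h1 h2; have time_hi := clock_hi t10 h1 h2.
apply: (@agree_order_cat R m' gamma th E up numE rho rho' hrho hrho' (trunc t2) _ phi
  (trunc t1) (fun i j r => ov i j (lo r * t1)) (fun a s => ang gamma th J kap a s)
  (fun i j s => [/\ j = pr i, kap i != 0, s = 2^-1 & typ i j])) => //.
- by move=> i; apply: trunc_continuous.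
- exact: trunc_cyl.
- by apply: continuous_subspaceT; exact: clock_cont.
- exact: clock0.
- exact: clock1.
- by move=> s t s0 st t1'; apply: clock_mono.
- move=> i j t tI /(trunc_meet t2I ap2)[me ph2].
  have [_ ij /= mE] := me; case/andP: tI => ta tb.
  have [ht|ht] := leP t 2^-1.
    apply: clock_inc_lo => //.
      apply/eqP => t1E; apply: (ap1 ij); move: mE; rewrite time_lo ?(ltW ta) //.
      by rewrite t1E mulr0.
    rewrite ltNge; apply/negP => h3; apply: (ap1 ij); move: mE; rewrite time_lo ?(ltW ta) //.
    by rewrite lo_ge // mul1r.
  (* The truncation has a meeting at time [phi t], so [w] has one at the corresponding time in the
     window, which must be c. *)
  have t4 : t = 3 / 4.
    have tI2 : 2^-1 < t <= 1 by rewrite ht ltW.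
    have [k1 [k2 k3]] := time_hi t tI2.
    have [hs|hs|hs] := ltgtP (2 * t - 1) 2^-1; last by lra.
      have [l1 l2] := k1 hs; case: (@apart_near (lo (phi t) * t2) _ _ i j ij mE).
        by rewrite l1 /=; lra.
      by rewrite lt_eqF.
    have [l1 l2] := k3 hs; case: (@apart_near (lo (phi t) * t2) _ _ i j ij mE).
      by rewrite l2 andbT; lra.
    by rewrite gt_eqF.
  by rewrite t4; apply: clock_inc_hi.
- by move=> i; apply: trunc_continuous.
- move=> i; apply: continuous_subspaceT => x; apply: cvgD; first exact: cvg_cst.
  by apply: cvgM; [exact: cvg_cst|exact: cvg_id].
- by move=> i; rewrite !trunc0.
- by move=> i; rewrite trunc1 /ang mulr1 addrC subrK jumpK.
- by move=> i; rewrite trunc1 /ang mulr0 addr0.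
- move=> t tI; have tI' : 0 <= 2 * t <= 1 by apply: half_le_in; case/andP: tI.
  have phI : 0 <= phi t <= 1 by apply: clock_in => //; case/andP: tI => a b; apply/andP; split; lra.
  apply: same_order_trans (same_order_sym (trunc_order phI ap2)) _.
  by rewrite time_lo //; apply: trunc_order.
- move=> t tI; have /andP[ta tb] := tI; have sI := half_gt_in tb ta.
  have phI : 0 <= phi t <= 1 by apply: clock_in => //; apply/andP; split; lra.
  apply: same_order_trans (same_order_sym (trunc_order phI ap2)) _.
  apply: same_order_trans (swap_order numE cD W ap1 ap2 sI).
  have [k1 [k2 k3]] := time_hi t tI.
  case: (ltgtP (2 * t - 1) 2^-1) k1 k2 k3 => hs k1 k2 k3.
  + by have [l1 l2] := k1 isT; exact: (same_order_sym (window_before W l1 l2)).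
  + by have [l1 l2] := k3 isT; exact: (same_order_sym (window_after W l1 l2)).
  + by rewrite k2.
- by move=> i j t tI; rewrite time_lo.
- move=> i j t tI; have [k1 [k2 k3]] := time_hi t tI.
  have no (s : R) : t1 <= s <= t2 -> s != c -> ~ ov i j s.
    move=> sI sc /(lift_ov pD (window_in W sI))[ij mE _].
    exact: (apart_near sI sc ij mE).
  case: (ltgtP (2 * t - 1) 2^-1) k1 k2 k3 => hs k1 k2 k3.
  + have [l1 l2] := k1 isT; split=> [[_ _ h3]|/no[]]; first by rewrite h3 ltxx in hs.
      by rewrite l1 /=; lra.
    by rewrite lt_eqF.
  + have [l1 l2] := k3 isT; split=> [[_ _ h3]|/no[]]; first by rewrite h3 ltxx in hs.
      by rewrite l2 andbT; lra.
    by rewrite gt_eqF.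
  + rewrite k2 //; split=> [[]//|o]; have [ij mE _] := lift_ov pD (window_in W (c_in W)) o.
    have jp : j = pr i.
      apply/eqP/negPn/negP => jp; rewrite eq_sym in ij.
      by case: (partner_neq cD W ij jp); rewrite mE.
    split=> //; have pi : pr i != i by rewrite -jp eq_sym.
    have [k0 [b fl]] := window_flips W pi; have [-> _] := jump_flips cD W fl.
    by case: (b).
- exact: (agree_swapping numE hrho hrho' (window_swap cD W ap1) typ_asym).
Qed.

End Step.

Lemma lift_ends_vt (a : 'I_m) (t : R) : E (cis (w a t)) -> exists k : int, w a t = vtt k.
Proof.
move=> /(pos_onto numE)[p]; rewrite /pos -cisD => /cis_eqP[k ->].
by exists ((p : int) + k * m); rewrite vt_period /vt res_ord divz_small ?ltz_nat ?ltn_ord // mul0r addr0.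
Qed.

Lemma spread_ends (t : R) (K : 'I_m -> int) : apart (w^~ t) -> (forall a, w a t = vtt (K a)) -> spread K.
Proof.
move=> ap hK a b k h; apply/eqP/negPn/negP => ab; apply: (ap _ _ ab).
by rewrite /= !hK h vt_period cis_period.
Qed.

Lemma apart0 : apart (w^~ 0).
Proof. by have [[_ _ _ [i0 _] _] _ _] := cD => i j ij h; case/eqP: ij; exact: i0. Qed.

Lemma apart1 : apart (w^~ 1).
Proof. by have [[_ _ _ [_ i1] _] _ _] := cD => i j ij h; case/eqP: ij; exact: i1. Qed.

Lemma ends_vt : exists K0 K1 : 'I_m -> int, (forall a, w a 0 = vtt (K0 a)) /\ (forall a, w a 1 = vtt (K1 a)).
Proof.
have [[_ _ hE _ _] _ _] := cD.
have /fin_all_exists[K0 h0] : forall a, exists k : int, w a 0 = vtt k.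
  by move=> a; apply: lift_ends_vt; have [] := hE a.
have /fin_all_exists[K1 h1] : forall a, exists k : int, w a 1 = vtt k.
  by move=> a; apply: lift_ends_vt; have [] := hE a.
by exists K0, K1.
Qed.

(** At time 0 the strands stand at endpoints, which the index numbers only up to a shift, so the
    slide is a rotation. *)
Lemma agree_start : agree (trunc_diagram 0).
Proof.
have [K0 [_ [h0 _]]] := ends_vt; have sK := spread_ends apart0 h0; have [pD _ _] := cD.
have [sh hsh] := index_vt numE sK.
have E0 : (fun a => w a 0) = (fun a => vtt (K0 a)) by apply/funext.
have ar := agree_rot numE hrho hrho' sh sK.
have at_ : agree (angle_diagram (trunc 0) (fun _ _ _ => False)).
  apply: (agree_order hrho hrho' _ _ _ _ _ ar).
  - by move=> i; apply: line_continuous.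
  - by move=> i; apply: trunc_continuous; apply: unit0.
  - by move=> i; rewrite trunc0 mul0r addr0 h0.
  - by move=> i; rewrite trunc1 E0 hsh mul1r [RHS]addrC subrK.
  - move=> t tI; apply: same_order_trans (trunc_order tI apart0); rewrite mulr0 E0.
    exact: (same_order_sym (rot_order numE K0 sh tI)).
apply: (agree_same hrho hrho' at_) => t tI; split=> [//|i j] /=; rewrite mulr0; split=> //.
by move=> /(lift_ov pD (unit0 R))[ij h _]; apply: (apart0 ij).
Qed.

Lemma apart_punctured x : 0 <= x <= 1 ->
  exists2 d : R, 0 < d & forall t, 0 <= t <= 1 -> 0 < `|t - x| < d -> apart (w^~ t).
Proof.
move=> xI; have [|p|d d0 hd] := @fin_exists_pos R _ (fun (p : 'I_m * 'I_m) e => p.1 != p.2 ->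
    forall t, 0 <= t <= 1 -> 0 < `|t - x| < e -> cis (w p.1 t) <> cis (w p.2 t)).
- move=> p e e' /andP[e'0 ee'] h ij t tI /andP[a1 a2]; apply: h => //.
  by rewrite a1 (lt_le_trans a2).
- have [->|ij] := eqVneq p.1 p.2; first by exists 1.
  have [mE|ne] := pselect (cis (w p.1 x) = cis (w p.2 x)); last first.
    have [e e0 he] := steady_near hc xI ne; exists e => // _ t tI /andP[_ a2].
    by have [] := he t tI a2.
  have [e e0 [k0 [s [_ he]]]] := flips_near hc cD xI ij mE; exists e => // _ t tI /andP[a1 a2] h.
  have [|g1 g2 _] := he t tI a2; first by rewrite -subr_eq0 -normr_gt0.
  case/eqP: g2; apply: cis_eq1_small g1 _.
  by rewrite -mulNr -mulrNz cis_period cisB h divff // cis_neq0.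
by exists d => // t tI tx i j ij; apply: (hd (i, j)).
Qed.

(** The induction concerns all times up to t at which strands are apart. A time of meeting yields no
    truncated diagram and has to be stepped over. *)
Lemma agree_trunc t : 0 <= t <= 1 -> apart (w^~ t) -> agree (trunc_diagram t).
Proof.
move=> tI; suff : forall s, 0 <= s <= t -> apart (w^~ s) -> agree (trunc_diagram s).
  by apply; case/andP: tI => -> _ /=.
move: t tI; apply: unit_interval_ind => [x xI|s /andP[s0 s0'] _]; last first.
  by have -> : s = 0; [apply/eqP; rewrite eq_le s0 s0'|exact: agree_start].
have [e e0 he] := local_window hc cD xI.
have step t1 t2 : 0 <= t1 -> t2 <= 1 -> `|t1 - x| < e -> `|t2 - x| < e -> t1 < t2 ->
    apart (w^~ t1) -> apart (w^~ t2) -> agree (trunc_diagram t1) -> agree (trunc_diagram t2).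
  move=> a1 a2 a3 a4 a5 p1 p2; have [c W] := he _ _ a1 a2 a3 a4 a5 p1 p2.
  exact: agree_step W p1 p2.
have [d d0 hd] := apart_punctured xI.
exists (Num.min e d); first by rewrite lt_min e0.
move=> s s' sI s'I; rewrite !lt_min => /andP[b1 b2] /andP[b3 b4] Ps r /andP[r0 rs'] apr.
have [rs|sr] := leP r s; first by apply: Ps => //; rewrite r0.
have rI : 0 <= r <= 1 by rewrite r0; case/andP: s'I => _; apply: le_trans.
have rx : `|r - x| < e.
  by move: b1 b3; rewrite !ltr_norml => /andP[? ?] /andP[? ?]; apply/andP; split; lra.
have [aps|naps] := pselect (apart (w^~ s)).
  apply: (step s r) => //; try by case/andP: sI; case/andP: rI.
  by apply: Ps => //; rewrite lexx; case/andP: sI => ->.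
have sx : s = x.
  apply/eqP/negPn/negP => sx; apply: naps; apply: hd => //; by rewrite normr_gt0 subr_eq0 sx.
have s0 : 0 < s.
  rewrite lt_neqAle; case/andP: sI => -> _; rewrite andbT; apply/eqP => s0.
  by apply: naps; rewrite -s0; exact: apart0.
(* Here strands meet at s, which forces s = x; the window then starts slightly earlier, at [q],
   where the strands are apart. *)
pose q := Num.max 0 (s - Num.min e d / 2).
have qE : q = 0 \/ q = s - Num.min e d / 2 by rewrite /q; case: leP; [right|left].
have ed : 0 < Num.min e d by rewrite lt_min e0.
have q0 : 0 <= q by rewrite /q le_max lexx.
have qs : q < s by rewrite /q gt_max s0 /=; lra.
have qx : `|q - x| < Num.min e d.
  have : s - Num.min e d / 2 <= q by rewrite /q le_max lexx orbT.
  by rewrite -sx ltr_norml => ?; apply/andP; split; lra.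
move: (qx); rewrite lt_min => /andP[qe qd].
have apq : apart (w^~ q).
  apply: hd; first by rewrite q0 /=; case/andP: sI => _ ?; lra.
  by rewrite normr_gt0 subr_eq0 -sx lt_eqF //= sx.
apply: (step q r) => //; try by case/andP: rI.
  by lra.
by apply: Ps => //; rewrite q0 ltW.
Qed.

(** Even at time 1 the truncation slides the strands, from the endpoints [K1] to those shifted by
    [sh]; a rotation by - sh brings them back. *)
Lemma agree_lift : agree (angle_diagram w ov).
Proof.
have [_ [K1 [_ h1]]] := ends_vt; have sK := spread_ends apart1 h1.
have [sh hsh] := index_vt numE sK; have sJ := index_spread apart1.
have E1 : (fun a => w a 1) = (fun a => vtt (K1 a)) by apply/funext.
have at1 := agree_trunc (unit1 R) apart1; have ar := agree_rot numE hrho hrho' (- sh) sJ.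
(* [phi] completes [w] during the first quarter, the running part of the truncation. The slide and
   the rotation take place while [w] stands still. *)
pose phi (t : R) := lo (lo t); have [pD _ _] := cD.
have llI t : 0 <= t <= 1 -> 0 <= phi t <= 1 by move=> tI; do 2!apply: lo_in.
apply: (@agree_order_cat R m' gamma th E up numE rho rho' hrho hrho' w ov phi
  _ _ _ _ hc cD _ _ _ _ _ _ _ _ _ _ _ _ _ _ at1 ar).
- by apply: continuous_subspaceT => x; apply: (@continuous_comp _ _ _ (@lo R) (@lo R)); exact: lo_cont.
- by rewrite /phi !lo0.
- by rewrite /phi !lo1.
- by move=> s t _ st _; do 2!apply: lo_mono.
- move=> i j t /andP[t0 t1] [_ ij /= mE].
  have t2 : lo t < 2^-1.
    rewrite ltNge; apply/negP => h; apply: (apart1 ij); by move: mE; rewrite /phi lo_ge.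
  have t4 : t < 4^-1 by move: t2; rewrite loE; case: (leP t 2^-1); lra.
  exists (4^-1 - t); first by lra.
  move=> q /andP[q0]; rewrite ltr_norml => /andP[q1 q2].
  have lE (r : R) : r < 4^-1 -> phi r = 4 * r.
    move=> r4; rewrite /phi !loE; have -> : r <= 2^-1 by lra.
    have -> : 2 * r <= 2^-1 by lra.
    by rewrite mulrA -natrM.
  have qq : 0 < q * q by rewrite -expr2 lt_neqAle eq_sym sqrf_eq0 -normr_gt0 q0 sqr_ge0.
  rewrite !lE //; lra.
- by move=> i; apply: trunc_continuous; exact: unit1.
- by move=> i; apply: line_continuous.
- by move=> i; rewrite trunc0.
- by move=> i; rewrite mul1r addrC subrK E1 hsh addrK h1.
- by move=> i; rewrite trunc1 mul0r addr0.
- move=> t /andP[t0 t1]; have tI : 0 <= t <= 1 by rewrite t0; lra.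
  have := trunc_order (half_le_in t0 t1) apart1; rewrite mulr1 /phi.
  by rewrite [lo t]loE t1.
- move=> t /andP[t0 t1]; rewrite /phi (lo_ge (ltW t0)) lo1.
  apply: same_order_trans (index_order numE apart1) _.
  exact: (rot_order numE _ _ (half_gt_in t1 t0)).
- by move=> i j t /andP[t0 t1]; rewrite mulr1 /phi [lo t]loE t1.
- move=> i j t /andP[t0 t1]; rewrite /phi (lo_ge (ltW t0)) lo1; split=> //.
  by move=> /(lift_ov pD (unit1 R))[ij h _]; apply: (apart1 ij).
Qed.

End Truncation.

(** * Uniqueness for arbitrary diagrams *)

Section RhoUnique.
Local Open Scope classical_set_scope.
Local Open Scope ring_scope.
Variables (R : realType) (m' : nat) (c : R[i]) (th : 'I_m'.+2 -> R) (E : set R[i]) (up : bool).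
Local Notation m := m'.+2.
Hypothesis numE : ccw_numbering c th E.

Lemma diagram_lift virt (D : diagram R m) : cyl_diagram virt E D -> exists w : 'I_m -> R -> R,
  (forall i, {within `[0, 1], continuous (w i)}) /\ same_diagram D (angle_diagram w (Defs.over D)).
Proof.
move=> [[hcp h1 _ _ _] _ _].
have /fin_all_exists[w hw] : forall i, exists wi : R -> R, {within `[0, 1], continuous wi} /\
    forall t, 0 <= t <= 1 -> strand D i t = cis (wi t).
  move=> i; have [a0 ha] := norm1_cis (h1 i 0 (unit0 R)).
  by have [wi [h2 _ h3]] := lift_exists (hcp i) (h1 i) ha; exists wi.
exists w; split=> [i|t tI]; first by have [] := hw i.
by split=> // i /=; have [_ ->] := hw i.
Qed.

Lemma rho_unique rho rho' (D : diagram R m) : is_rho up c th E rho -> is_rho up c th E rho' ->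
  cyl_diagram true E D -> rho D = rho' D.
Proof.
have [c1 _ _ _] := numE; have [gamma gE] := norm1_cis c1; move: numE; rewrite gE => num hr hr' cD.
have [w [hc sD]] := diagram_lift cD; have cD' := same_cyl sD cD.
have al := agree_lift num hr hr' hc cD'.
by have [] := agree_same hr hr' al (same_diagram_sym sD).
Qed.

End RhoUnique.

(** * The values of the transport on the generators *)

Section Blocks.
Local Open Scope ring_scope.
Variables (m' : nat) (i : 'I_m'.+2).
Local Notation m := m'.+2.
Local Notation j := (ordS i).

Lemma block2_mul (a b c d a' b' c' d' : laurent) :
  block2 i a b c d *m block2 i a' b' c' d' =
  block2 i (a * a' + b * c') (a * b' + b * d') (c * a' + d * c') (c * b' + d * d').
Proof.
have ji := negPf (ordS_neq i); have ij : (i == j) = false by rewrite eq_sym.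
apply/matrixP => p q; have rows (l : 'I_m) (A B : 'M[laurent]_m) : l = i \/ l = j ->
    (forall k, k != i -> k != j -> A l k = 0) -> (A *m B) l q = A l i * B i q + A l j * B j q.
  move=> _ h; rewrite !mxE (bigD1 i) //= (bigD1 j) ?ji //= big1 ?addr0 // => k /andP[ki kj].
  by rewrite h // mul0r.
have [->|pi] := eqVneq p i.
  rewrite rows; [|by left|by move=> k /negPf ki /negPf kj; rewrite mxE eqxx ki kj].
  by rewrite !mxE !eqxx ?ij ?ji; case: ifP => //; case: ifP => //; rewrite !mulr0 addr0.
have [->|pj] := eqVneq p j.
  rewrite rows; [|by right|by move=> k /negPf ki /negPf kj; rewrite mxE eqxx ji ki kj].
  by rewrite !mxE !eqxx ?ij ?ji; case: ifP => //; case: ifP => //; rewrite !mulr0 addr0.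
rewrite !mxE (bigD1 p) //= !mxE (negPf pi) (negPf pj) eqxx mul1r big1 ?addr0 // => l lp.
by rewrite !mxE (negPf pi) (negPf pj) eq_sym (negPf lp) mul0r.
Qed.

Lemma block2_id : block2 i 1 0 0 1 = 1%:M.
Proof.
have ji := negPf (ordS_neq i); apply/matrixP => p q; rewrite !mxE.
have [->|pi] := eqVneq p i; first by rewrite eq_sym; do 2?case: eqP.
have [->|pj] := eqVneq p j; last by [].
by have [->|qi] := eqVneq q i; rewrite ?ji // eq_sym; case: eqP.
Qed.

Variables (q s : laurent) (cl ov lf : rel 'I_m).
Hypothesis clE : forall a b, cl a b = (a == b) || (a == i) && (b == j) || (a == j) && (b == i).
Hypothesis lf_irr : irreflexive lf.

Lemma pot_over : (forall a b, ov a b = (a == j) && (b == i)) ->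
  pot q s cl ov lf = if lf j i then block2 i q (1 - q) 0 1 else 1%:M.
Proof.
move=> ovE; have ji := negPf (ordS_neq i); have ij : (i == j) = false by rewrite eq_sym.
have v0 a : vcount cl ov lf a = 0%N.
  apply: eq_card0 => b; rewrite !inE clE !ovE; apply/negbTE.
  have [->|ab] /= := eqVneq a b; first by rewrite lf_irr !andbF.
  rewrite [(b == j) && _]andbC; case: ((a == i) && _) => //=; first by rewrite andbF.
  by case: ((a == j) && _).
have card a : #|[pred o | ov o a && lf o a]| = (a == i) && lf j i :> nat.
  have [->|ai] := eqVneq a i; last by apply: eq_card0 => o; rewrite !inE ovE (negPf ai) andbF.
  case l: (lf j i); last by apply: eq_card0 => o; rewrite !inE ovE; case: eqP => [->|//]; rewrite l andbF.
  by rewrite -[RHS]/(1%N); apply: (@fintype.eq_card1 _ j) => o; rewrite !inE ovE eqxx andbT; case: eqP => [->|//]; rewrite l.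
have cardj a : #|[pred o | ov o j && lf o a]| = 0%N.
  by apply: eq_card0 => o; rewrite !inE ovE ji andbF.
rewrite -block2_id; apply/matrixP => a c; rewrite /pot !mxE v0 expr0 mul1r card ovE.
case l: (lf j i); rewrite !mxE [c == a]eq_sym.
  have [ai|ai] := eqVneq a i; subst => /=.
    have [_|ci] := eqVneq i c; first by rewrite expr1.
    have [cj|cj] := eqVneq c j; subst => //=; by rewrite l cardj expr0 mulr1.
  have [aj|aj] := eqVneq a j; subst => /=; rewrite expr0.
    have [<-|cj] := eqVneq j c; first by rewrite ji.
    by rewrite /= if_same.
  by rewrite andbF /=; case: eqP.
rewrite andbF expr0; have [ai|ai] := eqVneq a i; subst => /=.
  have [_|ci] := eqVneq i c; first by [].
  have [cj|cj] := eqVneq c j; subst => //=; by rewrite l.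
have [aj|aj] := eqVneq a j; subst => /=.
  have [<-|cj] := eqVneq j c; first by rewrite ji.
  by rewrite /= if_same.
by rewrite andbF /=; case: eqP.
Qed.

Lemma pot_virtual : (forall a b, ov a b = false) ->
  pot q s cl ov lf = block2 i (s ^+ lf j i) 0 0 (s ^+ lf i j).
Proof.
move=> ovE; have ji := negPf (ordS_neq i); have ij : (i == j) = false by rewrite eq_sym.
have card a : #|[pred o | ov o a && lf o a]| = 0%N.
  by apply: eq_card0 => o; rewrite !inE ovE.
have v1 : vcount cl ov lf i = lf j i :> nat.
  rewrite /vcount; case l: (lf j i).
    rewrite -[RHS]/(1%N); apply: (@fintype.eq_card1 _ j) => b; rewrite !inE clE !ovE eqxx ij /= orbF.
    by have [->|bj] /= := eqVneq b j; rewrite ?l ?orbT // orbF; case: eqP => // <-; rewrite lf_irr.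
  apply: eq_card0 => b; rewrite !inE clE !ovE eqxx ij /= orbF.
  by have [<-|ib] /= := eqVneq i b; rewrite ?lf_irr //; case: eqP => // ->.
have v2 : vcount cl ov lf j = lf i j :> nat.
  rewrite /vcount; case l: (lf i j).
    rewrite -[RHS]/(1%N); apply: (@fintype.eq_card1 _ i) => b; rewrite !inE clE !ovE eqxx ji /= orbF.
    by have [->|bi] /= := eqVneq b i; rewrite ?l ?orbT // orbF; case: eqP => // <-; rewrite lf_irr.
  apply: eq_card0 => b; rewrite !inE clE !ovE eqxx ji /= orbF.
  by have [<-|jb] /= := eqVneq j b; rewrite ?lf_irr //; case: eqP => // ->.
have v0 a : a != i -> a != j -> vcount cl ov lf a = 0%N.
  move=> /negPf ai /negPf aj; apply: eq_card0 => b; rewrite !inE clE ai aj /= !orbF.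
  by case: eqP => //= <-; rewrite lf_irr !andbF.
apply/matrixP => a c; rewrite /pot !mxE card ovE expr0 /= [c == a]eq_sym.
have [->|ai] := eqVneq a i; first by rewrite v1 [c == i]eq_sym; case: eqP => _; rewrite ?mulr1 // mulr0; case: ifP.
have [->|aj] := eqVneq a j.
  rewrite v2; have [<-|_] := eqVneq j c; first by rewrite ji mulr1.
  by rewrite mulr0 if_same.
by rewrite v0 // expr0 mul1r; case: eqP.
Qed.

End Blocks.

(** * Transport along an exchange of two neighbours *)

Section Generators.
Local Open Scope classical_set_scope.
Local Open Scope ring_scope.
Variables (R : realType) (m' : nat) (gamma : R) (th : 'I_m'.+2 -> R) (E : set R[i]) (up : bool).
Local Notation m := m'.+2.
Local Notation vtt := (vt gamma th).
Hypothesis numE : ccw_numbering (cis gamma) th E.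
Variable i : 'I_m.
Local Notation j := (ordS i).

Lemma swap_strandE e t : swap_strand (cis gamma) th i e t = cis (ang gamma th (@std_J m') (std_kappa i) e t).
Proof.
have := single_strand gamma th (std_data i) (@std_single _ i) (std_k0 i) e t.
by rewrite /std_J !res_ord.
Qed.

Lemma gap_bound : 0 < gap th i < 2 * pi.
Proof.
have := vt_gap gamma th (i : int); rewrite res_ord => <-.
have := vt_period gamma th (i : int) 1; rewrite !mul1r => h.
have h1 : vtt i < vtt ((i : int) + 1) by rewrite (ltr_vt numE); lia.
have h2 : vtt ((i : int) + 1) < vtt ((i : int) + m) by rewrite (ltr_vt numE); lia.
by rewrite h in h2; apply/andP; split; lra.
Qed.

Lemma swap_strand_meet e e' t : 0 <= t <= 1 -> e != e' ->
  swap_strand (cis gamma) th i e t = swap_strand (cis gamma) th i e' t ->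
  t = 2^-1 /\ ((e == i) && (e' == j) || (e == j) && (e' == i)).
Proof.
move=> tI ee'; rewrite !swap_strandE => h.
have [e'E k0 t2] := ang_meet numE (std_data i) tI tI ee' h; split; first by lra.
rewrite e'E /std_pr; move: k0; rewrite /std_kappa; have [_|ei] := eqVneq e i; first by rewrite eqxx.
by have [_|ej] := eqVneq e j; rewrite ?eqxx.
Qed.

Lemma swap_strand_half : swap_strand (cis gamma) th i i 2^-1 = swap_strand (cis gamma) th i j 2^-1.
Proof.
rewrite !swap_strandE; have := ang_pr_half gamma th (std_data i) i.
by rewrite /std_pr eqxx.
Qed.

Variables (D : diagram R m).
Hypothesis strandE : strand D = swap_strand (cis gamma) th i.

Lemma swap_turn t : turn D i j t = sin ((1 - 2 * t) * gap th i) /\ turn D j i t = - sin ((1 - 2 * t) * gap th i).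
Proof.
have ji := negPf (ordS_neq i).
have E1 : strand D i t = cis (gamma + th i + t * gap th i).
  by rewrite strandE /swap_strand eqxx -cisD addrA.
have E2 : strand D j t = cis (gamma + th i + t * gap th i + (1 - 2 * t) * gap th i).
  rewrite strandE /swap_strand ji eqxx -cisD.
  rewrite -(cis_period _ (if (i.+1 == m)%N then 1 else 0)); congr cis; rewrite /gap.
  by case: ifP => _; ring.
rewrite /turn E1 E2 -!cisB -sinN; split; rewrite /=; congr sin; ring.
Qed.

(** Within 1/4 of the middle, |1 - 2 t| < 1/2. A gap is less than 2 pi, so the angle stays below pi,
    where the sine has its sign. *)
Lemma swap_lf t : `|t - 2^-1| < 4^-1 -> lf D t i j = (t < 2^-1) /\ lf D t j i = (2^-1 < t).
Proof.
rewrite ltr_norml => /andP[h1 h2]; have /andP[g0 g2] := gap_bound; have [e1 e2] := swap_turn t.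
have small : `|(1 - 2 * t) * gap th i| < pi by rewrite ltr_norml; apply/andP; split; nra.
have [s1 s2] := sin_sgP small; rewrite /lf e1 e2 oppr_gt0 s1 s2.
rewrite [0 < _ * _]pmulr_lgt0 // pmulr_llt0 // subr_gt0 subr_lt0; split; apply/idP/idP; lra.
Qed.

Lemma swap_cl a b : cl D 2^-1 a b = (a == b) || (a == i) && (b == j) || (a == j) && (b == i).
Proof.
rewrite /cl strandE; have [->|ab] := eqVneq a b; first by rewrite eqxx.
apply/eqP/idP => [/(swap_strand_meet (half_in R) ab)[] //|/orP[]/andP[/eqP -> /eqP ->]].
  exact: swap_strand_half.
by rewrite swap_strand_half.
Qed.

Lemma lf_irreflexive t : 0 <= t <= 1 -> good up D -> irreflexive (lf D t).
Proof.
by move=> tI [[_ h1 _ _] _ _] a; rewrite /lf turn_nn ?ltxx // /cl ?eqxx //; apply: (h1 0) => //; exact: unit0.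
Qed.

(** The section is constant except at the single meeting at 1/2. [L] and [M] resolve this meeting by
    the positions before and after it, so the section is 1, then L^-1 at 1/2, then M L^-1. *)
Lemma swap_transport (L M : 'M[laurent]_m) : good up D ->
  (forall t, `|t - 2^-1| < 4^-1 -> t < 2^-1 -> dpot up D 2^-1 D t = L) ->
  (forall t, `|t - 2^-1| < 4^-1 -> 2^-1 < t -> dpot up D 2^-1 D t = M) ->
  [/\ L \in unitmx, M \in unitmx & transport up D = L *m invmx M].
Proof.
move=> [cD _ _] hL hM; have [_ h1 hl _] := cD.
have u2 y := dpot_unitmx D y (hl 0 2^-1 (unit0 R) (half_in R)).
have LU : L \in unitmx by rewrite -(hL (3 / 8)) ?u2 ?ltr_norml //; try (apply/andP; split); lra.
have MU : M \in unitmx by rewrite -(hM (5 / 8)) ?u2 ?ltr_norml //; try (apply/andP; split); lra.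
have h21 : (2^-1 : R) < 1 by lra.
split=> //; pose N (t : R) := if t < 2^-1 then 1%:M else if t == 2^-1 then invmx L else M *m invmx L.
have N0 : N 0 = 1%:M by rewrite /N invr_gt0 ltr0n.
have triv x y : 0 <= x <= 1 -> 0 <= y <= 1 -> x != 2^-1 -> dpot up D x D y = 1%:M.
  move=> xI yI x2; apply: dpot_injective.
  - by move=> a; apply: (h1 0) => //; exact: unit0.
  - by apply: (hl 0) => //; exact: unit0.
  - move=> a b; rewrite strandE => h; apply/eqP/negPn/negP => ab.
    by have [/eqP] := swap_strand_meet xI ab h; rewrite (negPf x2).
have hN : section up D N.
  move=> x xI; have [x2|x2|x2] := ltgtP x 2^-1.
  - exists (2^-1 - x) => [|y yI]; first by rewrite subr_gt0.
    rewrite ltr_norml => /andP[_ h]; have y2 : y < 2^-1 by lra.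
    by rewrite /flow triv ?mul1mx ?lt_eqF // /N x2 y2.
  - exists (x - 2^-1) => [|y yI]; first by rewrite subr_gt0.
    rewrite ltr_norml => /andP[h _]; have y2 : 2^-1 < y by lra.
    by rewrite /flow triv ?mul1mx ?gt_eqF // /N !ltNge !ltW //= !gt_eqF.
  - exists 4^-1 => [|y yI]; first by rewrite invr_gt0.
    rewrite x2 => y4; rewrite {2}/N ltxx eqxx /N; have [y2|y2|->] := ltgtP y 2^-1.
    + by rewrite /flow hL // mulmxV.
    + by rewrite /flow hM.
    + by rewrite (flow_id cD) //; exact: half_in.
rewrite (transportE cD N0 hN).
have -> : N 1 = M *m invmx L.
  by rewrite /N ltNge (ltW h21) gt_eqF.
set A := M *m invmx L; have AU : A \in unitmx by rewrite unitmx_mul MU unitmx_inv LU.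
have XA : L *m invmx M *m A = 1%:M by rewrite /A -mulmxA mulKmx // mulmxV.
by rewrite -[LHS]mul1mx -XA mulmxK.
Qed.

Lemma swap_place : place_mx (cis gamma) th ((strand D)^~ 0) = 1%:M /\
  place_mx (cis gamma) th ((strand D)^~ 1) = block2 i 0 1 1 0.
Proof.
have ji := negPf (ordS_neq i); have inj : injective (pos (cis gamma) th) := pos_inj numE.
have s0 a : strand D a 0 = pos (cis gamma) th a.
  by rewrite strandE /swap_strand !mul0r subr0 addr0; case: ifP => //; case: ifP.
have s1 a : strand D a 1 = pos (cis gamma) th (if a == i then j else if a == j then i else a).
  rewrite strandE /swap_strand !mul1r /pos; case: eqP => [->|_]; first by
    rewrite -!cisD -(cis_period (gamma + th j) (if (i.+1 == m)%N then 1 else 0)); congr cis; rewrite /gap;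
    case: ifP => _; ring.
  case: eqP => [->|//].
  rewrite -!cisD -(cis_period (gamma + th i) (if (i.+1 == m)%N then -1 else 0)); congr cis; rewrite /gap.
  by case: ifP => _; ring.
split; apply/matrixP => p a; rewrite !mxE.
  by rewrite s0 (inj_eq inj) eq_sym.
rewrite s1 (inj_eq inj); have [->|pi] := eqVneq p i.
  have [_|ai] := eqVneq a i; first by rewrite ji.
  by have [_|aj] := eqVneq a j; rewrite ?eqxx // (negPf ai).
have [->|pj] := eqVneq p j.
  have [_|ai] := eqVneq a i; first by rewrite eqxx.
  have [_|aj] := eqVneq a j; first by rewrite eq_sym ji.
  by rewrite (negPf aj).
have [aE|ai] := eqVneq a i; first by rewrite aE eq_sym (negPf pj) (negPf pi).
have [aE|aj] := eqVneq a j; first by rewrite aE eq_sym (negPf pi) (negPf pj).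
by rewrite eq_sym.
Qed.

Lemma block2_swapK : block2 i 0 1 1 0 *m (block2 i 0 1 1 0)^T = 1%:M.
Proof.
have ji := negPf (ordS_neq i).
have -> : (block2 i 0 1 1 0)^T = block2 i 0 1 1 0 :> 'M[laurent]_m.
  apply/matrixP => p q; rewrite !mxE; have [->|pi] := eqVneq p i.
    by have [_|qi] := eqVneq q i; [|case: eqP].
  have [pE|pj] := eqVneq p j; first by rewrite pE; have [_|qi] := eqVneq q i; [|case: eqP].
  have [qE|qi] := eqVneq q i; first by rewrite qE (negPf pi).
  by have [qE|qj] := eqVneq q j; [rewrite qE (negPf pj)|rewrite eq_sym].
by rewrite block2_mul !mul0r !mul1r !add0r !addr0 block2_id.
Qed.

Lemma swap_rho0 (L M X : 'M[laurent]_m) : good up D ->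
  (forall t, `|t - 2^-1| < 4^-1 -> t < 2^-1 -> dpot up D 2^-1 D t = L) ->
  (forall t, `|t - 2^-1| < 4^-1 -> 2^-1 < t -> dpot up D 2^-1 D t = M) ->
  X *m block2 i 0 1 1 0 *m M = L -> rho0 up (cis gamma) th D = X.
Proof.
move=> gD hL hM XE; have [LU MU tE] := swap_transport gD hL hM; have [p0 p1] := swap_place.
by rewrite /rho0 tE p0 p1 mul1mx -XE mulmxK // -mulmxA block2_swapK mulmx1.
Qed.

Lemma near_half_in (t : R) : `|t - 2^-1| < 4^-1 -> 0 <= t <= 1.
Proof. by rewrite ltr_norml => /andP[? ?]; apply/andP; split; lra. Qed.

End Generators.

(** * The matrices of sigma, tau and zeta *)

Section RhoZero.
Local Open Scope classical_set_scope.
Local Open Scope ring_scope.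
Variables (R : realType) (m' : nat) (gamma : R) (th : 'I_m'.+2 -> R) (E : set R[i]) (up : bool).
Local Notation m := m'.+2.
Hypothesis numE : ccw_numbering (cis gamma) th E.

Lemma sigma_cyl (i : 'I_m) : cyl_diagram true E (sigma_diagram up (cis gamma) th i).
Proof.
pose typ (a b : 'I_m) := if up then a = i /\ b = ordS i else a = ordS i /\ b = i.
have ty a b : typ a b -> ~ typ b a.
  by rewrite /typ; case: up => -[-> ->] [h _]; have := ordS_neq i; [rewrite h|rewrite -h]; rewrite eqxx.
have pE : std_pr i i = ordS i by rewrite /std_pr eqxx.
apply: (same_cyl _ (swapping_cyl numE (std_data i) ty)).
have := @single_sigma _ _ gamma th up (@std_J m') (std_kappa i) (std_pr i) typ i (std_data i) ty (@std_single _ i) (std_k0 i).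
rewrite std_perm rename1 pE /std_J res_ord; apply.
by rewrite /typ; case: up.
Qed.

Lemma tau_cyl (i : 'I_m) : cyl_diagram true E (tau_diagram (cis gamma) th i).
Proof.
pose typ (a b : 'I_m) := False.
have ty a b : typ a b -> ~ typ b a by [].
apply: (same_cyl _ (swapping_cyl numE (std_data i) ty)).
have := @single_tau _ _ gamma th (@std_J m') (std_kappa i) (std_pr i) typ i (std_data i) (@std_single _ i) (std_k0 i).
by rewrite std_perm rename1 /std_J res_ord; apply.
Qed.

(** Before the crossing the resolution is trivial; after it, the lower strand has the row (t^-1, 1 -
    t^-1). The inverse has the row (t, 1 - t), and the exchange of the final positions puts its
    entries in the prescribed order. *)
Lemma rho0_sigma (i : 'I_m) : rho0 up (cis gamma) th (sigma_diagram up (cis gamma) th i) = sigma_mx i.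
Proof.
have gD := cyl_diagram_good up (sigma_cyl i); set D := sigma_diagram _ _ _ _ in gD *.
have tU := laurent_t_unit.
have ovE a b : ov up D 2^-1 a b = (a == ordS i) && (b == i).
  rewrite /ov /D /=; case: (up); apply/asboolP/andP => [[_ [-> ->]]//|[/eqP -> /eqP ->]//].
have hd t : `|t - 2^-1| < 4^-1 -> dpot up D 2^-1 D t =
    if 2^-1 < t then block2 i laurent_t^-1 (1 - laurent_t^-1) 0 1 else 1%:M.
  move=> ht; have [_ lE] := swap_lf numE (D := D) erefl ht.
  rewrite /dpot (pot_over _ _ (swap_cl numE (D := D) erefl) (lf_irreflexive (near_half_in ht) gD) ovE).
  by rewrite lE.
apply: (swap_rho0 numE (D := D) erefl gD (L := 1%:M) (M := block2 i laurent_t^-1 (1 - laurent_t^-1) 0 1)).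
- by move=> t /hd ->; case: ltgtP.
- by move=> t /hd -> ->.
- rewrite /sigma_mx !block2_mul -(block2_id i); congr block2; rewrite !(mul0r, mulr0, mul1r, mulr1, add0r, addr0) //.
  + by rewrite divrr.
  + by rewrite mulrBr mulr1 divrr // addrC addrA subrK subrr.
Qed.

Lemma rho0_tau (i : 'I_m) : rho0 up (cis gamma) th (tau_diagram (cis gamma) th i) = tau_mx i.
Proof.
have gD := cyl_diagram_good up (tau_cyl i); set D := tau_diagram _ _ _ in gD *.
have sU := laurent_s_unit.
have ovE a b : ov up D 2^-1 a b = false.
  by rewrite /ov /D /=; case: (up); apply/asboolP.
have hd t : `|t - 2^-1| < 4^-1 -> dpot up D 2^-1 D t =
    block2 i (laurent_s^-1 ^+ (2^-1 < t)%R) 0 0 (laurent_s^-1 ^+ (t < 2^-1)%R).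
  move=> ht; have [lE lE'] := swap_lf numE (D := D) erefl ht.
  rewrite /dpot (pot_virtual _ _ (swap_cl numE (D := D) erefl) (lf_irreflexive (near_half_in ht) gD) ovE).
  by rewrite lE lE'.
apply: (swap_rho0 numE (D := D) erefl gD (L := block2 i 1 0 0 laurent_s^-1) (M := block2 i laurent_s^-1 0 0 1)).
- by move=> t /hd -> h; rewrite h ltNge ltW.
- by move=> t /hd -> h; rewrite h ltNge ltW.
- rewrite /tau_mx !block2_mul; congr block2; rewrite !(mul0r, mulr0, mulr1, add0r, addr0) //.
  by rewrite divrr.
Qed.

Lemma zeta_cyl : cyl_diagram true E (zeta_diagram (cis gamma) th).
Proof.
pose K0 (a : 'I_m) : int := (a : nat).
have sK0 : spread K0 by move=> a b k h; rewrite -[a]res_ord -/(K0 a) h res_period res_ord.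
apply: same_cyl (rot_cyl numE 1 sK0); have := rot1 gamma th sK0.
have -> : perm (spread_inj sK0) = 1%g by apply/permP => a; rewrite permE perm1 res_ord.
by rewrite rename1.
Qed.

Lemma rho0_zeta : rho0 up (cis gamma) th (zeta_diagram (cis gamma) th) = zeta_mx m.
Proof.
have gD := cyl_diagram_good up zeta_cyl; set D := zeta_diagram _ _ in gD *; have [cD _ _] := gD.
have inj : injective (pos (cis gamma) th) := pos_inj numE; have [_ h1 hl _] := cD.
have nomeet t : 0 <= t <= 1 -> injective ((strand D)^~ t).
  pose K0 (a : 'I_m) : int := (a : nat).
  have sK0 : spread K0 by move=> a b k h; rewrite -[a]res_ord -/(K0 a) h res_period res_ord.
  have := rot1 gamma th sK0; have -> : perm (spread_inj sK0) = 1%g by apply/permP => a; rewrite permE perm1 res_ord.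
  rewrite rename1 => sD tI a b; have [hs _] := sD t tI; rewrite -[strand D]/(strand (zeta_diagram _ _)).
  rewrite -!hs => h.
  apply/eqP/negPn/negP => ab.
  exact: (same_order_apart (rot_order numE K0 1 tI) (spread_apart numE sK0) ab h).
have hN : section up D (fun=> 1%:M).
  move=> x xI; exists 1 => // y yI _; rewrite /flow mulmx1; apply/esym/dpot_injective.
  - by move=> a; apply: (h1 0) => //; exact: unit0.
  - by apply: (hl 0) => //; exact: unit0.
  - exact: nomeet.
rewrite /rho0 (transportE cD erefl hN) invmx1 mulmx1.
have s0 a : strand D a 0 = pos (cis gamma) th a by rewrite /= mul0r addr0.
have s1 a : strand D a 1 = pos (cis gamma) th (ordS a).
  rewrite /= /pos -!cisD -(cis_period (gamma + th (ordS a)) (if (a.+1 == m)%N then 1 else 0)).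
  by congr cis; rewrite /gap; case: ifP => _; ring.
have -> : place_mx (cis gamma) th ((strand D)^~ 0) = 1%:M.
  by apply/matrixP => p a; rewrite !mxE s0 (inj_eq inj) eq_sym.
by apply/matrixP => p a; rewrite mul1mx !mxE s1 (inj_eq inj) eq_sym.
Qed.

Lemma rho0_is_rho : is_rho up (cis gamma) th E (rho0 up (cis gamma) th).
Proof.
have p1 (D : diagram R m) : power_map 1 D = D.
  by case: D => s o; rewrite /power_map; congr Diagram; apply/funext => a; apply/funext => t; rewrite expr1.
split.
- by move=> D cD; exact: (rho0_unit numE (cyl_fits up cD)).
(* Invariance is the case d = 1 of the statement about powers. *)
- move=> D D' _ _ eD; rewrite -[D]p1 -[D']p1; apply: (rho0_equiv (E := E) (d := 1%N) up _ _ _ _ eD) => //.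
- by move=> D D' cD cD'; exact: (rho0_mul numE (cyl_fits up cD) (cyl_fits up cD')).
- by split; [exact: rho0_sigma|exact: rho0_tau|exact: rho0_zeta].
Qed.

End RhoZero.

(** * Transport along the diagrams of a braid *)

Section Radial.
Local Open Scope classical_set_scope.
Local Open Scope ring_scope.
Variable R : realType.
Implicit Types z w : R[i].

(** The norm in [R[i]] is complex-valued; this is its real value, convenient for comparison and
    continuity. *)
Definition rad z : R := Num.sqrt (complex.Re z ^+ 2 + complex.Im z ^+ 2).
Definition dir z : R[i] := z / `|z|.

Lemma rad_norm z : `|z| = (rad z)%:C%C.
Proof. by rewrite normc_def. Qed.

Lemma rad_gt0 z : z != 0 -> 0 < rad z.
Proof. by move=> z0; rewrite -ltcR -rad_norm normr_gt0. Qed.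

Lemma dir_norm1 z : z != 0 -> `|dir z| = 1.
Proof. by move=> z0; rewrite normrM normfV normr_id divff // normr_eq0. Qed.

Lemma dirK z : z != 0 -> z = (rad z)%:C%C * dir z.
Proof. by move=> z0; rewrite -rad_norm /dir mulrCA divff ?mulr1 // normr_eq0. Qed.

Lemma dirE z : complex.Re (dir z) = complex.Re z / rad z /\ complex.Im (dir z) = complex.Im z / rad z.
Proof.
rewrite /dir rad_norm -fmorphV; case: z => a b /=; set r := (rad _)^-1.
by rewrite !mulr0 subr0 add0r.
Qed.

Lemma dir_inj z w : z != 0 -> w != 0 -> dir z = dir w -> rad z = rad w -> z = w.
Proof. by move=> z0 w0 h1 h2; rewrite (dirK z0) (dirK w0) h1 h2. Qed.

Lemma cfamilyB (f g : R * R -> R[i]) : cfamily f -> cfamily g -> cfamily (fun x => f x - g x).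
Proof.
move=> [fr fi] [gr gi]; split.
  rewrite (_ : (fun x => _) = (fun x => complex.Re (f x) - complex.Re (g x))).
    by move=> x; apply: cvgB; [exact: fr|exact: gr].
  by apply/funext => x; case: (f x) (g x) => [a b] [a' b'].
rewrite (_ : (fun x => _) = (fun x => complex.Im (f x) - complex.Im (g x))).
  by move=> x; apply: cvgB; [exact: fi|exact: gi].
by apply/funext => x; case: (f x) (g x) => [a b] [a' b'].
Qed.

Lemma rad_continuous (f : R * R -> R[i]) : cfamily f -> {within @square R, continuous (fun x => rad (f x))}.
Proof.
move=> [fr fi]; have cg : {within @square R, continuous
    (fun x => complex.Re (f x) ^+ 2 + complex.Im (f x) ^+ 2)}.
  by move=> x; apply: cvgD; apply: cvgM; [exact: fr|exact: fr|exact: fi|exact: fi].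
by move=> x; exact: (cvg_comp _ _ (cg x) (@sqrt_continuous R _)).
Qed.

Lemma cfamily_dir (f : R * R -> R[i]) : cfamily f -> (forall x, @square R x -> f x != 0) ->
  cfamily (fun x => dir (f x)).
Proof.
move=> cf f0; have cr := rad_continuous cf; case: cf => fr fi; split.
  rewrite (_ : (fun x => _) = (fun x => complex.Re (f x) / rad (f x))); last first.
    by apply/funext => x; have [-> _] := dirE (f x).
  apply/subspace_continuousP => x sx; apply: cvgM.
    by move/subspace_continuousP: fr; apply.
  apply: cvgV; first by rewrite gt_eqF // rad_gt0 // f0.
  by move/subspace_continuousP: cr; apply.
rewrite (_ : (fun x => _) = (fun x => complex.Im (f x) / rad (f x))); last first.
  by apply/funext => x; have [_ ->] := dirE (f x).
apply/subspace_continuousP => x sx; apply: cvgM.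
  by move/subspace_continuousP: fi; apply.
apply: cvgV; first by rewrite gt_eqF // rad_gt0 // f0.
by move/subspace_continuousP: cr; apply.
Qed.

End Radial.

(** * Coherence of the diagrams seen from strand k *)

Section BraidDiagrams.
Local Open Scope classical_set_scope.
Local Open Scope ring_scope.
Variables (R : realType) (n : nat) (far up : bool) (k : 'I_n).
Implicit Types (b : braid R n) (h : R -> braid R n).
Local Notation P := (p_diagram far k).

Definition seen b (l : 'I_n.-1) t : R[i] := b (lift k l) t - b k t.

Lemma seen_neq0 b t l : injective (b^~ t) -> seen b l t != 0.
Proof. by move=> inj; rewrite subr_eq0 (inj_eq inj) eq_sym neq_lift. Qed.

Lemma seen_inj b t : injective (b^~ t) -> injective ((seen b)^~ t).
Proof. by move=> inj l l' /addIr/inj/lift_inj. Qed.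

Lemma p_strandE b l t : strand (P b) l t = dir (seen b l t). Proof. by []. Qed.

Lemma p_overE b l j t : Defs.over (P b) l j t <-> dir (seen b l t) = dir (seen b j t) /\
  (if far then rad (seen b j t) < rad (seen b l t) else rad (seen b l t) < rad (seen b j t)).
Proof. by rewrite /= /seen /dir !rad_norm !ltcR. Qed.

Lemma seen_rad b t l j : injective (b^~ t) -> l != j -> dir (seen b l t) = dir (seen b j t) ->
  rad (seen b l t) != rad (seen b j t).
Proof.
move=> inj lj hd; apply: contra lj => /eqP hr; apply/eqP/(seen_inj inj).
by apply: dir_inj hd hr; apply: seen_neq0.
Qed.

(** Strands seen in one direction have different distances from strand k, because the strands of a
    braid are disjoint. So each cluster is one layer, ordered by distance, and this order persists
    nearby by continuity, however many strands meet. *)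
Lemma p_coherent h : (forall i, cfamily (fun x => h x.1 i x.2)) ->
  (forall u t : R, 0 <= u <= 1 -> 0 <= t <= 1 -> injective ((h u)^~ t)) ->
  coherent up (fun u => P (h u)).
Proof.
move=> hc inj; have cs l : cfamily (fun x => seen (h x.1) l x.2) by apply: cfamilyB.
have s0 (x : R * R) l : @square R x -> seen (h x.1) l x.2 != 0.
  by case: x => u t /squareP[uI tI]; apply: seen_neq0; apply: inj.
apply: coherent_intro.
- by move=> l; apply: (cfamily_dir (cs l)) => x; apply: s0.
- by move=> u l t uI tI; rewrite p_strandE dir_norm1 // seen_neq0 //; apply: inj.
- move=> u t i j uI tI /p_overE[_ h1] /p_overE[_ h2]; move: h1 h2; case: far => h1 h2;
    by have := lt_trans h1 h2; rewrite ltxx.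
- move=> u t uI tI; split.
  + by move=> i /p_overE[_]; rewrite if_same ltxx.
  + by move=> i j /p_overE[].
  + move=> i j l h1 h2; have [->|il] := eqVneq i l; [by left|right].
    have d1 : dir (seen (h u) i t) = dir (seen (h u) j t) by case: h1 => /p_overE[].
    have d2 : dir (seen (h u) j t) = dir (seen (h u) l t) by case: h2 => /p_overE[].
    have d3 := etrans d1 d2; have := seen_rad (inj u t uI tI) il d3.
    rewrite neq_lt => ne; split.
      case/orP: ne => ne; rewrite /classical_at !p_overE d3; move: ne; case: far => ne;
        by [left|right].
    move=> /p_overE[_ o1] /p_overE[_ o2]; apply/p_overE; split=> //.
    by move: o1 o2; case: far => o1 o2; [exact: lt_trans o2 o1|exact: lt_trans o1 o2].
- move=> u t i j uI tI ij /eqP; rewrite !p_strandE => hd.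
  have ne := seen_rad (inj u t uI tI) ij hd.
  have /within_squareP ci : {within @square R, continuous (fun x => rad (seen (h x.1) i x.2) - rad (seen (h x.1) j x.2))}.
    by move=> x; apply: cvgB; exact: rad_continuous.
  have [|d d0 hdl] := ci u t uI tI `|rad (seen (h u) i t) - rad (seen (h u) j t)|.
    by rewrite normr_gt0 subr_eq0.
  exists d => // u' t' u'I t'I hu ht /eqP; rewrite !p_strandE => hd'.
  have := hdl u' t' u'I t'I hu ht; rewrite !p_overE hd hd' /=.
  set a := rad _; set b := rad _; set a' := rad _; set b' := rad _ => hab.
  have key : (a < b) = (a' < b') /\ (b < a) = (b' < a').
    have [ab|ab|ab] := ltgtP a' b'; last by move: ne; rewrite -/a' -/b' ab eqxx.
      move: hab; rewrite [X in _ < X]ltr0_norm ?subr_lt0 // ltr_norml => /andP[h1 h2].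
      by split; apply/idP; lra.
    move: hab; rewrite [X in _ < X]gtr0_norm ?subr_gt0 // ltr_norml => /andP[h1 h2].
    by split; apply/idP; lra.
  by case: key => k1 k2; case: far; rewrite ?k1 ?k2; split=> -[_ ?].
Qed.

End BraidDiagrams.

(** * The matrix of a braid: isotopy invariance and multiplicativity *)

Section Powers.
Local Open Scope classical_set_scope.
Local Open Scope ring_scope.
Variables (R : realType) (n : nat) (far up : bool) (k : 'I_n) (d : nat) (z : 'I_n -> R[i]).
Hypotheses (d0 : (0 < d)%N) (hz : general_position k z).
Variables (c : R[i]) (th : 'I_n.-1 -> R).
Hypothesis numE : ccw_numbering c th (endpoints d k z).
Local Notation P := (p_diagram far k).
Implicit Types (b : braid R n).

(** Equal powers would make the ratio of two directions a root of X^e - 1, hence algebraic. *)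
Lemma direction_pow_inj e : (0 < e)%N -> injective (fun l => direction k z l ^+ e).
Proof.
move=> e0 l j h; apply/eqP/negPn/negP => lj; have [zi /(_ l j lj) tr] := hz; apply: tr.
have dj0 i : direction k z i != 0.
  by rewrite mulf_neq0 ?invr_eq0 ?normr_eq0 // subr_eq0 (inj_eq zi) eq_sym neq_lift.
exists ('X^e - 1); first by rewrite -size_poly_eq0 -[1]/(1%:P) size_XnsubC.
by rewrite rmorphB /= map_polyXn rmorph1 /root !hornerE expr_div_n h divff ?subrr // expf_neq0.
Qed.

Lemma endpoints_pow x y : endpoints 1 k z x -> endpoints 1 k z y -> x ^+ d = y ^+ d -> x = y.
Proof. by move=> [l _ <-] [j _ <-]; rewrite !expr1 => /(direction_pow_inj d0) ->. Qed.

Lemma p_ends b l : pure_braid z b -> strand (P b) l 0 = direction k z l /\ strand (P b) l 1 = direction k z l.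
Proof. by move=> [_ _ h0 h1]; rewrite !p_strandE /seen !h0 !h1. Qed.

Lemma pow_ends b l : pure_braid z b -> strand (power_map d (P b)) l 0 = direction k z l ^+ d /\
  strand (power_map d (P b)) l 1 = direction k z l ^+ d.
Proof.
by move=> /(p_ends l)[h0 h1]; rewrite -[strand _ l 0]/(strand (P b) l 0 ^+ d) -[strand _ l 1]/(strand (P b) l 1 ^+ d) h0 h1.
Qed.

Lemma pure_inj b t : pure_braid z b -> 0 <= t <= 1 -> injective (b^~ t).
Proof. by case=> _ h _ _; apply: h. Qed.

Lemma braid_coherent b : pure_braid z b -> coherent up (fun=> P b).
Proof.
move=> pb; apply: (@p_coherent _ _ _ _ _ (fun=> b)); last by move=> u t _; apply: pure_inj.
by move=> i; have [hc _ _ _] := pb; apply: cfamily_const.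
Qed.

Lemma p_fits b : pure_braid z b -> fits up (endpoints d k z) (power_map d (P b)).
Proof.
move=> pb; have cP := braid_coherent pb; split.
  split; first exact: (coherent_power d0 cP).
    by move=> i j; rewrite !(proj1 (pow_ends _ pb)) => /(direction_pow_inj d0).
  by move=> i j; rewrite !(proj2 (pow_ends _ pb)) => /(direction_pow_inj d0).
by move=> i; have [-> ->] := pow_ends i pb; split; exists i.
Qed.

Definition braid_value b := rho0 up c th (power_map d (P b)).

Lemma braid_value_unit b : pure_braid z b -> braid_value b \in unitmx.
Proof. by move=> /p_fits fb; exact: (rho0_unit numE fb). Qed.

Lemma same_p_diagram b b' : (forall i t, 0 <= t <= 1 -> b i t = b' i t) -> same_diagram (P b) (P b').
Proof. by move=> h t tI; split=> [l|l j] /=; rewrite !h. Qed.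

Lemma same_power_p_diagram b b' : (forall i t, 0 <= t <= 1 -> b i t = b' i t) ->
  same_diagram (power_map d (P b)) (power_map d (P b')).
Proof. by move=> /same_p_diagram; apply: same_diagram_power. Qed.

Lemma braid_value_isotopic b b' : pure_braid z b -> braid_isotopic z b b' -> braid_value b = braid_value b'.
Proof.
move=> pb [h [hc hp h0 h1]]; have p0 := hp 0 (unit0 R); have p1 := hp 1 (unit1 R).
have [g0 _] := p_fits p0; have [g1 _] := p_fits p1.
rewrite /braid_value -(rho0_same c th (same_power_p_diagram h0) g0).
rewrite -(rho0_same c th (same_power_p_diagram h1) g1).
apply: (@rho0_family _ _ _ _ _ (fun u => power_map d (P (h u)))).
- apply: (coherent_power d0); apply: p_coherent => // u t uI; apply: pure_inj; exact: hp.
- by move=> u uI; have [] := p_fits (hp u uI).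
- by move=> i; rewrite (proj1 (pow_ends _ p0)) (proj1 (pow_ends _ p1)).
- by move=> i; rewrite (proj2 (pow_ends _ p0)) (proj2 (pow_ends _ p1)).
Qed.

(** Every strand of a pure braid ends where the strand of the same name begins, and by
    [direction_pow_inj] this remains unambiguous after taking powers; so the product of the diagrams
    involves no renaming. *)
Lemma p_braid_mul b b' : pure_braid z b -> pure_braid z b' ->
  power_map d (P (braid_mul b b')) = diagram_mul (power_map d (P b)) (power_map d (P b')).
Proof.
move=> pb pb'; have cE i : continuation (power_map d (P b)) (power_map d (P b')) i = i.
  rewrite /continuation; case: pickP => [j|/(_ i)];
    rewrite (proj1 (pow_ends _ pb')) (proj2 (pow_ends _ pb)); last by rewrite eqxx.
  by move=> /eqP/(direction_pow_inj d0).
rewrite /diagram_mul /power_map /p_diagram /=; congr Diagram.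
  by apply/funext => i; apply/funext => t; rewrite cE /braid_mul; case: ifP.
apply/funext => i; apply/funext => j; apply/funext => t; rewrite !cE /braid_mul.
by case: ifP.
Qed.

Lemma braid_value_mul b b' : pure_braid z b -> pure_braid z b' ->
  braid_value (braid_mul b b') = braid_value b *m braid_value b'.
Proof.
move=> pb pb'; rewrite /braid_value p_braid_mul //.
by rewrite (rho0_mul numE (p_fits pb) (p_fits pb')).
Qed.

End Powers.

(** * General position *)

Section Avoid.
Local Open Scope classical_set_scope.
Local Open Scope ring_scope.
Variable R : realType.

(** A countable set has Lebesgue measure 0, an interval of length 2 e has not. *)
Lemma avoid_countable (T : countType) (f : T -> R) (x e : R) : 0 < e ->
  exists2 v, `|v - x| < e & forall t, f t != v.
Proof.
move=> e0; apply: contrapT => no.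
have cI : countable `]x - e, x + e[%classic.
  apply: (@sub_countable _ _ _ (range f)); last first.
    by apply: sub_countable (card_image_le _ _) _; exact: countableP.
  apply: subset_card_le => v /=; rewrite in_itv /= => vI; apply: contrapT => nv; apply: no; exists v.
    by rewrite ltr_norml; case/andP: vI => *; apply/andP; split; lra.
  by move=> t; apply/eqP => h; apply: nv; exists t.
have := countable_lebesgue_measure0 cI; rewrite lebesgue_measure_itv /= lte_fin.
have -> : x - e < x + e by lra.
rewrite -EFinB => -[]; lra.
Qed.

Variables (m d : nat).
Hypothesis d0 : (0 < d)%N.
Implicit Types x y : 'I_m -> R.

(* Strands of angles [x a] and [x b] meet after taking d-th powers. *)
Definition coin x (a b : 'I_m) := exists p : int, d%:R * (x a - x b) = p%:~R * (2 * pi).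

Lemma coin_sym x a b : coin x a b -> coin x b a.
Proof. by move=> [p hp]; exists (- p); rewrite mulrNz mulNr -hp; ring. Qed.

Lemma coin_trans x a b c : coin x a b -> coin x b c -> coin x a c.
Proof. by move=> [p hp] [q hq]; exists (p + q); rewrite intrD mulrDl -hp -hq; ring. Qed.

Definition scattered x := forall a b, a != b -> ~ coin x a b.

Definition mix x y (r : R) := fun a : 'I_m => x a + r * (y a - x a).

Definition no_triple x y := forall r a b c, 0 <= r <= 1 -> a != b -> b != c -> a != c ->
  coin (mix x y r) a b -> ~ coin (mix x y r) b c.

Lemma no_triple_sym x y : no_triple x y -> no_triple y x.
Proof.
move=> h r a b c rI; have rI' : 0 <= 1 - r <= 1 by case/andP: rI => *; apply/andP; split; lra.
have -> : mix y x r = mix x y (1 - r) by apply/funext => i; rewrite /mix; ring.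
exact: h.
Qed.

(* The only height of c at the end of the segment for which c passes through the point where
   the strands a and b, whose angles differ there by [p] turns, meet. *)
Definition bad_value x y (c a b : 'I_m) (p q : int) : R :=
  y b - (x b - x c) - (q%:~R * (2 * pi) / d%:R - (x b - x c)) * ((y a - y b) - (x a - x b)) /
    (p%:~R * (2 * pi) / d%:R - (x a - x b)).

Lemma triple_bad_value x y r a b c : scattered x -> a != b -> coin (mix x y r) a b ->
  coin (mix x y r) b c -> exists p q, y c = bad_value x y c a b p q.
Proof.
move=> sx ab [p hp] [q hq]; exists p, q; have dn : (d%:R : R) != 0 by rewrite pnatr_eq0 -lt0n.
have hp' : (x a - x b) + r * ((y a - y b) - (x a - x b)) = p%:~R * (2 * pi) / d%:R.
  by rewrite -hp /mix [_ * _ / _]mulrC mulKf //; ring.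
have hq' : (x b - x c) + r * ((y b - y c) - (x b - x c)) = q%:~R * (2 * pi) / d%:R.
  by rewrite -hq /mix [_ * _ / _]mulrC mulKf //; ring.
have pn : p%:~R * (2 * pi) / d%:R - (x a - x b) != 0.
  rewrite subr_eq0; apply/eqP => h; apply: (sx a b ab); exists p; rewrite -h mulrCA divff ?mulr1 //.
have eA : p%:~R * (2 * pi) / d%:R - (x a - x b) = r * ((y a - y b) - (x a - x b)) by rewrite -hp'; ring.
have eB : q%:~R * (2 * pi) / d%:R - (x b - x c) = r * ((y b - y c) - (x b - x c)) by rewrite -hq'; ring.
rewrite /bad_value eA eB; rewrite eA in pn; move: pn; set u := y a - y b - _.
rewrite mulf_eq0 negb_or => /andP[r0 u0].
by rewrite -mulrA [_ / (r * u)]mulrC invfM; field; rewrite r0 u0.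
Qed.

(** The values of [y] are chosen strand by strand. Each has to avoid countably many numbers: those
    which make it coincide with an earlier strand at the node, and the bad values for triple points
    on the segments from [x] and from [x']. *)
Lemma scattered_step x x' (v : 'I_m -> R) (e : R) : 0 < e -> scattered x -> scattered x' ->
  exists y, [/\ forall a, `|y a - v a| < e, scattered y, no_triple x y & no_triple x' y].
Proof.
move=> e0 sx sx'.
pose ok x y k := forall r (a b c : 'I_m), 0 <= r <= 1 -> a != b -> b != c -> a != c ->
  (a < k)%N -> (b < k)%N -> (c < k)%N -> coin (mix x y r) a b -> ~ coin (mix x y r) b c.
have main (k : nat) : (k <= m)%N -> exists y, [/\ forall a, `|y a - v a| < e,
    forall a b : 'I_m, (a < k)%N -> (b < k)%N -> a != b -> ~ coin y a b, ok x y k & ok x' y k].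
  elim: k => [_|k IH km]; first by exists v; split=> // a; rewrite subrr normr0.
  have [y [y1 y2 y3 y4]] := IH (ltnW km); pose c := Ordinal km.
  pose T : Type := (bool * ('I_m * 'I_m) * (int * int))%type.
  pose f (t : T) : R := bad_value (if t.1.1 then x else x') y c t.1.2.1 t.1.2.2 t.2.1 t.2.2.
  pose g (t : 'I_m * int) : R := y t.1 + t.2%:~R * (2 * pi) / d%:R.
  pose fg (t : (bool * ('I_m * 'I_m) * (int * int)) + 'I_m * int) : R := match t with inl t => f t | inr t => g t end.
  have [u ue uf] := avoid_countable fg (v c) e0.
  pose y' a := if a == c then u else y a.
  have yc : y' c = u by rewrite /y' eqxx.
  have yk (a : 'I_m) : (a < k)%N -> y' a = y a.
    by rewrite /y'; case: eqP => // -> /=; rewrite ltnn.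
  have kc (a : 'I_m) : (a < k.+1)%N -> a = c \/ (a < k)%N.
    rewrite ltnS leq_eqVlt => /orP[/eqP h|]; [left|by right]; exact: val_inj.
  have coin_k z z' (a b : 'I_m) : z a = z' a -> z b = z' b -> coin z a b -> coin z' a b.
    by move=> h1 h2 [p hp]; exists p; rewrite -h1 -h2.
  have dn : (d%:R : R) != 0 by rewrite pnatr_eq0 -lt0n.
  have step w (s : bool) : w = (if s then x else x') -> scattered w -> ok w y k -> ok w y' k.+1.
    move=> wE sw okw.
    have last r (a b : 'I_m) : a != b -> (a < k)%N -> (b < k)%N -> coin (mix w y' r) a b -> ~ coin (mix w y' r) b c.
      move=> ab ak bk h1 h2; have [p [q]] := triple_bad_value sw ab h1 h2; rewrite yc => h.
      have := uf (inl (s, (a, b), (p, q))); rewrite /fg /f -wE h /bad_value !yk // eqxx //.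
    have low (p q : 'I_m) : p != q -> q = c -> (p < k.+1)%N -> (p < k)%N.
      by move=> pq qc /kc[pc|//]; rewrite pc qc eqxx in pq.
    move=> r a b l rI ab bl al ak bk lk h1 h2; have [aE|ak'] := kc a ak.
      rewrite aE in h1; apply: (last r l b); [by rewrite eq_sym| | |exact: coin_sym|exact: coin_sym].
        by apply: (low l a); rewrite // eq_sym.
      by apply: (low b a); rewrite // eq_sym.
    have [bE|bk'] := kc b bk.
      rewrite bE in h1 h2; apply: (last r a l); [by []|by []| |exact: coin_trans h1 h2|exact: coin_sym].
      by apply: (low l b); rewrite // eq_sym.
    have [lE|lk'] := kc l lk; first by rewrite lE in h2; apply: (last r a b).
    by apply: (okw r a b l) => //; [apply: coin_k h1|apply: coin_k h2]; rewrite /mix !yk.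
  exists y'; split.
  - by move=> a; rewrite /y'; case: eqP => [->|_].
  - have lastc (a : 'I_m) : (a < k)%N -> ~ coin y' c a.
      move=> ak [p]; rewrite yc yk // => h; have := uf (inr (a, p)); rewrite /fg /g /= -h.
      by rewrite [_ * _ / _]mulrC mulKf // addrC subrK eqxx.
    move=> a b /kc[aE|ak] /kc[bE|bk] ab.
    + by rewrite aE bE eqxx in ab.
    + by rewrite aE; exact: lastc.
    + by rewrite bE => /coin_sym; apply: lastc.
    + by move=> h; apply: (y2 a b) => //; apply: coin_k h; rewrite yk.
  - exact: (step x true).
  - exact: (step x' false).
have [y [y1 y2 y3 y4]] := main m (leqnn m); exists y; split=> //.
- by move=> a b ab; apply: y2.
- by move=> r a b c *; apply: (y3 r a b c).
- by move=> r a b c *; apply: (y4 r a b c).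
Qed.

(** Both extreme nodes are prescribed, so the last segment offers no free choice at its end. Every
    inner node is therefore chosen well also with respect to [v N], and 1 < N provides an inner node
    before the last segment. *)
Lemma scattered_path (N : nat) (v : nat -> 'I_m -> R) (e : R) : (1 < N)%N -> 0 < e ->
  scattered (v 0%N) -> scattered (v N) -> exists y : nat -> 'I_m -> R,
  [/\ y 0%N = v 0%N, y N = v N, forall i a, `|y i a - v i a| < e,
      forall i, scattered (y i) & forall i, (i < N)%N -> no_triple (y i) (y i.+1)].
Proof.
move=> N1 e0 s0 sN; pose Q i x y := [/\ forall a, `|y a - v i.+1 a| < e, scattered y, no_triple x y & no_triple (v N) y].
have /choice[next hnext] : forall ix : nat * ('I_m -> R), exists y, scattered ix.2 -> Q ix.1 ix.2 y.
  move=> [i x]; have [sx|nsx] := pselect (scattered x); last by exists x.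
  by have [y hy] := scattered_step (v i.+1) e0 sx sN; exists y.
pose fix yy i := if i is j.+1 then next (j, yy j) else v 0%N.
have yys i : scattered (yy i).
  by elim: i => [//|i IH] /=; have [] := hnext (i, yy i) IH.
have yyQ i : Q i (yy i) (yy i.+1) by exact: (hnext (i, yy i) (yys i)).
exists (fun i => if i == N then v N else yy i); split.
- by case: eqP => // h; rewrite -h in N1.
- by rewrite eqxx.
- move=> i a; case: eqP => [->|_]; first by rewrite subrr normr0.
  case: i => [|i] /=; first by rewrite subrr normr0.
  by have [h _ _ _] := yyQ i; exact: h.
- by move=> i; case: eqP.
- move=> i iN; rewrite ltn_eqF //; case: eqP => [iE|_]; last by have [] := yyQ i.
  have i0 : i = i.-1.+1 by rewrite prednK // -(ltn_add2r 1) !addn1 iE.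
  by rewrite i0; have [_ _ _ h] := yyQ i.-1; apply: no_triple_sym.
Qed.

End Avoid.

(** * Piecewise linear interpolation *)

Section PiecewiseLinear.
Local Open Scope classical_set_scope.
Local Open Scope ring_scope.
Variables (R : realType) (y : nat -> R).

(** The retraction of R to [0, 1], written with absolute values so that its continuity is
    immediate. *)
Definition clamp (x : R) : R := (`|x| - `|x - 1| + 1) / 2.

Fixpoint pl (N : nat) (s : R) : R :=
  if N is M.+1 then pl M s + (y N - y M) * clamp (s - M%:R) else y 0%N.

Lemma pl_continuous N (g : R -> R) : continuous g -> continuous (fun t => pl N (g t)).
Proof.
move=> cg; elim: N => [|N IH] t /=; first exact: cvg_cst.
apply: cvgD; first exact: IH.
apply: cvgM; first exact: cvg_cst.
have cs : (g x - N%:R) @[x --> t] --> g t - N%:R by apply: cvgB; [exact: cg|exact: cvg_cst].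
apply: cvgM; last exact: cvg_cst.
apply: cvgD; last exact: cvg_cst.
by apply: cvgB; apply: cvg_norm; [|apply: cvgB; [|exact: cvg_cst]].
Qed.

Lemma clamp_le0 x : x <= 0 -> clamp x = 0.
Proof. by move=> h; rewrite /clamp !ler0_norm; lra. Qed.

Lemma clamp_ge1 x : 1 <= x -> clamp x = 1.
Proof. by move=> h; rewrite /clamp !ger0_norm; lra. Qed.

Lemma clamp_in x : 0 <= x <= 1 -> clamp x = x.
Proof. by move=> /andP[h1 h2]; rewrite /clamp ger0_norm // ler0_norm; lra. Qed.

Lemma pl_ge N s : N%:R <= s -> pl N s = y N.
Proof.
elim: N => [//|N IH] h /=; have h1 : (N%:R : R) + 1 <= s by rewrite natr1.
rewrite IH; last by lra.
by rewrite clamp_ge1; [rewrite mulr1 addrC subrK|lra].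
Qed.

Lemma pl_in N i s : (i < N)%N -> i%:R <= s <= i%:R + 1 -> pl N s = y i + (s - i%:R) * (y i.+1 - y i).
Proof.
elim: N => [//|N IH]; rewrite ltnS leq_eqVlt => /orP[/eqP -> /andP[h1 h2]|iN sI] /=.
  by rewrite pl_ge // clamp_in 1?mulrC //; apply/andP; split; lra.
rewrite IH // clamp_le0 ?mulr0 ?addr0 //.
have : (i%:R : R) + 1 <= N%:R by rewrite natr1 ler_nat.
by case/andP: sI => *; lra.
Qed.

Lemma pl0 N : pl N 0 = y 0%N.
Proof.
case: N => [//|N]; rewrite (@pl_in _ 0) ?ltnS //; last by rewrite lexx add0r ler01.
by rewrite subrr mul0r addr0.
Qed.

Lemma piece (N : nat) (s : R) : (0 < N)%N -> 0 <= s <= N%:R -> exists2 i, (i < N)%N & i%:R <= s <= i%:R + 1.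
Proof.
elim: N => [//|N IH] _ /andP[s0 sN]; case: N IH sN => [|N] IH sN.
  by exists 0%N => //; rewrite s0 add0r.
have [h|h] := leP s N.+1%:R.
  by have [|i iN iI] := IH isT _; [rewrite s0|exists i => //; apply: ltn_trans iN _].
by exists N.+1 => //; rewrite (ltW h) natr1.
Qed.

End PiecewiseLinear.

(** * Transversality of polygons with generic nodes *)

Section Transversal.
Local Open Scope classical_set_scope.
Local Open Scope ring_scope.
Variables (R : realType) (m d : nat).
Hypothesis d0 : (0 < d)%N.
Implicit Types (w : 'I_m -> R -> R).

(** The condition is put on coincidences of d-fold angles, which include the plain meetings, so it
    controls a diagram and its image under f_d at once. *)
Definition transversal w := forall t i j (p : int), 0 <= t <= 1 -> i != j ->
  d%:R * (w j t - w i t) = p%:~R * (2 * pi) ->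
  (forall l, l != i -> l != j -> ~ coin d (w^~ t) l i) /\
  xing (fun s => w j s - w i s - p%:~R * (2 * pi) / d%:R) t.

(** To be applied with e = 1 to the diagram itself and with e = d to its power: a coincidence of
    e-fold angles is one of d-fold angles because e divides d. *)
Lemma transversal_generic (E : set R[i]) w ov (e f : nat) : (e * f = d)%N ->
  (forall i, {within `[0, 1], continuous (w i)}) -> transversal w ->
  prediagram E (angle_diagram (fun i t => e%:R * w i t) ov) -> generic (angle_diagram (fun i t => e%:R * w i t) ov).
Proof.
move=> ef hc tw pD; have [e0 f0] : (0 < e)%N /\ (0 < f)%N by apply/andP; rewrite -muln_gt0 ef.
have en : (e%:R : R) != 0 by rewrite pnatr_eq0 -lt0n.
have fn : (f%:R : R) != 0 by rewrite pnatr_eq0 -lt0n.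
have dE : (d%:R : R) = f%:R * e%:R by rewrite -natrM mulnC ef.
have up_ (x : R) (k : int) : e%:R * x = k%:~R * (2 * pi) -> d%:R * x = (f%:Z * k)%:~R * (2 * pi).
  by rewrite dE -mulrA => ->; rewrite intrM mulrA.
apply: (lift_generic pD) => [i|i j t k tI ij Ek].
  by move=> x; apply: cvgM; [exact: cvg_cst|exact: hc].
have tI' : 0 <= t <= 1 by case/andP: tI => *; rewrite !ltW.
have Ek' : e%:R * (w j t - w i t) = k%:~R * (2 * pi) by rewrite mulrBr.
have [h1 h2] := tw t i j _ tI' ij (up_ _ _ Ek'); split.
  move=> l /cis_eqP[k' hk']; have [->|li] := eqVneq l i; first by left.
  have [->|lj] := eqVneq l j; first by right.
  case: (h1 l li lj); exists (f%:Z * k'); apply: up_; rewrite mulrBr hk'; ring.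
have xs := xing_scale en h2; apply: eq_xing xs => s.
have -> : (f%:Z * k)%:~R * (2 * pi) / d%:R = k%:~R * (2 * pi) / e%:R :> R.
  by rewrite dE intrM; field; rewrite en fn.
by rewrite mulrBr mulrBr [e%:R * (_ / _)]mulrC divfK.
Qed.

Variables (N : nat) (y : nat -> 'I_m -> R).
Hypothesis N0 : (0 < N)%N.
Hypothesis sy : forall i, scattered d (y i).
Hypothesis ty : forall i, (i < N)%N -> no_triple d (y i) (y i.+1).

Definition polygon l (t : R) := pl (fun i => y i l) N (N%:R * t).

Lemma polygon_continuous l : continuous (polygon l).
Proof. by apply: pl_continuous => t; apply: cvgM; [exact: cvg_cst|exact: cvg_id]. Qed.

Lemma polygon_piece (t : R) : 0 <= t <= 1 -> exists2 i, (i < N)%N & i%:R <= N%:R * t <= i%:R + 1.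
Proof.
move=> /andP[t0 t1]; apply: piece => //; rewrite mulr_ge0 //=.
by rewrite -[leRHS]mulr1 ler_wpM2l.
Qed.

Lemma polygonE i t l : (i < N)%N -> i%:R <= N%:R * t <= i%:R + 1 ->
  polygon l t = mix (y i) (y i.+1) (N%:R * t - i%:R) l.
Proof. by move=> iN sI; rewrite /polygon (pl_in _ iN sI). Qed.

Lemma polygon0 l : polygon l 0 = y 0%N l.
Proof. by rewrite /polygon mulr0 pl0. Qed.

Lemma polygon1 l : polygon l 1 = y N l.
Proof. by rewrite /polygon mulr1 pl_ge. Qed.

(** On a segment the difference of two angles is affine. A coincidence is not at a node, the nodes
    being scattered, and the slope is not 0, or the coincidence would extend to a node. *)
Lemma polygon_transversal : transversal polygon.
Proof.
move=> t a b p tI ab hp; have [i iN sI] := polygon_piece tI.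
pose r := N%:R * t - i%:R; have rI : 0 <= r <= 1 by case/andP: sI => *; rewrite /r; apply/andP; split; lra.
have pE : (fun l => polygon l t) = mix (y i) (y i.+1) r by apply/funext => l; apply: polygonE.
have dn : (d%:R : R) != 0 by rewrite pnatr_eq0 -lt0n.
have cab : coin d (mix (y i) (y i.+1) r) b a by exists p; rewrite -pE.
have ba : b != a by rewrite eq_sym.
split=> [l la lb|].
  by rewrite /= pE => cla; apply: (ty iN rI ba _ _ cab (coin_sym cla)); rewrite eq_sym.
have r0 : r != 0.
  apply/eqP => r0; apply: (sy ba (i := i)); case: cab => q hq; exists q; rewrite -hq r0 /mix; ring.
have r1 : r != 1.
  apply/eqP => r1; apply: (sy ba (i := i.+1)); case: cab => q hq; exists q; rewrite -hq r1 /mix; ring.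
pose sl := (y i.+1 b - y i b) - (y i.+1 a - y i a).
have sl0 : sl != 0.
  apply/eqP => s0; apply: (sy ba (i := i)); case: cab => q hq; exists q; rewrite -hq /mix; congr (_ * _).
  have -> : y i b + r * (y i.+1 b - y i b) - (y i a + r * (y i.+1 a - y i a)) = y i b - y i a + r * sl.
    by rewrite /sl; ring.
  by rewrite s0 mulr0 addr0.
have Np : (0 : R) < N%:R by rewrite ltr0n.
have [rp rl] : 0 < r /\ r < 1 by case/andP: rI => *; rewrite !lt_neqAle eq_sym r0 r1.
apply: (@xing_affine _ _ (sl * N%:R) (Num.min r (1 - r) / N%:R)).
- by rewrite mulf_neq0 // gt_eqF.
- by rewrite divr_gt0 // lt_min rp subr_gt0.
- move=> q; rewrite ltr_pdivlMr // lt_min => /andP[q1 q2].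
  have [q3 q4] : - r < N%:R * q /\ N%:R * q < 1 - r.
    have -> : N%:R * q = q * N%:R by rewrite mulrC.
    have aq : `|q * N%:R| = `|q| * N%:R by rewrite normrM (gtr0_norm Np).
    move: q1 q2; rewrite -aq !ltr_norml => /andP[? ?] /andP[? ?]; split=> //.
  have sI' : i%:R <= N%:R * (t + q) <= i%:R + 1.
    by move: q3 q4; rewrite /r mulrDr => q3 q4; apply/andP; split; lra.
  rewrite !(polygonE _ iN sI').
  have -> : p%:~R * (2 * pi) / d%:R = polygon b t - polygon a t by rewrite -hp mulrC mulKf.
  rewrite !(polygonE _ iN sI) /mix /sl; ring.
Qed.

End Transversal.

(** * Turning the strands about strand k *)

Section Perturbation.
Local Open Scope classical_set_scope.
Local Open Scope ring_scope.
Variable R : realType.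

Lemma unit_uniform (Q : R -> R -> Prop) : (forall s e e' : R, 0 < e' <= e -> Q s e -> Q s e') ->
  (forall t : R, 0 <= t <= 1 -> exists2 e : R, 0 < e & exists2 h : R, 0 < h &
     forall s, 0 <= s <= 1 -> `|s - t| < e -> Q s h) ->
  exists2 h : R, 0 < h & forall s, 0 <= s <= 1 -> Q s h.
Proof.
move=> mono loc; pose P (t : R) := exists2 h : R, 0 < h & forall s, 0 <= s <= t -> Q s h.
suff : P 1 by [].
apply: unit_interval_ind (unit1 R); last first.
  have [e e0 [h h0 hh]] := loc 0 (unit0 R); exists h => // s /andP[s0 s1].
  have -> : s = 0 by apply/eqP; rewrite eq_le s0 s1.
  by apply: hh; [exact: unit0|rewrite subrr normr0].
move=> t tI; have [e e0 [h h0 hh]] := loc t tI; exists e => // s s' sI s'I hs hs' [h' h'0 hh'].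
exists (Num.min h h'); first by rewrite lt_min h0.
move=> r /andP[r0 r1]; have [rs|sr] := leP r s.
  by apply: (mono r h'); [rewrite lt_min h0 h'0 /= ge_min lexx orbT|apply: hh'; rewrite r0].
apply: (mono r h); first by rewrite lt_min h0 h'0 /= ge_min lexx.
apply: hh; first by rewrite r0 (le_trans r1) //; case/andP: s'I.
by move: hs hs'; rewrite !ltr_norml => /andP[? ?] /andP[? ?]; apply/andP; split; lra.
Qed.

Variables (n : nat) (far : bool) (k : 'I_n) (d : nat) (z : 'I_n -> R[i]).
Hypotheses (d0 : (0 < d)%N) (hz : general_position k z).
Variable b : braid R n.
Hypothesis pb : pure_braid z b.
Local Notation m := n.-1.
Local Notation P := (p_diagram far k).

Lemma angles_exist : exists w : 'I_m -> R -> R, (forall l, {within `[0, 1], continuous (w l)}) /\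
  forall l t, 0 <= t <= 1 -> dir (seen k b l t) = cis (w l t).
Proof.
have [hc h1 _ _] := braid_coherent far true k pb.
have /fin_all_exists[w hw] : forall l, exists wl : R -> R, {within `[0, 1], continuous wl} /\
    forall t, 0 <= t <= 1 -> dir (seen k b l t) = cis (wl t).
  move=> l; have n1 t := h1 0 l t (unit0 R); have [a0 ha] := norm1_cis (n1 0 (unit0 R)).
  have cl := cfamily_slice (unit0 R) (hc l).
  by have [wl [h2 _ h3]] := lift_exists cl n1 ha; exists wl.
by exists w; split=> l; have [] := hw l.
Qed.

Variable w : 'I_m -> R -> R.
Hypothesis wc : forall l, {within `[0, 1], continuous (w l)}.
Hypothesis wE : forall l t, 0 <= t <= 1 -> dir (seen k b l t) = cis (w l t).

Lemma seen_polar l t : 0 <= t <= 1 -> seen k b l t = (rad (seen k b l t))%:C%C * cis (w l t).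
Proof. by move=> tI; rewrite -wE // -dirK // seen_neq0 //; apply: pure_inj pb tI. Qed.

Lemma seen_continuous l : cfamily (fun x => seen k b l x.2).
Proof. by have [hc _ _ _] := pb; apply: cfamilyB; apply: cfamily_const. Qed.

(** Turned about strand k, two strands can collide only when their distances from it are equal. At
    such times their angles differ modulo 2 pi, and compactness makes the difference uniform;
    turning each strand by less than half of it is safe. *)
Lemma separation : exists2 h : R, 0 < h & forall s, 0 <= s <= 1 -> forall l j, l != j ->
  rad (seen k b l s) = rad (seen k b j s) -> forall q : int, h <= `|w l s - w j s - q%:~R * (2 * pi)|.
Proof.
apply: unit_uniform.
  by move=> s e e' /andP[_ ee'] h l j lj hr q; apply: le_trans (h l j lj hr q).
move=> t tI.
pose Q (p : 'I_m * 'I_m) (e : R) := p.1 != p.2 -> forall s, 0 <= s <= 1 -> `|s - t| < e ->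
  rad (seen k b p.1 s) = rad (seen k b p.2 s) -> forall q : int, e <= `|w p.1 s - w p.2 s - q%:~R * (2 * pi)|.
have [|p|e e0 he] := @fin_exists_pos R _ Q.
- move=> p e e' /andP[e'0 ee'] h lj s sI hs hr q; apply: le_trans (ee') _.
  by apply: h => //; apply: lt_le_trans ee'.
- have [lj|lj] := eqVneq p.1 p.2; first by exists 1 => //; rewrite /Q lj eqxx.
  (* Distances which differ at t differ nearby, and then there is nothing to show. If they are equal
     at t, the difference of the angles stays strictly between two consecutive multiples of 2 pi. *)
  have [hr|hr] := eqVneq (rad (seen k b p.1 t)) (rad (seen k b p.2 t)); last first.
    have /within_squareP ci : {within @square R, continuous (fun x => rad (seen k b p.1 x.2) - rad (seen k b p.2 x.2))}.
      by move=> x; apply: cvgB; apply: rad_continuous; exact: seen_continuous.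
    have [|e e0 he] := ci 0 t (unit0 R) tI `|rad (seen k b p.1 t) - rad (seen k b p.2 t)|.
      by rewrite normr_gt0 subr_eq0.
    exists e => // _ s sI hs hr'; exfalso; have := he 0 s (unit0 R) sI _ hs.
    by rewrite /= subrr normr0 hr' subrr sub0r normrN ltxx => /(_ e0).
  pose f s := w p.1 s - w p.2 s; pose q := winding (f t).
  have /within_itvP cf : {within `[0, 1], continuous f} by move=> x; apply: cvgB; exact: wc.
  have := winding_lt (f t) (q + 1); rewrite ltzD1 lexx => /esym h2.
  have h1 : q%:~R * (2 * pi) < f t.
    rewrite lt_neqAle; apply/andP; split; last by rewrite leNgt -winding_lt ltxx.
    apply/eqP => h; case/eqP: lj; apply: (seen_inj (k := k) (pure_inj pb tI)).
    rewrite /= (seen_polar p.1 tI) (seen_polar p.2 tI) hr -(cis_period (w p.2 t) q) h; congr (_ * cis _).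
    by rewrite /f addrC subrK.
  pose g := Num.min (f t - q%:~R * (2 * pi)) ((q + 1)%:~R * (2 * pi) - f t).
  have g0 : 0 < g by rewrite lt_min !subr_gt0 h1.
  have [|e e0 he] := cf t tI (g / 2); first by rewrite divr_gt0.
  exists (Num.min e (g / 2)) => [|_ s sI]; first by rewrite lt_min e0 divr_gt0.
  rewrite lt_min => /andP[/(he s sI) hs _] _ q'; rewrite ge_min; apply/orP; right.
  rewrite -/(f s).
  have gl : g <= f t - q%:~R * (2 * pi) /\ g <= (q + 1)%:~R * (2 * pi) - f t.
    by rewrite /g !ge_min !lexx orbT.
  move: hs; rewrite ltr_norml => /andP[s1 s2]; have [q'q|qq'] := lerP q' q.
    have : (q'%:~R : R) * (2 * pi) <= q%:~R * (2 * pi) by rewrite ler_pM2r ?twopi_gt0 // ler_int.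
    by move=> h; apply: le_trans (ler_norm _); case: gl; lra.
  have : ((q + 1)%:~R : R) * (2 * pi) <= q'%:~R * (2 * pi).
    by rewrite ler_pM2r ?twopi_gt0 // ler_int lezD1.
  by move=> h; rewrite -normrN; apply: le_trans (ler_norm _); case: gl; lra.
exists e => //; exists e => // s sI hs l j lj hr q; exact: (he (l, j)).
Qed.

Variables (w' : 'I_m -> R -> R) (h : R).
Hypothesis h0 : 0 < h.
Hypothesis sep : forall s, 0 <= s <= 1 -> forall l j, l != j ->
  rad (seen k b l s) = rad (seen k b j s) -> forall q : int, h <= `|w l s - w j s - q%:~R * (2 * pi)|.
Hypothesis w'c : forall l, {within `[0, 1], continuous (w' l)}.
Hypothesis close : forall l t, 0 <= t <= 1 -> `|w' l t - w l t| < h / 2.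
Hypotheses (w'0 : forall l, w' l 0 = w l 0) (w'1 : forall l, w' l 1 = w l 1).

(** Turning keeps the distances from strand k, so it changes only the directions in which strands
    are seen and not which of them is nearer. *)
Definition turned (u : R) : braid R n := fun i t =>
  if unlift k i is Some l then b k t + seen k b l t * cis (u * (w' l t - w l t)) else b k t.

Lemma turned_k u t : turned u k t = b k t.
Proof. by rewrite /turned unlift_none. Qed.

Lemma turned_lift u l t : turned u (lift k l) t = b k t + seen k b l t * cis (u * (w' l t - w l t)).
Proof. by rewrite /turned liftK. Qed.

Lemma seen_turned u l t : seen k (turned u) l t = seen k b l t * cis (u * (w' l t - w l t)).
Proof. by rewrite /seen turned_lift turned_k addrC addKr. Qed.

Lemma rad_turned u l t : rad (seen k (turned u) l t) = rad (seen k b l t).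
Proof.
have : `|seen k (turned u) l t| = `|seen k b l t| by rewrite seen_turned normrM norm_cis mulr1.
by rewrite !rad_norm => /complexI.
Qed.

Lemma dir_turned u l t : 0 <= t <= 1 -> dir (seen k (turned u) l t) = cis (w l t + u * (w' l t - w l t)).
Proof.
move=> tI; rewrite cisD -wE // /dir seen_turned normrM norm_cis mulr1.
by rewrite mulrAC.
Qed.

Lemma turned_inj u t : 0 <= u <= 1 -> 0 <= t <= 1 -> injective ((turned u)^~ t).
Proof.
move=> uI tI; have nz l : seen k (turned u) l t != 0.
  by rewrite seen_turned mulf_neq0 ?cis_neq0 // seen_neq0 //; apply: pure_inj pb tI.
have key l j : turned u (lift k l) t = turned u (lift k j) t -> l = j.
  move=> e; have e' : seen k (turned u) l t = seen k (turned u) j t by rewrite /seen e.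
  apply/eqP/negPn/negP => lj; have hr : rad (seen k b l t) = rad (seen k b j t) by rewrite -!(rad_turned u) e'.
  have /cis_eqP[q hq] : cis (w l t + u * (w' l t - w l t)) = cis (w j t + u * (w' j t - w j t)).
    by rewrite -!dir_turned // e'.
  have := sep tI lj hr q; rewrite leNgt => /negP; apply.
  have := close l tI; have := close j tI; rewrite !ltr_norml => /andP[a1 a2] /andP[a3 a4].
  have eq1 : w l t - w j t - q%:~R * (2 * pi) = u * ((w' j t - w j t) - (w' l t - w l t)) by lra.
  rewrite eq1; case/andP: uI => u0 u1; apply/andP; split; nra.
move=> i j /=; case: (unliftP k i) => [l ->|->]; case: (unliftP k j) => [l' ->|->] //.
- by move=> /key ->.
- by move=> e; have := nz l; rewrite /seen e subrr eqxx.
- by move=> e; have := nz l'; rewrite /seen -e subrr eqxx.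
Qed.

Lemma cfamilyD (f g : R * R -> R[i]) : cfamily f -> cfamily g -> cfamily (fun x => f x + g x).
Proof.
move=> cf cg; have := cfamilyB cf (cfamilyB (cfamily_cst 0) cg).
by rewrite (_ : (fun x => _ - _) = (fun x => f x + g x)) //; apply/funext => x; rewrite sub0r opprK.
Qed.

Lemma turned_cfamily i : cfamily (fun x => turned x.1 i x.2).
Proof.
have [hc _ _ _] := pb; rewrite /turned; case: (unlift k i) => [l|]; last exact: cfamily_const.
apply: cfamilyD; first exact: cfamily_const.
apply: cfamilyM; first exact: seen_continuous.
apply: cis_cfamily => x; apply: cvgM.
  by move: x; apply: continuous_subspaceT => x; exact: cvg_fst.
have c4 (f : R -> R) : {within `[0, 1], continuous f} -> {within @square R, continuous (fun x : R * R => f x.2)}.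
  move=> /within_itvP cf; apply/within_squareP => u' t' u'I t'I e' e'0.
  by have [e e0 he] := cf t' t'I e' e'0; exists e => // u2 t2 *; apply: he.
by apply: cvgB; [exact: (c4 _ (@w'c l))|exact: (c4 _ (@wc l))].
Qed.

Lemma turned_pure u : 0 <= u <= 1 -> pure_braid z (turned u).
Proof.
move=> uI; have [_ _ b0 b1] := pb; split.
- by move=> i; exact: (cfamily_slice uI (turned_cfamily i)).
- by move=> t tI; exact: turned_inj.
- move=> i; case: (unliftP k i) => [l ->|->]; last by rewrite turned_k.
  by rewrite turned_lift w'0 subrr mulr0 cis0 mulr1 /seen addrC subrK.
- move=> i; case: (unliftP k i) => [l ->|->]; last by rewrite turned_k.
  by rewrite turned_lift w'1 subrr mulr0 cis0 mulr1 /seen addrC subrK.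
Qed.

Lemma turned_isotopic : braid_isotopic z b (turned 1).
Proof.
exists turned; split.
- exact: turned_cfamily.
- exact: turned_pure.
- move=> i t tI; case: (unliftP k i) => [l ->|->]; last by rewrite turned_k.
  by rewrite turned_lift mul0r cis0 mulr1 /seen addrC subrK.
- by [].
Qed.

Hypothesis tw : transversal d w'.

Lemma turned_dir l t : 0 <= t <= 1 -> dir (seen k (turned 1) l t) = cis (w' l t).
Proof. by move=> tI; rewrite dir_turned // mul1r addrC subrK. Qed.

Lemma turned_over l j t : 0 <= t <= 1 -> Defs.over (P (turned 1)) l j t ->
  [/\ l != j, cis (w' l t) = cis (w' j t) & ~ Defs.over (P (turned 1)) j l t].
Proof.
move=> tI /p_overE[h1 h2]; split.
- by apply: contraTneq h2 => ->; rewrite if_same ltxx.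
- by rewrite -!turned_dir.
- by move/p_overE => [_]; move: h2; case: far => h2 h3; have := lt_trans h2 h3; rewrite ltxx.
Qed.

Lemma turned_power_lift e : same_diagram (angle_diagram (fun l t => e%:R * w' l t) (Defs.over (P (turned 1))))
  (power_map e (P (turned 1))).
Proof.
move=> t tI; split=> // l; rewrite -[strand _ l t]/(cis (e%:R * w' l t)) -cisX.
by rewrite -turned_dir // -p_strandE.
Qed.

Lemma turned_power_cyl e f : (e * f = d)%N -> cyl_diagram true (endpoints e k z) (power_map e (P (turned 1))).
Proof.
move=> ef; apply: same_cyl (turned_power_lift e) _.
have e0 : (0 < e)%N by have : (0 < e * f)%N by [rewrite ef|]; rewrite muln_gt0 => /andP[].
have pt := turned_pure (unit1 R).
have s0 l : cis (e%:R * w' l 0) = direction k z l ^+ e.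
  by rewrite -cisX -turned_dir ?unit0 // -(proj1 (p_ends far k l pt)).
have s1 l : cis (e%:R * w' l 1) = direction k z l ^+ e.
  by rewrite -cisX -turned_dir ?unit1 // -(proj2 (p_ends far k l pt)).
have pD : prediagram (endpoints e k z) (angle_diagram (fun l t => e%:R * w' l t) (Defs.over (P (turned 1)))).
  apply: lift_prediagram.
  - by move=> l x; apply: cvgM; [exact: cvg_cst|exact: w'c].
  - by move=> l; rewrite s0 s1; split; exists l.
  - by move=> l j lj; rewrite !s0 !s1; split=> /(direction_pow_inj hz e0) h1; rewrite h1 eqxx in lj.
  - move=> l j t tI /(turned_over tI)[h1 h2 h3]; split=> //.
    by rewrite -!cisX h2.
split=> //; last by left.
exact: transversal_generic ef w'c tw pD.
Qed.

Lemma turned_cyl : cyl_diagram false (endpoints 1 k z) (P (turned 1)).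
Proof.
have p1 : power_map 1 (P (turned 1)) = P (turned 1).
  by rewrite /power_map; case: (P _) => s o; congr Diagram; apply/funext => a; apply/funext => t; rewrite expr1.
have [pD gD _] := turned_power_cyl (mul1n d); rewrite p1 in pD gD; split=> //; right.
move=> l j t [tI lj]; rewrite !p_strandE => hd.
have := seen_rad (turned_inj (unit1 R) tI) lj hd; rewrite neq_lt => ne.
by case/orP: ne => ne; rewrite /classical_at !p_overE hd; move: ne; case: far => ne; by [left|right].
Qed.

End Perturbation.

Lemma mix_near (R : realType) (r a b x e : R) : 0 <= r <= 1 -> `|a - x| < e -> `|b - x| < e ->
  `|a + r * (b - a) - x| < e.
Proof.
move=> rI; rewrite !ltr_norml => /andP[a1 a2] /andP[b1 b2].
have m1 : 0 < (1 - r) * (e - (a - x)) + r * (e - (b - x)) by apply: mix_gt0 => //; lra.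
have m2 : 0 < (1 - r) * (e + (a - x)) + r * (e + (b - x)) by apply: mix_gt0 => //; lra.
by apply/andP; split; lra.
Qed.

(** * Every pure braid has a generic representative *)

Section GenericBraid.
Local Open Scope classical_set_scope.
Local Open Scope ring_scope.
Variables (R : realType) (n : nat) (far : bool) (k : 'I_n) (d : nat) (z : 'I_n -> R[i]).
Hypotheses (d0 : (0 < d)%N) (hz : general_position k z).

(** The tolerance h / 2 allowed by [separation] is shared equally: h / 4 for the oscillation of the
    angles between nodes and h / 4 for the displacement of the nodes. *)
Lemma generic_braid_exists (b : braid R n) : pure_braid z b -> exists b', [/\ braid_isotopic z b b',
  cyl_diagram false (endpoints 1 k z) (p_diagram far k b') &
  cyl_diagram true (endpoints d k z) (power_map d (p_diagram far k b'))].
Proof.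
move=> pb; have [w [wc wE]] := angles_exist far k pb; have [h h0 sep] := separation pb wc wE.
have e0 : 0 < h / 4 by rewrite divr_gt0.
have [e ee he] : exists2 e : R, 0 < e & forall s s', 0 <= s <= 1 -> 0 <= s' <= 1 -> `|s - s'| < e ->
    forall l, `|w l s - w l s'| < h / 4.
  apply: unit_interval_lebesgue => t tI.
  have [|l|e ee he] := @fin_exists_pos R _ (fun l e => forall s, 0 <= s <= 1 -> `|s - t| < e -> `|w l s - w l t| < h / 8).
  - by move=> l x x' /andP[_ xx'] hx s sI hs; apply: hx => //; apply: lt_le_trans xx'.
  - have /within_itvP cl := @wc l; have [|e ee he] := cl t tI (h / 8); first by rewrite divr_gt0.
    by exists e.
  exists e => // s s' sI s'I hs hs' l; have := he l s sI hs; have := he l s' s'I hs'.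
  by rewrite !ltr_norml => /andP[? ?] /andP[? ?]; apply/andP; split; lra.
(* Large enough for 1 / N < e, and at least 2 as [scattered_path] requires. *)
pose N := (Num.bound e^-1).+2.
have N1 : (1 < N)%N by [].
have Np : (0 : R) < N%:R by rewrite ltr0n.
have Ne : N%:R^-1 < e.
  rewrite -[e]invrK ltf_pV2 ?posrE ?invr_gt0 //.
  have := archi_boundP (ltW (_ : 0 < e^-1)); rewrite invr_gt0 => /(_ ee) => lt1; apply: lt_trans lt1 _.
  by rewrite ltr_nat /N; lia.
pose v (i : nat) l := w l (i%:R / N%:R).
(* The prescribed nodes at both ends are scattered because the base points are in general
   position. *)
have ends t : t = 0 \/ t = 1 -> scattered d (fun l => w l t).
  move=> t01 l j lj [p hp]; have tI : 0 <= t <= 1 by case: t01 => ->; rewrite ?unit0 ?unit1.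
  have /(direction_pow_inj hz d0) lE : direction k z l ^+ d = direction k z j ^+ d.
    have dE i : direction k z i = cis (w i t).
      have [p0 p1] := p_ends far k i pb; rewrite -wE //; case: t01 => ->; by [rewrite -p0|rewrite -p1].
    rewrite !dE !cisX -(cis_period (d%:R * w j t) p) -hp; congr cis; ring.
  by rewrite lE eqxx in lj.
have v0 : v 0%N = (fun l => w l 0) by rewrite /v mul0r.
have vN : v N = (fun l => w l 1) by rewrite /v divff // gt_eqF.
have [||y [y0 yN yv sy ty]] := scattered_path (d := d) (v := v) d0 N1 e0.
- by rewrite v0; apply: ends; left.
- by rewrite vN; apply: ends; right.
pose w' := polygon N y.
have w'c l : {within `[0, 1], continuous (w' l)} by apply: continuous_subspaceT; exact: polygon_continuous.
have close l t : 0 <= t <= 1 -> `|w' l t - w l t| < h / 2.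
  move=> tI; have [i iN sI] := polygon_piece (ltnW N1) tI.
  rewrite /w' (polygonE _ _ iN sI) /mix.
  have iI (i' : nat) : (i' <= N)%N -> 0 <= (i'%:R : R) / N%:R <= 1.
    by move=> i'N; rewrite divr_ge0 //= ler_pdivrMr // mul1r ler_nat.
  have near (i' : nat) : (i' <= N)%N -> `|N%:R * t - i'%:R| <= 1 -> `|y i' l - w l t| < h / 2.
    move=> i'N h1; have : `|i'%:R / N%:R - t| < e.
      apply: le_lt_trans Ne; have -> : i'%:R / N%:R - t = - (N%:R * t - i'%:R) / N%:R.
        by field; rewrite gt_eqF.
      by rewrite normrM normrN [`|N%:R^-1|]gtr0_norm ?invr_gt0 // ler_piMl // invr_ge0 ltW.
    move=> /(he _ _ (iI i' i'N) tI)/(_ l); have := yv i' l; rewrite -/(v i' l).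
    by rewrite !ltr_norml => /andP[? ?] /andP[? ?]; apply/andP; split; lra.
  have rI : 0 <= N%:R * t - i%:R <= 1 by case/andP: sI => *; apply/andP; split; lra.
  have n1 : `|y i l - w l t| < h / 2.
    by apply: (near i (ltnW iN)); rewrite ger0_norm; case/andP: rI.
  have n2 : `|y i.+1 l - w l t| < h / 2.
    by apply: (near i.+1 iN); rewrite -natr1 ler_norml; case/andP: rI => *; apply/andP; split; lra.
  exact: mix_near rI n1 n2.
have w'0 l : w' l 0 = w l 0 by rewrite /w' polygon0 y0 v0.
have w'1 l : w' l 1 = w l 1 by rewrite /w' polygon1 yN vN.
have tw : transversal d w' by apply: (polygon_transversal d0 (ltnW N1) sy ty).
exists (turned k b w w' 1); split.
- exact: (turned_isotopic pb wc wE sep w'c close w'0 w'1).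
- exact: (turned_cyl far d0 hz pb wc wE sep w'c close w'0 w'1 tw).
- exact: (turned_power_cyl far d0 hz pb wc wE sep w'c close w'0 w'1 tw (muln1 d)).
Qed.

End GenericBraid.

(** * The representation *)

Theorem corollary1 (R : realType) (n : nat) (hn : (3 <= n)%N) (k : 'I_n)
    (d : nat) (hd : (1 <= d)%N)
    (z : 'I_n -> R[i]) (hz : general_position k z)
    (far up : bool) (c : R[i]) (th : 'I_n.-1 -> R)
    (hth : ccw_numbering c th (endpoints d k z)) :
  (exists rho, is_rho up c th (endpoints d k z) rho) /\
  (forall rho, is_rho up c th (endpoints d k z) rho ->
   exists F : braid R n -> 'M[laurent]_n.-1,
   [/\ forall b, pure_braid z b -> forall M,
         composition_value far k d rho z b M <-> M = F b,
       forall b b', pure_braid z b -> pure_braid z b' ->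
         braid_isotopic z b b' -> F b = F b',
       forall b, pure_braid z b -> F b \in unitmx
     & forall b b', pure_braid z b -> pure_braid z b' ->
         F (braid_mul b b') = F b *m F b']).
Proof.
(* From n >= 3 one gets n - 1 >= 2, so that a position differs from the cyclically next one. *)
case: n hn k z hz th hth => [|[|[|n]]] // _ k z hz th hth.
have r0 : is_rho up c th (endpoints d k z) (rho0 up c th).
  have [c1 _ _ _] := hth; have [gamma gE] := norm1_cis c1; move: hth; rewrite gE => num.
  exact: rho0_is_rho.
split=> [|rho hrho]; first by exists (rho0 up c th).
(* Uniqueness replaces an arbitrary [rho] by [rho0], whose invariance extends to the projections of
   all braids met during an isotopy, generic or not. *)
have uniq D : cyl_diagram true (endpoints d k z) D -> rho D = rho0 up c th D.
  by move=> cD; exact: (@rho_unique R n c th _ up hth rho _ D hrho r0 cD).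
exists (braid_value far up k d c th); split.
- move=> b pb M; split=> [[b' [D [ib cP eD cD ->]]]|->].
    apply: etrans (uniq _ cD) _; apply/esym; apply: etrans (braid_value_isotopic far up hd hz c th pb ib) _.
    exact: (rho0_equiv up c th hd (endpoints_pow hd hz) eD).
  have [b' [ib cP cD]] := generic_braid_exists far hd hz pb.
  exists b', (p_diagram far k b'); split=> //; first exact: rst_refl.
  exact: etrans (braid_value_isotopic far up hd hz c th pb ib) (esym (uniq _ cD)).
- by move=> b b' pb _ ib; apply: braid_value_isotopic ib.
- by move=> b; apply: braid_value_unit.
- by move=> b b'; apply: braid_value_mul.
Qed.
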